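(* Let $p>3$ be prime and suppose $0\le m\le p-1$. Then $$\mathcal R_{p,m}(z):=\frac1{\eta(pz)}\,\mathcal K_{p,m}(z)$$ is a weakly holomorphic modular form of weight $\frac12$ on $\Gamma_1(p)$ with multiplier. In particular, $$\mathcal R_{p,m}(z)\big|[A]_{\frac12}=\frac{\exp\left(\frac{2\pi ibm}p\right)}{\nu_\eta({}^pA)}\,\mathcal R_{p,m}(z)$$ for $A=\begin{pmatrix}a&b\\c&d\end{pmatrix}\in\Gamma_1(p)$, where ${}^pA=\begin{pmatrix}a&pb\\c/p&d\end{pmatrix}$.
   Context: Notation: $z$ is in the upper half plane, $q=\exp(2\pi iz)$, $q^r=\exp(2\pi irz)$, $(q;q)_\infty=\prod_{n\ge1}(1-q^n)$, $\eta(z)=q^{1/24}(q;q)_\infty$; for $A=\begin{pmatrix}a&b\\c&d\end{pmatrix}\in\mathrm{SL}_2(\mathbb Z)$ and $k\in\frac12\mathbb Z$, $(F|[A]_k)(z)=(cz+d)^{-k}F\left(\frac{az+b}{cz+d}\right)$ with principal value. The eta-multiplier $\nu_\eta$ is defined by $\eta|[A]_{\frac12}=\nu_\eta(A)\eta$ for $A\in\mathrm{SL}_2(\mathbb Z)$. $\chi_{12}(n)=1$ if $n\equiv\pm1\pmod{12}$, $-1$ if $n\equiv\pm5\pmod{12}$, $0$ otherwise. For $p>3$ prime and $1\le\ell\le\frac12(p-1)$ set $$\mathcal N\left(\tfrac1p;z\right)=\csc\left(\tfrac\pi p\right)\frac{q^{-1/24}}{(q;q)_\infty}\left(1+\sum_{n=1}^\infty\frac{(-1)^n(1+q^n)(2-2\cos(2\pi/p))}{1-2\cos(2\pi/p)q^n+q^{2n}}q^{\frac12n(3n+1)}\right),$$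 $$\mathcal M\left(\tfrac\ell p;z\right)=\frac{2q^{\frac{3\ell}{2p}(1-\frac\ell p)-\frac1{24}}}{(q;q)_\infty}\sum_{n\in\mathbb Z}\frac{(-1)^nq^{n+\ell/p}}{1-q^{n+\ell/p}}q^{\frac32n(n+1)},$$ $$\varepsilon_2\left(\tfrac\ell p;z\right)=\begin{cases}2\exp\left(-3\pi iz(\frac\ell p-\frac16)^2\right)&0<\frac\ell p<\frac16,\\0&\frac16<\frac\ell p<\frac56,\end{cases}$$ $$\mathcal J\left(\tfrac1p;z\right)=\eta(p^2z)\left(\mathcal N\left(\tfrac1p;z\right)-2\chi_{12}(p)\sum_{\ell=1}^{\frac12(p-1)}(-1)^\ell\sin\left(\tfrac{6\ell\pi}p\right)\left(\mathcal M\left(\tfrac\ell p;p^2z\right)+\varepsilon_2\left(\tfrac\ell p;p^2z\right)\right)\right).$$ For $0\le m\le p-1$, $$\mathcal K_{p,m}(z):=\sin\left(\tfrac\pi p\right)\cdot\frac1p\sum_{r=0}^{p-1}\exp\left(-\tfrac{2\pi irm}p\right)\mathcal J\left(\tfrac1p;\tfrac{z+r}p\right).$$ A weakly holomorphic modular form is holomorphic on the upper half plane, transforms as a modular form (here with a multiplier), and is allowed poles at the cusps. *)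

(* Defs.v *)
From Stdlib Require Export Reals ZArith Znumtheory.
From Coquelicot Require Export Coquelicot.
Open Scope R_scope.

Definition IZC (n : Z) : C := RtoC (IZR n).

(** Limits and sums of complex sequences: the unique limit when it exists,
    an unspecified value otherwise. *)
Definition C_lim_seq (u : nat -> C) : C :=
  iota (T := C_CompleteNormedModule) (fun l =>
    filterlim u eventually (locally (T := C_UniformSpace) l)).

Definition C_Series (a : nat -> C) : C :=
  iota (T := C_CompleteNormedModule) (fun l =>
    is_series (K := C_AbsRing) (V := C_NormedModule) a l).

Definition C_Series_Z (a : Z -> C) : C :=
  (C_Series (fun n => a (Z.of_nat n))
   + C_Series (fun n => a (- Z.of_nat (S n))%Z))%C.

Definition C_sum (a : nat -> C) (i j : nat) : C :=
  sum_n_m (G := C_AbelianMonoid) a i j.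

(** a 1 * ... * a n *)
Fixpoint C_prod (a : nat -> C) (n : nat) : C :=
  match n with
  | O => RtoC 1
  | S k => (C_prod a k * a n)%C
  end.

Definition cexp (z : C) : C :=
  (RtoC (exp (Re z)) * (cos (Im z), sin (Im z)))%C.

(** Principal argument, with values in (-PI, PI] for z <> 0. *)
Definition Carg (z : C) : R :=
  if Rle_dec 0 (Im z) then acos (Re z / Cmod z) else - acos (Re z / Cmod z).

Definition Clog (z : C) : C := (ln (Cmod z), Carg z).

Definition Cpower (z : C) (s : R) : C := cexp (RtoC s * Clog z)%C.

Definition upper_half (z : C) : Prop := 0 < Im z.

(** q^r = exp(2 pi i r z). *)
Definition qpow (r : R) (z : C) : C := cexp (RtoC (2 * PI * r) * Ci * z)%C.

Definition qpoch (z : C) : C :=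
  C_lim_seq (C_prod (fun n => RtoC 1 - qpow (INR n) z)%C).

Definition eta (z : C) : C := (qpow (1 / 24) z * qpoch z)%C.

Record mat2 := Mat2 { m_a : Z; m_b : Z; m_c : Z; m_d : Z }.

Definition mat2_mul (A B : mat2) : mat2 :=
  Mat2 (m_a A * m_a B + m_b A * m_c B) (m_a A * m_b B + m_b A * m_d B)
       (m_c A * m_a B + m_d A * m_c B) (m_c A * m_b B + m_d A * m_d B).

Definition SL2Z (A : mat2) : Prop := (m_a A * m_d A - m_b A * m_c A = 1)%Z.

Definition Gamma1 (N : nat) (A : mat2) : Prop :=
  SL2Z A /\ (Z.of_nat N | m_a A - 1)%Z /\ (Z.of_nat N | m_d A - 1)%Z
  /\ (Z.of_nat N | m_c A)%Z.

Definition autom (A : mat2) (z : C) : C := (IZC (m_c A) * z + IZC (m_d A))%C.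

Definition moebius (A : mat2) (z : C) : C :=
  ((IZC (m_a A) * z + IZC (m_b A)) / autom A z)%C.

Definition slash (k : R) (F : C -> C) (A : mat2) (z : C) : C :=
  (Cpower (autom A z) (- k) * F (moebius A z))%C.

(** The constant nu such that eta | [A]_{1/2} = nu * eta on the upper half
    plane. *)
Definition nu_eta (A : mat2) : C :=
  iota (T := C_CompleteNormedModule) (fun v : C =>
    forall z : C, upper_half z -> slash (1 / 2) eta A z = (v * eta z)%C).

Definition multiplier_system (k : R) (G : mat2 -> Prop) (nu : mat2 -> C) : Prop :=
  (forall A, G A -> Cmod (nu A) = 1) /\
  (forall A B z, G A -> G B -> upper_half z ->
     (nu (mat2_mul A B) * Cpower (autom (mat2_mul A B) z) k)%C =
     (nu A * nu B * Cpower (autom A (moebius B z)) k * Cpower (autom B z) k)%C).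

Definition holomorphic_on_upper_half (f : C -> C) : Prop :=
  forall z, upper_half z -> ex_derive (K := C_AbsRing) (V := C_NormedModule) f z.

(** [f] has an expansion in real powers of q, with exponents spaced by 1/h and
    bounded below; the least exponent [r] may be negative (a pole at infinity)
    and need not lie in (1/h)Z, because of the multiplier. *)
Definition meromorphic_at_infinity (f : C -> C) : Prop :=
  exists (h : nat) (r : R) (a : nat -> C), (0 < h)%nat /\
    forall z, upper_half z ->
      is_series (K := C_AbsRing) (V := C_NormedModule)
        (fun n => (a n * qpow (r + INR n / INR h) z)%C) (f z).

(** Every cusp is the image of infinity under some B in SL2(Z). *)
Definition meromorphic_at_cusps (k : R) (f : C -> C) : Prop :=
  forall B, SL2Z B -> meromorphic_at_infinity (slash k f B).

Definition weakly_holomorphic_modular_form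
    (k : R) (G : mat2 -> Prop) (nu : mat2 -> C) (f : C -> C) : Prop :=
  multiplier_system k G nu /\
  holomorphic_on_upper_half f /\
  (forall A, G A -> forall z, upper_half z -> slash k f A z = (nu A * f z)%C) /\
  meromorphic_at_cusps k f.

Definition chi12 (n : Z) : R :=
  match (n mod 12)%Z with
  | 1%Z | 11%Z => 1
  | 5%Z | 7%Z => -1
  | _ => 0
  end.

(** For p prime > 3 these are N(1/p; z), M(l/p; z), eps_2(l/p; z), J(1/p; z). *)
Definition calN (p : nat) (z : C) : C :=
  let c := cos (2 * PI / INR p) in
  (RtoC (/ sin (PI / INR p)) * (qpow (- (1 / 24)) z / qpoch z)
   * (RtoC 1 + C_Series (fun j =>
        let n := S j in
        RtoC ((-1) ^ n) * (RtoC 1 + qpow (INR n) z) * RtoC (2 - 2 * c)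
        / (RtoC 1 - RtoC (2 * c) * qpow (INR n) z + qpow (2 * INR n) z)
        * qpow (INR n * (3 * INR n + 1) / 2) z)))%C.

Definition calM (l p : nat) (z : C) : C :=
  let x := INR l / INR p in
  (RtoC 2 * qpow (3 / 2 * x * (1 - x) - 1 / 24) z / qpoch z
   * C_Series_Z (fun n =>
       RtoC (powerRZ (-1) n) * qpow (IZR n + x) z
       / (RtoC 1 - qpow (IZR n + x) z)
       * qpow (3 / 2 * IZR n * (IZR n + 1)) z))%C.

(** epsilon_2(l/p; z), for 0 < l/p < 5/6. *)
Definition eps2 (l p : nat) (z : C) : C :=
  let x := INR l / INR p in
  if Rlt_dec x (1 / 6)
  then (RtoC 2 * cexp (RtoC (-3 * PI * (x - 1 / 6) ^ 2) * Ci * z))%C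
  else RtoC 0.

Definition calJ (p : nat) (z : C) : C :=
  let w := (RtoC (INR p ^ 2) * z)%C in
  (eta w
   * (calN p z
      - RtoC (2 * chi12 (Z.of_nat p))
        * C_sum (fun l =>
            RtoC ((-1) ^ l * sin (6 * INR l * PI / INR p))
            * (calM l p w + eps2 l p w)) 1 ((p - 1) / 2)))%C.

Definition calK (p m : nat) (z : C) : C :=
  (RtoC (sin (PI / INR p)) * RtoC (/ INR p)
   * C_sum (fun r =>
       cexp (RtoC (- (2 * PI * INR r * INR m / INR p)) * Ci)
       * calJ p ((z + RtoC (INR r)) / RtoC (INR p))) 0 (p - 1))%C.

Definition calR (p m : nat) (z : C) : C :=
  (RtoC 1 / eta (RtoC (INR p) * z) * calK p m z)%C.

(** The matrix (a, p b; c / p, d), meant for c divisible by p. *)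
Definition conj_p (p : nat) (A : mat2) : mat2 :=
  Mat2 (m_a A) (Z.of_nat p * m_b A) (m_c A / Z.of_nat p) (m_d A).

Definition nu_R (p m : nat) (A : mat2) : C :=
  (cexp (RtoC (2 * PI * IZR (m_b A) * INR m / INR p) * Ci)
   / nu_eta (conj_p p A))%C.

(* Main.v *)
Require Import Defs.
From Stdlib Require Import Lra Lia Psatz FunctionalExtensionality.

(** The function [calJ] combines the mock objects [calN] and [calM] in such a
    way that their mock parts cancel; what is left is a weight one form built
    from theta values at points of order [p].  Its twisted averages over
    translations, divided by [eta (p z)], are the functions [calR].

    _The cancellation._  Both mock objects are values of the Appell sums
    [B al u t].  Partial fractions of the reciprocal of a product of three theta
    functions ([asd], a limit of Lagrange interpolation) express
    [e(3al/2) B al + e(-3al/2) B (-al)] through [B 0] and a quotient of theta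
    values ([asd_theta]).  Sum this over [al = k/p] and let [u] tend to [1/p]
    ([identity_at_root]).  In the terms with [B 0 (1/p)] one recognizes [calN]
    ([calN_rank]), with a factor [Gam] that the quintuple product identity turns
    into the eta quotient of the definition of [calJ] ([Gam_eta]).  On the other
    side the sum over [k] is a sum over roots of unity; splitting the remaining
    sum over the integers into residue classes modulo [p] yields sums
    [B 0 (l p t) (p^2 t)], which are the functions [calM], and pentagonal sums,
    which are the terms [eps2] ([class_decomposition]).  Since [u = 1/p] is a
    singular point, the limit leaves logarithmic derivatives of theta; the
    result is [calJ_theta].

    _Modularity._  Functions with the quasi-periods of theta form a line, by
    their Fourier expansions ([theta_type_unique]); so theta satisfies its
    transformation law with some constant ([theta_modular]).  The constants
    cancel in [torsion_form], which is attached to a primitive row [(a, d)] and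
    on which [SL2(Z)] acts through its right action on rows, in weight one
    ([torsion_form_modular]).  It depends on the row modulo [p] only up to
    signs, and these are trivial for the rows that occur
    ([torsion_form_periodic]).  Hence [calJ] has weight one for the matrices with
    [p^2 | c] and [d = 1 (mod p)], and its averages transform under
    [Gamma1(p)] with the character [exp (2 pi i b m / p)] ([average_modular]).

    _The eta multiplier._  Both theta'(0) and the product of theta over the half
    periods are multiples of [eta^3]; eliminating the unknown constant of the
    theta transformation between them shows that the sixth power of
    [slash (1/2) eta A / eta] is constant ([eta_sixth_power]), so the quotient
    itself is constant by continuity ([nu_eta_spec]).

    _The cusps._  Theta constants belong to the class [modq] of periodic
    holomorphic functions of exponential growth.  Members of this class have
    expansions of the required kind ([modq_expansion]) and it contains the
    inverses of its members without zeros ([modq_inv]).  The matrices that arise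
    at a cusp are unimodular times upper triangular ([hermite_form]), which
    reduces every cusp to this class ([calR_cusp]). *)

(** * Complex numbers, limits and series *)

Lemma C_eq (z w : C) : Re z = Re w -> Im z = Im w -> z = w.
Proof. intros H1 H2. apply injective_projections; assumption. Qed.

Lemma Re_plus z w : Re (z + w)%C = Re z + Re w. Proof. reflexivity. Qed.
Lemma Im_plus z w : Im (z + w)%C = Im z + Im w. Proof. reflexivity. Qed.
Lemma Re_opp z : Re (- z)%C = - Re z. Proof. reflexivity. Qed.
Lemma Im_opp z : Im (- z)%C = - Im z. Proof. reflexivity. Qed.
Lemma Re_minus z w : Re (z - w)%C = Re z - Re w. Proof. reflexivity. Qed.
Lemma Im_minus z w : Im (z - w)%C = Im z - Im w. Proof. reflexivity. Qed.
Lemma Re_mult z w : Re (z * w)%C = Re z * Re w - Im z * Im w. Proof. reflexivity. Qed.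
Lemma Im_mult z w : Im (z * w)%C = Re z * Im w + Im z * Re w. Proof. reflexivity. Qed.
Lemma Re_R x : Re (RtoC x) = x. Proof. reflexivity. Qed.
Lemma Im_R x : Im (RtoC x) = 0. Proof. reflexivity. Qed.
Lemma Re_i : Re Ci = 0. Proof. reflexivity. Qed.
Lemma Im_i : Im Ci = 1. Proof. reflexivity. Qed.
Lemma Re_pair x y : Re (x, y) = x. Proof. reflexivity. Qed.
Lemma Im_pair x y : Im (x, y) = y. Proof. reflexivity. Qed.

Lemma Ci_neq0 : Ci <> RtoC 0.
Proof. intros E. apply (f_equal Im) in E. rewrite Im_i, Im_R in E. lra. Qed.

Lemma Cminus_neq0_sym z w : (z - w)%C <> RtoC 0 -> (w - z)%C <> RtoC 0.
Proof. intros H E. apply H. replace (z - w)%C with (- (w - z))%C by ring. rewrite E. ring. Qed.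

Ltac ReIm := rewrite ?Re_plus, ?Im_plus, ?Re_opp, ?Im_opp, ?Re_minus, ?Im_minus,
  ?Re_mult, ?Im_mult, ?Re_R, ?Im_R, ?Re_i, ?Im_i, ?Re_pair, ?Im_pair.
Ltac Ceq := apply C_eq; repeat (progress ReIm).

Lemma RtoC_neq0 x : x <> 0 -> RtoC x <> RtoC 0.
Proof. intros h E. apply h. apply RtoC_inj. auto. Qed.

Lemma Cmod_minus_sym z w : Cmod (z - w) = Cmod (w - z).
Proof. rewrite <- Cmod_opp. f_equal. ring. Qed.

Lemma Cmod_tri2 z w : Cmod z - Cmod w <= Cmod (z - w).
Proof. pose proof (Cmod_triangle (z - w) w). replace (z - w + w)%C with z in H by ring. lra. Qed.

Lemma Cmod_neq0 z : Cmod z <> 0 -> z <> RtoC 0.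
Proof. intros H E. apply H. rewrite E. apply Cmod_0. Qed.

Lemma Cmod_pos z : z <> RtoC 0 -> 0 < Cmod z.
Proof. apply Cmod_gt_0. Qed.

Lemma Im_le_Cmod z : Rabs (Im z) <= Cmod z.
Proof.
  replace (Im z) with (- Re (Ci * z)%C) by (ReIm; ring).
  rewrite Rabs_Ropp. eapply Rle_trans; [apply re_le_Cmod|].
  rewrite Cmod_mult, Cmod_Ci. lra.
Qed.

Lemma Cmod_le_ReIm z : Cmod z <= Rabs (Re z) + Rabs (Im z).
Proof.
  replace z with (RtoC (Re z) + Ci * RtoC (Im z))%C at 1 by (Ceq; ring).
  eapply Rle_trans; [apply Cmod_triangle|].
  rewrite Cmod_mult, Cmod_Ci, !Cmod_R. lra.
Qed.

(** A complex number is estimated by the real parts of its rotations: this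
    reduces complex estimates to real calculus. *)
Lemma Cmod_le_rotations w M :
  (forall k, Cmod k = 1 -> Re (k * w)%C <= M) -> Cmod w <= M.
Proof.
  intros H. destruct (Ceq_dec w 0) as [E|E].
  - rewrite E, Cmod_0. specialize (H 1%C Cmod_1). rewrite E in H.
    revert H. ReIm. lra.
  - pose proof (Cmod_pos _ E) as P.
    assert (P' : RtoC (Cmod w) <> 0%C) by (intros E'; apply RtoC_inj in E'; lra).
    specialize (H (Cconj w / RtoC (Cmod w))%C).
    rewrite Cmod_div, Cmod_conj, Cmod_R, (Rabs_pos_eq (Cmod w)) in H; try lra; auto.
    specialize (H ltac:(field; lra)).
    replace (Cconj w / RtoC (Cmod w) * w)%C with (RtoC (Cmod w)) in H.
    + exact H.
    + pose proof (Cmod2_conj w) as Q.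
      replace (Cconj w / RtoC (Cmod w) * w)%C with ((w * Cconj w) / RtoC (Cmod w))%C
        by (field; auto).
      rewrite <- Q, RtoC_pow. field. auto.
Qed.

(** ** Limits of sequences *)

Definition Clim (u : nat -> C) (l : C) : Prop :=
  forall eps, 0 < eps -> exists N, forall n, (N <= n)%nat -> Cmod (u n - l) < eps.

(** The balls of the product uniform structure are squares, hence the factor. *)
Lemma ball_Cmod (x y : C) (e : R) : ball (M := C_UniformSpace) x e y -> Cmod (y - x) < sqrt 2 * e.
Proof.
  intros H.
  destruct (Rlt_dec 0 e) as [he|he].
  - apply (C_NormedModule_mixin_compat2 x y (mkposreal e he) H).
  - exfalso. destruct H as [H _]. apply he.
    apply Rle_lt_trans with (2 := H). apply Rabs_pos.
Qed.

Lemma Clim_filterlim u l :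
  Clim u l <-> filterlim u eventually (locally (T := C_UniformSpace) l).
Proof.
  split.
  - intros H P [e He]. destruct (H e (cond_pos e)) as [N HN].
    exists N. intros n hn. apply He. apply C_NormedModule_mixin_compat1. apply HN; auto.
  - intros H e he.
    assert (h2 : 0 < sqrt 2) by (apply sqrt_lt_R0; lra).
    assert (he' : 0 < e / sqrt 2) by (apply Rdiv_lt_0_compat; lra).
    destruct (H (ball l (mkposreal _ he'))) as [N HN].
    + exists (mkposreal _ he'). auto.
    + exists N. intros n hn. specialize (HN n hn). apply ball_Cmod in HN. simpl in HN.
      replace (sqrt 2 * (e / sqrt 2)) with e in HN by (field; lra). exact HN.
Qed.

(** The structures on [C] given by its absolute value, for which limits and
    derivatives of products are available. *)
Notation CA := (AbsRing_UniformSpace C_AbsRing).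
Notation CV := (AbsRing_NormedModule C_AbsRing).

Lemma Clim_CA u l : Clim u l <-> filterlim u eventually (locally (T := CA) l).
Proof.
  split.
  - intros H P [e He]. destruct (H e (cond_pos e)) as [N HN]. exists N. intros n hn. apply He, HN, hn.
  - intros H e he. apply (H (fun y => Cmod (y - l) < e)). exists (mkposreal e he). auto.
Qed.

Lemma Clim_unique u l l' : Clim u l -> Clim u l' -> l = l'.
Proof.
  intros H H'. destruct (Ceq_dec l l') as [E|E]; auto. exfalso.
  assert (P : 0 < Cmod (l - l')).
  { apply Cmod_pos. intros E'. apply E. replace l with (l - l' + l')%C by ring. rewrite E'. ring. }
  destruct (H (Cmod (l - l') / 2)) as [N HN]; [lra|].
  destruct (H' (Cmod (l - l') / 2)) as [N' HN']; [lra|].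
  specialize (HN (N + N')%nat ltac:(lia)). specialize (HN' (N + N')%nat ltac:(lia)).
  rewrite Cmod_minus_sym in HN.
  pose proof (Cmod_triangle (l - u (N+N')%nat) (u (N+N')%nat - l')) as T.
  replace (l - u (N + N')%nat + (u (N + N')%nat - l'))%C with (l - l')%C in T by ring. lra.
Qed.

Lemma Clim_ext_ev u v l N : (forall n, (N <= n)%nat -> u n = v n) -> Clim u l -> Clim v l.
Proof.
  intros E H e he. destruct (H e he) as [M HM]. exists (N + M)%nat.
  intros n hn. rewrite <- E by lia. apply HM. lia.
Qed.

Lemma Clim_ext u v l : (forall n, u n = v n) -> Clim u l -> Clim v l.
Proof. intros E. apply (Clim_ext_ev u v l 0). auto. Qed.

Lemma Clim_const c : Clim (fun _ => c) c.
Proof. intros e he. exists 0%nat. intros. replace (c - c)%C with (RtoC 0) by ring. rewrite Cmod_0. auto. Qed.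

Lemma Clim_plus u v a b : Clim u a -> Clim v b -> Clim (fun n => u n + v n)%C (a + b)%C.
Proof.
  rewrite !Clim_CA. intros H K. eapply filterlim_comp_2; [exact H|exact K|].
  apply (filterlim_plus (V := CV) a b).
Qed.

Lemma Clim_bounded u a : Clim u a -> exists M, 0 < M /\ forall n, Cmod (u n) <= M.
Proof.
  intros H. destruct (H 1) as [N HN]; [lra|].
  assert (K : forall k, exists M, 0 < M /\ forall n, (n < k)%nat -> Cmod (u n) <= M).
  { induction k as [|k [M [h IH]]].
    - exists 1. split; [lra|]. intros; lia.
    - exists (M + Cmod (u k)). pose proof (Cmod_ge_0 (u k)). split; [lra|]. intros n hn.
      destruct (Nat.eq_dec n k) as [->|]; [lra|]. specialize (IH n ltac:(lia)). lra. }
  destruct (K N) as [M [h HM]]. exists (M + Cmod a + 1). pose proof (Cmod_ge_0 a). split; [lra|].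
  intros n. destruct (le_lt_dec N n) as [l|l].
  - specialize (HN n l). pose proof (Cmod_tri2 (u n) a). lra.
  - specialize (HM n l). lra.
Qed.

Lemma Clim_mult u v a b : Clim u a -> Clim v b -> Clim (fun n => u n * v n)%C (a * b)%C.
Proof.
  rewrite !Clim_CA. intros H K. eapply filterlim_comp_2; [exact H|exact K|].
  apply (filterlim_mult (K := C_AbsRing) a b).
Qed.

Lemma Clim_scal c u a : Clim u a -> Clim (fun n => c * u n)%C (c * a)%C.
Proof. apply Clim_mult. apply Clim_const. Qed.

Lemma Clim_opp u a : Clim u a -> Clim (fun n => - u n)%C (- a)%C.
Proof.
  intros H. apply Clim_ext with (fun n => (- RtoC 1) * u n)%C. { intros; ring. }
  replace (- a)%C with ((- RtoC 1) * a)%C by ring. apply Clim_scal; auto.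
Qed.

Lemma Clim_minus u v a b : Clim u a -> Clim v b -> Clim (fun n => u n - v n)%C (a - b)%C.
Proof. intros. apply Clim_plus; auto. apply Clim_opp; auto. Qed.

Lemma Clim_bounded_below u a : Clim u a -> a <> RtoC 0 -> (forall n, u n <> RtoC 0) ->
  exists m, 0 < m /\ forall n, m <= Cmod (u n).
Proof.
  intros H ha hu. pose proof (Cmod_pos _ ha) as P.
  destruct (H (Cmod a / 2)) as [N HN]; [lra|].
  assert (K : forall k, exists m, 0 < m /\ forall n, (n < k)%nat -> m <= Cmod (u n)).
  { induction k as [|k [m [h IH]]].
    - exists 1. split; [lra|]. intros; lia.
    - exists (Rmin m (Cmod (u k))). pose proof (Cmod_pos _ (hu k)). split.
      + apply Rmin_pos; auto.
      + intros n hn. destruct (Nat.eq_dec n k) as [->|]; [apply Rmin_r|].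
        eapply Rle_trans; [apply Rmin_l|]. apply IH. lia. }
  destruct (K N) as [m [h Hm]]. exists (Rmin m (Cmod a / 2)). split; [apply Rmin_pos; lra|].
  intros n. destruct (le_lt_dec N n) as [l|l].
  - specialize (HN n l). pose proof (Cmod_tri2 a (u n)). rewrite Cmod_minus_sym in HN.
    eapply Rle_trans; [apply Rmin_r|]. lra.
  - eapply Rle_trans; [apply Rmin_l|]. auto.
Qed.

Lemma Clim_inv u a : Clim u a -> a <> RtoC 0 -> (forall n, u n <> RtoC 0) ->
  Clim (fun n => / u n)%C (/ a)%C.
Proof.
  intros H ha hu. destruct (Clim_bounded_below u a H ha hu) as [m [hm Hm]].
  pose proof (Cmod_pos _ ha) as P. intros e he.
  destruct (H (e * (m * Cmod a))) as [N HN]; [repeat apply Rmult_lt_0_compat; auto|].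
  exists N. intros n hn. specialize (HN n hn).
  replace (/ u n - / a)%C with ((a - u n) * / (u n * a))%C by (field; split; auto).
  pose proof (Cmod_pos _ (hu n)).
  rewrite Cmod_mult, Cmod_inv, Cmod_mult, Cmod_minus_sym by (apply Cmult_neq_0; auto).
  apply Rmult_lt_reg_r with (Cmod (u n) * Cmod a); [apply Rmult_lt_0_compat; auto|].
  rewrite Rmult_assoc, Rinv_l, Rmult_1_r by (apply Rmult_integral_contrapositive; lra).
  eapply Rlt_le_trans; [apply HN|]. apply Rmult_le_compat_l; [lra|].
  apply Rmult_le_compat_r; [lra|auto].
Qed.

Lemma Clim_subseq u a (f : nat -> nat) : (forall n, (n <= f n)%nat) -> Clim u a -> Clim (fun n => u (f n)) a.
Proof. intros h H e he. destruct (H e he) as [N HN]. exists N. intros n hn. apply HN. specialize (h n). lia. Qed.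

(** ** Finite sums and series *)

Fixpoint Csum (a : nat -> C) (n : nat) : C :=
  match n with O => RtoC 0 | S k => (Csum a k + a k)%C end.

Lemma Csum_ext a b n : (forall k, (k < n)%nat -> a k = b k) -> Csum a n = Csum b n.
Proof. induction n as [|n IH]; intros H; simpl; auto. rewrite IH, H; auto. Qed.

Lemma Csum_plus a b n : Csum (fun k => a k + b k)%C n = (Csum a n + Csum b n)%C.
Proof. induction n as [|n IH]; simpl; [|rewrite IH]; ring. Qed.

Lemma Csum_scal c a n : Csum (fun k => c * a k)%C n = (c * Csum a n)%C.
Proof. induction n as [|n IH]; simpl; [|rewrite IH]; ring. Qed.

Lemma Csum_minus a b n : Csum (fun k => a k - b k)%C n = (Csum a n - Csum b n)%C.
Proof. induction n as [|n IH]; simpl; [|rewrite IH]; ring. Qed.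

Lemma Csum_zero a n : (forall k, (k < n)%nat -> a k = RtoC 0) -> Csum a n = RtoC 0.
Proof. induction n as [|n IH]; intros H; simpl; auto. rewrite IH, H; auto. ring. Qed.

Lemma Csum_split a m n : Csum a (m + n) = (Csum a m + Csum (fun k => a (m + k)%nat) n)%C.
Proof.
  induction n as [|n IH].
  - rewrite Nat.add_0_r. simpl. ring.
  - rewrite Nat.add_succ_r. simpl. rewrite IH. ring.
Qed.

Lemma Csum_single a n i : (i < n)%nat -> (forall k, (k < n)%nat -> k <> i -> a k = RtoC 0) ->
  Csum a n = a i.
Proof.
  induction n as [|n IH]; intros hi H; [lia|]. simpl.
  destruct (Nat.eq_dec i n) as [->|E].
  - rewrite Csum_zero; [ring|]. intros k hk. apply H; lia.
  - rewrite IH by (auto; lia). rewrite (H n) by lia. ring.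
Qed.

Lemma Csum_swap (a : nat -> nat -> C) m n :
  Csum (fun i => Csum (a i) n) m = Csum (fun j => Csum (fun i => a i j) m) n.
Proof.
  induction m as [|m IH]; simpl.
  - rewrite Csum_zero; auto.
  - rewrite IH, <- Csum_plus. reflexivity.
Qed.

Lemma Csum_rev a n : Csum a n = Csum (fun k => a (n - 1 - k)%nat) n.
Proof.
  induction n as [|n IH]; auto.
  pose proof (Csum_split (fun k => a (S n - 1 - k)%nat) 1 n) as E.
  change (1 + n)%nat with (S n) in E. rewrite E. simpl Csum at 1. rewrite IH.
  replace (Csum (fun k => a (S n - 1 - (1 + k))%nat) n) with (Csum (fun k => a (n - 1 - k)%nat) n).
  - simpl. replace (n - 0 - 0)%nat with n by lia. ring.
  - apply Csum_ext. intros k hk. f_equal. lia.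
Qed.

Fixpoint Rsum (a : nat -> R) (n : nat) : R :=
  match n with O => 0 | S k => Rsum a k + a k end.

Lemma Cmod_Csum a n : Cmod (Csum a n) <= Rsum (fun k => Cmod (a k)) n.
Proof.
  induction n as [|n IH]; simpl; [rewrite Cmod_0; lra|].
  eapply Rle_trans; [apply Cmod_triangle|]. lra.
Qed.

Lemma Rsum_le a b n : (forall k, (k < n)%nat -> a k <= b k) -> Rsum a n <= Rsum b n.
Proof. induction n as [|n IH]; intros H; simpl; [lra|]. specialize (IH (fun k h => H k (Nat.lt_lt_succ_r _ _ h))). specialize (H n ltac:(lia)). lra. Qed.

Lemma Rsum_mono a m n : (forall k, 0 <= a k) -> (m <= n)%nat -> Rsum a m <= Rsum a n.
Proof. intros H. induction 1 as [|n l IH]; [lra|]. simpl. specialize (H n). lra. Qed.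

Lemma Rsum_scal c a n : Rsum (fun k => c * a k) n = c * Rsum a n.
Proof. induction n as [|n IH]; simpl; [|rewrite IH]; ring. Qed.

Lemma sum_n_Csum (a : nat -> C) n : sum_n (G := C_AbelianMonoid) a n = Csum a (S n).
Proof.
  induction n as [|n IH].
  - rewrite sum_O. simpl. symmetry. apply Cplus_0_l.
  - rewrite sum_Sn, IH. reflexivity.
Qed.

Definition sums (a : nat -> C) (l : C) : Prop := Clim (Csum a) l.

Lemma sums_is_series a l : sums a l <-> is_series (K := C_AbsRing) (V := C_NormedModule) a l.
Proof.
  split; intros H.
  - apply Clim_filterlim. apply Clim_ext with (fun n => Csum a (S n)).
    + intros n. symmetry. apply sum_n_Csum.
    + apply (Clim_subseq (Csum a) l S); auto.
  - apply Clim_filterlim in H. intros e he. destruct (H e he) as [N HN].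
    exists (S N). intros n hn. destruct n as [|n]; [lia|].
    rewrite <- sum_n_Csum. apply HN. lia.
Qed.

Lemma C_Series_unique a l : sums a l -> C_Series a = l.
Proof.
  intros H. apply sums_is_series in H. unfold C_Series. apply (iota_unique (K := C_AbsRing) (V := C_CompleteNormedModule)); auto.
  intros y Hy. apply sums_is_series in H, Hy. apply (Clim_unique _ _ _ Hy H).
Qed.

Lemma C_lim_seq_unique u l : Clim u l -> C_lim_seq u = l.
Proof.
  intros H. unfold C_lim_seq. apply (iota_unique (K := C_AbsRing) (V := C_CompleteNormedModule)); [|apply Clim_filterlim; auto].
  intros y Hy. apply Clim_filterlim in Hy. apply (Clim_unique _ _ _ Hy H).
Qed.

Lemma sums_unique a l l' : sums a l -> sums a l' -> l = l'.
Proof. apply Clim_unique. Qed.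

Lemma sums_ext a b l : (forall n, a n = b n) -> sums a l -> sums b l.
Proof. intros E. apply Clim_ext. intros n. apply Csum_ext. auto. Qed.

Lemma sums_plus a b l l' : sums a l -> sums b l' -> sums (fun n => a n + b n)%C (l + l')%C.
Proof. intros H K. eapply Clim_ext; [|apply (Clim_plus _ _ _ _ H K)]. intros n. rewrite Csum_plus. auto. Qed.

Lemma sums_scal c a l : sums a l -> sums (fun n => c * a n)%C (c * l)%C.
Proof. intros H. eapply Clim_ext; [|apply (Clim_scal c _ _ H)]. intros n. rewrite Csum_scal. auto. Qed.

Lemma sums_minus a b l l' : sums a l -> sums b l' -> sums (fun n => a n - b n)%C (l - l')%C.
Proof. intros H K. eapply Clim_ext; [|apply (Clim_minus _ _ _ _ H K)]. intros n. rewrite Csum_minus. auto. Qed.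

Lemma sums_finite a N : (forall n, (N <= n)%nat -> a n = RtoC 0) -> sums a (Csum a N).
Proof.
  intros H. apply Clim_ext_ev with (fun _ => Csum a N) N; [|apply Clim_const].
  intros n hn. replace n with (N + (n - N))%nat by lia. rewrite Csum_split.
  rewrite (Csum_zero (fun k => a (N + k)%nat)); [ring|]. intros; apply H; lia.
Qed.

Lemma sums_shift1 a l : sums (fun n => a (S n)) l <-> sums a (a O + l)%C.
Proof.
  assert (E : forall n, Csum a (S n) = (a O + Csum (fun n => a (S n)) n)%C).
  { intros n. pose proof (Csum_split a 1 n) as E. change (1 + n)%nat with (S n) in E.
    rewrite E. simpl. ring. }
  split; intros H.
  - intros e he. destruct (H e he) as [N HN]. exists (S N). intros [|n] hn; [lia|].
    rewrite E. specialize (HN n ltac:(lia)).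
    replace (a 0%nat + Csum (fun n0 : nat => a (S n0)) n - (a 0%nat + l))%C
      with (Csum (fun n0 : nat => a (S n0)) n - l)%C by ring. auto.
  - intros e he. destruct (H e he) as [N HN]. exists N. intros n hn.
    specialize (HN (S n) ltac:(lia)). rewrite E in HN.
    replace (a 0%nat + Csum (fun n0 : nat => a (S n0)) n - (a 0%nat + l))%C
      with (Csum (fun n0 : nat => a (S n0)) n - l)%C in HN by ring. auto.
Qed.

Lemma sums_term a l : sums a l -> Clim a (RtoC 0).
Proof.
  intros H. apply Clim_ext with (fun n => Csum a (S n) - Csum a n)%C.
  { intros n; simpl; ring. }
  replace (RtoC 0) with (l - l)%C by ring. apply Clim_minus; auto.
  apply (Clim_subseq (Csum a) l S); auto.
Qed.

Definition summable (b : nat -> R) : Prop :=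
  (forall n, 0 <= b n) /\ exists B, forall n, Rsum b n <= B.

Lemma summable_ex_series b : (forall n, 0 <= b n) -> ex_series b -> summable b.
Proof.
  intros hb [l H]. split; auto. exists l. intros n.
  assert (E : forall n, Rsum b (S n) = sum_n b n).
  { induction n0 as [|k IH]; [rewrite sum_O; simpl; ring|]. rewrite sum_Sn, <- IH. reflexivity. }
  assert (M : Rsum b n <= Rsum b (S n)) by (apply Rsum_mono; auto).
  eapply Rle_trans; [apply M|]. rewrite E.
  apply (is_lim_seq_incr_compare (sum_n b) l); auto.
  intros k. rewrite sum_Sn. unfold plus; simpl. specialize (hb (S k)). lra.
Qed.

Lemma summable_le a b : (forall n, 0 <= a n <= b n) -> summable b -> summable a.
Proof.
  intros H [_ [B HB]]. split; [intros; apply H|]. exists B. intros n.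
  eapply Rle_trans; [|apply HB]. apply Rsum_le. intros; apply H.
Qed.

Lemma summable_scal c a : 0 <= c -> summable a -> summable (fun n => c * a n).
Proof.
  intros hc [h [B HB]]. split; [intros; apply Rmult_le_pos; auto|].
  exists (c * B). intros n. rewrite Rsum_scal. apply Rmult_le_compat_l; auto.
Qed.

Lemma summable_plus a b : summable a -> summable b -> summable (fun n => a n + b n).
Proof.
  intros [h [B HB]] [h' [B' HB']]. split; [intros n; specialize (h n); specialize (h' n); lra|].
  exists (B + B'). intros n.
  replace (Rsum (fun n => a n + b n) n) with (Rsum a n + Rsum b n).
  - specialize (HB n). specialize (HB' n). lra.
  - induction n as [|n IH]; simpl; [ring|]. rewrite <- IH. ring.
Qed.

Lemma summable_ex a : summable a -> ex_series a.
Proof.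
  intros [h [B HB]].
  assert (E : forall n, sum_n a n = Rsum a (S n)).
  { induction n as [|k IH]; [rewrite sum_O; simpl; ring|]. rewrite sum_Sn, IH. reflexivity. }
  destruct (ex_finite_lim_seq_incr (sum_n a) B) as [l Hl].
  - intros n. rewrite !E. apply Rsum_mono; auto.
  - intros n. rewrite E. apply HB.
  - exists l. exact Hl.
Qed.

Lemma summable_tail a : summable a -> forall e, 0 < e -> exists N, forall m n, (N <= m)%nat ->
  Rsum (fun k => a (m + k)%nat) n < e.
Proof.
  intros [h [B HB]] e he.
  assert (G : Un_growing (Rsum a)) by (intros n; simpl; specialize (h n); lra).
  destruct (growing_cv (Rsum a) G) as [l Hl].
  { exists B. intros x [n ->]. apply HB. }
  destruct (Hl e he) as [N HN]. exists N. intros m n hm.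
  assert (E : forall m n, Rsum a (m + n) = Rsum a m + Rsum (fun k => a (m + k)%nat) n).
  { intros m0 n0. induction n0 as [|k IH]; [rewrite Nat.add_0_r; simpl; ring|].
    rewrite Nat.add_succ_r. simpl. rewrite IH. ring. }
  pose proof (growing_ineq _ _ G Hl (m + n)%nat) as K1. rewrite E in K1.
  specialize (HN m ltac:(lia)). unfold Rdist in HN.
  pose proof (growing_ineq _ _ G Hl m) as K2.
  rewrite Rabs_left1 in HN by lra. lra.
Qed.

Lemma sums_majorant a b : (forall n, Cmod (a n) <= b n) -> summable b -> exists l, sums a l.
Proof.
  intros H S. assert (S' : ex_series b) by (apply summable_ex; auto).
  destruct (ex_series_le (K := C_AbsRing) (V := C_CompleteNormedModule) a b) as [l Hl]; auto.
  exists l. apply sums_is_series. exact Hl.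
Qed.

Lemma Cmod_lim_le u l M : Clim u l -> (forall n, Cmod (u n) <= M) -> Cmod l <= M.
Proof.
  intros H K. apply Rnot_lt_le. intros C. destruct (H (Cmod l - M)) as [N HN]; [lra|].
  specialize (HN N (le_n _)). rewrite Cmod_minus_sym in HN.
  pose proof (Cmod_tri2 l (u N)). specialize (K N). lra.
Qed.

Lemma sums_bound a l b B : sums a l -> (forall n, Cmod (a n) <= b n) -> (forall n, Rsum b n <= B) ->
  Cmod l <= B.
Proof.
  intros H K L. apply (Cmod_lim_le _ _ _ H). intros n.
  eapply Rle_trans; [apply Cmod_Csum|]. eapply Rle_trans; [apply Rsum_le; intros; apply K|]. auto.
Qed.

(** Dominated convergence: finitely many terms converge, and a tail of [b] bounds the rest. *)
Lemma tannery (u : nat -> nat -> C) (l : nat -> C) (b : nat -> R) (s : nat -> C) (t : C) :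
  (forall k, Clim (fun N => u N k) (l k)) ->
  (forall N k, Cmod (u N k) <= b k) -> summable b ->
  (forall N, sums (u N) (s N)) -> sums l t -> Clim s t.
Proof.
  intros Hl Hb Hs Hu Ht e he.
  destruct (summable_tail b Hs (e/4)) as [K HK]; [lra|].
  assert (Lb : forall k, Cmod (l k) <= b k).
  { intros k. apply (Cmod_lim_le _ _ _ (Hl k)). auto. }
  assert (T : forall (v : nat -> C) r, sums v r -> (forall k, Cmod (v k) <= b k) ->
     Cmod (r - Csum v K) <= e/4).
  { intros v r Hv Hvb. apply Cmod_lim_le with (fun n => Csum v (K + n) - Csum v K)%C.
    - apply Clim_minus; [|apply Clim_const]. apply (Clim_subseq (Csum v) r (fun n => (K + n)%nat)); auto. intros; lia.
    - intros n. rewrite Csum_split.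
      replace (Csum v K + Csum (fun k => v (K + k)%nat) n - Csum v K)%C with (Csum (fun k => v (K + k)%nat) n) by ring.
      eapply Rle_trans; [apply Cmod_Csum|]. apply Rlt_le.
      eapply Rle_lt_trans; [|apply (HK K n (le_n _))]. apply Rsum_le. auto. }
  assert (F : Clim (fun N => Csum (u N) K) (Csum l K)).
  { clear - Hl. induction K as [|K IH]; simpl; [apply Clim_const|]. apply Clim_plus; auto. }
  destruct (F (e/4)) as [N HN]; [lra|]. exists N. intros n hn. specialize (HN n hn).
  pose proof (T _ _ (Hu n) (Hb n)) as T1. pose proof (T _ _ Ht Lb) as T2.
  replace (s n - t)%C with ((s n - Csum (u n) K) + ((Csum (u n) K - Csum l K) + (Csum l K - t)))%C by ring.
  rewrite (Cmod_minus_sym t) in T2.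
  eapply Rle_lt_trans; [apply Cmod_triangle|].
  pose proof (Cmod_triangle (Csum (u n) K - Csum l K) (Csum l K - t)). lra.
Qed.

(** * Complex differentiation *)

Definition Cder (f : C -> C) (z l : C) : Prop :=
  is_derive (K := C_AbsRing) (V := C_NormedModule) f z l.

Lemma Cder_eps f z l :
  Cder f z l <->
  (forall e, 0 < e -> exists d, 0 < d /\ forall h, Cmod h < d ->
     Cmod (f (z + h)%C - f z - h * l)%C <= e * Cmod h).
Proof.
  split.
  - intros [_ H] e he. destruct (H z (fun P h => h) (mkposreal e he)) as [d Hd].
    exists d. split; [apply cond_pos|]. intros h hh. specialize (Hd (z + h)%C).
    change (Cmod (z + h - z)%C < d -> Cmod (f (z + h)%C - f z - (z + h - z) * l)%C <= e * Cmod (z + h - z)%C) in Hd.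
    replace (z + h - z)%C with h in Hd by ring. auto.
  - intros H. split. { apply is_linear_scal_l. }
    intros x Hx. rewrite <- (is_filter_lim_locally_unique (V := CV) _ _ Hx). intros e. destruct (H e (cond_pos e)) as [d [hd Hd]]. exists (mkposreal _ hd). intros y Hy.
    specialize (Hd (y - z)%C Hy). replace (z + (y - z))%C with (y : C) in Hd by (symmetry; apply (fun w : C => ltac:(ring) : (z + (w - z))%C = w)).
    exact Hd.
Qed.

(** The two normed module structures on [C] give the same derivatives; the one of
    [CV] is that of the product rule and the chain rule. *)
Lemma Cder_CV f z l : Cder f z l <-> is_derive (K := C_AbsRing) (V := CV) f z l.
Proof. split; intros [_ H]; (split; [apply is_linear_scal_l|exact H]). Qed.

Lemma Cder_ext f g z l : (forall x, f x = g x) -> Cder f z l -> Cder g z l.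
Proof. intros E. apply is_derive_ext. auto. Qed.

Lemma Cder_ext_loc f g z l d : 0 < d -> (forall x, Cmod (x - z)%C < d -> f x = g x) -> Cder f z l -> Cder g z l.
Proof.
  intros hd E H. rewrite Cder_eps in H |- *. intros e he. destruct (H e he) as [d' [h' H']].
  exists (Rmin d d'). split; [apply Rmin_pos; auto|]. intros h hh.
  pose proof (Rmin_l d d'). pose proof (Rmin_r d d').
  rewrite <- !E.
  - apply H'. lra.
  - replace (z - z)%C with (RtoC 0) by ring. rewrite Cmod_0. auto.
  - replace (z + h - z)%C with h by ring. lra.
Qed.

Lemma Cder_unique f z l l' : Cder f z l -> Cder f z l' -> l = l'.
Proof.
  intros H H'. destruct (Ceq_dec (l - l') 0) as [E|E]; [replace l with (l - l' + l')%C by ring; rewrite E; ring|].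
  pose proof (Cmod_pos _ E) as P. exfalso.
  assert (D : Cder (fun x => f x - f x)%C z (l - l')%C) by (apply (is_derive_minus (K := C_AbsRing) (V := C_NormedModule)); auto).
  rewrite Cder_eps in D. destruct (D (Cmod (l - l') / 2)) as [d [hd Hd]]; [lra|].
  specialize (Hd (RtoC (d / 2))). rewrite Cmod_R, Rabs_pos_eq in Hd by lra. replace (f (z + RtoC (d / 2))%C - f (z + RtoC (d / 2))%C - (f z - f z) - RtoC (d / 2) * (l - l'))%C with (- (RtoC (d / 2) * (l - l')))%C in Hd by ring.
  rewrite Cmod_opp, Cmod_mult, Cmod_R, Rabs_pos_eq in Hd by lra.
  assert (0 < d * Cmod (l - l')) by (apply Rmult_lt_0_compat; auto). lra.
Qed.

Lemma Cder_const c z : Cder (fun _ => c) z (RtoC 0).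
Proof. apply (is_derive_const (K := C_AbsRing) (V := C_NormedModule)). Qed.

Lemma Cder_id z : Cder (fun x => x) z (RtoC 1).
Proof. apply Cder_CV, (is_derive_id (K := C_AbsRing)). Qed.

Lemma Cder_plus f g z a b : Cder f z a -> Cder g z b -> Cder (fun x => f x + g x)%C z (a + b)%C.
Proof. apply (is_derive_plus (K := C_AbsRing) (V := C_NormedModule)). Qed.

Definition Ccont (f : C -> C) (z : C) : Prop :=
  forall e, 0 < e -> exists d, 0 < d /\ forall x, Cmod (x - z)%C < d -> Cmod (f x - f z)%C < e.

Lemma Ccont_CA f z : Ccont f z <-> continuous (T := CA) (U := CA) f z.
Proof.
  split.
  - intros H P [e He]. destruct (H e (cond_pos e)) as [d [hd Hd]]. exists (mkposreal d hd). intros x hx. apply He, Hd, hx.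
  - intros H e he. destruct (H (fun y => Cmod (y - f z) < e)) as [d Hd]; [exists (mkposreal e he); auto|].
    exists d. split; [apply cond_pos|]. apply Hd.
Qed.

Lemma Cder_cont f z l : Cder f z l -> Ccont f z.
Proof. rewrite Cder_CV, Ccont_CA. intros H. apply (ex_derive_continuous (K := C_AbsRing) (V := CV) f z). exists l. auto. Qed.

Lemma Cder_mult f g z a b : Cder f z a -> Cder g z b -> Cder (fun x => f x * g x)%C z (a * g z + f z * b)%C.
Proof. rewrite !Cder_CV. intros H K. apply (is_derive_mult (K := C_AbsRing) _ _ _ _ _ H K Cmult_comm). Qed.

Lemma Cder_scal c f z a : Cder f z a -> Cder (fun x => c * f x)%C z (c * a)%C.
Proof.
  intros H. replace (c * a)%C with (0 * f z + c * a)%C by ring.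
  apply (Cder_mult (fun _ => c) f); auto. apply Cder_const.
Qed.

Lemma Cder_minus f g z a b : Cder f z a -> Cder g z b -> Cder (fun x => f x - g x)%C z (a - b)%C.
Proof. apply (is_derive_minus (K := C_AbsRing) (V := C_NormedModule)). Qed.

Lemma Cder_comp f g z a b : Cder f (g z) a -> Cder g z b -> Cder (fun x => f (g x)) z (a * b)%C.
Proof. rewrite (Cmult_comm a), !Cder_CV. apply (is_derive_comp (K := C_AbsRing) (V := CV)). Qed.

Lemma Cder_eq f z a b : Cder f z a -> a = b -> Cder f z b.
Proof. intros H <-. auto. Qed.

Lemma Ccont_lim f z u : Ccont f z -> Clim u z -> Clim (fun n => f (u n)) (f z).
Proof.
  intros H K e he. destruct (H e he) as [d [hd Hd]]. destruct (K d hd) as [N HN].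
  exists N. intros n hn. apply Hd. apply HN; auto.
Qed.

Lemma Cder_inv g z b : Cder g z b -> g z <> RtoC 0 -> Cder (fun x => / g x)%C z (- b / (g z * g z))%C.
Proof.
  intros Hg h0.
  assert (I : Cder Cinv (g z) (- / (g z * g z))%C).
  { apply Cder_eps. intros e he. pose proof (Cmod_pos _ h0) as P. set (w := g z) in *.
    set (m := Cmod w) in *.
    exists (Rmin (m / 2) (e * (m * m * m / 2))).
    assert (0 < e * (m * m * m / 2)) by (repeat apply Rmult_lt_0_compat; lra).
    split; [apply Rmin_pos; lra|]. intros h hh.
    pose proof (Rmin_l (m/2) (e * (m * m * m / 2))). pose proof (Rmin_r (m/2) (e * (m * m * m / 2))).
    assert (L : m / 2 <= Cmod (w + h)%C).
    { pose proof (Cmod_tri2 w (- h)) as T. rewrite Cmod_opp in T.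
      replace (w - - h)%C with (w + h)%C in T by ring. fold m in T. lra. }
    assert (N : (w + h)%C <> 0%C) by (apply Cmod_neq0; lra).
    replace (/ (w + h)%C - / w - h * - / (w * w))%C with (h * h * / ((w + h)%C * (w * w)))%C
      by (field; auto).
    rewrite Cmod_mult, Cmod_inv by (repeat apply Cmult_neq_0; auto).
    rewrite !Cmod_mult. assert (Q : m / 2 * (m * m) <= Cmod (w + h)%C * (m * m)) by (apply Rmult_le_compat_r; nra).
    assert (Q0 : 0 < m / 2 * (m * m)) by (repeat apply Rmult_lt_0_compat; lra).
    assert (Q1 : / (Cmod (w + h)%C * (m * m)) <= / (m / 2 * (m * m))) by (apply Rinv_le_contravar; auto).
    pose proof (Cmod_ge_0 h) as h0'.
    apply Rle_trans with (Cmod h * Cmod h * / (m / 2 * (m * m))).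
    { apply Rmult_le_compat_l; auto. nra. }
    apply Rmult_le_reg_r with (m / 2 * (m * m)); auto.
    rewrite Rmult_assoc, Rinv_l, Rmult_1_r by lra. nra. }
  eapply Cder_eq; [apply (Cder_comp Cinv g z); eauto|]. field. auto.
Qed.

Lemma Cder_div f g z a b : Cder f z a -> Cder g z b -> g z <> RtoC 0 ->
  Cder (fun x => f x / g x)%C z ((a * g z - f z * b) / (g z * g z))%C.
Proof.
  intros H K h. eapply Cder_eq.
  - apply (Cder_mult f (fun x => / g x)%C); [apply H|apply Cder_inv; eauto].
  - simpl. field. auto.
Qed.

(** Termwise differentiation under a summable bound for the second-order
    remainders. *)
Lemma Cder_sums (f : nat -> C -> C) (f' : nat -> C) (F : C -> C) (L : C) (M : nat -> R) z d :
  0 < d -> summable M ->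
  (forall n h, Cmod h < d -> Cmod (f n (z + h) - f n z - h * f' n)%C <= M n * (Cmod h * Cmod h)) ->
  (forall h, Cmod h < d -> sums (fun n => f n (z + h)%C) (F (z + h)%C)) -> sums f' L ->
  Cder F z L.
Proof.
  intros hd [HM [B HB]] H HF HL. apply Cder_eps. intros e he.
  assert (hB : 0 <= B) by (apply (HB 0%nat)).
  set (d' := Rmin d (e / (B + 1))).
  assert (0 < e / (B + 1)) by (apply Rdiv_lt_0_compat; lra).
  exists d'. split; [apply Rmin_pos; auto|]. intros h hh.
  pose proof (Rmin_l d (e / (B + 1))). pose proof (Rmin_r d (e / (B + 1))). fold d' in H1, H2.
  assert (S0 : sums (fun n => f n z) (F z)).
  { replace z with (z + 0)%C by ring. apply HF. rewrite Cmod_0. auto. }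
  assert (S1 : sums (fun n => f n (z + h) - f n z - h * f' n)%C (F (z + h)%C - F z - h * L)%C).
  { apply sums_minus; [apply sums_minus; auto; apply HF; lra|apply sums_scal; auto]. }
  pose proof (Cmod_ge_0 h) as hp.
  apply Rle_trans with (Cmod h * Cmod h * B).
  - apply (sums_bound _ _ (fun n => Cmod h * Cmod h * M n) _ S1).
    + intros n. rewrite (Rmult_comm _ (M n)). apply H. lra.
    + intros n. rewrite Rsum_scal. apply Rmult_le_compat_l; [nra|auto].
  - assert (K : Cmod h * (B + 1) <= e).
    { apply Rmult_le_reg_r with (/ (B + 1)); [apply Rinv_0_lt_compat; lra|].
      rewrite Rmult_assoc, Rinv_r, Rmult_1_r by lra. lra. }
    nra.
Qed.

(** ** The exponential *)

Ltac Req := match goal with |- ?a = ?b => change (@eq R a b) end.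

Lemma exp_mono x y : x <= y -> exp x <= exp y.
Proof. intros [h| ->]; [left; apply exp_increasing; auto|lra]. Qed.

Lemma cexp_plus z w : cexp (z + w) = (cexp z * cexp w)%C.
Proof.
  unfold cexp. Ceq; rewrite exp_plus.
  - rewrite cos_plus. ring.
  - rewrite sin_plus. ring.
Qed.

Lemma cexp_0 : cexp (RtoC 0) = RtoC 1.
Proof. unfold cexp. Ceq; rewrite ?exp_0, ?cos_0, ?sin_0; ring. Qed.

Lemma Cmod_cexp z : Cmod (cexp z)%C = exp (Re z).
Proof.
  unfold cexp. rewrite Cmod_mult, Cmod_R, (Rabs_pos_eq (exp _)) by (apply Rlt_le, exp_pos).
  unfold Cmod, fst, snd. replace (cos (Im z) ^ 2 + sin (Im z) ^ 2) with 1.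
  - rewrite sqrt_1. ring.
  - pose proof (sin2_cos2 (Im z)) as H. unfold Rsqr in H. lra.
Qed.

Lemma cexp_neq0 z : cexp z <> RtoC 0.
Proof. apply Cmod_neq0. rewrite Cmod_cexp. pose proof (exp_pos (Re z)). lra. Qed.

(** On the segment from [0] to [z] the second derivative of every rotated real part
    is at most [|z|^2 exp |z|]; apply the mean value theorem twice. *)
Lemma cexp_bound z : Cmod (cexp z - 1 - z)%C <= Cmod z * Cmod z * exp (Cmod z).
Proof.
  apply Cmod_le_rotations. intros k hk.
  set (g := fun t => Re (k * (cexp (RtoC t * z) - 1 - RtoC t * z))%C).
  remember (k * z)%C as w eqn:Ew.
  set (g1 := fun t => Re (w * (cexp (RtoC t * z) - 1))%C).
  set (g2 := fun t => Re (w * z * cexp (RtoC t * z))%C).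
  assert (R1 : forall t, Re (RtoC t * z)%C = t * Re z) by (intros; ReIm; ring).
  assert (R2 : forall t, Im (RtoC t * z)%C = t * Im z) by (intros; ReIm; ring).
  assert (Rc : forall t, Re (cexp (RtoC t * z)) = exp (t * Re z) * cos (t * Im z)).
  { intros t. unfold cexp. rewrite R1, R2. ReIm. ring. }
  assert (Ic : forall t, Im (cexp (RtoC t * z)) = exp (t * Re z) * sin (t * Im z)).
  { intros t. unfold cexp. rewrite R1, R2. ReIm. ring. }
  assert (D1 : forall t, is_derive g t (g1 t)).
  { intros t. apply (is_derive_ext (fun t => Re k * (exp (t * Re z) * cos (t * Im z) - 1 - t * Re z)
        - Im k * (exp (t * Re z) * sin (t * Im z) - t * Im z))).
    - intros s. Req. unfold g. repeat (progress (ReIm; rewrite ?R1, ?R2, ?Rc, ?Ic)). ring.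
    - auto_derive; auto. Req. unfold g1. rewrite Ew. repeat (progress (ReIm; rewrite ?R1, ?R2, ?Rc, ?Ic)). ring. }
  assert (D2 : forall t, is_derive g1 t (g2 t)).
  { intros t. apply (is_derive_ext (fun t => Re w * (exp (t * Re z) * cos (t * Im z) - 1)
        - Im w * (exp (t * Re z) * sin (t * Im z)))).
    - intros s. Req. unfold g1. repeat (progress (ReIm; rewrite ?R1, ?R2, ?Rc, ?Ic)). ring.
    - auto_derive; auto. Req. unfold g2. repeat (progress (ReIm; rewrite ?R1, ?R2, ?Rc, ?Ic)). ring. }
  assert (Bd : forall t, 0 <= t <= 1 -> Rabs (g2 t) <= Cmod z * Cmod z * exp (Cmod z)).
  { intros t ht. eapply Rle_trans; [apply re_le_Cmod|].
    rewrite !Cmod_mult, Ew, Cmod_mult, hk, Cmod_cexp, R1. rewrite Rmult_1_l.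
    apply Rmult_le_compat_l; [nra|].
    pose proof (re_le_Cmod z) as Q. apply Rabs_le_between in Q.
    assert (t * Re z <= Cmod z) by nra.
    apply exp_mono; auto. }
  set (M := Cmod z * Cmod z * exp (Cmod z)) in *.
  assert (E0 : g 0 = 0).
  { unfold g. replace (RtoC 0 * z)%C with (RtoC 0) by ring. rewrite cexp_0.
    replace (k * (1 - 1 - 0))%C with (RtoC 0) by ring. reflexivity. }
  assert (E1 : g1 0 = 0).
  { unfold g1. replace (RtoC 0 * z)%C with (RtoC 0) by ring. rewrite cexp_0.
    replace (w * (1 - 1))%C with (RtoC 0) by ring. reflexivity. }
  assert (B1 : forall t, 0 <= t <= 1 -> Rabs (g1 t) <= M).
  { intros t ht. destruct (MVT_gen g1 0 t g2) as [c [hc Hc]].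
    - intros; apply D2.
    - intros x _. apply continuity_pt_filterlim. apply (ex_derive_continuous g1). eexists; apply D2.
    - rewrite Rmin_left, Rmax_right in hc by lra. rewrite E1 in Hc.
      replace (g1 t) with (g2 c * (t - 0)) by lra.
      rewrite Rabs_mult, (Rabs_pos_eq (t - 0)) by lra.
      specialize (Bd c ltac:(lra)). pose proof (Rabs_pos (g2 c)). nra. }
  destruct (MVT_gen g 0 1 g1) as [c [hc Hc]].
  - intros; apply D1.
  - intros x _. apply continuity_pt_filterlim. apply (ex_derive_continuous g). eexists; apply D1.
  - rewrite Rmin_left, Rmax_right in hc by lra. rewrite E0 in Hc.
    specialize (B1 c ltac:(lra)). apply Rabs_le_between in B1.
    replace (Re (k * (cexp z - 1 - z))%C) with (g 1).
    + lra.
    + unfold g. replace (RtoC 1 * z)%C with z by ring. reflexivity.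
Qed.

Lemma Cder_cexp z : Cder cexp z (cexp z).
Proof.
  apply Cder_eps. intros e he. pose proof (exp_pos (Re z)) as E.
  set (K := exp (Re z) * exp 1).
  assert (hK : 0 < K) by (apply Rmult_lt_0_compat; [auto|apply exp_pos]).
  exists (Rmin 1 (e / K)). assert (0 < e / K) by (apply Rdiv_lt_0_compat; lra).
  split; [apply Rmin_pos; lra|]. intros h hh.
  pose proof (Rmin_l 1 (e / K)). pose proof (Rmin_r 1 (e / K)).
  replace (cexp (z + h) - cexp z - h * cexp z)%C with (cexp z * (cexp h - 1 - h))%C
    by (rewrite cexp_plus; ring).
  rewrite Cmod_mult, Cmod_cexp. pose proof (cexp_bound h) as Bd. pose proof (Cmod_ge_0 h) as hp.
  assert (X : exp (Cmod h) <= exp 1) by (left; apply exp_increasing; lra).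
  apply Rle_trans with (exp (Re z) * (Cmod h * Cmod h * exp 1)).
  - apply Rmult_le_compat_l; [lra|]. eapply Rle_trans; [apply Bd|]. apply Rmult_le_compat_l; [nra|auto].
  - assert (Q : Cmod h * K <= e).
    { apply Rmult_le_reg_r with (/ K); [apply Rinv_0_lt_compat; auto|].
      rewrite Rmult_assoc, Rinv_r, Rmult_1_r by lra. lra. }
    replace (exp (Re z) * (Cmod h * Cmod h * exp 1)) with (Cmod h * (Cmod h * K)) by (unfold K; ring). nra.
Qed.

Notation INC n := (RtoC (INR n)).
Notation twopii := (RtoC (2 * PI) * Ci)%C.

Definition ex (u : C) : C := cexp (twopii * u)%C.

Lemma ex_plus u v : ex (u + v) = (ex u * ex v)%C.
Proof. unfold ex. rewrite <- cexp_plus. f_equal. ring. Qed.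

Lemma ex_0 : ex (RtoC 0) = RtoC 1.
Proof. unfold ex. rewrite Cmult_0_r. apply cexp_0. Qed.

Lemma ex_neq0 u : ex u <> RtoC 0.
Proof. apply cexp_neq0. Qed.

Lemma ex_opp u : ex (- u) = (/ ex u)%C.
Proof.
  assert (H : (ex u * ex (- u))%C = RtoC 1).
  { rewrite <- ex_plus. replace (u + - u)%C with (RtoC 0) by ring. apply ex_0. }
  pose proof (ex_neq0 u). replace (ex (- u)) with (/ ex u * (ex u * ex (- u)))%C by (field; auto).
  rewrite H. ring.
Qed.

Lemma ex_minus u v : ex (u - v) = (ex u / ex v)%C.
Proof. unfold Cminus. rewrite ex_plus, ex_opp. reflexivity. Qed.

Lemma Cmod_ex u : Cmod (ex u)%C = exp (- (2 * PI * Im u)).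
Proof. unfold ex. rewrite Cmod_cexp. f_equal. ReIm. ring. Qed.

Lemma ex_R x : ex (RtoC x) = (cos (2 * PI * x), sin (2 * PI * x)).
Proof.
  unfold ex, cexp.
  assert (A : Re (twopii * RtoC x)%C = 0) by (repeat (progress ReIm); ring).
  assert (B : Im (twopii * RtoC x)%C = 2 * PI * x) by (repeat (progress ReIm); ring).
  rewrite A, B, exp_0. ring.
Qed.

Lemma ex_Z n : ex (IZC n) = RtoC 1.
Proof.
  assert (N : forall k, ex (INC k) = RtoC 1).
  { intros k. rewrite ex_R. replace (2 * PI * INR k) with (0 + 2 * INR k * PI) by ring.
    rewrite cos_period, sin_period, cos_0, sin_0. reflexivity. }
  unfold IZC. destruct (Z_le_gt_dec 0 n) as [h|h].
  - rewrite <- (Z2Nat.id n h), <- INR_IZR_INZ. apply N.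
  - replace (RtoC (IZR n)) with (- INC (Z.to_nat (- n)))%C.
    + rewrite ex_opp, N. field; intros E; apply RtoC_inj in E; lra.
    + rewrite INR_IZR_INZ, Z2Nat.id by lia. rewrite opp_IZR, RtoC_opp. ring.
Qed.

Lemma ex_eq u v n : (u = v + IZC n)%C -> ex u = ex v.
Proof. intros ->. rewrite ex_plus, ex_Z. ring. Qed.

Lemma ex_half : ex (RtoC (1/2)) = (- RtoC 1)%C.
Proof.
  rewrite ex_R. replace (2 * PI * (1/2)) with PI by field.
  rewrite cos_PI, sin_PI. Ceq; ring.
Qed.

Lemma ex_neq1_Im u : Im u <> 0 -> ex u <> RtoC 1.
Proof.
  intros h E. apply (f_equal Cmod) in E. rewrite Cmod_ex, Cmod_1, <- exp_0 in E.
  apply exp_inv in E. pose proof PI_RGT_0. nra.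
Qed.

Lemma ex_neq1_R x : 0 < x < 1 -> ex (RtoC x) <> RtoC 1.
Proof.
  intros h E. rewrite ex_R in E. apply (f_equal fst) in E. simpl in E.
  replace (2 * PI * x) with (2 * (PI * x)) in E by ring. rewrite cos_2a_sin in E.
  pose proof PI_RGT_0.
  assert (0 < sin (PI * x)) by (apply sin_gt_0; nra). nra.
Qed.

Lemma Cder_ex_lin a b u : Cder (fun u => ex (a * u + b)%C) u (twopii * a * ex (a * u + b))%C.
Proof.
  unfold ex. eapply Cder_eq.
  - apply (Cder_comp cexp (fun u => twopii * (a * u + b))%C).
    + apply Cder_cexp.
    + apply Cder_scal. apply Cder_plus; [apply Cder_scal; apply Cder_id|apply Cder_const].
  - ring.
Qed.

Lemma qpow_ex r z : qpow r z = ex (RtoC r * z).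
Proof. unfold qpow, ex. f_equal. rewrite !RtoC_mult. ring. Qed.

Lemma sgn_ex n : RtoC ((-1) ^ n) = ex (RtoC (INR n / 2)).
Proof.
  induction n as [|n IH].
  - simpl. replace (0 / 2) with 0 by field. rewrite ex_0. reflexivity.
  - rewrite S_INR. replace ((INR n + 1) / 2) with (INR n / 2 + 1/2) by field.
    rewrite RtoC_plus, ex_plus, <- IH, ex_half. simpl. rewrite RtoC_mult.
    replace (RtoC (-1)) with (- RtoC 1)%C by (rewrite <- RtoC_opp; reflexivity). ring.
Qed.

(** * Sums over the integers *)

Lemma IZC_plus m n : IZC (m + n) = (IZC m + IZC n)%C.
Proof. unfold IZC. rewrite plus_IZR, RtoC_plus. auto. Qed.
Lemma IZC_minus m n : IZC (m - n) = (IZC m - IZC n)%C.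
Proof. unfold IZC. rewrite minus_IZR, RtoC_minus. auto. Qed.
Lemma IZC_opp n : IZC (- n) = (- IZC n)%C.
Proof. unfold IZC. rewrite opp_IZR, RtoC_opp. auto. Qed.
Lemma IZC_mult m n : IZC (m * n) = (IZC m * IZC n)%C.
Proof. unfold IZC. rewrite mult_IZR, RtoC_mult. auto. Qed.

Definition zpair (f : Z -> C) (i : nat) : C := (f (Z.of_nat i) + f (-1 - Z.of_nat i)%Z)%C.

Definition rzsummable (b : Z -> R) : Prop :=
  summable (fun i => b (Z.of_nat i)) /\ summable (fun i => b (-1 - Z.of_nat i)%Z).

Definition zsummable (f : Z -> C) : Prop := rzsummable (fun n => Cmod (f n)).

(** Absolute convergence together with the value of the sum; the terms are
    grouped as [f i + f (-1 - i)], so that partial sums run over the symmetric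
    ranges [-N <= n < N]. *)
Definition zsums (f : Z -> C) (l : C) : Prop := zsummable f /\ sums (zpair f) l.

Definition Zsum (f : Z -> C) : C := C_Series (zpair f).

Lemma zsums_Zsum_eq f l : zsums f l -> Zsum f = l.
Proof. intros [_ H]. apply C_Series_unique. auto. Qed.

Lemma zsummable_sums f : zsummable f -> zsums f (Zsum f).
Proof.
  intros H. split; auto. destruct H as [H H'].
  destruct (sums_majorant (zpair f) (fun i => Cmod (f (Z.of_nat i)) + Cmod (f (-1 - Z.of_nat i)%Z))) as [l Hl].
  - intros n. apply Cmod_triangle.
  - apply summable_plus; auto.
  - unfold Zsum. rewrite (C_Series_unique _ _ Hl). auto.
Qed.

Lemma zsums_unique f l l' : zsums f l -> zsums f l' -> l = l'.
Proof. intros [_ H] [_ K]. apply (sums_unique _ _ _ H K). Qed.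

Lemma Z_ind2 (n : Z) : exists i, n = Z.of_nat i \/ n = (-1 - Z.of_nat i)%Z.
Proof.
  destruct (Z_le_gt_dec 0 n).
  - exists (Z.to_nat n). left. lia.
  - exists (Z.to_nat (-1 - n)). right. lia.
Qed.

Lemma rzsummable_le a b : (forall n, 0 <= a n <= b n) -> rzsummable b -> rzsummable a.
Proof.
  intros H [K L]. split.
  - apply (summable_le _ (fun i => b (Z.of_nat i))); auto.
  - apply (summable_le _ (fun i => b (-1 - Z.of_nat i)%Z)); auto.
Qed.

Lemma rzsummable_scal c a : 0 <= c -> rzsummable a -> rzsummable (fun n => c * a n).
Proof. intros h [K L]. split; [apply (summable_scal c _ h K)|apply (summable_scal c _ h L)]. Qed.

Lemma rzsummable_plus a b : rzsummable a -> rzsummable b -> rzsummable (fun n => a n + b n).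
Proof. intros [K L] [K' L']. split; [apply (summable_plus _ _ K K')|apply (summable_plus _ _ L L')]. Qed.

Lemma rzsummable_ext a b : (forall n, a n = b n) -> rzsummable a -> rzsummable b.
Proof.
  intros E H. apply rzsummable_le with a; auto. intros n. rewrite E. split; [|lra].
  rewrite <- E. destruct H as [[h _] [h' _]]. destruct (Z_ind2 n) as [i [->| ->]]; auto.
Qed.

Lemma summable_shift a : summable a <-> 0 <= a O /\ summable (fun n => a (S n)).
Proof.
  assert (E : forall n, Rsum a (S n) = a O + Rsum (fun k => a (S k)) n).
  { induction n as [|n IH]; [simpl; ring|]. change (Rsum a (S (S n))) with (Rsum a (S n) + a (S n)). rewrite IH. simpl. ring. }
  split.
  - intros [h [B HB]]. split; auto. split; auto. exists B. intros n.
    specialize (HB (S n)). rewrite E in HB. specialize (h O). lra.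
  - intros [h0 [h [B HB]]]. split; [intros [|n]; auto|]. exists (a O + B). intros [|n].
    + specialize (HB O). simpl in *. lra.
    + rewrite E. specialize (HB n). lra.
Qed.

Lemma rzsummable_shift a : rzsummable a -> rzsummable (fun n => a (n + 1)%Z).
Proof.
  intros [H K]. split.
  - apply summable_shift in H. destruct H as [_ H]. eapply summable_le; [|apply H].
    intros n. replace (Z.of_nat n + 1)%Z with (Z.of_nat (S n)) by lia. split; [|lra]. apply H.
  - apply summable_shift. split.
    + apply (proj1 H O).
    + eapply summable_le; [|apply K]. intros n.
      replace (-1 - Z.of_nat (S n) + 1)%Z with (-1 - Z.of_nat n)%Z by lia. split; [|lra]. apply K.
Qed.

Lemma rzsummable_refl a : rzsummable a -> rzsummable (fun n => a (-1 - n)%Z).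
Proof.
  intros [H K]. split; [exact K|].
  eapply summable_le; [|apply H]. intros n.
  replace (-1 - (-1 - Z.of_nat n))%Z with (Z.of_nat n) by lia. split; [|lra]. apply H.
Qed.

Lemma zsummable_rle f b : (forall n, Cmod (f n) <= b n) -> rzsummable b -> zsummable f.
Proof. intros H. apply rzsummable_le. intros n. split; auto. apply Cmod_ge_0. Qed.

Lemma zsummable_ext f g : (forall n, f n = g n) -> zsummable f -> zsummable g.
Proof. intros E. apply rzsummable_ext. intros; rewrite E; auto. Qed.

Lemma zsums_ext f g l : (forall n, f n = g n) -> zsums f l -> zsums g l.
Proof.
  intros E [H K]. split; [apply (zsummable_ext f g); auto|].
  eapply sums_ext; [|apply K]. intros n. unfold zpair. rewrite !E. auto.
Qed.

Lemma zsums_plus f g l l' : zsums f l -> zsums g l' -> zsums (fun n => f n + g n)%C (l + l')%C.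
Proof.
  intros [H K] [H' K']. split.
  - eapply zsummable_rle; [|apply (rzsummable_plus _ _ H H')]. intros. apply Cmod_triangle.
  - eapply sums_ext; [|apply (sums_plus _ _ _ _ K K')]. intros n. unfold zpair. ring.
Qed.

Lemma zsums_scal c f l : zsums f l -> zsums (fun n => c * f n)%C (c * l)%C.
Proof.
  intros [H K]. split.
  - eapply zsummable_rle; [|apply (rzsummable_scal (Cmod c) _ (Cmod_ge_0 _) H)].
    intros. rewrite Cmod_mult. lra.
  - eapply sums_ext; [|apply (sums_scal c _ _ K)]. intros n. unfold zpair. ring.
Qed.

Lemma zsums_minus f g l l' : zsums f l -> zsums g l' -> zsums (fun n => f n - g n)%C (l - l')%C.
Proof.
  intros H K. replace (l - l')%C with (l + (-1) * l')%C by ring.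
  eapply zsums_ext; [|apply (zsums_plus _ _ _ _ H (zsums_scal (-1) _ _ K))]. intros n; simpl. ring.
Qed.

Lemma zsums_zero : zsums (fun _ => RtoC 0) (RtoC 0).
Proof.
  split.
  - assert (S : summable (fun i => Cmod 0)).
    { split; [intros; apply Cmod_ge_0|]. exists 0. intros n. induction n; simpl; rewrite ?Cmod_0 in *; lra. }
    split; exact S.
  - apply Clim_ext with (fun _ => RtoC 0); [|apply Clim_const]. intros n.
    rewrite Csum_zero; auto. intros; unfold zpair; ring.
Qed.

Lemma zsums_Csum (F : nat -> Z -> C) (l : nat -> C) K :
  (forall k, (k < K)%nat -> zsums (F k) (l k)) ->
  zsums (fun n => Csum (fun k => F k n) K) (Csum l K).
Proof.
  induction K as [|K IH]; intros H; simpl; [apply zsums_zero|].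
  apply zsums_plus; [apply IH; intros; apply H; lia|apply H; lia].
Qed.

Lemma zsums_refl f l : zsums f l -> zsums (fun n => f (-1 - n)%Z) l.
Proof.
  intros [H K]. split; [apply (rzsummable_refl _ H)|].
  eapply sums_ext; [|apply K]. intros n. unfold zpair.
  replace (-1 - (-1 - Z.of_nat n))%Z with (Z.of_nat n) by lia. ring.
Qed.

Lemma zsum_range f N : Csum (zpair f) N = Csum (fun k => f (Z.of_nat k - Z.of_nat N)%Z) (2 * N).
Proof.
  induction N as [|N IH]; auto.
  set (g := fun k => f (Z.of_nat k - Z.of_nat (S N))%Z).
  replace (2 * S N)%nat with (1 + (2 * N + 1))%nat by lia.
  rewrite (Csum_split g 1 (2 * N + 1)), (Csum_split _ (2 * N) 1).
  replace (Csum (fun k => g (1 + k)%nat) (2 * N)) with (Csum (zpair f) N).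
  - change (Csum (zpair f) (S N)) with (Csum (zpair f) N + zpair f N)%C.
    assert (E : forall v, Csum v 1 = v O) by (intros; simpl; ring). rewrite !E.
    unfold zpair, g.
    replace (Z.of_nat 0 - Z.of_nat (S N))%Z with (-1 - Z.of_nat N)%Z by lia.
    replace (Z.of_nat (1 + (2 * N + 0)) - Z.of_nat (S N))%Z with (Z.of_nat N) by lia. ring.
  - rewrite IH. apply Csum_ext. intros k _. unfold g. f_equal. lia.
Qed.

Lemma zsums_split f l : zsums f l -> exists s r,
  sums (fun i => f (Z.of_nat i)) s /\ sums (fun i => f (-1 - Z.of_nat i)%Z) r /\ l = (s + r)%C.
Proof.
  intros [[H1 H2] H].
  destruct (sums_majorant (fun n => f (Z.of_nat n)) _ (fun n => Rle_refl _) H1) as [s Hs].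
  destruct (sums_majorant (fun n => f (-1 - Z.of_nat n)%Z) _ (fun n => Rle_refl _) H2) as [r Hr].
  exists s, r. repeat split; auto. apply (sums_unique _ _ _ H (sums_plus _ _ _ _ Hs Hr)).
Qed.

Lemma zsums_shift f l : zsums f l -> zsums (fun n => f (n + 1)%Z) l.
Proof.
  intros H. destruct (zsums_split f l H) as [s [r [Hs [Hr _]]]]. destruct H as [H K].
  split; [apply (rzsummable_shift _ H)|].
  assert (E : forall N, Csum (zpair (fun n => f (n + 1)%Z)) N
     = (Csum (zpair f) N + f (Z.of_nat N) - f (- Z.of_nat N)%Z)%C).
  { induction N as [|N IH]; [simpl; ring|].
    simpl Csum. rewrite IH. unfold zpair.
    replace (-1 - Z.of_nat N + 1)%Z with (- Z.of_nat N)%Z by lia. rewrite Nat2Z.inj_succ.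
    replace (- Z.succ (Z.of_nat N))%Z with (-1 - Z.of_nat N)%Z by lia. unfold Z.succ. ring. }
  eapply Clim_ext; [intros N; symmetry; apply E|]. replace l with (l + 0 - 0)%C by ring. apply Clim_minus.
  - apply Clim_plus; auto. apply (sums_term _ _ Hs).
  - intros e he. destruct (sums_term _ _ Hr e he) as [N HN]. exists (S N). intros n hn. specialize (HN (n - 1)%nat ltac:(lia)).
    replace (-1 - Z.of_nat (n - 1))%Z with (- Z.of_nat n)%Z in HN by lia. auto.
Qed.

Lemma zsums_neg f l : zsums f l -> zsums (fun n => f (- n)%Z) l.
Proof.
  intros H. apply zsums_shift, zsums_refl in H. eapply zsums_ext; [|apply H].
  intros n. cbv beta. f_equal. lia.
Qed.

Lemma zsums_addn f l k : zsums f l -> zsums (fun n => f (n + k)%Z) l.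
Proof.
  assert (P : forall j f, zsums f l -> zsums (fun n => f (n + Z.of_nat j)%Z) l).
  { clear f. induction j as [|j IH]; intros f H.
    - eapply zsums_ext; [|apply H]. intros; cbv beta; f_equal; lia.
    - apply zsums_shift, IH in H. eapply zsums_ext; [|apply H]. intros; cbv beta; f_equal; lia. }
  intros H. destruct (Z_le_gt_dec 0 k).
  - rewrite <- (Z2Nat.id k) by lia. apply (P _ _ H).
  - apply zsums_neg, (P (Z.to_nat (-k))), zsums_neg in H.
    eapply zsums_ext; [|apply H]. intros; cbv beta; f_equal; lia.
Qed.

(** The reflection permutes the terms, so the sum is its own negative. *)
Lemma zsums_antisym f l k : zsums f l -> (forall n, f (k - n)%Z = (- f n)%C) -> l = RtoC 0.
Proof.
  intros H A. assert (K : zsums (fun n => (-1) * f n)%C l).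
  { apply zsums_neg, (zsums_addn _ _ (-k)) in H. eapply zsums_ext; [|apply H].
    intros n. cbv beta. replace (- (n + - k))%Z with (k - n)%Z by lia. rewrite A. ring. }
  pose proof (zsums_unique _ _ _ K (zsums_scal (-1) _ _ H)) as E.
  assert (E2 : (2 * l)%C = 0%C).
  { replace (2 * l)%C with (l - (-1) * l)%C by ring. rewrite <- E. ring. }
  replace l with ((/2) * (2 * l))%C by (field; intros Q; apply RtoC_inj in Q; lra). rewrite E2. ring.
Qed.

Lemma Csum_blocks (g : nat -> C) p M :
  Csum g (M * p) = Csum (fun a => Csum (fun m => g (m * p + a)%nat) M) p.
Proof.
  induction M as [|M IH].
  - simpl. rewrite Csum_zero; auto.
  - replace (S M * p)%nat with (M * p + p)%nat by lia. rewrite Csum_split, IH. simpl.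
    rewrite Csum_plus. reflexivity.
Qed.

(** The symmetric partial sums of length [2 N p] consist of whole blocks of residues. *)
Lemma zsums_residues (p : nat) f (l : nat -> C) : (0 < p)%nat -> zsummable f ->
  (forall a, (a < p)%nat -> zsums (fun m => f (Z.of_nat a + Z.of_nat p * m)%Z) (l a)) ->
  zsums f (Csum l p).
Proof.
  intros hp Hf Hl. pose proof (zsummable_sums f Hf) as H.
  replace (Csum l p) with (Zsum f); auto.
  apply (Clim_unique (fun N => Csum (zpair f) (N * p))).
  - destruct H as [_ H]. apply (Clim_subseq (Csum (zpair f)) _ (fun N => (N * p)%nat)); auto. intros; nia.
  - apply Clim_ext with (fun N => Csum (fun a => Csum (zpair (fun m => f (Z.of_nat a + Z.of_nat p * m)%Z)) N) p).
    + intros N. rewrite zsum_range.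
      replace (2 * (N * p))%nat with ((2 * N) * p)%nat by ring. rewrite Csum_blocks.
      apply Csum_ext. intros a _. rewrite zsum_range. apply Csum_ext. intros m _. f_equal.
      rewrite !Nat2Z.inj_add, !Nat2Z.inj_mul. ring.
    + assert (K : forall q, (q <= p)%nat -> Clim (fun N => Csum (fun a => Csum (zpair (fun m => f (Z.of_nat a + Z.of_nat p * m)%Z)) N) q) (Csum l q)).
      { induction q as [|q IH]; intros h; simpl; [apply Clim_const|].
        apply Clim_plus; [apply IH; lia|]. apply Hl. lia. }
      apply K. auto.
Qed.

Lemma C_Series_Z_zsums f l : zsums f l -> C_Series_Z f = l.
Proof.
  intros H. destruct (zsums_split f l H) as [s [r [Hs [Hr ->]]]]. unfold C_Series_Z.
  rewrite (C_Series_unique _ _ Hs), (C_Series_unique _ r); auto.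
  eapply sums_ext; [|apply Hr]. intros n. cbv beta. f_equal. lia.
Qed.

(** Dominated convergence for sums over the integers. *)
Lemma ztannery (u : nat -> Z -> C) (l : Z -> C) (b : Z -> R) (s : nat -> C) (t : C) :
  (forall k, Clim (fun N => u N k) (l k)) ->
  (forall N k, Cmod (u N k) <= b k) -> rzsummable b ->
  (forall N, zsums (u N) (s N)) -> zsums l t -> Clim s t.
Proof.
  intros Hl Hb [S1 S2] Hs [_ Ht].
  apply (tannery (fun N => zpair (u N)) (zpair l) (fun i => b (Z.of_nat i) + b (-1 - Z.of_nat i)%Z)); auto.
  - intros k. apply Clim_plus; apply Hl.
  - intros N k. eapply Rle_trans; [apply Cmod_triangle|]. apply Rplus_le_compat; auto.
  - apply summable_plus; auto.
  - intros N. apply Hs.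
Qed.

(** ** Gaussian majorants *)

Lemma summable_exp : summable (fun i => exp (- INR i)).
Proof.
  apply summable_ex_series; [intros; left; apply exp_pos|].
  apply ex_series_ext with (fun n => (exp (-1)) ^ n).
  - intros n. induction n as [|n IH]; [simpl; f_equal; rewrite <- exp_0; f_equal; lra|].
    simpl pow. rewrite IH, S_INR, <- exp_plus. f_equal. ring.
  - apply ex_series_geom. rewrite Rabs_pos_eq by (left; apply exp_pos).
    rewrite <- exp_0. apply exp_increasing. lra.
Qed.

Lemma rzsummable_exp : rzsummable (fun n => exp (- Rabs (IZR n))).
Proof.
  assert (E : forall i, Rabs (IZR (Z.of_nat i)) = INR i).
  { intros i. rewrite <- INR_IZR_INZ. apply Rabs_pos_eq, pos_INR. }
  split.
  - eapply summable_le; [|apply summable_exp]. intros n. rewrite E. split; [left; apply exp_pos|lra].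
  - eapply summable_le; [|apply summable_exp]. intros n. split; [left; apply exp_pos|].
    rewrite minus_IZR, <- Rabs_Ropp. replace (- (-1 - IZR (Z.of_nat n))) with (INR n + 1) by (rewrite INR_IZR_INZ; ring).
    pose proof (pos_INR n). rewrite Rabs_pos_eq by lra. apply exp_mono. lra.
Qed.

(** Completing a square bounds the terms by a multiple of [exp (- |n|)]. *)
Lemma rzsummable_gauss a B D : 0 < a ->
  rzsummable (fun n => exp (- (a * (IZR n * IZR n)) + B * Rabs (IZR n) + D)).
Proof.
  intros ha. set (K := (B + 1) * (B + 1) / (4 * a) + D).
  eapply rzsummable_le; [|apply (rzsummable_scal (exp K) _ (Rlt_le _ _ (exp_pos K)) rzsummable_exp)].
  intros n. split; [left; apply exp_pos|]. rewrite <- exp_plus. apply exp_mono. unfold K.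
  set (x := Rabs (IZR n)). replace (IZR n * IZR n) with (x * x) by (unfold x; rewrite <- Rabs_mult; apply Rabs_pos_eq; nra).
  assert (0 <= (2 * a * x - (B + 1)) * (2 * a * x - (B + 1)) / (4 * a)).
  { apply Rmult_le_pos; [apply Rle_0_sqr|]. left. apply Rinv_0_lt_compat. lra. }
  replace ((2 * a * x - (B + 1)) * (2 * a * x - (B + 1)) / (4 * a)) with (a * (x * x) - (B + 1) * x + (B + 1) * (B + 1) / (4 * a)) in H by (field; lra).
  lra.
Qed.

Lemma le_exp x : x <= exp x.
Proof. pose proof (exp_ineq1_le x). lra. Qed.

(** ** Derivatives of sums of exponentials *)

Lemma Cder_zsums (f : Z -> C -> C) (f' : Z -> C) (F : C -> C) (L : C) (M : Z -> R) z d :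
  0 < d -> rzsummable M ->
  (forall n h, Cmod h < d -> Cmod (f n (z + h) - f n z - h * f' n)%C <= M n * (Cmod h * Cmod h)) ->
  (forall x, Cmod (x - z) < d -> zsums (fun n => f n x) (F x)) -> zsums f' L ->
  Cder F z L.
Proof.
  intros hd [M1 M2] H HF [_ HL].
  apply (Cder_sums (fun i x => zpair (fun n => f n x) i) (zpair f') F L
    (fun i => M (Z.of_nat i) + M (-1 - Z.of_nat i)%Z) z d hd).
  - apply summable_plus; auto.
  - intros n h hh. unfold zpair.
    replace (f (Z.of_nat n) (z + h) + f (-1 - Z.of_nat n)%Z (z + h) - (f (Z.of_nat n) z + f (-1 - Z.of_nat n)%Z z)
      - h * (f' (Z.of_nat n) + f' (-1 - Z.of_nat n)%Z))%C with
      ((f (Z.of_nat n) (z + h) - f (Z.of_nat n) z - h * f' (Z.of_nat n)) +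
       (f (-1 - Z.of_nat n)%Z (z + h) - f (-1 - Z.of_nat n)%Z z - h * f' (-1 - Z.of_nat n)%Z))%C by ring.
    eapply Rle_trans; [apply Cmod_triangle|]. rewrite Rmult_plus_distr_r.
    apply Rplus_le_compat; apply H; auto.
  - intros h hh. apply HF. replace (z + h - z)%C with h by ring. auto.
  - auto.
Qed.

Lemma ex_remainder l z h : Cmod (ex (RtoC l * (z + h)) - ex (RtoC l * z) - h * (twopii * RtoC l * ex (RtoC l * z)))
  <= exp (- (2 * PI * (l * Im z))) * (4 * PI * PI * (l * l)) * exp (2 * PI * Rabs l * Cmod h) * (Cmod h * Cmod h).
Proof.
  set (w := (twopii * (RtoC l * h))%C).
  assert (E : ex (RtoC l * h) = cexp w) by reflexivity.
  replace (ex (RtoC l * (z + h)) - ex (RtoC l * z) - h * (twopii * RtoC l * ex (RtoC l * z)))%C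
    with (ex (RtoC l * z) * (cexp w - 1 - w))%C.
  - assert (Ew : Cmod w = 2 * PI * Rabs l * Cmod h).
    { unfold w. rewrite !Cmod_mult, !Cmod_R, Cmod_Ci. rewrite (Rabs_pos_eq (2 * PI)) by (pose proof PI_RGT_0; lra). ring. }
    rewrite Cmod_mult, Cmod_ex.
    replace (Im (RtoC l * z)) with (l * Im z) by (ReIm; ring).
    pose proof (cexp_bound w) as Bd. rewrite Ew in Bd.
    eapply Rle_trans; [apply Rmult_le_compat_l; [left; apply exp_pos|apply Bd]|].
    right. replace (l * l) with (Rabs l * Rabs l) by (rewrite <- Rabs_mult; apply Rabs_pos_eq; nra). ring.
  - rewrite <- E. replace (RtoC l * (z + h))%C with (RtoC l * z + RtoC l * h)%C by ring.
    rewrite ex_plus. unfold w. ring.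
Qed.

Lemma Cder_expsum (c : Z -> C) (la : Z -> R) F z r L : 0 < r ->
  rzsummable (fun n => Cmod (c n) * (la n * la n) * exp (2 * PI * (Rabs (la n) * r - la n * Im z))) ->
  (forall x, Cmod (x - z) < r -> zsums (fun n => c n * ex (RtoC (la n) * x))%C (F x)) ->
  zsums (fun n => c n * (twopii * RtoC (la n)) * ex (RtoC (la n) * z))%C L ->
  Cder F z L.
Proof.
  intros hr HM HF HL.
  apply (Cder_zsums (fun n x => c n * ex (RtoC (la n) * x))%C
    (fun n => c n * (twopii * RtoC (la n)) * ex (RtoC (la n) * z))%C F L _ z r hr
    (rzsummable_scal (4 * PI * PI) _ ltac:(pose proof PI_RGT_0; nra) HM)); [|auto|apply HL].
  intros n h hh.
  replace (c n * ex (RtoC (la n) * (z + h)) - c n * ex (RtoC (la n) * z) -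
    h * (c n * (twopii * RtoC (la n)) * ex (RtoC (la n) * z)))%C with
    (c n * (ex (RtoC (la n) * (z + h)) - ex (RtoC (la n) * z) - h * (twopii * RtoC (la n) * ex (RtoC (la n) * z))))%C by ring.
  rewrite Cmod_mult. eapply Rle_trans; [apply Rmult_le_compat_l; [apply Cmod_ge_0|apply ex_remainder]|].
  assert (X : exp (- (2 * PI * (la n * Im z))) * exp (2 * PI * Rabs (la n) * Cmod h) <= exp (2 * PI * (Rabs (la n) * r - la n * Im z))).
  { rewrite <- exp_plus. apply exp_mono. pose proof PI_RGT_0. pose proof (Rabs_pos (la n)).
    assert (Rabs (la n) * Cmod h <= Rabs (la n) * r) by (apply Rmult_le_compat_l; lra). nra. }
  set (E1 := exp (- (2 * PI * (la n * Im z)))) in *. set (E2 := exp (2 * PI * Rabs (la n) * Cmod h)) in *.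
  set (E3 := exp (2 * PI * (Rabs (la n) * r - la n * Im z))) in *.
  set (K := Cmod (c n) * (la n * la n) * (4 * PI * PI) * (Cmod h * Cmod h)).
  replace (Cmod (c n) * (E1 * (4 * PI * PI * (la n * la n)) * E2 * (Cmod h * Cmod h))) with (K * (E1 * E2)) by (unfold K; ring).
  replace (4 * PI * PI * (Cmod (c n) * (la n * la n) * E3) * (Cmod h * Cmod h)) with (K * E3) by (unfold K; ring).
  apply Rmult_le_compat_l; auto. pose proof (Cmod_ge_0 (c n)). pose proof (Cmod_ge_0 h).
  assert (Q : 0 <= la n * la n) by apply Rle_0_sqr. unfold K.
  revert Q. generalize (la n * la n). intros s Q. assert (Q2 : 0 <= 4 * PI * PI) by nra.
  apply Rmult_le_pos; [apply Rmult_le_pos; [apply Rmult_le_pos|]|apply Rmult_le_pos]; auto.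
Qed.

(** * Fourier expansions of periodic holomorphic functions *)

Definition gcont (g : R -> C) : Prop :=
  forall t e, 0 < e -> exists d, 0 < d /\ forall s, Rabs (s - t) < d -> Cmod (g s - g t) < e.

(** Integral over [0,1], assembled from two real integrals; [Re (- Ci * z)] is
    the imaginary part of [z]. *)
Definition Jint (k : C) (g : R -> C) : R := RInt (fun t => Re (k * g t)%C) 0 1.
Definition CI (g : R -> C) : C := (Jint 1 g, Jint (- Ci) g).

Lemma gcont_Re g k t : gcont g -> continuous (fun s => Re (k * g s)%C) t.
Proof.
  intros H. apply continuity_pt_filterlim. intros e he.
  pose proof (Cmod_ge_0 k). assert (he' : 0 < e / (Cmod k + 1)) by (apply Rdiv_lt_0_compat; lra).
  destruct (H t _ he') as [d [hd Hd]]. exists d. split; auto. intros s [_ hs].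
  change (Rabs (Re (k * g s)%C - Re (k * g t)%C) < e).
  specialize (Hd s hs). rewrite <- Re_minus. replace (k * g s - k * g t)%C with (k * (g s - g t))%C by ring.
  eapply Rle_lt_trans; [apply re_le_Cmod|]. rewrite Cmod_mult.
  replace e with ((Cmod k + 1) * (e / (Cmod k + 1))) by (field; lra).
  nra.
Qed.

Lemma gcont_ex_RInt g k a b : gcont g -> ex_RInt (fun s => Re (k * g s)%C) a b.
Proof. intros H. apply (ex_RInt_continuous (V := R_CompleteNormedModule)). intros. apply gcont_Re; auto. Qed.

Lemma RI_plus (f g : R -> R) a b : ex_RInt f a b -> ex_RInt g a b ->
  RInt (fun t => f t + g t) a b = RInt f a b + RInt g a b.
Proof. apply (RInt_plus (V := R_CompleteNormedModule)). Qed.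

Lemma RI_scal (f : R -> R) a b l : ex_RInt f a b -> RInt (fun t => l * f t) a b = l * RInt f a b.
Proof. apply (RInt_scal (V := R_CompleteNormedModule)). Qed.

Lemma ex_RI_scal (f : R -> R) a b l : ex_RInt f a b -> ex_RInt (fun t => l * f t) a b.
Proof. apply (ex_RInt_scal (V := R_NormedModule)). Qed.

Lemma Jint_CI g k : gcont g -> Re (k * CI g)%C = Jint k g.
Proof.
  intros H. unfold CI. ReIm. unfold Jint. symmetry.
  transitivity (RInt (fun t => Re k * Re (1 * g t)%C + (- Im k) * Re (- Ci * g t)%C) 0 1).
  - apply RInt_ext. intros t _. Req. repeat (progress ReIm). ring.
  - pose proof (gcont_ex_RInt g 1 0 1 H) as I1. pose proof (gcont_ex_RInt g (- Ci) 0 1 H) as I2.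
    rewrite (RI_plus (fun t => Re k * Re (1 * g t)%C) (fun t => - Im k * Re (- Ci * g t)%C) 0 1
      (ex_RI_scal _ _ _ _ I1) (ex_RI_scal _ _ _ _ I2)).
    rewrite (RI_scal _ _ _ _ I1), (RI_scal _ _ _ _ I2). ring.
Qed.

Lemma C_eq_rot z w : (forall k, Re (k * z)%C = Re (k * w)%C) -> z = w.
Proof.
  intros H. pose proof (H 1%C) as H1. pose proof (H (- Ci)%C) as H2. revert H1 H2.
  repeat (progress ReIm). intros. apply C_eq; lra.
Qed.

Lemma Jint_ext g g' k : (forall t, 0 <= t <= 1 -> g t = g' t) -> Jint k g = Jint k g'.
Proof.
  intros H. unfold Jint. apply RInt_ext. intros t ht. rewrite Rmin_left, Rmax_right in ht by lra. rewrite H by lra. auto.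
Qed.

Lemma CI_ext g g' : (forall t, 0 <= t <= 1 -> g t = g' t) -> CI g = CI g'.
Proof. intros H. unfold CI. rewrite !(Jint_ext g g'); auto. Qed.

Lemma CI_plus g h : gcont g -> gcont h -> CI (fun t => g t + h t)%C = (CI g + CI h)%C.
Proof.
  intros Hg Hh.
  assert (E : forall k, Jint k (fun t => g t + h t)%C = Jint k g + Jint k h).
  { intros k. transitivity (RInt (fun t => Re (k * g t)%C + Re (k * h t)%C) 0 1).
    - apply RInt_ext. intros t _. Req. repeat (progress ReIm). ring.
    - apply RI_plus; apply gcont_ex_RInt; auto. }
  unfold CI. rewrite !E. reflexivity.
Qed.

Lemma CI_scal c g : gcont g -> CI (fun t => c * g t)%C = (c * CI g)%C.
Proof.
  intros Hg.
  assert (E : forall k, Jint k (fun t => c * g t)%C = Re (k * (c * CI g))%C).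
  { intros k. replace (k * (c * CI g))%C with ((k * c) * CI g)%C by ring. rewrite Jint_CI by auto.
    apply RInt_ext. intros t _. f_equal. ring. }
  unfold CI at 1. rewrite !E. apply C_eq; repeat (progress ReIm); ring.
Qed.

Lemma CI_bound g M : gcont g -> (forall t, 0 <= t <= 1 -> Cmod (g t) <= M) -> Cmod (CI g) <= M.
Proof.
  intros Hg H. apply Cmod_le_rotations. intros k hk. rewrite Jint_CI by auto. replace M with (RInt (fun _ => M) 0 1).
  - apply RInt_le; [lra|apply gcont_ex_RInt; auto|apply ex_RInt_const|].
    intros t ht. eapply Rle_trans; [apply Rle_abs|]. eapply Rle_trans; [apply re_le_Cmod|].
    rewrite Cmod_mult, hk, Rmult_1_l. apply H. lra.
  - rewrite RInt_const. unfold scal; simpl. unfold mult; simpl. Req. ring.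
Qed.

Lemma gcont_ext g h : (forall t, g t = h t) -> gcont g -> gcont h.
Proof. intros E H t e he. destruct (H t e he) as [d [hd Hd]]. exists d. split; auto. intros s hs. rewrite <- !E. auto. Qed.

Lemma gcont_const c : gcont (fun _ => c).
Proof. intros t e he. exists 1. split; [lra|]. intros. replace (c - c)%C with (RtoC 0) by ring. rewrite Cmod_0. auto. Qed.

Lemma gcont_CA g : gcont g <-> forall t, continuous (T := R_UniformSpace) (U := CA) g t.
Proof.
  split.
  - intros H t P [e He]. destruct (H t e (cond_pos e)) as [d [hd Hd]]. exists (mkposreal d hd). intros x hx. apply He, Hd, hx.
  - intros H t e he. destruct (H t (fun y => Cmod (y - g t) < e)) as [d Hd]; [exists (mkposreal e he); auto|].
    exists d. split; [apply cond_pos|]. apply Hd.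
Qed.

Lemma gcont_plus g h : gcont g -> gcont h -> gcont (fun t => g t + h t)%C.
Proof. rewrite !gcont_CA. intros H K t. apply (continuous_plus (V := CV) g h t); auto. Qed.

Lemma gcont_mult g h : gcont g -> gcont h -> gcont (fun t => g t * h t)%C.
Proof. rewrite !gcont_CA. intros H K t. apply (continuous_mult (K := C_AbsRing) g h t); auto. Qed.

Lemma gcont_shift g s : gcont g -> gcont (fun t => g (t + s)).
Proof.
  intros H t e he. destruct (H (t + s) e he) as [d [hd Hd]]. exists d. split; auto.
  intros u hu. apply Hd. replace (u + s - (t + s)) with (u - t) by ring. auto.
Qed.

Lemma Ccont_gcont F (z : C) : (forall t, Ccont F (z + RtoC t)%C) -> gcont (fun t => F (z + RtoC t)%C).
Proof.
  intros H t e he. destruct (H t e he) as [d [hd Hd]]. exists d. split; auto. intros s hs. apply Hd.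
  replace (z + RtoC s - (z + RtoC t))%C with (RtoC (s - t)) by (rewrite RtoC_minus; ring). rewrite Cmod_R. auto.
Qed.

Lemma gcont_ex n : gcont (fun t => ex (IZC n * RtoC t)).
Proof.
  eapply gcont_ext; [|apply (Ccont_gcont (fun z => ex (IZC n * z + 0)) 0)].
  - intros t. cbv beta. f_equal. ring.
  - intros t. eapply Cder_cont. apply Cder_ex_lin.
Qed.

Lemma CI_periodic g s : gcont g -> (forall t, g (t + 1) = g t) -> CI (fun t => g (t + s)) = CI g.
Proof.
  intros Hg P.
  assert (E : forall k, Jint k (fun t => g (t + s)) = Jint k g).
  { intros k. set (G := fun t => Re (k * g t)%C).
    assert (I : forall a b, ex_RInt G a b) by (intros; apply gcont_ex_RInt; auto).
    assert (Sh : forall v a b, RInt (fun t => G (t + v)) a b = RInt G (a + v) (b + v)).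
    { intros v a b. pose proof (RInt_comp_lin G 1 v a b) as L. rewrite !Rmult_1_l in L. rewrite <- L by auto.
      apply RInt_ext. intros x _. Req. rewrite !Rmult_1_l. auto. }
    change (RInt (fun t => G (t + s)) 0 1 = RInt G 0 1). rewrite Sh.
    rewrite <- (RInt_Chasles G (0 + s) 0 (1 + s)) by auto.
    rewrite <- (RInt_Chasles G 0 1 (1 + s)) by auto.
    assert (E1 : RInt G 1 (1 + s) = RInt G 0 s).
    { transitivity (RInt (fun t => G (t + 1)) 0 s).
      - rewrite Sh. f_equal; ring.
      - apply RInt_ext. intros x _. unfold G. rewrite P. auto. }
    rewrite E1, Rplus_0_l. rewrite <- (opp_RInt_swap G s 0) by auto.
    unfold plus, opp; simpl. Req. ring. }
  unfold CI. rewrite !E. auto.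
Qed.

Lemma ex_int_period n t : ex (IZC n * RtoC (t + 1)) = ex (IZC n * RtoC t).
Proof. apply (ex_eq _ _ n). rewrite RtoC_plus. ring. Qed.

(** The exponential changes sign under a shift by half its period. *)
Lemma CI_half_shift h n : gcont h -> (forall t, h (t + 1) = h t) -> n <> 0%Z ->
  CI (fun t => h t * ex (IZC n * RtoC t))%C =
  ((/ 2) * CI (fun t => (h t + (- (1)) * h (t + / (2 * IZR n))%R) * ex (IZC n * RtoC t)))%C.
Proof.
  intros Hh P hn. set (s := / (2 * IZR n)).
  assert (n0 : IZR n <> 0) by (apply not_0_IZR; auto).
  set (g := fun t => (h t * ex (IZC n * RtoC t))%C).
  assert (Hg : gcont g) by (apply gcont_mult; [auto|apply gcont_ex]).
  assert (E1 : CI (fun t => g (t + s)) = CI g).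
  { apply CI_periodic; auto. intros t. unfold g. rewrite P, ex_int_period. auto. }
  assert (E2 : forall t, g (t + s) = ((- (1)) * h (t + s)%R * ex (IZC n * RtoC t))%C).
  { intros t. unfold g. replace (IZC n * RtoC (t + s))%C with (IZC n * RtoC t + RtoC (1/2))%C.
    - rewrite ex_plus, ex_half. ring.
    - replace (RtoC (1/2)) with (RtoC (IZR n * s)) by (f_equal; unfold s; field; auto).
      rewrite RtoC_plus, RtoC_mult. unfold IZC. ring. }
  rewrite (CI_ext (fun t => g (t + s)) (fun t => (- (1)) * h (t + s)%R * ex (IZC n * RtoC t))%C) in E1 by auto.
  assert (Hs : gcont (fun t => (- (1)) * h (t + s)%R * ex (IZC n * RtoC t))%C).
  { apply gcont_mult; [|apply gcont_ex]. apply gcont_mult; [apply gcont_const|]. apply gcont_shift; auto. }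
  rewrite (CI_ext (fun t => (h t + (- (1)) * h (t + s)%R) * ex (IZC n * RtoC t))%C
     (fun t => g t + (- (1)) * h (t + s)%R * ex (IZC n * RtoC t))%C).
  - rewrite CI_plus by auto. rewrite E1. field.
  - intros t _. unfold g. ring.
Qed.

(** The difference on the right of [CI_half_shift] is small by uniform continuity. *)
Lemma riemann_lebesgue h : gcont h -> (forall t, h (t + 1) = h t) ->
  forall e, 0 < e -> exists N, (0 < N)%Z /\ forall n, (N <= Z.abs n)%Z -> Cmod (CI (fun t => h t * ex (IZC n * RtoC t))%C) < e.
Proof.
  intros Hh P e he.
  assert (U : forall k, {d : posreal | forall x y, -1 <= x <= 2 -> -1 <= y <= 2 -> Rabs (x - y) < d ->
      Rabs (Re (k * h x)%C - Re (k * h y)%C) < e / 2}).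
  { intros k. assert (he2 : 0 < e / 2) by lra.
    refine (@Heine_cor2 (fun t => Re (k * h t)%C) (-1) 2 _ (mkposreal _ he2)).
    intros x _. apply continuity_pt_filterlim. apply gcont_Re; auto. }
  destruct (U 1%C) as [d1 H1]. destruct (U (- Ci)%C) as [d2 H2].
  assert (hd : 0 < Rmin d1 d2) by (apply Rmin_pos; apply cond_pos).
  destruct (archimed (/ (Rmin d1 d2))) as [A _].
  exists (Z.max 1 (up (/ Rmin d1 d2))). split; [lia|]. intros n hn.
  assert (n0 : (n <> 0)%Z) by lia. rewrite CI_half_shift by auto.
  set (s := / (2 * IZR n)).
  assert (B1 : / Rmin d1 d2 < Rabs (IZR n)).
  { rewrite <- abs_IZR. eapply Rlt_le_trans; [apply A|]. apply IZR_le. lia. }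
  assert (B0 : 1 <= Rabs (IZR n)) by (rewrite <- abs_IZR; apply IZR_le; lia).
  assert (Es : Rabs s = / 2 * / Rabs (IZR n)).
  { unfold s. rewrite Rabs_inv, Rabs_mult, (Rabs_pos_eq 2) by lra. field. lra. }
  assert (B2 : / Rabs (IZR n) < Rmin d1 d2).
  { rewrite <- (Rinv_inv (Rmin d1 d2)). apply Rinv_lt_contravar; auto.
    apply Rmult_lt_0_compat; [apply Rinv_0_lt_compat; auto|lra]. }
  assert (B3 : / Rabs (IZR n) <= 1) by (rewrite <- Rinv_1; apply Rinv_le_contravar; lra).
  assert (Hs : gcont (fun t => (h t + (- (1)) * h (t + s)%R) * ex (IZC n * RtoC t))%C).
  { apply gcont_mult; [|apply gcont_ex]. apply gcont_plus; auto. apply gcont_mult; [apply gcont_const|]. apply gcont_shift; auto. }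
  assert (L : Cmod (CI (fun t => (h t + (- (1)) * h (t + s)%R) * ex (IZC n * RtoC t))%C) <= e).
  { apply CI_bound; auto. intros t ht. rewrite Cmod_mult, Cmod_ex.
    replace (Im (IZC n * RtoC t)) with 0 by (unfold IZC; ReIm; ring). rewrite Rmult_0_r, Ropp_0, exp_0, Rmult_1_r.
    pose proof (Rmin_l d1 d2). pose proof (Rmin_r d1 d2).
    assert (D : Rabs (t - (t + s)) < Rmin d1 d2).
    { replace (t - (t + s)) with (- s) by ring. rewrite Rabs_Ropp, Es. lra. }
    assert (R2 : -1 <= t + s <= 2).
    { assert (Rabs s <= / 2) by (rewrite Es; lra). apply Rabs_le_between in H3. lra. }
    specialize (H1 t (t + s) ltac:(lra) R2 ltac:(lra)). specialize (H2 t (t + s) ltac:(lra) R2 ltac:(lra)).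
    eapply Rle_trans; [apply Cmod_le_ReIm|].
    replace (Re (h t + - (1) * h (t + s)%R)%C) with (Re (1 * h t)%C - Re (1 * h (t + s)%R)%C) by (repeat (progress ReIm); ring).
    replace (Im (h t + - (1) * h (t + s)%R)%C) with (Re (- Ci * h t)%C - Re (- Ci * h (t + s)%R)%C) by (repeat (progress ReIm); ring).
    lra. }
  rewrite Cmod_mult. replace (Cmod (/ 2)) with (/ 2).
  - lra.
  - rewrite Cmod_inv, Cmod_R, Rabs_pos_eq by (try lra; intros Q; apply RtoC_inj in Q; lra). auto.
Qed.

Lemma CI_const c : CI (fun _ => c) = c.
Proof.
  apply C_eq_rot. intros k. rewrite Jint_CI by apply gcont_const. unfold Jint.
  rewrite RInt_const. unfold scal; simpl. unfold mult; simpl. Req. ring.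
Qed.

Lemma CI_ex n : n <> 0%Z -> CI (fun t => ex (IZC n * RtoC t)) = RtoC 0.
Proof.
  intros hn. rewrite (CI_ext _ (fun t => (fun _ => RtoC 1) t * ex (IZC n * RtoC t))%C) by (intros; ring).
  rewrite CI_half_shift; auto; [|apply gcont_const].
  rewrite (CI_ext _ (fun t => 0)%C) by (intros; ring). rewrite CI_const. ring.
Qed.

(** ** Quotients at a common zero *)

(** The rule of l'Hopital, through the two difference quotients. *)
Lemma quotient_lim A B a b : Cder A 0 a -> Cder B 0 b -> A 0%C = 0%C -> B 0%C = 0%C -> b <> 0%C ->
  forall e, 0 < e -> exists d, 0 < d /\ forall w : C, w <> 0%C -> Cmod w < d ->
    B w <> 0%C /\ Cmod (A w / B w - a / b) < e.
Proof.
  intros HA HB A0 B0 hb e he. pose proof (Cmod_pos _ hb) as P. pose proof (Cmod_ge_0 a) as Pa. set (m := Cmod b) in *.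
  set (K := 2 * (m + Cmod a) / (m * m)). assert (hK : 0 < K) by (unfold K; apply Rdiv_lt_0_compat; nra).
  set (e1 := Rmin (m / 2) (e / (2 * K))).
  assert (M1 : e1 <= m / 2) by apply Rmin_l. assert (M2 : e1 <= e / (2 * K)) by apply Rmin_r.
  assert (he1 : 0 < e1) by (apply Rmin_pos; [lra|apply Rdiv_lt_0_compat; lra]).
  assert (Q : forall F l, Cder F 0 l -> F 0%C = 0%C -> exists d, 0 < d /\ forall w : C, w <> 0%C -> Cmod w < d -> Cmod (F w / w - l) <= e1).
  { intros F l HF F0. rewrite Cder_eps in HF. destruct (HF e1 he1) as [d [hd Hd]]. exists d. split; auto. intros w hw hwd.
    specialize (Hd w hwd). rewrite Cplus_0_l, F0 in Hd. replace (F w / w - l)%C with ((F w - 0 - w * l) / w)%C by (field; auto).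
    pose proof (Cmod_pos _ hw). rewrite Cmod_div by auto. apply Rmult_le_reg_r with (Cmod w); auto. unfold Rdiv.
    rewrite Rmult_assoc, Rinv_l by lra. lra. }
  destruct (Q A a HA A0) as [d [hd Hd]]. destruct (Q B b HB B0) as [d' [hd' Hd']].
  exists (Rmin d d'). split; [apply Rmin_pos; auto|]. intros w hw0 hw. pose proof (Rmin_l d d'). pose proof (Rmin_r d d').
  specialize (Hd w hw0 ltac:(lra)). specialize (Hd' w hw0 ltac:(lra)). set (x := (A w / w)%C) in *. set (y := (B w / w)%C) in *.
  pose proof (Cmod_tri2 b y) as T. rewrite Cmod_minus_sym in T. fold m in T.
  assert (NY : y <> 0%C) by (apply Cmod_neq0; lra).
  assert (EB : B w = (y * w)%C) by (unfold y; field; auto). assert (EA : A w = (x * w)%C) by (unfold x; field; auto).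
  rewrite EA, EB. split; [apply Cmult_neq_0; auto|].
  replace (x * w / (y * w) - a / b)%C with (((x - a) * b - a * (y - b)) / (y * b))%C by (field; auto).
  rewrite Cmod_div, Cmod_mult by (apply Cmult_neq_0; auto). assert (Nu : Cmod ((x - a) * b - a * (y - b)) <= e1 * (m + Cmod a)).
  { eapply Rle_trans; [apply Cmod_triangle|]. rewrite Cmod_opp, !Cmod_mult. fold m. nra. }
  apply Rle_lt_trans with (e1 * K).
  - apply Rmult_le_reg_r with (Cmod y * m); [nra|]. unfold Rdiv. rewrite Rmult_assoc, Rinv_l, Rmult_1_r by nra.
    eapply Rle_trans; [apply Nu|]. apply Rle_trans with (e1 * K * (m / 2 * m)); [right; unfold K; field; lra|].
    apply Rmult_le_compat_l; nra.
  - apply Rmult_le_compat_r with (r := K) in M2; [|lra]. replace (e / (2 * K) * K) with (e / 2) in M2 by (field; lra). lra.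
Qed.

(** ** Holomorphic functions on the upper half plane *)

(** Continuity of the derivative is included so that one may differentiate under the
    integral sign. *)
Definition hol (f : C -> C) : Prop :=
  exists f', forall z, upper_half z -> Cder f z (f' z) /\ Ccont f' z.

Lemma Cder_line F z w s k l : Cder F (z + RtoC s * w)%C l ->
  is_derive (fun s => Re (k * F (z + RtoC s * w))%C) s (Re (k * (l * w))%C).
Proof.
  intros H. rewrite Cder_eps in H. apply is_derive_Reals. intros e he.
  pose proof (Cmod_ge_0 k). pose proof (Cmod_ge_0 w).
  set (M := (Cmod k + 1) * (Cmod w + 1)). assert (hM : 0 < M) by (unfold M; nra).
  destruct (H (e / M)) as [d [hd Hd]]; [apply Rdiv_lt_0_compat; lra|].
  assert (hd' : 0 < d / (Cmod w + 1)) by (apply Rdiv_lt_0_compat; lra).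
  exists (mkposreal _ hd'). intros h h0 hh. simpl in hh.
  assert (hw : Cmod (RtoC h * w) < d).
  { rewrite Cmod_mult, Cmod_R. apply Rle_lt_trans with (Rabs h * (Cmod w + 1)); [apply Rmult_le_compat_l; [apply Rabs_pos|lra]|].
    replace d with (d / (Cmod w + 1) * (Cmod w + 1)) by (field; lra). apply Rmult_lt_compat_r; lra. }
  specialize (Hd _ hw).
  replace (z + RtoC s * w + RtoC h * w)%C with (z + RtoC (s + h) * w)%C in Hd by (rewrite RtoC_plus; ring).
  set (D := (F (z + RtoC (s + h) * w) - F (z + RtoC s * w) - RtoC h * w * l)%C) in *.
  replace ((Re (k * F (z + RtoC (s + h) * w))%C - Re (k * F (z + RtoC s * w))%C) / h - Re (k * (l * w))%C)
    with (Re (k * D)%C / h).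
  - unfold Rdiv. rewrite Rabs_mult. pose proof (Rabs_pos_lt h h0).
    rewrite Rabs_inv. apply Rmult_lt_reg_r with (Rabs h); auto.
    rewrite Rmult_assoc, Rinv_l, Rmult_1_r by lra.
    eapply Rle_lt_trans; [apply re_le_Cmod|]. rewrite Cmod_mult.
    rewrite Cmod_mult, Cmod_R in Hd.
    apply Rle_lt_trans with (Cmod k * (e / M * (Rabs h * Cmod w))).
    + apply Rmult_le_compat_l; auto.
    + replace (Cmod k * (e / M * (Rabs h * Cmod w))) with ((e / M * Rabs h) * (Cmod k * Cmod w)) by ring.
      replace (e * Rabs h) with ((e / M * Rabs h) * M) by (field; lra).
      apply Rmult_lt_compat_l.
      * apply Rmult_lt_0_compat; auto. apply Rdiv_lt_0_compat; lra.
      * unfold M. nra.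
  - unfold D. repeat (progress ReIm). field. auto.
Qed.

Lemma hol_cont f z : hol f -> upper_half z -> Ccont f z.
Proof. intros [f' H] hz. apply (Cder_cont _ _ _ (proj1 (H z hz))). Qed.

Lemma hol_gcont f z : hol f -> upper_half z -> gcont (fun t => f (z + RtoC t)%C).
Proof.
  intros H hz. apply Ccont_gcont. intros t. apply hol_cont; auto.
  unfold upper_half in *. ReIm. lra.
Qed.

Lemma hol_ext f g : (forall z, upper_half z -> f z = g z) -> hol f -> hol g.
Proof.
  intros E [f' H]. exists f'. intros z hz. split; [|apply H; auto].
  apply Cder_ext_loc with f (Im z); [apply hz| |apply H; auto].
  intros x hx. apply E. unfold upper_half in *. pose proof (Im_le_Cmod (x - z)) as Q. rewrite Im_minus in Q.
  apply Rabs_le_between in Q. lra.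
Qed.

Lemma Ccont_plus f g z : Ccont f z -> Ccont g z -> Ccont (fun x => f x + g x)%C z.
Proof. rewrite !Ccont_CA. apply (continuous_plus (U := CA) (V := CV)). Qed.

Lemma Ccont_const c z : Ccont (fun _ => c) z.
Proof. intros e he. exists 1. split; [lra|]. intros. replace (c - c)%C with (RtoC 0) by ring. rewrite Cmod_0. auto. Qed.

Lemma Ccont_mult a b z : Ccont a z -> Ccont b z -> Ccont (fun x => a x * b x)%C z.
Proof. rewrite !Ccont_CA. apply (continuous_mult (U := CA) (K := C_AbsRing)). Qed.

Lemma Re_k_cont F k (z : C) e : Ccont F z -> 0 < e -> exists d, 0 < d /\
  forall x, Cmod (x - z) < d -> Rabs (Re (k * F x)%C - Re (k * F z)%C) < e.
Proof.
  intros H he. pose proof (Cmod_ge_0 k).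
  destruct (H (e / (Cmod k + 1))) as [d [hd Hd]]; [apply Rdiv_lt_0_compat; lra|].
  exists d. split; auto. intros x hx. specialize (Hd x hx).
  rewrite <- Re_minus. replace (k * F x - k * F z)%C with (k * (F x - F z))%C by ring.
  eapply Rle_lt_trans; [apply re_le_Cmod|]. rewrite Cmod_mult.
  replace e with ((Cmod k + 1) * (e / (Cmod k + 1))) by (field; lra).
  pose proof (Cmod_ge_0 (F x - F z)). nra.
Qed.

Lemma upper_line t y : 0 < y -> upper_half (RtoC t + RtoC y * Ci)%C.
Proof. intros h. unfold upper_half. repeat (progress ReIm). lra. Qed.

(** The integral of a periodic holomorphic function over a horizontal period
    does not depend on the height: its derivative in the height is the integral
    of a derivative along the period. *)
Lemma hol_int_height F : hol F -> (forall z, upper_half z -> F (z + 1)%C = F z) ->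
  forall y1 y2, 0 < y1 -> y1 < y2 ->
  CI (fun t => F (RtoC t + RtoC y1 * Ci)%C) = CI (fun t => F (RtoC t + RtoC y2 * Ci)%C).
Proof.
  intros HF P y1 y2 h1 h12. pose proof HF as [F' HF'].
  assert (G : forall y, 0 < y -> gcont (fun t => F (RtoC t + RtoC y * Ci)%C)).
  { intros y hy. eapply gcont_ext; [|apply (hol_gcont F (RtoC y * Ci)%C HF)].
    - intros t. cbv beta. f_equal. ring.
    - replace (RtoC y * Ci)%C with (RtoC 0 + RtoC y * Ci)%C by ring. apply upper_line; auto. }
  assert (G' : forall y, 0 < y -> gcont (fun t => F' (RtoC t + RtoC y * Ci)%C)).
  { intros y hy. eapply gcont_ext; [|apply (Ccont_gcont F' (RtoC y * Ci)%C)].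
    - intros t. cbv beta. f_equal. ring.
    - intros t. rewrite Cplus_comm. apply HF'. apply upper_line; auto. }
  apply C_eq_rot. intros k. rewrite !Jint_CI by (apply G; lra).
  set (f := fun y t => Re (k * F (RtoC t + RtoC y * Ci)%C)%C).
  set (I := fun y => RInt (fun t => f y t) 0 1).
  assert (D : forall y t, 0 < y -> is_derive (fun u => f u t) y (Re (k * (F' (RtoC t + RtoC y * Ci)%C * Ci))%C)).
  { intros y t hy. apply (Cder_line F (RtoC t) Ci y k). apply HF'. apply upper_line; auto. }
  assert (Loc : forall y, 0 < y -> forall Q : R -> Prop, (forall v, 0 < v -> Q v) -> locally y Q).
  { intros y hy Q HQ. exists (mkposreal y hy). intros v hv. apply HQ.
    change (Rabs (v - y) < y) in hv. apply Rabs_lt_between in hv. lra. }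
  assert (Dz : forall y, y1 <= y <= y2 -> is_derive I y zero).
  { intros y hy. assert (y0 : 0 < y) by lra.
    assert (E : RInt (fun t => Derive (fun u => f u t) y) 0 1 = 0).
    { rewrite (RInt_ext _ (fun t => Re ((k * Ci) * F' (RtoC t + RtoC y * Ci)%C)%C)).
      - apply is_RInt_unique.
        replace 0 with (minus (Re ((k * Ci) * F (RtoC 1 + RtoC y * Ci)%C)%C) (Re ((k * Ci) * F (RtoC 0 + RtoC y * Ci)%C)%C)) at 2.
        + apply (is_RInt_derive (V := R_CompleteNormedModule) (fun t => Re ((k * Ci) * F (RtoC t + RtoC y * Ci)%C)%C)).
          * intros t _. apply (is_derive_ext (fun s => Re ((k * Ci) * F (RtoC y * Ci + RtoC s * 1)%C)%C)).
            { intros s. f_equal. f_equal. f_equal. ring. }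
            replace (Re (k * Ci * F' (RtoC t + RtoC y * Ci)%C)) with (Re (k * Ci * (F' (RtoC t + RtoC y * Ci)%C * 1))%C) by (f_equal; ring).
            apply (Cder_line F (RtoC y * Ci) 1 t (k * Ci)).
            replace (RtoC y * Ci + RtoC t * 1)%C with (RtoC t + RtoC y * Ci)%C by ring.
            apply HF'. apply upper_line; auto.
          * intros t _. apply (gcont_Re (fun t => F' (RtoC t + RtoC y * Ci)%C)). apply G'; auto.
        + replace (RtoC 1 + RtoC y * Ci)%C with (RtoC 0 + RtoC y * Ci + 1)%C by ring.
          rewrite P by (apply upper_line; auto). apply Rminus_diag_eq. auto.
      - intros t _. transitivity (Re (k * (F' (RtoC t + RtoC y * Ci)%C * Ci))%C).
        + apply is_derive_unique. apply D; auto.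
        + f_equal. ring. }
    change zero with 0. rewrite <- E. apply is_derive_RInt_param.
    - apply Loc; auto. intros v hv t _. eexists. apply D; auto.
    - intros t _. apply continuity_2d_pt_ext_loc with (fun u v => Re ((k * Ci) * F' (RtoC v + RtoC u * Ci)%C)%C).
      + exists (mkposreal y y0). intros u v hu _. simpl in hu. apply Rabs_lt_between in hu.
        transitivity (Re (k * (F' (RtoC v + RtoC u * Ci)%C * Ci))%C); [f_equal; ring|].
        symmetry. apply is_derive_unique. apply D. lra.
      + intros e. destruct (Re_k_cont F' (k * Ci) (RtoC t + RtoC y * Ci)%C e) as [d [hd Hd]].
        * apply HF'. apply upper_line; auto.
        * apply cond_pos.
        * assert (hd2 : 0 < d / 2) by lra. exists (mkposreal _ hd2). simpl. intros u v hu hv. apply Hd.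
          eapply Rle_lt_trans; [apply Cmod_le_ReIm|].
          replace (Re (RtoC v + RtoC u * Ci - (RtoC t + RtoC y * Ci))%C) with (v - t) by (repeat (progress ReIm); ring).
          replace (Im (RtoC v + RtoC u * Ci - (RtoC t + RtoC y * Ci))%C) with (u - y) by (repeat (progress ReIm); ring).
          lra.
    - apply Loc; auto. intros v hv. apply (gcont_ex_RInt (fun t => F (RtoC t + RtoC v * Ci)%C)). apply G; auto. }
  apply (eq_is_derive (V := R_NormedModule) I y1 y2 Dz h12).
Qed.

Lemma z_ReIm z : z = (RtoC (Re z) + RtoC (Im z) * Ci)%C.
Proof. Ceq; ring. Qed.

Lemma hol_int_const F : hol F -> (forall z, upper_half z -> F (z + 1)%C = F z) ->
  forall z w, upper_half z -> upper_half w ->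
  CI (fun t => F (z + RtoC t)%C) = CI (fun t => F (w + RtoC t)%C).
Proof.
  intros HF P.
  assert (A : forall z, upper_half z -> CI (fun t => F (z + RtoC t)%C) = CI (fun t => F (RtoC t + RtoC (Im z) * Ci)%C)).
  { intros z hz. rewrite <- (CI_periodic (fun t => F (RtoC t + RtoC (Im z) * Ci)%C) (Re z)).
    - apply CI_ext. intros t _. f_equal. rewrite (z_ReIm z) at 1. rewrite RtoC_plus. ring.
    - eapply gcont_ext; [|apply (hol_gcont F (RtoC (Im z) * Ci)%C HF)].
      + intros t. cbv beta. f_equal. ring.
      + replace (RtoC (Im z) * Ci)%C with (RtoC 0 + RtoC (Im z) * Ci)%C by ring. apply upper_line; auto.
    - intros t. rewrite RtoC_plus. rewrite <- (P (RtoC t + _)%C) by (apply upper_line; auto). f_equal. ring. }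
  intros z w hz hw. rewrite !A by auto. destruct (Rtotal_order (Im z) (Im w)) as [h|[h|h]].
  - apply hol_int_height; auto.
  - rewrite h. auto.
  - symmetry. apply hol_int_height; auto.
Qed.

Definition fcoef (f : C -> C) (n : Z) : C :=
  CI (fun t => f (Ci + RtoC t)%C * ex (- IZC n * (Ci + RtoC t)))%C.

Lemma hol_mult_ex f n : hol f -> hol (fun z => f z * ex (- IZC n * z))%C.
Proof.
  intros [f' H].
  assert (E : forall z, Cder (fun z => ex (- IZC n * z)) z (twopii * - IZC n * ex (- IZC n * z))%C).
  { intros z. eapply Cder_eq; [apply (Cder_ext (fun z => ex (- IZC n * z + 0)))|].
    - intros x. f_equal. ring.
    - apply Cder_ex_lin.
    - f_equal. f_equal. ring. }
  exists (fun z => f' z * ex (- IZC n * z) + f z * (twopii * - IZC n * ex (- IZC n * z)))%C.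
  intros z hz. destruct (H z hz) as [Hd Hc]. split; [apply (Cder_mult f (fun z => ex (- IZC n * z))); auto|].
  apply Ccont_plus.
  - apply Ccont_mult; auto. apply (Cder_cont _ _ _ (E z)).
  - apply Ccont_mult; [apply (Cder_cont _ _ _ Hd)|].
    apply Ccont_mult; [apply Ccont_const|]. apply (Cder_cont _ _ _ (E z)).
Qed.

Lemma fcoef_line f n z : hol f -> (forall z, upper_half z -> f (z + 1)%C = f z) -> upper_half z ->
  fcoef f n = CI (fun t => f (z + RtoC t)%C * ex (- IZC n * (z + RtoC t)))%C.
Proof.
  intros H P hz. apply (hol_int_const (fun z => f z * ex (- IZC n * z))%C).
  - apply hol_mult_ex; auto.
  - intros w hw. rewrite P by auto. f_equal. apply (ex_eq _ _ (- n)). rewrite IZC_opp. ring.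
  - unfold upper_half. rewrite Im_i. lra.
  - auto.
Qed.

(** The coefficient may be computed at any height, hence bounded at each of them. *)
Lemma fcoef_bound f n z M : hol f -> (forall z, upper_half z -> f (z + 1)%C = f z) -> upper_half z ->
  (forall t, 0 <= t <= 1 -> Cmod (f (z + RtoC t)%C) <= M) -> Cmod (fcoef f n) <= M * exp (2 * PI * (IZR n * Im z)).
Proof.
  intros H P hz HM. rewrite (fcoef_line f n z) by auto. apply CI_bound.
  - apply (hol_gcont (fun z => f z * ex (- IZC n * z))%C z); auto. apply hol_mult_ex; auto.
  - intros t ht. rewrite Cmod_mult, Cmod_ex.
    replace (- (2 * PI * Im (- IZC n * (z + RtoC t)))) with (2 * PI * (IZR n * Im z)).
    + apply Rmult_le_compat_r; [left; apply exp_pos|auto].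
    + unfold IZC. repeat (progress ReIm). ring.
Qed.

(** Pointwise convergence of the Fourier series: subtract the value [f z] and
    divide by [ex t - 1]; the partial sums then telescope and the
    Riemann-Lebesgue lemma applies. *)
Theorem fourier_expansion f z : hol f -> (forall z, upper_half z -> f (z + 1)%C = f z) -> upper_half z ->
  sums (zpair (fun n => fcoef f n * ex (IZC n * z))%C) (f z).
Proof.
  intros H P hz. pose proof H as [f' H'].
  set (D := fun t => (ex (RtoC t) - 1)%C).
  set (c := (f' z / twopii)%C).
  set (h := fun t => if Ceq_dec (D t) 0 then c else ((f (z + RtoC t)%C - f z) / D t)%C).
  assert (Pz : forall (n : Z) s, f (z + RtoC (IZR n + s))%C = f (z + RtoC s)%C).
  { assert (Q : forall (n : nat) s, f (z + RtoC (INR n + s))%C = f (z + RtoC s)%C).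
    { induction n as [|n IH]; intros s; [f_equal; f_equal; f_equal; simpl; ring|].
      rewrite <- (IH s). rewrite S_INR.
      replace (z + RtoC (INR n + 1 + s))%C with (z + RtoC (INR n + s) + 1)%C by (rewrite !RtoC_plus; ring).
      apply P. unfold upper_half in *. ReIm. lra. }
    intros n s. destruct (Z_le_gt_dec 0 n) as [l|l].
    - rewrite <- (Z2Nat.id n l), <- INR_IZR_INZ. apply Q.
    - rewrite <- (Q (Z.to_nat (- n)) (IZR n + s)). f_equal. f_equal. f_equal.
      rewrite INR_IZR_INZ, Z2Nat.id, opp_IZR by lia. ring. }
  assert (Dp : forall t, D (t + 1) = D t).
  { intros t. unfold D. f_equal. apply (ex_eq _ _ 1). rewrite RtoC_plus. reflexivity. }
  assert (hp : forall t, h (t + 1) = h t).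
  { intros t. unfold h. rewrite Dp. destruct (Ceq_dec (D t) 0); auto. f_equal. f_equal.
    rewrite <- (Pz 1%Z t). f_equal. f_equal. f_equal. ring. }
  assert (Dint : forall t, D t = 0%C -> exists n, t = IZR n).
  { intros t Ht. destruct (base_Int_part t) as [B1 B2].
    exists (Int_part t). destruct (Rle_lt_or_eq_dec _ _ B1) as [B|B]; auto. exfalso.
    apply (ex_neq1_R (t - IZR (Int_part t))); [lra|].
    replace (ex (RtoC (t - IZR (Int_part t)))) with (D t + 1)%C; [rewrite Ht; ring|].
    unfold D. rewrite (ex_eq _ (RtoC (t - IZR (Int_part t))) (Int_part t)); [ring|].
    rewrite RtoC_minus. unfold IZC. ring. }
  assert (HA : forall w, upper_half (z + w)%C -> Cder (fun w => f (z + w) - f z)%C w (f' (z + w)%C)).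
  { intros w hw. eapply Cder_eq; [apply Cder_minus; [apply (Cder_comp f (fun w => (z + w)%C)); [apply H', hw|]|apply Cder_const]|].
    - apply Cder_plus; [apply Cder_const|apply Cder_id].
    - ring. }
  assert (HD : forall w, Cder (fun w => ex w - 1)%C w (twopii * ex w)%C).
  { intros w. apply (Cder_ext (fun w => ex (1 * w + 0) - 1)%C); [intros x; do 2 f_equal; ring|].
    eapply Cder_eq; [apply Cder_minus; [apply Cder_ex_lin|apply Cder_const]|]. replace (1 * w + 0)%C with w by ring. ring. }
  assert (hc : gcont h).
  { intros t e he. destruct (Ceq_dec (D t) 0) as [Et|Nt].
    - destruct (Dint t Et) as [n En].
      destruct (quotient_lim (fun w => f (z + w) - f z)%C (fun w => ex w - 1)%C (f' z) twopii) with (e := e)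
        as [d [hd Hd]]; auto.
      + pose proof (HA 0%C) as Q. rewrite Cplus_0_r in Q. auto.
      + pose proof (HD 0%C) as Q. rewrite ex_0, Cmult_1_r in Q. auto.
      + rewrite Cplus_0_r. ring.
      + rewrite ex_0. ring.
      + apply Cmult_neq_0; [apply RtoC_neq0; pose proof PI_RGT_0; lra|]. apply Ci_neq0.
      + exists d. split; auto. intros s hs. unfold h at 2. destruct (Ceq_dec (D t) 0); [|contradiction].
        unfold h. destruct (Ceq_dec (D s) 0); [replace (c - c)%C with (RtoC 0) by ring; rewrite Cmod_0; auto|].
        set (w := RtoC (s - t)).
        assert (Ew : D s = (ex w - 1)%C).
        { unfold D, w. f_equal. apply (ex_eq _ _ n). rewrite RtoC_minus, En. unfold IZC. ring. }
        assert (Ef : f (z + RtoC s)%C = f (z + w)%C).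
        { unfold w. rewrite <- (Pz n (s - t)). f_equal. f_equal. f_equal. rewrite En. ring. }
        rewrite Ef, Ew. apply Hd.
        * intros E0. apply n0. rewrite Ew, E0, ex_0. ring.
        * unfold w. rewrite Cmod_R. auto.
    - assert (U : upper_half (z + RtoC t)%C) by (unfold upper_half in *; ReIm; lra).
      destruct (Cder_cont _ _ _ (Cder_div _ _ _ _ _ (HA _ U) (HD (RtoC t)) Nt) e he) as [d [hd Hd]].
      destruct (Cder_cont _ _ _ (HD (RtoC t)) _ (Cmod_pos _ Nt)) as [d' [hd' Hd']].
      exists (Rmin d d'). split; [apply Rmin_pos; auto|]. intros s hs. pose proof (Rmin_l d d'). pose proof (Rmin_r d d').
      specialize (Hd (RtoC s)). specialize (Hd' (RtoC s)). rewrite <- RtoC_minus, Cmod_R in Hd, Hd'.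
      fold (D s) (D t) in Hd, Hd'. unfold h. destruct (Ceq_dec (D t) 0); [contradiction|].
      destruct (Ceq_dec (D s) 0) as [E|E]; [|apply Hd; lra].
      exfalso. rewrite E in Hd'. replace (0 - D t)%C with (- D t)%C in Hd' by ring. rewrite Cmod_opp in Hd'. lra. }
  set (hh := fun n : Z => CI (fun t => h t * ex (IZC n * RtoC t))%C).
  assert (T : forall n, (fcoef f n * ex (IZC n * z))%C = ((if Z.eq_dec n 0 then f z else 0) + (hh (1 - n)%Z - hh (- n)%Z))%C).
  { intros n. rewrite (fcoef_line f n z) by auto.
    assert (G0 : forall n, gcont (fun t => h t * ex (IZC n * RtoC t))%C) by (intros; apply gcont_mult; auto; apply gcont_ex).
    assert (Gn : gcont (fun t => f (z + RtoC t)%C * ex (- IZC n * (z + RtoC t)))%C).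
    { apply (hol_gcont (fun z => f z * ex (- IZC n * z))%C z); auto. apply hol_mult_ex; auto. }
    rewrite Cmult_comm, <- CI_scal by auto.
    rewrite (CI_ext _ (fun t => f z * ex (IZC (- n) * RtoC t) + (h t * ex (IZC (1 - n) * RtoC t) + (- (1)) * (h t * ex (IZC (- n) * RtoC t)))))%C.
    - rewrite CI_plus; [|apply gcont_mult; [apply gcont_const|apply gcont_ex]|apply gcont_plus; auto; apply gcont_mult; [apply gcont_const|auto]].
      rewrite CI_plus; [|auto|apply gcont_mult; [apply gcont_const|auto]].
      rewrite !CI_scal by (auto; apply gcont_ex). fold (hh (1 - n)%Z). fold (hh (- n)%Z).
      destruct (Z.eq_dec n 0) as [E|E].
      + rewrite E. rewrite (CI_ext (fun t => ex (IZC (- 0) * RtoC t)) (fun _ => RtoC 1)).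
        * rewrite CI_const. ring.
        * intros t _. replace (IZC (- 0) * RtoC t)%C with (RtoC 0); [apply ex_0|]. unfold IZC. simpl. ring.
      + rewrite CI_ex by lia. ring.
    - intros t _.
      replace (ex (IZC n * z) * (f (z + RtoC t)%C * ex (- IZC n * (z + RtoC t))))%C with (f (z + RtoC t)%C * ex (IZC (- n) * RtoC t))%C.
      2: { replace (ex (IZC n * z) * (f (z + RtoC t)%C * ex (- IZC n * (z + RtoC t))))%C with
             (f (z + RtoC t)%C * (ex (IZC n * z) * ex (- IZC n * (z + RtoC t))))%C by ring.
           rewrite <- ex_plus. f_equal. f_equal. rewrite IZC_opp. ring. }
      replace (IZC (1 - n) * RtoC t)%C with (IZC (- n) * RtoC t + RtoC t)%C by (rewrite IZC_minus, IZC_opp; unfold IZC; ring).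
      rewrite ex_plus.
      replace (f (z + RtoC t)%C) with (f z + h t * D t)%C; [unfold D; ring|].
      unfold h. destruct (Ceq_dec (D t) 0) as [E|E].
      + rewrite E. destruct (Dint t E) as [k ->]. replace (IZR k) with (IZR k + 0) by ring. rewrite Pz.
        replace (z + RtoC 0)%C with z by ring. ring.
      + field. auto. }
  assert (S : forall N, Csum (zpair (fun n => fcoef f n * ex (IZC n * z))%C) (S N) =
     (f z + (hh (Z.of_nat N + 2)%Z - hh (- Z.of_nat N)%Z))%C).
  { induction N as [|N IH].
    - simpl. unfold zpair. rewrite !T. simpl. ring.
    - change (Csum (zpair (fun n => fcoef f n * ex (IZC n * z))%C) (Datatypes.S (Datatypes.S N))) with
        (Csum (zpair (fun n => fcoef f n * ex (IZC n * z))%C) (Datatypes.S N) + zpair (fun n => fcoef f n * ex (IZC n * z))%C (Datatypes.S N))%C.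
      rewrite IH. unfold zpair. rewrite !T.
      destruct (Z.eq_dec (Z.of_nat (Datatypes.S N)) 0); [lia|].
      destruct (Z.eq_dec (-1 - Z.of_nat (Datatypes.S N)) 0); [lia|].
      replace (1 - Z.of_nat (Datatypes.S N))%Z with (- Z.of_nat N)%Z by lia.
      replace (1 - (-1 - Z.of_nat (Datatypes.S N)))%Z with (Z.of_nat (Datatypes.S N) + 2)%Z by lia.
      replace (- (-1 - Z.of_nat (Datatypes.S N)))%Z with (Z.of_nat N + 2)%Z by lia. ring. }
  intros e he. destruct (riemann_lebesgue h hc hp (e/2)) as [N [N0 HN]]; [lra|].
  exists (Datatypes.S (Z.to_nat N)). intros [|n] hn; [lia|]. rewrite S.
  replace (f z + (hh (Z.of_nat n + 2)%Z - hh (- Z.of_nat n)%Z) - f z)%C with (hh (Z.of_nat n + 2)%Z - hh (- Z.of_nat n)%Z)%C by ring.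
  eapply Rle_lt_trans; [apply Cmod_triangle|]. rewrite Cmod_opp.
  pose proof (HN (Z.of_nat n + 2)%Z ltac:(lia)). pose proof (HN (- Z.of_nat n)%Z ltac:(lia)).
  unfold hh. lra.
Qed.

(** * Theta functions *)

Definition Tterm (j : nat) (a : R) (u t : C) (n : Z) : C :=
  (ex (IZC n / 2) * (twopii * RtoC (IZR n + a)) ^ j
   * ex (RtoC ((IZR n + a) * (IZR n + a) / 2) * t + RtoC (IZR n + a) * u))%C.

(** The theta function with characteristic [a] and its successive derivatives
    in [u]; [a = 1/2] is the odd Jacobi theta function. *)
Definition T (j : nat) (a : R) (u t : C) : C := Zsum (Tterm j a u t).

Lemma RtoC_half x : RtoC (x / 2) = (RtoC x / 2)%C.
Proof. rewrite RtoC_div by lra. auto. Qed.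

Lemma Im_Rmult x z : Im (RtoC x * z) = x * Im z.
Proof. ReIm. ring. Qed.

Lemma Cmod_2piix x : Cmod (twopii * RtoC x) = 2 * PI * Rabs x.
Proof. rewrite !Cmod_mult, !Cmod_R, Cmod_Ci, (Rabs_pos_eq (2 * PI)); [ring|pose proof PI_RGT_0; lra]. Qed.

Lemma Cmod_exZ2 n : Cmod (ex (IZC n / 2)) = 1.
Proof.
  rewrite Cmod_ex. replace (IZC n / 2)%C with (RtoC (IZR n / 2)).
  - rewrite Im_R, Rmult_0_r, Ropp_0. apply exp_0.
  - unfold IZC. rewrite RtoC_half. auto.
Qed.

Lemma Cmod_Tterm j a u t n : Cmod (Tterm j a u t n) =
  (2 * PI * Rabs (IZR n + a)) ^ j * exp (- (2 * PI * ((IZR n + a) * (IZR n + a) / 2 * Im t + (IZR n + a) * Im u))).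
Proof.
  unfold Tterm. rewrite !Cmod_mult, Cmod_exZ2, Cmod_pow, Cmod_2piix, Cmod_ex, Im_plus, !Im_Rmult. ring.
Qed.

(** The power is absorbed by an exponential, which the Gaussian factor dominates. *)
Lemma rzsummable_theta k a y v : 0 < y ->
  rzsummable (fun n => Rabs (IZR n + a) ^ k * exp (- (PI * y * ((IZR n + a) * (IZR n + a))) + v * Rabs (IZR n + a))).
Proof.
  intros hy. pose proof PI_RGT_0 as hpi.
  assert (hpy : 0 < PI * y) by nra.
  set (w := INR k + Rabs v). assert (hw : 0 <= w) by (unfold w; pose proof (pos_INR k); pose proof (Rabs_pos v); lra).
  eapply rzsummable_le; [|apply (rzsummable_gauss (PI * y / 2) w (PI * y * (a * a) + w * Rabs a)); lra].
  intros n. set (x := Rabs (IZR n + a)). assert (hx : 0 <= x) by apply Rabs_pos.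
  split; [apply Rmult_le_pos; [apply pow_le; auto|left; apply exp_pos]|].
  assert (P : x ^ k <= exp (INR k * x)).
  { clear - hx. induction k as [|k IH].
    - rewrite Rmult_0_l, exp_0. lra.
    - rewrite S_INR. replace ((INR k + 1) * x) with (x + INR k * x) by ring. rewrite exp_plus.
      apply Rmult_le_compat; auto; [apply pow_le; auto|apply le_exp]. }
  eapply Rle_trans; [apply Rmult_le_compat_r; [left; apply exp_pos|apply P]|].
  rewrite <- exp_plus. apply exp_mono.
  assert (X : x <= Rabs (IZR n) + Rabs a) by apply Rabs_triang.
  assert (Y : IZR n * IZR n / 2 - a * a <= (IZR n + a) * (IZR n + a)).
  { assert (0 <= (IZR n + 2 * a) * (IZR n + 2 * a)) by apply Rle_0_sqr. lra. }
  assert (V : v * x <= Rabs v * x) by (apply Rmult_le_compat_r; auto; apply Rle_abs).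
  assert (Wx : w * x <= w * (Rabs (IZR n) + Rabs a)) by (apply Rmult_le_compat_l; auto).
  unfold w in Wx at 1.
  assert (PI * y * (IZR n * IZR n / 2 - a * a) <= PI * y * ((IZR n + a) * (IZR n + a))) by (apply Rmult_le_compat_l; lra).
  lra.
Qed.

Lemma opp_mult_le x v : - (x * v) <= Rabs v * Rabs x.
Proof. rewrite <- Rabs_mult, Rmult_comm, <- (Rabs_Ropp (v * x)). apply Rle_abs. Qed.

Lemma exp_lin_bound x v y : exp (- (2 * PI * (x * x / 2 * y + x * v))) <= exp (- (PI * y * (x * x)) + 2 * PI * Rabs v * Rabs x).
Proof.
  apply exp_mono. pose proof PI_RGT_0. pose proof (opp_mult_le x v). nra.
Qed.

Lemma zsummable_Tterm j a u t : upper_half t -> zsummable (Tterm j a u t).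
Proof.
  intros ht.
  eapply zsummable_rle; [|apply (rzsummable_scal ((2 * PI) ^ j) _ (pow_le (2 * PI) j ltac:(pose proof PI_RGT_0; lra))
    (rzsummable_theta j a (Im t) (2 * PI * Rabs (Im u)) ht))].
  intros n. rewrite Cmod_Tterm, Rpow_mult_distr, Rmult_assoc. pose proof PI_RGT_0.
  apply Rmult_le_compat_l; [apply pow_le; lra|]. apply Rmult_le_compat_l; [apply pow_le, Rabs_pos|].
  apply exp_lin_bound.
Qed.

Lemma zsums_T j a u t : upper_half t -> zsums (Tterm j a u t) (T j a u t).
Proof. intros. apply zsummable_sums, zsummable_Tterm; auto. Qed.

Lemma T_unique j a u t l : zsums (Tterm j a u t) l -> T j a u t = l.
Proof. apply zsums_Zsum_eq. Qed.

Lemma Cder_T_u j a u t : upper_half t -> Cder (fun u => T j a u t) u (T (S j) a u t).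
Proof.
  intros ht. pose proof PI_RGT_0 as hpi.
  apply (Cder_expsum (fun n => ex (IZC n / 2) * (twopii * RtoC (IZR n + a)) ^ j
     * ex (RtoC ((IZR n + a) * (IZR n + a) / 2) * t))%C (fun n => IZR n + a) _ u 1 _ Rlt_0_1).
  - eapply rzsummable_le; [|apply (rzsummable_scal ((2 * PI) ^ j) _ (pow_le (2 * PI) j ltac:(lra))
      (rzsummable_theta (j + 2) a (Im t) (2 * PI * (1 + Rabs (Im u))) ht))].
    intros n. cbv beta. set (x := IZR n + a). split.
    + apply Rmult_le_pos; [apply Rmult_le_pos; [apply Cmod_ge_0|apply Rle_0_sqr]|left; apply exp_pos].
    + rewrite !Cmod_mult, Cmod_exZ2, Cmod_pow, Cmod_2piix, Cmod_ex, Im_Rmult, Rpow_mult_distr, pow_add.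
      replace (Rabs x ^ 2) with (x * x) by (simpl; rewrite Rmult_1_r, <- Rabs_mult; symmetry; apply Rabs_pos_eq, Rle_0_sqr).
      set (A := (2 * PI) ^ j). set (B := Rabs x ^ j).
      set (E1 := exp (- (2 * PI * (x * x / 2 * Im t)))). set (E2 := exp (2 * PI * (Rabs x * 1 - x * Im u))).
      replace (1 * (A * B) * E1 * (x * x) * E2) with ((A * B * (x * x)) * (E1 * E2)) by ring.
      set (E3 := exp _). replace (A * (B * (x * x) * E3)) with ((A * B * (x * x)) * E3) by ring.
      apply Rmult_le_compat_l.
      * apply Rmult_le_pos; [apply Rmult_le_pos; apply pow_le; [lra|apply Rabs_pos]|apply Rle_0_sqr].
      * unfold E1, E2, E3. rewrite <- exp_plus. apply exp_mono. pose proof (opp_mult_le x (Im u)). nra.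
  - intros x _. eapply zsums_ext; [|apply (zsums_T j a x t ht)]. intros n. unfold Tterm. rewrite ex_plus. ring.
  - eapply zsums_ext; [|apply (zsums_T (S j) a u t ht)]. intros n. unfold Tterm. rewrite ex_plus. simpl. ring.
Qed.

(** The heat equation, valid term by term. *)
Lemma Cder_T_t j a u t : upper_half t -> Cder (fun t => T j a u t) t (T (S (S j)) a u t / (4 * RtoC PI * Ci))%C.
Proof.
  intros ht. pose proof PI_RGT_0 as hpi. unfold upper_half in ht.
  assert (hr : 0 < Im t / 2) by lra.
  apply (Cder_expsum (fun n => ex (IZC n / 2) * (twopii * RtoC (IZR n + a)) ^ j
     * ex (RtoC (IZR n + a) * u))%C (fun n => (IZR n + a) * (IZR n + a) / 2) _ t (Im t / 2) _ hr).
  - eapply rzsummable_le; [|apply (rzsummable_scal ((2 * PI) ^ j / 4) _ ltac:(apply Rmult_le_pos; [apply pow_le; lra|lra])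
      (rzsummable_theta (j + 4) a (Im t / 2) (2 * PI * Rabs (Im u)) hr))].
    intros n. cbv beta. set (x := IZR n + a). assert (hxx : 0 <= x * x) by apply Rle_0_sqr. split.
    + apply Rmult_le_pos; [apply Rmult_le_pos; [apply Cmod_ge_0|apply Rle_0_sqr]|left; apply exp_pos].
    + rewrite !Cmod_mult, Cmod_exZ2, Cmod_pow, Cmod_2piix, Cmod_ex, Im_Rmult, Rpow_mult_distr, pow_add.
      replace (Rabs x ^ 4) with ((x * x) * (x * x)).
      2: { replace 4%nat with (2 + 2)%nat by lia. rewrite pow_add. simpl. rewrite !Rmult_1_r, <- Rabs_mult, Rabs_pos_eq; auto. }
      rewrite (Rabs_pos_eq (x * x / 2)) by lra.
      set (A := (2 * PI) ^ j). set (B := Rabs x ^ j).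
      set (E1 := exp (- (2 * PI * (x * Im u)))). set (E2 := exp (2 * PI * (x * x / 2 * (Im t / 2) - x * x / 2 * Im t))).
      replace (1 * (A * B) * E1 * (x * x / 2 * (x * x / 2)) * E2) with ((A / 4 * B * (x * x * (x * x))) * (E1 * E2)) by field.
      set (E3 := exp _). replace (A / 4 * (B * (x * x * (x * x)) * E3)) with ((A / 4 * B * (x * x * (x * x))) * E3) by ring.
      apply Rmult_le_compat_l.
      * apply Rmult_le_pos; [apply Rmult_le_pos; [apply Rmult_le_pos; [apply pow_le; lra|lra]|apply pow_le, Rabs_pos]|nra].
      * unfold E1, E2, E3. rewrite <- exp_plus. apply exp_mono. pose proof (opp_mult_le x (Im u)). nra.
  - intros x hx. assert (hx' : upper_half x).
    { unfold upper_half. pose proof (Im_le_Cmod (x - t)) as Q. rewrite Im_minus in Q. apply Rabs_le_between in Q. lra. }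
    eapply zsums_ext; [|apply (zsums_T j a u x hx')]. intros n. unfold Tterm. rewrite ex_plus. ring.
  - replace (T (S (S j)) a u t / (4 * RtoC PI * Ci))%C with (/ (4 * RtoC PI * Ci) * T (S (S j)) a u t)%C by (unfold Cdiv; ring).
    eapply zsums_ext; [|apply (zsums_scal (/ (4 * RtoC PI * Ci)) _ _ (zsums_T (S (S j)) a u t ht))].
    intros n. unfold Tterm. rewrite ex_plus. rewrite RtoC_half, !RtoC_mult. simpl Cpow.
    assert (N1 : RtoC PI <> 0%C) by (apply RtoC_neq0; lra).
    assert (N2 : Ci <> 0%C) by apply Ci_neq0.
    field. auto.
Qed.

Lemma T_odd u t : upper_half t -> T 0 (1/2) (- u) t = (- T 0 (1/2) u t)%C.
Proof.
  intros ht. apply T_unique.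
  replace (- T 0 (1/2) u t)%C with ((- (1)) * T 0 (1/2) u t)%C by ring.
  eapply zsums_ext; [|apply (zsums_scal _ _ _ (zsums_refl _ _ (zsums_T 0 (1/2) u t ht)))].
  intros n. unfold Tterm. rewrite minus_IZR.
  replace (RtoC (-1 - IZR n + 1 / 2)) with (- RtoC (IZR n + 1/2))%C by (rewrite <- RtoC_opp; f_equal; field).
  replace ((-1 - IZR n + 1 / 2) * (-1 - IZR n + 1 / 2)) with ((IZR n + 1/2) * (IZR n + 1/2)) by field.
  replace (ex (IZC (-1 - n) / 2)) with (- ex (IZC n / 2))%C.
  - replace (- RtoC (IZR n + 1/2) * u)%C with (RtoC (IZR n + 1/2) * - u)%C by ring. ring.
  - rewrite (ex_eq (IZC (-1 - n) / 2) (IZC n / 2 + RtoC (1/2)) (- n - 1)).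
    + rewrite ex_plus, ex_half. ring.
    + rewrite !IZC_minus, IZC_opp, RtoC_half. unfold IZC. field.
Qed.

Lemma T_shift_tau (m : Z) u t : upper_half t ->
  T 0 (1/2) (u + IZC m * t) t = (ex (IZC m / 2 - IZC m * u - IZC m * IZC m / 2 * t) * T 0 (1/2) u t)%C.
Proof.
  intros ht. apply T_unique.
  eapply zsums_ext; [|apply (zsums_scal _ _ _ (zsums_addn _ _ m (zsums_T 0 (1/2) u t ht)))].
  intros n. unfold Tterm. rewrite !Cmult_1_r, <- !ex_plus.
  apply (ex_eq _ _ m). rewrite IZC_plus, plus_IZR. rewrite !RtoC_half, !RtoC_mult, !RtoC_plus, RtoC_half. unfold IZC. field.
Qed.

Lemma T_shift_1 (m : Z) u t : upper_half t ->
  T 0 (1/2) (u + IZC m) t = (ex (IZC m / 2) * T 0 (1/2) u t)%C.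
Proof.
  intros ht. apply T_unique.
  eapply zsums_ext; [|apply (zsums_scal _ _ _ (zsums_T 0 (1/2) u t ht))].
  intros n. unfold Tterm. rewrite !Cmult_1_r, <- !ex_plus.
  apply (ex_eq _ _ (- (n * m))). rewrite IZC_opp, IZC_mult. rewrite !RtoC_half, !RtoC_mult, !RtoC_plus, RtoC_half. unfold IZC. field.
Qed.

(** * Infinite products and the Jacobi triple product *)

Fixpoint Cprod (f : nat -> C) (n : nat) : C :=
  match n with O => RtoC 1 | S k => (Cprod f k * f k)%C end.

Lemma Cprod_ext f g n : (forall k, (k < n)%nat -> f k = g k) -> Cprod f n = Cprod g n.
Proof. induction n as [|n IH]; intros H; simpl; auto. rewrite IH, H; auto. Qed.

Lemma Cprod_mult f g n : Cprod (fun k => f k * g k)%C n = (Cprod f n * Cprod g n)%C.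
Proof. induction n as [|n IH]; simpl; [|rewrite IH]; ring. Qed.

Lemma Cprod_neq0 f n : (forall k, (k < n)%nat -> f k <> RtoC 0) -> Cprod f n <> RtoC 0.
Proof.
  induction n as [|n IH]; intros H; simpl; [apply RtoC_neq0; lra|]. apply Cmult_neq_0; auto.
Qed.

Lemma Cprod_split f m n : Cprod f (m + n) = (Cprod f m * Cprod (fun k => f (m + k)%nat) n)%C.
Proof.
  induction n as [|n IH].
  - rewrite Nat.add_0_r. simpl. ring.
  - rewrite Nat.add_succ_r. simpl. rewrite IH. ring.
Qed.

(** The partial products [p n] are bounded, so their increments [p n * f n] are summable. *)
Lemma prod_conv f b : (forall n, Cmod (f n) <= b n) -> summable b ->
  exists l, Clim (Cprod (fun n => 1 + f n)%C) l.
Proof.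
  intros H [hb [B HB]]. set (p := Cprod (fun n => 1 + f n)%C).
  assert (Bd : forall n, Cmod (p n) <= exp (Rsum b n)).
  { induction n as [|n IH]; [unfold p; simpl; rewrite Cmod_1, exp_0; lra|].
    change (p (S n)) with (p n * (1 + f n))%C. simpl Rsum. rewrite Cmod_mult, exp_plus.
    apply Rmult_le_compat; try apply Cmod_ge_0; auto.
    eapply Rle_trans; [apply Cmod_triangle|]. rewrite Cmod_1. specialize (H n).
    pose proof (exp_ineq1_le (b n)). lra. }
  assert (E : forall n, p n = (1 + Csum (fun k => p k * f k) n)%C).
  { induction n as [|n IH]; [unfold p; simpl; ring|].
    change (p (S n)) with (p n * (1 + f n))%C. simpl Csum. rewrite IH at 1.
    transitivity (1 + Csum (fun k => p k * f k) n + p n * f n)%C; [rewrite <- IH; ring|ring]. }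
  destruct (sums_majorant (fun k => p k * f k)%C (fun k => exp B * b k)) as [l Hl].
  - intros n. rewrite Cmod_mult. apply Rmult_le_compat; try apply Cmod_ge_0; auto.
    eapply Rle_trans; [apply Bd|]. apply exp_mono. auto.
  - apply summable_scal; [left; apply exp_pos|split; eauto].
  - exists (1 + l)%C. eapply Clim_ext; [intros n; symmetry; apply E|]. apply Clim_plus; auto. apply Clim_const.
Qed.

(** An absolutely convergent product of nonzero factors is nonzero, because the
    product of the inverses converges as well. *)
Lemma prod_conv_neq0 f b l : (forall n, Cmod (f n) <= b n) -> summable b ->
  Clim (Cprod (fun n => 1 + f n)%C) l -> (forall n, (1 + f n)%C <> RtoC 0) -> l <> RtoC 0.
Proof.
  intros H S Hl N.
  assert (L1 : Clim (fun n => 1 + f n)%C 1%C).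
  { destruct (sums_majorant f b H S) as [s Hs]. replace (RtoC 1) with (1 + 0)%C at 1 by ring.
    apply Clim_plus; [apply Clim_const|apply (sums_term _ _ Hs)]. }
  destruct (Clim_bounded_below _ _ L1) as [m [hm Hm]]; auto.
  { apply RtoC_neq0; lra. }
  destruct (prod_conv (fun n => - f n / (1 + f n))%C (fun n => / m * b n)) as [l' Hl'].
  - intros n. rewrite Cmod_div, Cmod_opp by auto. specialize (Hm n). rewrite Rmult_comm. apply Rmult_le_compat; auto; try apply Cmod_ge_0.
    + left. apply Rinv_0_lt_compat. lra.
    + apply Rinv_le_contravar; auto.
  - apply summable_scal; auto. left. apply Rinv_0_lt_compat; auto.
  - intros E. rewrite E in Hl. pose proof (Clim_mult _ _ _ _ Hl Hl') as K.
    rewrite Cmult_0_l in K. apply Clim_ext with (v := fun _ => RtoC 1) in K.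
    + pose proof (Clim_unique _ _ _ K (Clim_const 1)) as Q. symmetry in Q. apply RtoC_inj in Q. lra.
    + intros n. rewrite <- Cprod_mult. induction n as [|n IH]; simpl; auto. rewrite IH. field. auto.
Qed.

(** The q-shifted factorial [prod_(k < N) (1 - e(u) q^k)] and its limit. *)
Definition qfac (u t : C) (N : nat) : C := Cprod (fun k => 1 - ex (u + INC k * t))%C N.
Definition qinf (u t : C) : C := C_lim_seq (qfac u t).

Lemma Cmod_ex_ap u t k : Cmod (ex (u + INC k * t)) = exp (- (2 * PI * Im u)) * exp (- (2 * PI * Im t)) ^ k.
Proof.
  rewrite Cmod_ex, Im_plus, Im_Rmult.
  replace (- (2 * PI * (Im u + INR k * Im t))) with (- (2 * PI * Im u) + INR k * - (2 * PI * Im t)) by ring.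
  rewrite exp_plus. f_equal. induction k as [|k IH]; [simpl; rewrite Rmult_0_l; apply exp_0|].
  rewrite S_INR, Rmult_plus_distr_r, exp_plus, IH, Rmult_1_l. simpl. ring.
Qed.

Lemma exp_Im_lt1 t : upper_half t -> 0 < exp (- (2 * PI * Im t)) < 1.
Proof.
  intros h. split; [apply exp_pos|]. rewrite <- exp_0. apply exp_increasing.
  unfold upper_half in h. pose proof PI_RGT_0. nra.
Qed.

Lemma summable_geom c r : 0 <= c -> 0 <= r < 1 -> summable (fun k => c * r ^ k).
Proof.
  intros hc hr. apply summable_scal; auto. apply summable_ex_series.
  - intros; apply pow_le; lra.
  - apply ex_series_geom. rewrite Rabs_pos_eq; lra.
Qed.

Lemma qfac_lim u t : upper_half t -> Clim (qfac u t) (qinf u t).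
Proof.
  intros h. pose proof (exp_Im_lt1 t h).
  destruct (prod_conv (fun k => - ex (u + INC k * t))%C _ (fun k => Req_le _ _ eq_refl)) as [l Hl].
  - eapply summable_le; [|apply (summable_geom (exp (- (2 * PI * Im u))) (exp (- (2 * PI * Im t))))].
    + intros k. rewrite Cmod_opp, Cmod_ex_ap. split; [|lra]. apply Rmult_le_pos; [left; apply exp_pos|apply pow_le; lra].
    + left; apply exp_pos.
    + lra.
  - unfold qinf. rewrite (C_lim_seq_unique _ l); auto.
Qed.

Lemma qinf_neq0 u t : upper_half t -> (forall k : nat, ex (u + INC k * t) <> RtoC 1) -> qinf u t <> RtoC 0.
Proof.
  intros h N. pose proof (exp_Im_lt1 t h).
  apply (prod_conv_neq0 (fun k => - ex (u + INC k * t))%C (fun k => Cmod (- ex (u + INC k * t))%C)).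
  - intros; lra.
  - eapply summable_le; [|apply (summable_geom (exp (- (2 * PI * Im u))) (exp (- (2 * PI * Im t))))].
    + intros k. rewrite Cmod_opp, Cmod_ex_ap. split; [|lra]. apply Rmult_le_pos; [left; apply exp_pos|apply pow_le; lra].
    + left; apply exp_pos.
    + lra.
  - apply qfac_lim; auto.
  - intros k E. apply (N k). replace (ex (u + INC k * t)) with (1 - (1 + - ex (u + INC k * t)))%C by ring.
    rewrite E. ring.
Qed.

Lemma qfac_neq0 u t N : (forall k : nat, ex (u + INC k * t) <> RtoC 1) -> qfac u t N <> RtoC 0.
Proof.
  intros H. apply Cprod_neq0. intros k _ E. apply (H k).
  replace (ex (u + INC k * t)) with (1 - (1 - ex (u + INC k * t)))%C by ring. rewrite E. ring.
Qed.

Lemma ex_tt_neq1 t k : upper_half t -> ex (t + INC k * t) <> RtoC 1.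
Proof.
  intros h. apply ex_neq1_Im. rewrite Im_plus, Im_Rmult. unfold upper_half in h. pose proof (pos_INR k). nra.
Qed.

Lemma qfac_S u t N : qfac u t (S N) = (qfac u t N * (1 - ex (u + INC N * t)))%C.
Proof. reflexivity. Qed.

(** [1 / (q;q)_m], extended by zero to negative [m] so that the recurrence in
    [m] holds everywhere. *)
Definition iq (t : C) (m : Z) : C := if Z_lt_dec m 0 then RtoC 0 else (/ qfac t t (Z.to_nat m))%C.

Lemma iq_rec t m : upper_half t -> iq t (m - 1) = (iq t m * (1 - ex (IZC m * t)))%C.
Proof.
  intros h. unfold iq. destruct (Z_lt_dec m 0); destruct (Z_lt_dec (m - 1) 0); try lia.
  - ring.
  - assert (m = 0%Z) by lia. subst m. replace (IZC 0 * t)%C with (RtoC 0) by (unfold IZC; ring). rewrite ex_0. ring.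
  - replace (Z.to_nat m) with (S (Z.to_nat (m - 1))) by lia. rewrite qfac_S.
    assert (N := ex_tt_neq1 t (Z.to_nat (m - 1)) h).
    replace (t + INC (Z.to_nat (m - 1)) * t)%C with (IZC m * t)%C in *.
    + field. split.
      * intros E. apply N. replace (ex (IZC m * t)) with (1 - (1 - ex (IZC m * t)))%C by ring. rewrite E. ring.
      * apply qfac_neq0. intros k. apply ex_tt_neq1; auto.
    + rewrite INR_IZR_INZ, Z2Nat.id by lia. unfold IZC. rewrite minus_IZR, RtoC_minus. ring.
Qed.

Definition jN (u t : C) (N : nat) : C := (qfac u t N * qfac (t - u) t N)%C.

Definition jterm (u t : C) (n : Z) : C :=
  ex (IZC n / 2 + IZC n * (IZC n - 1) / 2 * t + IZC n * u)%C.

Lemma finite_support_zsummable f N : (forall n : Z, (Z.of_nat N <= Z.abs n)%Z -> f n = RtoC 0) -> zsummable f.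
Proof.
  intros H.
  assert (S : forall g : nat -> C, (forall k, (N <= k)%nat -> g k = RtoC 0) -> summable (fun k => Cmod (g k))).
  { intros g Hg. split; [intros; apply Cmod_ge_0|]. exists (Rsum (fun k => Cmod (g k)) N). intros n.
    destruct (le_lt_dec n N) as [l|l].
    - apply Rsum_mono; auto. intros; apply Cmod_ge_0.
    - replace n with (N + (n - N))%nat by lia. generalize (n - N)%nat. intros k. induction k as [|k IH].
      + rewrite Nat.add_0_r. lra.
      + rewrite Nat.add_succ_r. simpl. rewrite Hg, Cmod_0 by lia. lra. }
  split; [apply (S (fun i => f (Z.of_nat i)))|apply (S (fun i => f (-1 - Z.of_nat i)%Z))]; intros; apply H; lia.
Qed.

(** Induction on [N]: the two factors that are new on the left combine neighbouring
    terms on the right, by the recurrence of [iq]. *)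
Lemma finite_jacobi u t N : upper_half t ->
  zsums (fun n => jterm u t n * (qfac t t (2 * N) * iq t (Z.of_nat N - n) * iq t (Z.of_nat N + n)))%C (jN u t N).
Proof.
  intros h. induction N as [|N IH].
  - split.
    + apply (finite_support_zsummable _ 1). intros n hn. unfold iq.
      destruct (Z_lt_dec (Z.of_nat 0 - n) 0); destruct (Z_lt_dec (Z.of_nat 0 + n) 0); try ring. lia.
    + replace (jN u t 0) with (Csum (zpair (fun n : Z => jterm u t n * (qfac t t (2 * 0) * iq t (Z.of_nat 0 - n) * iq t (Z.of_nat 0 + n)))%C) 1).
      * apply sums_finite. intros n hn. unfold zpair, iq.
        destruct (Z_lt_dec (Z.of_nat 0 - Z.of_nat n) 0); [|lia].
        destruct (Z_lt_dec (Z.of_nat 0 + (-1 - Z.of_nat n)) 0); [|lia]. ring.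
      * unfold zpair, iq, jN. simpl. unfold jterm.
        replace (IZC 0 / 2 + IZC 0 * (IZC 0 - 1) / 2 * t + IZC 0 * u)%C with (RtoC 0) by (unfold IZC; field).
        rewrite ex_0. unfold qfac. simpl. field.
        intros E. apply (ex_tt_neq1 t 0 h). simpl INR.
        replace (ex (t + 0 * t)) with (1 - (1 - ex (t + 0 * t)))%C by ring. rewrite E. ring.
  - set (F := fun n => (jterm u t n * (qfac t t (2 * N) * iq t (Z.of_nat N - n) * iq t (Z.of_nat N + n)))%C) in IH.
    set (nn := INC N).
    assert (E : jN u t (S N) = ((1 + ex ((2 * nn + 1) * t)) * jN u t N + (- ex (u + nn * t)) * jN u t N + (- ex ((nn + 1) * t - u)) * jN u t N)%C).
    { unfold jN. rewrite !qfac_S. fold nn.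
      replace (ex ((2 * nn + 1) * t)) with (ex (u + nn * t) * ex (t - u + nn * t))%C by (rewrite <- ex_plus; f_equal; ring).
      replace ((nn + 1) * t - u)%C with (t - u + nn * t)%C by ring. ring. }
    rewrite E.
    pose proof (zsums_plus _ _ _ _ (zsums_plus _ _ _ _ (zsums_scal (1 + ex ((2 * nn + 1) * t)) _ _ IH)
      (zsums_scal (- ex (u + nn * t)) _ _ (zsums_addn _ _ (-1) IH))) (zsums_scal (- ex ((nn + 1) * t - u)) _ _ (zsums_addn _ _ 1 IH))) as K.
    eapply zsums_ext; [|apply K]. intros n. unfold F.
    replace (Z.of_nat N - (n + -1))%Z with (Z.of_nat (S N) - n)%Z by lia.
    replace (Z.of_nat N + (n + 1))%Z with (Z.of_nat (S N) + n)%Z by lia.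
    replace (Z.of_nat N + (n + -1))%Z with (Z.of_nat (S N) + n - 1 - 1)%Z by lia.
    replace (Z.of_nat N - (n + 1))%Z with (Z.of_nat (S N) - n - 1 - 1)%Z by lia.
    replace (Z.of_nat N + n)%Z with (Z.of_nat (S N) + n - 1)%Z by lia.
    replace (Z.of_nat N - n)%Z with (Z.of_nat (S N) - n - 1)%Z by lia.
    rewrite !(iq_rec t) by auto.
    replace (2 * S N)%nat with (S (S (2 * N))) by lia. rewrite !qfac_S.
    set (X := ex ((nn - IZC n) * t)). set (Y := ex ((nn + IZC n) * t)). set (q := ex t).
    assert (EN : IZC (Z.of_nat (S N)) = (nn + 1)%C).
    { unfold IZC, nn. rewrite <- INR_IZR_INZ, S_INR, RtoC_plus. auto. }
    replace (ex (IZC (Z.of_nat (S N) - n) * t)) with (X * q)%C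
      by (unfold X, q; rewrite <- ex_plus, IZC_minus, EN; f_equal; ring).
    replace (ex (IZC (Z.of_nat (S N) - n - 1) * t)) with X
      by (unfold X; rewrite !IZC_minus, EN; f_equal; unfold IZC; ring).
    replace (ex (IZC (Z.of_nat (S N) + n) * t)) with (Y * q)%C
      by (unfold Y, q; rewrite <- ex_plus, IZC_plus, EN; f_equal; ring).
    replace (ex (IZC (Z.of_nat (S N) + n - 1) * t)) with Y
      by (unfold Y; rewrite !IZC_minus, IZC_plus, EN; f_equal; unfold IZC; ring).
    assert (E2N : INC (2 * N) = (2 * nn)%C) by (unfold nn; rewrite mult_INR, RtoC_mult; reflexivity).
    assert (E2N' : INC (S (2 * N)) = (2 * nn + 1)%C) by (rewrite S_INR, RtoC_plus, E2N; reflexivity).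
    rewrite E2N, E2N'.
    replace (ex (t + 2 * nn * t)) with (X * Y * q)%C by (unfold X, Y, q; rewrite <- !ex_plus; f_equal; ring).
    replace (ex (t + (2 * nn + 1) * t)) with (X * Y * q * q)%C by (unfold X, Y, q; rewrite <- !ex_plus; f_equal; ring).
    replace (ex ((2 * nn + 1) * t)) with (X * Y * q)%C by (unfold X, Y, q; rewrite <- !ex_plus; f_equal; ring).
    replace (jterm u t (n + -1)) with (- jterm u t n * (X * q / ex (u + nn * t)))%C.
    2: { unfold jterm, X, q. rewrite <- ex_plus, <- ex_minus.
         replace (- ex (IZC n / 2 + IZC n * (IZC n - 1) / 2 * t + IZC n * u))%C with (ex (RtoC (1/2)) * ex (IZC n / 2 + IZC n * (IZC n - 1) / 2 * t + IZC n * u))%C by (rewrite ex_half; ring).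
         rewrite <- !ex_plus. apply (ex_eq _ _ 1). rewrite IZC_plus, RtoC_half. unfold IZC. field. }
    replace (jterm u t (n + 1)) with (- jterm u t n * (Y * q / ex ((nn + 1) * t - u)))%C.
    2: { unfold jterm, Y, q. rewrite <- ex_plus, <- ex_minus.
         replace (- ex (IZC n / 2 + IZC n * (IZC n - 1) / 2 * t + IZC n * u))%C with (ex (RtoC (1/2)) * ex (IZC n / 2 + IZC n * (IZC n - 1) / 2 * t + IZC n * u))%C by (rewrite ex_half; ring).
         rewrite <- !ex_plus. apply (ex_eq _ _ 0). rewrite IZC_plus, RtoC_half. unfold IZC. field. }
    pose proof (ex_neq0 (u + nn * t)). pose proof (ex_neq0 ((nn + 1) * t - u)).
    field. auto.
Qed.

Lemma Clim_reindex u l (f : nat -> nat) : (forall M, exists N, forall n, (N <= n)%nat -> (M <= f n)%nat) ->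
  Clim u l -> Clim (fun n => u (f n)) l.
Proof.
  intros H K e he. destruct (K e he) as [M HM]. destruct (H M) as [N HN].
  exists N. intros n hn. apply HM. auto.
Qed.

Lemma jterm_T u t n : jterm u t n = (ex (u / 2 - t / 8) * Tterm 0 (- (1/2)) u t n)%C.
Proof.
  unfold jterm, Tterm. simpl Cpow. rewrite Cmult_1_r, <- !ex_plus. f_equal.
  rewrite RtoC_half, RtoC_mult, RtoC_plus, RtoC_opp, RtoC_half. unfold IZC. field.
Qed.

Lemma zsummable_jterm u t : upper_half t -> zsummable (jterm u t).
Proof.
  intros h. apply (zsummable_ext (fun n => ex (u / 2 - t / 8) * Tterm 0 (- (1/2)) u t n)%C).
  - intros n. symmetry. apply jterm_T.
  - apply (proj1 (zsums_scal _ _ _ (zsums_T 0 (- (1/2)) u t h))).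
Qed.

Lemma qinf_tt_neq0 t : upper_half t -> qinf t t <> RtoC 0.
Proof. intros h. apply qinf_neq0; auto. intros k. apply ex_tt_neq1; auto. Qed.

Lemma Clim_iq t (f : nat -> Z) : upper_half t ->
  (forall M, exists N, forall n, (N <= n)%nat -> (M <= f n)%Z) -> Clim (fun n => iq t (f n)) (/ qinf t t)%C.
Proof.
  intros h H. destruct (H 0%Z) as [N0 H0].
  apply Clim_ext_ev with (fun n => / qfac t t (Z.to_nat (f n)))%C N0.
  - intros n hn. unfold iq. destruct (Z_lt_dec (f n) 0); auto. specialize (H0 n hn). lia.
  - apply (Clim_reindex (fun k => / qfac t t k)%C _ (fun n => Z.to_nat (f n))).
    + intros M. destruct (H (Z.of_nat M)) as [N HN]. exists N. intros n hn. specialize (HN n hn). lia.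
    + apply Clim_inv; [apply qfac_lim; auto|apply qinf_tt_neq0; auto|].
      intros n. apply qfac_neq0. intros k. apply ex_tt_neq1; auto.
Qed.

Lemma iq_bounded t : upper_half t -> exists K, 0 < K /\ forall m, Cmod (iq t m) <= K.
Proof.
  intros h. destruct (Clim_bounded (fun n => / qfac t t n)%C (/ qinf t t)%C) as [K [hK HK]].
  - apply Clim_inv; [apply qfac_lim; auto|apply qinf_tt_neq0; auto|].
    intros n. apply qfac_neq0. intros k. apply ex_tt_neq1; auto.
  - exists K. split; auto. intros m. unfold iq. destruct (Z_lt_dec m 0); auto. rewrite Cmod_0. lra.
Qed.

Theorem jacobi_triple_product u t : upper_half t ->
  zsums (jterm u t) (qinf t t * (qinf u t * qinf (t - u) t))%C.
Proof.
  intros h. pose proof (qinf_tt_neq0 t h) as P0.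
  destruct (iq_bounded t h) as [K [hK HK]].
  destruct (Clim_bounded _ _ (qfac_lim t t h)) as [B [hB HB]].
  destruct (zsummable_sums _ (zsummable_jterm u t h)) as [Z1 Z2].
  assert (ZS : zsums (jterm u t) (Zsum (jterm u t))) by (split; auto).
  assert (L : Clim (jN u t) (/ qinf t t * Zsum (jterm u t))%C).
  { apply (ztannery (fun N n => jterm u t n * (qfac t t (2 * N) * iq t (Z.of_nat N - n) * iq t (Z.of_nat N + n)))%C
      (fun n => / qinf t t * jterm u t n)%C (fun n => (B * K * K) * Cmod (jterm u t n))).
    - intros n. replace (/ qinf t t * jterm u t n)%C with (jterm u t n * (qinf t t * / qinf t t * / qinf t t))%C by (field; auto).
      apply Clim_scal. apply Clim_mult; [apply Clim_mult|].
      + apply (Clim_subseq (qfac t t) _ (fun N => (2 * N)%nat)); [intros; lia|apply qfac_lim; auto].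
      + apply Clim_iq; auto. intros M. exists (Z.to_nat (M + n)). intros; lia.
      + apply Clim_iq; auto. intros M. exists (Z.to_nat (M - n)). intros; lia.
    - intros N n. rewrite !Cmod_mult, Rmult_comm. apply Rmult_le_compat_r; [apply Cmod_ge_0|].
      apply Rmult_le_compat; try apply Cmod_ge_0; auto.
      + apply Rmult_le_pos; apply Cmod_ge_0.
      + apply Rmult_le_compat; try apply Cmod_ge_0; auto.
    - apply rzsummable_scal; auto. repeat apply Rmult_le_pos; lra.
    - intros N. apply finite_jacobi; auto.
    - apply zsums_scal; auto. }
  assert (L' : Clim (jN u t) (qinf u t * qinf (t - u) t)%C) by (apply Clim_mult; apply qfac_lim; auto).
  rewrite (Clim_unique _ _ _ L' L).
  replace (qinf t t * (/ qinf t t * Zsum (jterm u t)))%C with (Zsum (jterm u t)) by (field; auto). exact ZS.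
Qed.

Lemma T_char_shift j a u t : upper_half t -> T j (a + 1) u t = (- T j a u t)%C.
Proof.
  intros h. apply T_unique. replace (- T j a u t)%C with ((- (1)) * T j a u t)%C by ring.
  eapply zsums_ext; [|apply (zsums_scal _ _ _ (zsums_shift _ _ (zsums_T j a u t h)))].
  intros n. unfold Tterm. rewrite plus_IZR. replace (IZR n + 1 + a) with (IZR n + (a + 1)) by ring.
  replace (ex (IZC (n + 1) / 2)) with (- ex (IZC n / 2))%C; [ring|].
  replace (IZC (n + 1) / 2)%C with (IZC n / 2 + RtoC (1/2))%C by (rewrite IZC_plus, RtoC_half; unfold IZC; field).
  rewrite ex_plus, ex_half. ring.
Qed.

Definition theta (u t : C) : C := T 0 (1/2) u t.

Lemma theta_product u t : upper_half t ->
  theta u t = (- ex (t / 8 - u / 2) * (qinf t t * (qinf u t * qinf (t - u) t)))%C.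
Proof.
  intros h. pose proof (jacobi_triple_product u t h) as J.
  assert (E : (qinf t t * (qinf u t * qinf (t - u) t))%C = (ex (u / 2 - t / 8) * T 0 (- (1/2)) u t)%C).
  { apply (zsums_unique _ _ _ J). eapply zsums_ext; [|apply (zsums_scal _ _ _ (zsums_T 0 (- (1/2)) u t h))].
    intros n. symmetry. apply jterm_T. }
  rewrite E. unfold theta. replace (1/2) with (- (1/2) + 1) at 1 by field. rewrite T_char_shift by auto.
  replace (- ex (t / 8 - u / 2) * (ex (u / 2 - t / 8) * T 0 (- (1 / 2)) u t))%C
    with (- (ex (t / 8 - u / 2) * ex (u / 2 - t / 8)) * T 0 (- (1 / 2)) u t)%C by ring.
  rewrite <- ex_plus. replace (t / 8 - u / 2 + (u / 2 - t / 8))%C with (RtoC 0) by field. rewrite ex_0. ring.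
Qed.

Lemma theta_neq0_R x t : upper_half t -> 0 < x < 1 -> theta (RtoC x) t <> RtoC 0.
Proof.
  intros h hx. rewrite theta_product by auto. pose proof h as h'. unfold upper_half in h'.
  repeat apply Cmult_neq_0.
  - intros E. apply (ex_neq0 (t / 8 - RtoC x / 2)). replace (ex (t / 8 - RtoC x / 2)) with (- - ex (t / 8 - RtoC x / 2))%C by ring.
    rewrite E. ring.
  - apply qinf_tt_neq0; auto.
  - apply qinf_neq0; auto. intros [|k].
    + simpl INR. replace (RtoC x + RtoC 0 * t)%C with (RtoC x) by ring. apply ex_neq1_R; auto.
    + apply ex_neq1_Im. rewrite Im_plus, Im_Rmult, Im_R. pose proof (pos_INR k). rewrite S_INR. nra.
  - apply qinf_neq0; auto. intros k. apply ex_neq1_Im. rewrite Im_plus, Im_Rmult, Im_minus, Im_R.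
    pose proof (pos_INR k). nra.
Qed.

Lemma theta_nontrivial t : upper_half t -> exists u, upper_half u /\ theta u t <> RtoC 0.
Proof.
  intros h. exists (RtoC (1/2) + IZC 1 * t)%C. split.
  - unfold upper_half in *. unfold IZC. repeat (progress ReIm). lra.
  - unfold theta. rewrite T_shift_tau by auto. apply Cmult_neq_0; [apply ex_neq0|].
    apply theta_neq0_R; auto. lra.
Qed.

(** * The theta function at zero and the eta function *)

(** Sequential continuity of [u |-> (e(u); q)_oo], by dominated convergence in
    the telescoped product. *)
Lemma qinf_cont u t (v : nat -> C) : upper_half t -> Clim v u -> Clim (fun m => qinf (v m) t) (qinf u t).
Proof.
  intros h Hv. destruct (Clim_bounded v u Hv) as [M [hM HM]]. pose proof (exp_Im_lt1 t h) as hr.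
  pose proof PI_RGT_0 as hpi.
  set (r := exp (- (2 * PI * Im t))) in *. set (c := exp (2 * PI * M)). assert (hc : 0 < c) by apply exp_pos.
  assert (Sb : summable (fun k => c * r ^ k)) by (apply summable_geom; lra).
  destruct Sb as [hb [B HB]].
  set (f := fun w k => (- ex (w + INC k * t))%C).
  assert (Q : forall w k, Cmod w <= M -> Cmod (f w k) <= c * r ^ k).
  { intros w k hw. unfold f. rewrite Cmod_opp, Cmod_ex_ap. apply Rmult_le_compat_r; [apply pow_le; lra|].
    apply exp_mono. pose proof (Im_le_Cmod w) as I. apply Rabs_le_between in I. nra. }
  assert (Bd : forall w, Cmod w <= M -> forall n, Cmod (qfac w t n) <= exp B).
  { intros w hw n. apply Rle_trans with (exp (Rsum (fun k => c * r ^ k) n)); [|apply exp_mono; auto].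
    induction n as [|n IH]; [unfold qfac; simpl; rewrite Cmod_1, exp_0; lra|].
    rewrite qfac_S. simpl Rsum. rewrite Cmod_mult, exp_plus.
    apply Rmult_le_compat; try apply Cmod_ge_0; auto.
    eapply Rle_trans; [apply Cmod_triangle|]. rewrite Cmod_1. specialize (Q w n hw). unfold f in Q.
    pose proof (exp_ineq1_le (c * r ^ n)). lra. }
  assert (E : forall w n, qfac w t n = (1 + Csum (fun k => qfac w t k * f w k) n)%C).
  { intros w. induction n as [|n IH]; [unfold qfac; simpl; ring|].
    rewrite qfac_S. simpl Csum.
    transitivity (1 + Csum (fun k => qfac w t k * f w k) n + qfac w t n * f w n)%C; [rewrite <- IH; unfold f; ring|ring]. }
  assert (S : forall w, sums (fun k => qfac w t k * f w k)%C (qinf w t - 1)%C).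
  { intros w. apply Clim_ext with (fun n => qfac w t n - 1)%C.
    - intros n. rewrite E at 1. ring.
    - apply Clim_minus; [apply qfac_lim; auto|apply Clim_const]. }
  assert (C : forall k, Clim (fun m => f (v m) k) (f u k)).
  { intros k. apply Clim_opp.
    apply (Ccont_lim (fun w => ex (w + INC k * t)) u v); auto.
    apply (Cder_cont _ _ (twopii * 1 * ex (1 * u + INC k * t))%C).
    apply (Cder_ext (fun w => ex (1 * w + INC k * t))); [intros; f_equal; ring|]. apply Cder_ex_lin. }
  assert (Cf : forall k, Clim (fun m => qfac (v m) t k) (qfac u t k)).
  { induction k as [|k IH]; [exact (Clim_const (RtoC 1))|].
    apply Clim_ext with (fun m => qfac (v m) t k * (1 + f (v m) k))%C.
    - intros m. rewrite qfac_S. reflexivity.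
    - rewrite qfac_S. apply Clim_mult; auto. replace (1 - ex (u + INC k * t))%C with (1 + f u k)%C by (unfold f; ring).
      apply Clim_plus; [apply Clim_const|auto]. }
  assert (L : Clim (fun m => qinf (v m) t - 1)%C (qinf u t - 1)%C).
  { apply (tannery (fun m k => qfac (v m) t k * f (v m) k)%C (fun k => qfac u t k * f u k)%C (fun k => exp B * (c * r ^ k))).
    - intros k. apply Clim_mult; auto.
    - intros m k. rewrite Cmod_mult. apply Rmult_le_compat; try apply Cmod_ge_0; auto.
    - apply summable_scal; [left; apply exp_pos|split; eauto].
    - intros m. apply S.
    - apply S. }
  apply Clim_ext with (fun m => (qinf (v m) t - 1) + 1)%C; [intros; ring|].
  replace (qinf u t) with (qinf u t - 1 + 1)%C by ring. apply Clim_plus; [auto|apply Clim_const].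
Qed.

Lemma qinf_step u t : upper_half t -> qinf u t = ((1 - ex u) * qinf (u + t) t)%C.
Proof.
  intros h. apply (Clim_unique (fun n => qfac u t (S n))).
  - apply (Clim_subseq (qfac u t) _ S); auto. apply qfac_lim; auto.
  - apply Clim_ext with (fun n => (1 - ex u) * qfac (u + t) t n)%C; [|apply Clim_scal, qfac_lim; auto].
    induction n as [|n IH].
    + unfold qfac. simpl. replace (u + 0 * t)%C with u by ring. ring.
    + rewrite (qfac_S u), <- IH, qfac_S, S_INR, RtoC_plus.
      replace (u + t + INC n * t)%C with (u + (INC n + RtoC 1) * t)%C by ring. ring.
Qed.

Lemma qinf_period u t n : qinf (u + IZC n) t = qinf u t.
Proof.
  unfold qinf. f_equal. apply functional_extensionality. intros N. unfold qfac. apply Cprod_ext. intros k _.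
  f_equal. apply (ex_eq _ _ n). ring.
Qed.

Definition thetap (u t : C) : C := T 1 (1/2) u t.

Lemma Cder_theta u t : upper_half t -> Cder (fun u => theta u t) u (thetap u t).
Proof. intros h. apply Cder_T_u; auto. Qed.

Lemma theta_0 t : upper_half t -> theta 0 t = RtoC 0.
Proof.
  intros h. pose proof (T_odd 0 t h) as E. fold (theta 0 t) in E.
  replace (- 0)%C with (RtoC 0) in E by ring. assert (E2 : (2 * theta 0 t)%C = 0%C) by (replace (2 * theta 0 t)%C with (theta 0 t + theta 0 t)%C by ring; rewrite E at 1; ring).
  replace (theta 0 t) with (/ 2 * (2 * theta 0 t))%C by field. rewrite E2. ring.
Qed.

Lemma two_pi_i_neq0 : twopii <> RtoC 0.
Proof.
  apply Cmult_neq_0; [apply RtoC_neq0; pose proof PI_RGT_0; lra|].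
  apply Ci_neq0.
Qed.

Lemma Clim_small_real : Clim (fun m => RtoC (/ (INR m + 2))) 0%C.
Proof.
  intros e he. destruct (archimed_cor1 e he) as [N [HN N0]]. exists N. intros n hn.
  replace (RtoC (/ (INR n + 2)) - 0)%C with (RtoC (/ (INR n + 2))) by ring.
  pose proof (pos_INR n). rewrite Cmod_R, Rabs_pos_eq by (left; apply Rinv_0_lt_compat; lra).
  eapply Rlt_trans; [|apply HN]. apply Rinv_lt_contravar.
  - apply Rmult_lt_0_compat; [apply lt_0_INR; auto|lra].
  - apply le_INR in hn. lra.
Qed.

Lemma Cder_1mex : Cder (fun w => 1 - ex w)%C 0 (- twopii)%C.
Proof.
  replace (- twopii)%C with (0 - twopii)%C by ring.
  apply Cder_minus; [apply Cder_const|]. eapply Cder_eq; [apply (Cder_ext (fun w => ex (1 * w + 0)))|].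
  - intros x. f_equal. ring.
  - apply Cder_ex_lin.
  - replace (1 * 0 + 0)%C with (RtoC 0) by ring. rewrite ex_0. ring.
Qed.

(** Sequences that tend to zero without meeting it compute derivatives. *)
Lemma quotient_Clim A B a b (v : nat -> C) : Cder A 0 a -> Cder B 0 b -> A 0%C = 0%C -> B 0%C = 0%C -> b <> 0%C ->
  Clim v 0%C -> (forall n, v n <> 0%C) -> Clim (fun n => A (v n) / B (v n))%C (a / b)%C.
Proof.
  intros HA HB A0 B0 hb Hv N e he. destruct (quotient_lim A B a b HA HB A0 B0 hb e he) as [d [hd Hd]].
  destruct (Hv d hd) as [M HM]. exists M. intros n hn. apply Hd; auto.
  specialize (HM n hn). replace (v n - 0)%C with (v n) in HM by ring. auto.
Qed.

(** Divide the product of [theta] by [1 - e(u)] and let [u] tend to zero. *)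
Theorem thetap_0 t : upper_half t -> thetap 0 t = (twopii * (ex (t / 8) * (qinf t t * qinf t t * qinf t t)))%C.
Proof.
  intros h. set (v := fun m => RtoC (/ (INR m + 2))).
  assert (hv : forall m, 0 < / (INR m + 2) < 1).
  { intros m. pose proof (pos_INR m). split; [apply Rinv_0_lt_compat; lra|].
    rewrite <- Rinv_1. apply Rinv_lt_contravar; lra. }
  assert (L1 : Clim (fun n => theta (v n) t / (1 - ex (v n)))%C (thetap 0 t / (- twopii))%C).
  { apply (quotient_Clim (fun u => theta u t) (fun w => 1 - ex w)%C).
    - apply Cder_theta; auto.
    - apply Cder_1mex.
    - apply theta_0; auto.
    - rewrite ex_0. ring.
    - intros E. apply two_pi_i_neq0. replace twopii with (- - twopii)%C by ring. rewrite E. ring.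
    - apply Clim_small_real.
    - intros n. apply RtoC_neq0. specialize (hv n). lra. }
  assert (L2 : Clim (fun n => theta (v n) t / (1 - ex (v n)))%C (- ex (t / 8 - 0 / 2) * (qinf t t * (qinf (0 + t) t * qinf (t - 0) t)))%C).
  { apply Clim_ext with (fun n => - ex (t / 8 - v n / 2) * (qinf t t * (qinf (v n + t) t * qinf (t - v n) t)))%C.
    - intros n. rewrite theta_product, (qinf_step (v n)) by auto. field.
      intros E. apply (ex_neq1_R _ (hv n)). change (RtoC (/ (INR n + 2))) with (v n).
      replace (ex (v n)) with (1 - (1 - ex (v n)))%C by ring. rewrite E. ring.
    - apply Clim_mult.
      + apply Clim_opp. apply (Ccont_lim (fun w => ex (t / 8 - w / 2))%C 0 v); [|apply Clim_small_real].
        apply (Cder_cont _ _ (twopii * (- / 2) * ex ((- / 2) * 0 + t / 8))%C).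
        apply (Cder_ext (fun w => ex ((- / 2) * w + t / 8))%C); [intros; f_equal; field|]. apply Cder_ex_lin.
      + apply Clim_scal. apply Clim_mult.
        * apply qinf_cont; auto. apply Clim_plus; [apply Clim_small_real|apply Clim_const].
        * apply qinf_cont; auto. apply Clim_minus; [apply Clim_const|apply Clim_small_real]. }
  pose proof (Clim_unique _ _ _ L1 L2) as E.
  replace (t / 8 - 0 / 2)%C with (t / 8)%C in E by field. replace (0 + t)%C with t in E by ring. replace (t - 0)%C with t in E by ring.
  pose proof two_pi_i_neq0.
  replace (thetap 0 t) with (- twopii * (thetap 0 t / (- twopii)))%C.
  - rewrite E. ring.
  - field. split; intros E'; apply H; rewrite E'; ring.
Qed.

Lemma qpoch_qinf z : qpoch z = qinf z z.
Proof.
  unfold qpoch, qinf. f_equal. apply functional_extensionality. intros N. induction N as [|N IH]; [reflexivity|].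
  change (C_prod (fun n => 1 - qpow (INR n) z)%C N * (1 - qpow (INR (S N)) z)
    = Cprod (fun k => 1 - ex (z + INC k * z)) N * (1 - ex (z + INC N * z)))%C.
  rewrite IH, qpow_ex, S_INR, RtoC_plus. do 3 f_equal. ring.
Qed.

Lemma eta_qinf z : eta z = (ex (z / 24) * qinf z z)%C.
Proof. unfold eta. rewrite qpoch_qinf, qpow_ex. f_equal. f_equal. rewrite RtoC_div by lra. field. Qed.

Lemma eta_neq0 z : upper_half z -> eta z <> RtoC 0.
Proof. intros h. rewrite eta_qinf. apply Cmult_neq_0; [apply ex_neq0|apply qinf_tt_neq0; auto]. Qed.

Lemma thetap_0_eta t : upper_half t -> thetap 0 t = (twopii * (eta t * eta t * eta t))%C.
Proof.
  intros h. rewrite thetap_0 by auto. rewrite eta_qinf.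
  replace (t / 8)%C with (t / 24 + t / 24 + t / 24)%C by field. rewrite !ex_plus. ring.
Qed.

(** [prod (1 + q^k) (1 - q^(2k-1)) = 1]: multiply by [prod (1 - q^k)]. *)
Lemma euler_odd_distinct t : upper_half t ->
  (qinf (t + RtoC (1/2)) t * qinf (t / 2) t * qinf (t / 2 + RtoC (1/2)) t)%C = RtoC 1.
Proof.
  intros h. set (W := (qinf (t + RtoC (1/2)) t * qinf (t / 2) t * qinf (t / 2 + RtoC (1/2)) t)%C).
  pose proof (qinf_tt_neq0 t h) as N.
  assert (E : (W * qinf t t)%C = qinf t t).
  { apply (Clim_unique (fun n => qfac t t (2 * n))).
    - apply Clim_ext with (fun n => qfac (t + RtoC (1/2)) t n * qfac (t / 2) t n * qfac (t / 2 + RtoC (1/2)) t n * qfac t t n)%C.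
      + intros n. induction n as [|n IH]; [unfold qfac; simpl; ring|].
        replace (2 * S n)%nat with (S (S (2 * n))) by lia. rewrite !qfac_S, <- IH.
        rewrite S_INR, mult_INR, RtoC_plus, RtoC_mult. change (INR 2) with 2.
        set (x := ex (t / 2 + INC n * t)).
        replace (ex (t + RtoC (1/2) + INC n * t)) with (- ex (t + INC n * t))%C.
        2: { replace (t + RtoC (1/2) + INC n * t)%C with (t + INC n * t + RtoC (1/2))%C by ring. rewrite (ex_plus _ (RtoC (1/2))), ex_half. ring. }
        replace (ex (t / 2 + RtoC (1/2) + INC n * t)) with (- x)%C.
        2: { unfold x. replace (t / 2 + RtoC (1/2) + INC n * t)%C with (t / 2 + INC n * t + RtoC (1/2))%C by ring. rewrite (ex_plus _ (RtoC (1/2))), ex_half. ring. }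
        replace (ex (t + 2 * INC n * t)) with (x * x)%C by (unfold x; rewrite <- ex_plus; f_equal; field).
        replace (ex (t + (2 * INC n + 1) * t)) with (ex (t + INC n * t) * ex (t + INC n * t))%C by (rewrite <- ex_plus; f_equal; ring).
        ring.
      + repeat apply Clim_mult; apply qfac_lim; auto.
    - apply (Clim_subseq (qfac t t) _ (fun n => (2 * n)%nat)); [intros; lia|apply qfac_lim; auto]. }
  replace W with (W * qinf t t * / qinf t t)%C by (field; auto). rewrite E. field. auto.
Qed.

(** Each infinite product occurs twice, and their product is given by Euler's identity. *)
Lemma two_torsion_product t : upper_half t ->
  (theta (RtoC (1/2)) t * theta (t / 2) t * theta (t / 2 + RtoC (1/2)) t)%C = (2 * ex (- t / 4) * (eta t * eta t * eta t))%C.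
Proof.
  intros h. rewrite !theta_product, !eta_qinf by auto.
  pose proof (euler_odd_distinct t h) as W.
  rewrite (qinf_step (RtoC (1/2))), ex_half by auto.
  replace (RtoC (1/2) + t)%C with (t + RtoC (1/2))%C by ring.
  replace (t - RtoC (1/2))%C with (t + RtoC (1/2) + IZC (-1))%C by (unfold IZC; rewrite RtoC_half; field).
  replace (t - t / 2)%C with (t / 2)%C by field.
  replace (t - (t / 2 + RtoC (1/2)))%C with (t / 2 + RtoC (1/2) + IZC (-1))%C by (unfold IZC; rewrite RtoC_half; field).
  rewrite !qinf_period.
  set (A := qinf (t + RtoC (1/2)) t) in *. set (B := qinf (t / 2) t) in *. set (D := qinf (t / 2 + RtoC (1/2)) t) in *.
  set (P := qinf t t).
  replace (ex (t / 8 - RtoC (1/2) / 2)) with (ex (t / 24) * ex (t / 24) * ex (t / 24) * ex (- RtoC (1/2) / 2))%C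
    by (rewrite <- !ex_plus; f_equal; field).
  replace (ex (t / 8 - t / 2 / 2)) with (ex (- t / 8)) by (f_equal; field).
  replace (ex (t / 8 - (t / 2 + RtoC (1/2)) / 2)) with (ex (- t / 8) * ex (- RtoC (1/2) / 2))%C by (rewrite <- ex_plus; f_equal; field).
  replace (ex (- t / 4)) with (ex (- t / 8) * ex (- t / 8))%C by (rewrite <- ex_plus; f_equal; field).
  assert (Q : (ex (- RtoC (1/2) / 2) * ex (- RtoC (1/2) / 2))%C = (- (1))%C).
  { rewrite <- ex_plus. rewrite (ex_eq _ (RtoC (1/2)) (-1)); [apply ex_half|]. unfold IZC. rewrite RtoC_half. field. }
  set (e := ex (- RtoC (1/2) / 2)) in *. set (f := ex (- t / 8)). set (g := ex (t / 24)).
  transitivity (- 2 * (e * e) * (f * f) * (g * g * g) * (P * P * P) * ((A * B * D) * (A * B * D)))%C; [ring|].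
  rewrite Q, W. ring.
Qed.

(** * Modular transformation of the theta function *)

Lemma autom_neq0 A z : SL2Z A -> upper_half z -> autom A z <> RtoC 0.
Proof.
  intros hA hz E. unfold SL2Z, upper_half, autom in *.
  assert (E1 := f_equal Im E). assert (E2 := f_equal Re E). revert E1 E2. unfold IZC. repeat (progress ReIm). intros E1 E2.
  assert (c0 : IZR (m_c A) = 0) by nra. apply eq_IZR in c0. rewrite c0 in *.
  assert (d0 : IZR (m_d A) = 0) by lra. apply eq_IZR in d0. rewrite d0 in *. lia.
Qed.

Lemma det_IZC A : SL2Z A -> (IZC (m_a A) * IZC (m_d A) - IZC (m_b A) * IZC (m_c A))%C = RtoC 1.
Proof. intros h. rewrite <- !IZC_mult, <- IZC_minus, h. reflexivity. Qed.

Lemma Im_div_conj w D : Im w * Cmod D ^ 2 = Im (w * D * Cconj D)%C.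
Proof.
  replace (w * D * Cconj D)%C with (w * (D * Cconj D))%C by ring. rewrite <- Cmod2_conj.
  repeat (progress ReIm). ring.
Qed.

Lemma moebius_upper A z : SL2Z A -> upper_half z -> upper_half (moebius A z).
Proof.
  intros hA hz. pose proof (autom_neq0 A z hA hz) as N. unfold upper_half in *.
  pose proof (Im_div_conj (moebius A z) (autom A z)) as H.
  replace (moebius A z * autom A z)%C with (IZC (m_a A) * z + IZC (m_b A))%C in H by (unfold moebius; field; auto).
  replace (Im ((IZC (m_a A) * z + IZC (m_b A)) * Cconj (autom A z))%C) with (Im z) in H.
  - pose proof (Cmod_pos _ N) as P. assert (0 < Cmod (autom A z) ^ 2) by (apply pow_lt; auto).
    apply Rmult_lt_reg_r with (Cmod (autom A z) ^ 2); auto. lra.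
  - unfold autom, IZC, Cconj. repeat (progress ReIm).
    assert (E : IZR (m_a A) * IZR (m_d A) - IZR (m_b A) * IZR (m_c A) = 1).
    { rewrite <- !mult_IZR, <- minus_IZR. rewrite hA. reflexivity. }
    cbv [Re Im fst snd]. destruct z as [x y]. transitivity ((IZR (m_a A) * IZR (m_d A) - IZR (m_b A) * IZR (m_c A)) * y); [rewrite E|]; ring.
Qed.

Lemma hol_const c : hol (fun _ => c).
Proof. exists (fun _ => 0%C). intros z _. split; [apply Cder_const|apply Ccont_const]. Qed.

Lemma hol_plus f g : hol f -> hol g -> hol (fun z => f z + g z)%C.
Proof.
  intros [f' Hf] [g' Hg]. exists (fun z => f' z + g' z)%C. intros z hz.
  destruct (Hf z hz), (Hg z hz). split; [apply Cder_plus; auto|apply Ccont_plus; auto].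
Qed.

Lemma hol_mult f g : hol f -> hol g -> hol (fun z => f z * g z)%C.
Proof.
  intros [f' Hf] [g' Hg]. exists (fun z => f' z * g z + f z * g' z)%C. intros z hz.
  destruct (Hf z hz) as [D1 C1], (Hg z hz) as [D2 C2]. split; [apply (Cder_mult f g); auto|].
  apply Ccont_plus; apply Ccont_mult; auto; eapply Cder_cont; eauto.
Qed.

Lemma hol_scal c f : hol f -> hol (fun z => c * f z)%C.
Proof. apply hol_mult, hol_const. Qed.

Lemma hol_minus f g : hol f -> hol g -> hol (fun z => f z - g z)%C.
Proof.
  intros Hf Hg. apply (hol_ext (fun z => f z + (- (1)) * g z)%C); [intros; ring|].
  apply hol_plus; auto. apply hol_scal; auto.
Qed.

Lemma hol_ex_lin a b : hol (fun z => ex (a * z + b)).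
Proof.
  exists (fun z => twopii * a * ex (a * z + b))%C. intros z _. split; [apply Cder_ex_lin|].
  apply Ccont_mult; [apply Ccont_const|]. eapply Cder_cont, Cder_ex_lin.
Qed.

Definition periodic1 (f : C -> C) : Prop := forall z, upper_half z -> f (z + 1)%C = f z.

Lemma fcoef_minus_scal f g c n : hol f -> hol g ->
  fcoef (fun z => f z - c * g z)%C n = (fcoef f n - c * fcoef g n)%C.
Proof.
  intros Hf Hg. unfold fcoef.
  assert (G : forall h, hol h -> gcont (fun t => h (Ci + RtoC t) * ex (- IZC n * (Ci + RtoC t)))%C).
  { intros h Hh. apply (hol_gcont (fun z => h z * ex (- IZC n * z))%C Ci); [apply hol_mult_ex; auto|].
    unfold upper_half. rewrite Im_i. lra. }
  rewrite (CI_ext _ (fun t => f (Ci + RtoC t) * ex (- IZC n * (Ci + RtoC t)) + (- c) * (g (Ci + RtoC t) * ex (- IZC n * (Ci + RtoC t))))%C)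
    by (intros; ring).
  rewrite CI_plus, CI_scal; [ring|auto|auto|apply gcont_mult; [apply gcont_const|auto]].
Qed.

Definition theta_type (t : C) (f : C -> C) : Prop :=
  (forall u, f (u + 1)%C = (- f u)%C) /\ (forall u, f (u + t)%C = (- ex (- u - t / 2) * f u)%C).

(** Move the line of integration by [t]. *)
Lemma fcoef_rec t F : upper_half t -> hol F -> periodic1 F ->
  (forall u, F (u + t)%C = (- ex (- u - t) * F u)%C) ->
  forall n, fcoef F n = (- ex (- IZC (n + 1) * t) * fcoef F (n + 1))%C.
Proof.
  intros ht HF P Q n. unfold upper_half in ht. rewrite (fcoef_line F n (Ci + t)) by (auto; unfold upper_half; rewrite Im_plus, Im_i; lra).
  unfold fcoef. rewrite <- CI_scal.
  - apply CI_ext. intros s _. replace (Ci + t + RtoC s)%C with (Ci + RtoC s + t)%C by ring. rewrite Q.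
    replace (- IZC n * (Ci + RtoC s + t))%C with (- IZC (n + 1) * t + - IZC (n + 1) * (Ci + RtoC s) + (Ci + RtoC s + t))%C
      by (rewrite IZC_plus; unfold IZC; ring).
    rewrite !ex_plus.
    replace (ex (- (Ci + RtoC s) - t)) with (/ (ex Ci * ex (RtoC s) * ex t))%C.
    2: { rewrite <- !ex_plus, <- ex_opp. f_equal. ring. }
    field. repeat split; apply ex_neq0.
  - apply (hol_gcont (fun z => F z * ex (- IZC (n + 1) * z))%C Ci); [apply hol_mult_ex; auto|].
    unfold upper_half. rewrite Im_i. lra.
Qed.

(** The Fourier coefficients of such a function are determined by one of them,
    so the space of these functions is one-dimensional. *)
Lemma theta_type_unique t f g : upper_half t -> hol f -> hol g -> theta_type t f -> theta_type t g ->
  (exists u, upper_half u /\ g u <> RtoC 0) -> exists c, forall u, f u = (c * g u)%C.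
Proof.
  intros ht Hf Hg [f1 f2] [g1 g2] [u0 [hu0 gu0]].
  set (tw := fun (f : C -> C) u => (f u * ex ((- / 2) * u + 0))%C).
  assert (Htw : forall f, hol f -> hol (tw f)) by (intros; apply hol_mult; auto; apply hol_ex_lin).
  assert (P : forall f, (forall u, f (u + 1)%C = (- f u)%C) -> periodic1 (tw f)).
  { intros k h z _. unfold tw. rewrite h. replace (- / 2 * (z + 1) + 0)%C with (- / 2 * z + 0 + - RtoC (1/2))%C by (rewrite RtoC_half; field).
    rewrite (ex_plus _ (- _)), ex_opp, ex_half. field. }
  assert (Q : forall f, (forall u, f (u + t)%C = (- ex (- u - t / 2) * f u)%C) -> forall u, tw f (u + t)%C = (- ex (- u - t) * tw f u)%C).
  { intros k h u. unfold tw. rewrite h.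
    replace (- / 2 * (u + t) + 0)%C with (- / 2 * u + 0 + - t / 2)%C by field.
    replace (- u - t)%C with (- u - t / 2 + - t / 2)%C by field. rewrite !ex_plus. ring. }
  set (c0 := (fcoef (tw f) 0 / fcoef (tw g) 0)%C).
  assert (Z : forall F, hol F -> periodic1 F -> (forall u, F (u + t)%C = (- ex (- u - t) * F u)%C) -> fcoef F 0 = 0%C ->
     forall u, upper_half u -> F u = 0%C).
  { intros F HF PF QF F0 u hu. pose proof (fcoef_rec t F ht HF PF QF) as R.
    assert (A : forall n : nat, fcoef F (Z.of_nat n) = 0%C).
    { induction n as [|n IH]; auto. replace (Z.of_nat (S n)) with (Z.of_nat n + 1)%Z by lia.
      rewrite R in IH. pose proof (ex_neq0 (- IZC (Z.of_nat n + 1) * t)) as N.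
      replace (fcoef F (Z.of_nat n + 1)) with (- / ex (- IZC (Z.of_nat n + 1) * t) * (- ex (- IZC (Z.of_nat n + 1) * t) * fcoef F (Z.of_nat n + 1)))%C
        by (field; auto). rewrite IH. ring. }
    assert (B : forall n : nat, fcoef F (- Z.of_nat n) = 0%C).
    { induction n as [|n IH]; auto. rewrite R. replace (- Z.of_nat (S n) + 1)%Z with (- Z.of_nat n)%Z by lia. rewrite IH. ring. }
    apply (sums_unique _ _ _ (fourier_expansion F u HF PF hu)).
    apply Clim_ext with (fun _ => 0%C); [|apply Clim_const].
    intros n. rewrite Csum_zero; auto. intros k _. unfold zpair.
    rewrite A. replace (-1 - Z.of_nat k)%Z with (- Z.of_nat (S k))%Z by lia. rewrite B. ring. }
  assert (N0 : fcoef (tw g) 0 <> 0%C).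
  { intros E. apply gu0. pose proof (Z (tw g) (Htw g Hg) (P g g1) (Q g g2) E u0 hu0) as K. unfold tw in K.
    pose proof (ex_neq0 (- / 2 * u0 + 0)). replace (g u0) with (g u0 * ex (- / 2 * u0 + 0) * / ex (- / 2 * u0 + 0))%C by (field; auto).
    rewrite K. ring. }
  assert (U : forall u, upper_half u -> f u = (c0 * g u)%C).
  { intros u hu.
    assert (K : (fun z => tw f z - c0 * tw g z)%C u = 0%C).
    { apply (Z (fun z => tw f z - c0 * tw g z)%C).
      - apply hol_minus; [auto|apply hol_scal; auto].
      - intros z hz. rewrite (P f f1 z hz), (P g g1 z hz). auto.
      - intros z. rewrite (Q f f2), (Q g g2). ring.
      - rewrite fcoef_minus_scal by auto. unfold c0. field. auto.
      - auto. }
    unfold tw in K. pose proof (ex_neq0 (- / 2 * u + 0)) as N.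
    replace (f u) with ((f u * ex (- / 2 * u + 0) - c0 * (g u * ex (- / 2 * u + 0))) * / ex (- / 2 * u + 0) + c0 * g u)%C by (field; auto).
    rewrite K. ring. }
  exists c0.
  assert (D : forall n u, 0 < Im u + INR n * Im t -> f u = (c0 * g u)%C).
  { induction n as [|n IH]; intros u hu; [apply U; unfold upper_half; simpl in hu; lra|].
    rewrite S_INR in hu.
    assert (E : f (u + t)%C = (c0 * g (u + t)%C)%C) by (apply IH; rewrite Im_plus; lra).
    rewrite f2, g2 in E. pose proof (ex_neq0 (- u - t / 2)) as N.
    replace (f u) with (- / ex (- u - t / 2) * (- ex (- u - t / 2) * f u))%C by (field; auto). rewrite E. field. auto. }
  intros u. unfold upper_half in ht. destruct (archimed (- Im u / Im t)) as [A _].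
  apply (D (Z.to_nat (up (- Im u / Im t)))).
  assert (B : - Im u / Im t < INR (Z.to_nat (up (- Im u / Im t)))).
  { eapply Rlt_le_trans; [apply A|]. rewrite INR_IZR_INZ. apply IZR_le. lia. }
  apply Rmult_lt_compat_r with (r := Im t) in B; auto. unfold Rdiv in B. rewrite Rmult_assoc, Rinv_l, Rmult_1_r in B by lra. lra.
Qed.

Lemma hol_theta_scaled k t : upper_half t -> hol (fun u => theta (k * u) t).
Proof.
  intros ht. exists (fun u => thetap (k * u) t * k)%C. intros u _.
  assert (K : Cder (fun u => (k * u)%C) u k) by (eapply Cder_eq; [apply Cder_scal, Cder_id|ring]).
  split.
  - apply (Cder_comp (fun u => theta u t) (fun u => (k * u)%C)); auto. apply Cder_theta; auto.
  - apply Ccont_mult; [|apply Ccont_const].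
    apply (Cder_cont (fun u => thetap (k * u) t) u (T 2 (1/2) (k * u) t * k)%C).
    apply (Cder_comp (fun u => thetap u t) (fun u => (k * u)%C)); auto. apply Cder_T_u; auto.
Qed.

Lemma Cder_ex_quad k u : Cder (fun u => ex (k * u * u)) u (twopii * (2 * k * u) * ex (k * u * u))%C.
Proof.
  eapply Cder_eq.
  - apply (Cder_ext (fun u => cexp (twopii * (k * u * u)))%C); [intros; unfold ex; f_equal; ring|].
    apply (Cder_comp cexp (fun u => twopii * (k * u * u))%C); [apply Cder_cexp|].
    apply Cder_scal. apply (Cder_mult (fun u => k * u)%C (fun u => u)); [apply Cder_scal, Cder_id|apply Cder_id].
  - unfold ex. ring.
Qed.

Lemma hol_ex_quad k : hol (fun u => ex (k * u * u)).
Proof.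
  exists (fun u => twopii * (2 * k * u) * ex (k * u * u))%C. intros u _. split; [apply Cder_ex_quad|].
  apply Ccont_mult; [|eapply Cder_cont, Cder_ex_quad]. apply Ccont_mult; [apply Ccont_const|].
  apply Ccont_mult; [apply Ccont_const|]. eapply Cder_cont, Cder_id.
Qed.

Lemma SL2Z_parity x y r s : (x * r - s * y = 1 \/ x * r - s * y = -1)%Z -> exists k, (x - y - x * y = 2 * k + 1)%Z.
Proof.
  intros h. destruct (Z.Even_or_Odd x) as [[i ->]|[i ->]]; destruct (Z.Even_or_Odd y) as [[j ->]|[j ->]].
  - exfalso. lia.
  - exists (i - j - 1 - 2 * i * j - i)%Z. ring.
  - exists (i - j - 2 * i * j - j)%Z. ring.
  - exists (i - j - 1 - 2 * i * j - i - j)%Z. ring.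
Qed.

Lemma theta_shift m n u t : upper_half t ->
  theta (u + IZC m * t + IZC n) t = (ex (IZC n / 2 + IZC m / 2 - IZC m * u - IZC m * IZC m / 2 * t) * theta u t)%C.
Proof.
  intros h. unfold theta. rewrite T_shift_1, T_shift_tau by auto.
  rewrite Cmult_assoc, <- ex_plus. f_equal. f_equal. ring.
Qed.

Lemma theta_is_theta_type t : upper_half t -> theta_type t (fun u => theta u t).
Proof.
  intros h. split; intros u.
  - pose proof (theta_shift 0 1 u t h) as E. replace (u + IZC 0 * t + IZC 1)%C with (u + 1)%C in E by (unfold IZC; ring).
    rewrite E. replace (IZC 1 / 2 + IZC 0 / 2 - IZC 0 * u - IZC 0 * IZC 0 / 2 * t)%C with (RtoC (1/2)) by (unfold IZC; rewrite RtoC_half; field).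
    rewrite ex_half. ring.
  - pose proof (theta_shift 1 0 u t h) as E. replace (u + IZC 1 * t + IZC 0)%C with (u + t)%C in E by (unfold IZC; ring).
    rewrite E. replace (IZC 0 / 2 + IZC 1 / 2 - IZC 1 * u - IZC 1 * IZC 1 / 2 * t)%C with (RtoC (1/2) + (- u - t / 2))%C by (unfold IZC; rewrite RtoC_half; field).
    rewrite ex_plus, ex_half. ring.
Qed.

(** After removing the Gaussian factor the left-hand side has the quasi-periods of
    [theta].  The constant is never computed: it cancels in all uses. *)
Theorem theta_modular A t : SL2Z A -> upper_half t -> exists c, c <> RtoC 0 /\ forall u,
  theta (u / autom A t) (moebius A t) = (c * ex (IZC (m_c A) * u * u / (2 * autom A t)) * theta u t)%C.
Proof.
  intros hA ht. pose proof (autom_neq0 A t hA ht) as N. pose proof (moebius_upper A t hA ht) as ht'.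
  pose proof (det_IZC A hA) as det. pose proof hA as hA'. unfold SL2Z in hA'.
  set (D := autom A t) in *. set (t' := moebius A t) in *.
  set (a := IZC (m_a A)) in *. set (b := IZC (m_b A)) in *. set (c := IZC (m_c A)) in *. set (d := IZC (m_d A)) in *.
  assert (ED : D = (c * t + d)%C) by reflexivity.
  assert (E3 : (t' * D)%C = (a * t + b)%C) by (unfold t', moebius; fold D a b; field; auto).
  assert (E1 : (/ D)%C = (a - c * t')%C).
  { replace (a - c * t')%C with ((a * D - c * (t' * D)) / D)%C by (field; auto). rewrite E3, ED.
    replace (a * (c * t + d) - c * (a * t + b))%C with (a * d - b * c)%C by ring. rewrite det. field. rewrite <- ED. auto. }
  assert (E2 : (t / D)%C = (d * t' - b)%C).
  { replace (d * t' - b)%C with ((d * (t' * D) - b * D) / D)%C by (field; auto). rewrite E3, ED.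
    replace (d * (a * t + b) - b * (c * t + d))%C with ((a * d - b * c) * t)%C by ring. rewrite det. field. rewrite <- ED. auto. }
  set (f := fun u => (ex ((- c / (2 * D)) * u * u) * theta (/ D * u) t')%C).
  destruct (theta_type_unique t f (fun u => theta u t)) as [k Hk]; auto.
  - apply hol_mult; [apply hol_ex_quad|apply hol_theta_scaled; auto].
  - apply (hol_ext (fun u => theta (1 * u) t)); [intros; f_equal; ring|apply hol_theta_scaled; auto].
  - split; intros u; unfold f.
    + replace (/ D * (u + 1))%C with (/ D * u + IZC (- m_c A) * t' + IZC (m_a A))%C.
      2: { rewrite IZC_opp. fold a c. replace (/ D * (u + 1))%C with (/ D * u + / D)%C by ring. rewrite E1 at 3. ring. }
      rewrite theta_shift by auto. rewrite Cmult_assoc, <- ex_plus.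
      destruct (SL2Z_parity (m_a A) (m_c A) (m_d A) (m_b A) ltac:(lia)) as [k Hk].
      replace (ex (- c / (2 * D) * (u + 1) * (u + 1) + (IZC (m_a A) / 2 + IZC (- m_c A) / 2 - IZC (- m_c A) * (/ D * u) - IZC (- m_c A) * IZC (- m_c A) / 2 * t')))
        with (ex (RtoC (1/2) + (- c / (2 * D)) * u * u)); [rewrite ex_plus, ex_half; ring|].
      symmetry. apply (ex_eq _ _ k).
      assert (K : (2 * IZC k + 1)%C = (a - c - a * c)%C).
      { unfold a, c. rewrite <- IZC_mult, <- !IZC_minus, Hk, IZC_plus, IZC_mult. reflexivity. }
      replace (IZC k) with ((a - c - a * c - 1) / 2)%C by (rewrite <- K; field).
      rewrite IZC_opp, RtoC_half. fold a c.
      replace (- c / (2 * D) * (u + 1) * (u + 1))%C with (- c / (2 * D) * u * u - c * u * / D - c / 2 * / D)%C by (field; auto).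
      replace (c / 2 * / D)%C with (c / 2 * (a - c * t'))%C by (rewrite E1; auto).
      replace (- c / (2 * D) * u * u)%C with (- c * u * u / 2 * / D)%C by (field; auto). field. auto.
    + replace (/ D * (u + t))%C with (/ D * u + IZC (m_d A) * t' + IZC (- m_b A))%C.
      2: { rewrite IZC_opp. fold b d. replace (/ D * (u + t))%C with (/ D * u + t / D)%C by (field; auto). rewrite E2. ring. }
      rewrite theta_shift by auto. rewrite Cmult_assoc, <- ex_plus.
      destruct (SL2Z_parity (m_d A) (m_b A) (m_a A) (m_c A) ltac:(lia)) as [k Hk].
      replace (ex (- c / (2 * D) * (u + t) * (u + t) + (IZC (- m_b A) / 2 + IZC (m_d A) / 2 - IZC (m_d A) * (/ D * u) - IZC (m_d A) * IZC (m_d A) / 2 * t')))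
        with (ex (RtoC (1/2) + (- c / (2 * D)) * u * u + (- u - t / 2))); [rewrite !ex_plus, ex_half; ring|].
      symmetry. apply (ex_eq _ _ k).
      assert (K : (2 * IZC k + 1)%C = (d - b - d * b)%C).
      { unfold b, d. rewrite <- IZC_mult, <- !IZC_minus, Hk, IZC_plus, IZC_mult. reflexivity. }
      replace (IZC k) with ((d - b - d * b - 1) / 2)%C by (rewrite <- K; field).
      rewrite IZC_opp, RtoC_half. fold b d.
      replace (- c / (2 * D) * (u + t) * (u + t))%C with (- c / (2 * D) * u * u - c * u * (t / D) - c / 2 * t * (t / D))%C by (field; auto).
      replace (d * (/ D * u))%C with (u - c * u * (t / D))%C.
      2: { replace (u - c * u * (t / D))%C with (u * (D - c * t) / D)%C by (field; auto). rewrite ED at 1. field. auto. }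
      replace (c / 2 * t * (t / D))%C with (t / 2 + d * b / 2 - d * d / 2 * t')%C.
      * field. auto.
      * rewrite E2. replace (c / 2 * t * (d * t' - b))%C with (d / 2 * (t' * (c * t + d)) - d * d / 2 * t' - b * c * t / 2)%C by field.
        rewrite <- ED, E3. replace t with ((a * d - b * c) * t)%C at 1 by (rewrite det; ring). field.
  - apply theta_is_theta_type; auto.
  - apply theta_nontrivial; auto.
  - exists k.
    assert (H : forall u, theta (u / D) t' = (k * ex (c * u * u / (2 * D)) * theta u t)%C).
    { intros u. specialize (Hk u). unfold f in Hk.
      replace (u / D)%C with (/ D * u)%C by (unfold Cdiv; ring).
      replace (- c / (2 * D) * u * u)%C with (- (c * u * u / (2 * D)))%C in Hk by (field; auto).
      rewrite ex_opp in Hk. pose proof (ex_neq0 (c * u * u / (2 * D))) as N2.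
      replace (theta (/ D * u) t') with (ex (c * u * u / (2 * D)) * (/ ex (c * u * u / (2 * D)) * theta (/ D * u) t'))%C by (field; auto).
      rewrite Hk. ring. }
    split; auto. intros E. apply (theta_neq0_R (1/2) t' ht'); [lra|].
    pose proof (H (RtoC (1/2) * D)%C) as K. replace (RtoC (1/2) * D / D)%C with (RtoC (1/2)) in K by (field; auto).
    rewrite K, E. ring.
Qed.

(** * Partial fractions *)

Definition pskip (f : nat -> C) (i M : nat) : C :=
  Cprod (fun j => if Nat.eq_dec j i then RtoC 1 else f j) M.

Lemma pskip_out f i M : (M <= i)%nat -> pskip f i M = Cprod f M.
Proof. intros h. apply Cprod_ext. intros k hk. destruct (Nat.eq_dec k i); auto. lia. Qed.

(** Induction on the number of nodes: a product of two simple fractions is a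
    combination of them, and the coefficient at the new pole is again an expansion,
    namely the one at [/ a M]. *)
Lemma lagrange_partial_fractions (a : nat -> C) (M r : nat) :
  (r < M)%nat -> (forall i, (i < M)%nat -> a i <> RtoC 0) ->
  (forall i j, (i < M)%nat -> (j < M)%nat -> i <> j -> a i <> a j) ->
  forall x, (forall i, (i < M)%nat -> (1 - a i * x)%C <> RtoC 0) ->
  (x ^ r / Cprod (fun j => 1 - a j * x)%C M)%C =
  Csum (fun i => (/ a i) ^ r / pskip (fun j => 1 - a j / a i)%C i M / (1 - a i * x))%C M.
Proof.
  revert r. induction M as [|M IH]; intros r hr h0 hd x hx; [lia|].
  assert (h0M : a M <> 0%C) by (apply h0; lia).
  assert (Q : forall i, (i < M)%nat -> (1 - a i / a M)%C <> 0%C).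
  { intros i hi E. apply (hd i M); try lia. replace (a i) with (a M * (1 - (1 - a i / a M)))%C by (field; auto). rewrite E. ring. }
  assert (PS : forall i, (i < M)%nat -> pskip (fun j => 1 - a j / a i)%C i (S M) = (pskip (fun j => 1 - a j / a i)%C i M * (1 - a M / a i))%C).
  { intros i hi. unfold pskip. simpl. destruct (Nat.eq_dec M i); [lia|auto]. }
  assert (PM : pskip (fun j => 1 - a j / a M)%C M (S M) = Cprod (fun j => 1 - a j / a M)%C M).
  { unfold pskip at 1. simpl. destruct (Nat.eq_dec M M); [|lia]. fold (pskip (fun j => 1 - a j / a M)%C M M).
    rewrite pskip_out by lia. ring. }
  assert (PN : forall i, (i < M)%nat -> pskip (fun j => 1 - a j / a i)%C i M <> 0%C).
  { intros i hi. apply Cprod_neq0. intros k hk. destruct (Nat.eq_dec k i); [apply RtoC_neq0; lra|].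
    intros E. apply (hd k i); try lia.
    replace (a k) with (a i * (1 - (1 - a k / a i)))%C by (field; auto). rewrite E. ring. }
  assert (HxM : (1 - a M * x)%C <> 0%C) by (apply hx; lia).
  assert (C1 : Cprod (fun j => 1 - a j * x)%C M <> 0%C) by (apply Cprod_neq0; intros; apply hx; lia).
  assert (C2 : Cprod (fun j => 1 - a j / a M)%C M <> 0%C) by (apply Cprod_neq0; auto).
  assert (h0' : forall i, (i < M)%nat -> a i <> 0%C) by (intros; apply h0; lia).
  assert (hd' : forall i j, (i < M)%nat -> (j < M)%nat -> i <> j -> a i <> a j) by (intros; apply hd; lia).
  assert (IHx : forall s, (s < M)%nat -> _) by (intros s hs; exact (IH s hs h0' hd' x (fun i hi => hx i (Nat.lt_lt_succ_r _ _ hi)))).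
  assert (IHm : forall s, (s < M)%nat -> (((/ a M) ^ s / Cprod (fun j => 1 - a j / a M)%C M)%C =
     Csum (fun i => (/ a i) ^ s / pskip (fun j => 1 - a j / a i)%C i M / (1 - a i / a M))%C M)).
  { intros s hs. apply (IH s hs h0' hd' (/ a M)%C). intros i hi. apply (Q i hi). }
  change (Cprod (fun j => 1 - a j * x)%C (S M)) with (Cprod (fun j => 1 - a j * x)%C M * (1 - a M * x))%C.
  destruct (Nat.eq_dec M 0) as [->|M0].
  { replace r with O by lia. unfold pskip. simpl in *. field. auto. }
  (* [r] may equal [M], where the induction hypothesis does not apply: then one
     factor [x] is set aside. *)
  assert (exists s c, (s < M)%nat /\ (forall y, y ^ r = c y * y ^ s)%C /\ (c = (fun _ => RtoC 1) \/ c = (fun y => y))) as [s [c [hs [Ec Hc]]]].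
  { destruct (Nat.eq_dec r M) as [->|N].
    - exists (M - 1)%nat, (fun y => y). repeat split; auto; [lia|]. intros y. destruct M as [|M]; [lia|].
      replace (S M - 1)%nat with M by lia. reflexivity.
    - exists r, (fun _ => RtoC 1). repeat split; auto; [lia|]. intros. ring. }
  simpl Csum. rewrite PM, !Ec.
  replace (c x * x ^ s / (Cprod (fun j => 1 - a j * x) M * (1 - a M * x)))%C
    with (c x / (1 - a M * x) * (x ^ s / Cprod (fun j => 1 - a j * x) M))%C by (field; auto).
  replace (c (/ a M) * (/ a M) ^ s / Cprod (fun j => 1 - a j / a M) M / (1 - a M * x))%C
    with (c (/ a M) / (1 - a M * x) * ((/ a M) ^ s / Cprod (fun j => 1 - a j / a M) M))%C by (field; auto).
  rewrite IHx, IHm, <- !Csum_scal, <- Csum_plus by auto. apply Csum_ext. intros i hi.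
  rewrite PS, Ec by auto. specialize (Q i hi). specialize (PN i hi). specialize (h0' i hi).
  assert (Hxi : (1 - a i * x)%C <> 0%C) by (apply hx; lia).
  set (am := a M) in *. set (ai := a i) in *.
  assert (F1 : (am - ai)%C <> 0%C) by (intros E; apply Q; replace (1 - ai / am)%C with ((am - ai) / am)%C by (field; auto); rewrite E; unfold Cdiv; ring).
  assert (F2 := Cminus_neq0_sym _ _ F1).
  destruct Hc as [-> | ->]; field; repeat split; auto.
Qed.

(** ** Products over symmetric ranges *)

Definition nonlat (b t : C) : Prop := forall k : Z, ex (b + IZC k * t) <> RtoC 1.

Lemma nonlat_nat b t (k : nat) : nonlat b t -> ex (b + INC k * t) <> RtoC 1.
Proof. intros H. rewrite INR_IZR_INZ. apply (H (Z.of_nat k)). Qed.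

Lemma nonlat_opp b t : nonlat b t -> nonlat (- b) t.
Proof.
  intros H k E. apply (H (- k)%Z). replace (b + IZC (- k) * t)%C with (- (- b + IZC k * t))%C by (rewrite IZC_opp; ring).
  rewrite ex_opp, E. field.
Qed.

Lemma nonlat_tminus b t (k : nat) : nonlat b t -> ex (t - b + INC k * t) <> RtoC 1.
Proof.
  intros H. apply nonlat_opp in H. specialize (H (Z.of_nat k + 1)%Z).
  replace (t - b + INC k * t)%C with (- b + IZC (Z.of_nat k + 1) * t)%C; auto.
  rewrite IZC_plus. unfold IZC. rewrite <- INR_IZR_INZ. ring.
Qed.

Lemma Cprod_first f n : Cprod f (S n) = (f O * Cprod (fun k => f (S k)) n)%C.
Proof. pose proof (Cprod_split f 1 n) as E. change (1 + n)%nat with (S n) in E. rewrite E. simpl. ring. Qed.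

Lemma prod_negative b t (k : nat) :
  Cprod (fun j => 1 - ex (b + (INC j - INC k) * t))%C k =
  (ex (INC k / 2 + INC k * b - INC k * (INC k + 1) / 2 * t) * qfac (t - b) t k)%C.
Proof.
  induction k as [|k IH].
  - simpl. replace (0 / 2 + 0 * b - 0 * (0 + 1) / 2 * t)%C with (RtoC 0) by field. rewrite ex_0. unfold qfac. simpl. ring.
  - rewrite Cprod_first.
    rewrite (Cprod_ext _ (fun j => 1 - ex (b + (INC j - INC k) * t))%C).
    2: { intros j _. f_equal. f_equal. f_equal. rewrite !S_INR, !RtoC_plus. ring. }
    rewrite IH, qfac_S. rewrite S_INR, RtoC_plus. set (n := INC k). simpl INR.
    replace (1 - ex (b + (0 - (n + 1)) * t))%C with (ex (RtoC (1/2) + b - (n + 1) * t) * (1 - ex (t - b + n * t)))%C.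
    2: { match goal with |- (?E * (RtoC 1 - ?F))%C = _ => replace (E * (1 - F))%C with (E - E * F)%C by ring end. rewrite <- ex_plus.
         replace (RtoC (1/2) + b - (n + 1) * t + (t - b + n * t))%C with (RtoC (1/2)) by ring.
         replace (RtoC (1/2) + b - (n + 1) * t)%C with (RtoC (1/2) + (b + (0 - (n + 1)) * t))%C by ring.
         rewrite ex_plus, ex_half. ring. }
    replace (ex ((n + 1) / 2 + (n + 1) * b - (n + 1) * (n + 1 + 1) / 2 * t))
      with (ex (RtoC (1/2) + b - (n + 1) * t) * ex (n / 2 + n * b - n * (n + 1) / 2 * t))%C.
    2: { rewrite <- ex_plus. f_equal. rewrite RtoC_half. field. }
    ring.
Qed.

Lemma prod_range b t (k m : nat) :
  Cprod (fun j => 1 - ex (b + (INC j - INC k) * t))%C (k + m) =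
  (ex (INC k / 2 + INC k * b - INC k * (INC k + 1) / 2 * t) * qfac (t - b) t k * qfac b t m)%C.
Proof.
  rewrite Cprod_split, prod_negative. f_equal. unfold qfac. apply Cprod_ext. intros j _.
  f_equal. f_equal. f_equal. rewrite plus_INR, RtoC_plus. ring.
Qed.

Lemma prod_range_skip t (k m : nat) :
  Cprod (fun j => if Nat.eq_dec j k then RtoC 1 else 1 - ex (0 + (INC j - INC k) * t))%C (k + S m) =
  (ex (INC k / 2 - INC k * (INC k + 1) / 2 * t) * qfac t t k * qfac t t m)%C.
Proof.
  rewrite Cprod_split, Cprod_first.
  rewrite (Cprod_ext _ (fun j => 1 - ex (0 + (INC j - INC k) * t))%C k).
  2: { intros j hj. destruct (Nat.eq_dec j k); auto. lia. }
  rewrite prod_negative. destruct (Nat.eq_dec (k + 0) k); [|lia].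
  replace (t - 0)%C with t by ring.
  replace (INC k / 2 + INC k * 0 - INC k * (INC k + 1) / 2 * t)%C
    with (INC k / 2 - INC k * (INC k + 1) / 2 * t)%C by ring.
  rewrite Cmult_1_l. f_equal. apply Cprod_ext. intros j _.
  destruct (Nat.eq_dec (k + S j) k); [lia|]. f_equal. f_equal.
  rewrite plus_INR, S_INR, !RtoC_plus. ring.
Qed.

(** ** The finite identity *)

Section FiniteASD.
Variables (t u a1 a2 a3 : C) (N : nat).
Hypothesis ht : upper_half t.
Hypothesis hsum : (a1 + a2 + a3 = 0)%C.
Hypothesis h12 : nonlat (a2 - a1) t.
Hypothesis h13 : nonlat (a3 - a1) t.
Hypothesis h23 : nonlat (a3 - a2) t.
Hypothesis hu1 : nonlat (u + a1) t.
Hypothesis hu2 : nonlat (u + a2) t.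
Hypothesis hu3 : nonlat (u + a3) t.

Let K := (2 * N + 1)%nat.
Let off (k : nat) : C := (INC k - INC N)%C.
Let blk (al : C) (k : nat) : C := ex (al + off k * t).
Let a (i : nat) : C :=
  if lt_dec i K then blk a1 i else if lt_dec i (K + K) then blk a2 (i - K) else blk a3 (i - (K + K)).

Definition asd_factor (d : C) (k : nat) : C := (qfac (t - d) t k * qfac d t (2 * N + 1 - k))%C.
Definition asd_num (al : C) (n : C) : C := ex (n / 2 + 3 * n * al + 3 * n * (n + 1) / 2 * t).
Definition asd_res (al al' al'' : C) (k : nat) : C :=
  (asd_num al (INC k - INC N) /
    (qfac t t k * qfac t t (2 * N - k) * asd_factor (al' - al) k * asd_factor (al'' - al) k))%C.
Definition asd_J (v : C) : C := (qfac (t - v) t N * qfac v t (N + 1))%C.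

Lemma nonlat_sym x y : nonlat (x - y) t -> nonlat (y - x) t.
Proof. intros H. apply nonlat_opp in H. replace (y - x)%C with (- (x - y))%C by ring. exact H. Qed.

Lemma blk_div al al' k k' : (blk al' k' / blk al k)%C = ex ((al' - al) + (INC k' - INC k) * t).
Proof. unfold blk, off. rewrite <- ex_minus. f_equal. ring. Qed.

Lemma blk_inj al k k' : blk al k = blk al k' -> k = k'.
Proof.
  intros E. destruct (Nat.eq_dec k k') as [|Ne]; auto. exfalso.
  assert (E' : (blk al k / blk al k')%C = 1%C) by (rewrite E; field; apply ex_neq0).
  rewrite blk_div in E'. apply ex_neq1_Im in E'; auto.
  rewrite <- RtoC_minus. rewrite Im_plus, Im_Rmult, Im_minus.
  unfold upper_half in ht. intros E0. apply Ne. apply INR_eq. nra.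
Qed.

Lemma blk_diff al al' k k' : nonlat (al' - al) t -> blk al k <> blk al' k'.
Proof.
  intros H E.
  assert (E' : (blk al' k' / blk al k)%C = 1%C) by (rewrite <- E; field; apply ex_neq0).
  rewrite blk_div in E'. apply (H (Z.of_nat k' - Z.of_nat k)%Z).
  rewrite IZC_minus. unfold IZC. rewrite <- !INR_IZR_INZ. exact E'.
Qed.

Lemma a_block1 k : (k < K)%nat -> a k = blk a1 k.
Proof. intros h. unfold a. destruct (lt_dec k K); auto. lia. Qed.
Lemma a_block2 k : (k < K)%nat -> a (K + k) = blk a2 k.
Proof.
  intros h. unfold a. destruct (lt_dec (K + k) K); [lia|]. destruct (lt_dec (K + k) (K + K)); [|lia]. f_equal. lia.
Qed.
Lemma a_block3 k : (k < K)%nat -> a (K + K + k) = blk a3 k.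
Proof.
  intros h. unfold a. destruct (lt_dec (K + K + k) K); [lia|]. destruct (lt_dec (K + K + k) (K + K)); [lia|]. f_equal. lia.
Qed.

Lemma a_cases (P : nat -> Prop) :
  (forall k, (k < K)%nat -> P k) -> (forall k, (k < K)%nat -> P (K + k)%nat) -> (forall k, (k < K)%nat -> P (K + K + k)%nat) ->
  forall i, (i < K + K + K)%nat -> P i.
Proof.
  intros H1 H2 H3 i hi. destruct (lt_dec i K); auto. destruct (lt_dec i (K + K)).
  - replace i with (K + (i - K))%nat by lia. apply H2. lia.
  - replace i with (K + K + (i - (K + K)))%nat by lia. apply H3. lia.
Qed.

Lemma a_neq0 i : a i <> RtoC 0.
Proof. unfold a, blk. destruct (lt_dec i K); [|destruct (lt_dec i (K + K))]; apply ex_neq0. Qed.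

Lemma a_inj : forall i j, (i < K + K + K)%nat -> (j < K + K + K)%nat -> i <> j -> a i <> a j.
Proof.
  intros i j hi hj. revert i hi j hj.
  apply (a_cases (fun i => forall j, (j < K + K + K)%nat -> i <> j -> a i <> a j));
  intros k hk; apply (a_cases (fun j => _ <> j -> _ <> a j)); intros k' hk' Ne;
  rewrite ?(a_block1 k), ?(a_block2 k), ?(a_block3 k), ?(a_block1 k'), ?(a_block2 k'), ?(a_block3 k') by auto.
  - intros E. apply blk_inj in E. lia.
  - apply blk_diff; auto.
  - apply blk_diff; auto.
  - apply blk_diff. apply nonlat_sym; auto.
  - intros E. apply blk_inj in E. lia.
  - apply blk_diff; auto.
  - apply blk_diff. apply nonlat_sym; auto.
  - apply blk_diff. apply nonlat_sym; auto.
  - intros E. apply blk_inj in E. lia.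
Qed.

Lemma one_minus_blk al k : (1 - blk al k * ex u)%C = (1 - ex (u + al + off k * t))%C.
Proof. unfold blk. rewrite <- ex_plus. f_equal. f_equal. ring. Qed.

Lemma off_nonlat v k : nonlat v t -> (1 - ex (v + off k * t))%C <> RtoC 0.
Proof.
  intros H E. apply (H (Z.of_nat k - Z.of_nat N)%Z). rewrite IZC_minus. unfold IZC. rewrite <- !INR_IZR_INZ. fold (off k).
  replace (ex (v + off k * t)) with (1 - (1 - ex (v + off k * t)))%C by ring. rewrite E. ring.
Qed.

Lemma pow_inv_ex z n : ((/ ex z) ^ n)%C = ex (- (INC n * z)).
Proof.
  induction n as [|n IH]; [simpl; replace (- (0 * z))%C with (RtoC 0) by ring; rewrite ex_0; auto|].
  rewrite Cpow_S, IH, S_INR, RtoC_plus, <- ex_opp, <- ex_plus. f_equal. ring.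
Qed.

Lemma pow_ex z n : ((ex z) ^ n)%C = ex (INC n * z).
Proof.
  induction n as [|n IH]; [simpl; replace (0 * z)%C with (RtoC 0) by ring; rewrite ex_0; auto|].
  rewrite Cpow_S, IH, S_INR, RtoC_plus, <- ex_plus. f_equal. ring.
Qed.

Lemma cross_block al al' k : (k < K)%nat ->
  Cprod (fun j => 1 - blk al' j / blk al k)%C K =
  (ex (INC k / 2 + INC k * (al' - al) - INC k * (INC k + 1) / 2 * t) * asd_factor (al' - al) k)%C.
Proof.
  intros hk. rewrite (Cprod_ext _ (fun j => 1 - ex ((al' - al) + (INC j - INC k) * t))%C).
  2: { intros j _. rewrite blk_div. auto. }
  replace K with (k + (2 * N + 1 - k))%nat at 1 by (unfold K in *; lia).
  rewrite prod_range. unfold asd_factor. ring.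
Qed.

Lemma own_block al k : (k < K)%nat ->
  Cprod (fun j => if Nat.eq_dec j k then RtoC 1 else (1 - blk al j / blk al k)%C) K =
  (ex (INC k / 2 - INC k * (INC k + 1) / 2 * t) * qfac t t k * qfac t t (2 * N - k))%C.
Proof.
  intros hk. rewrite (Cprod_ext _ (fun j => if Nat.eq_dec j k then RtoC 1 else 1 - ex (0 + (INC j - INC k) * t))%C).
  2: { intros j _. destruct (Nat.eq_dec j k); auto. rewrite blk_div. f_equal. f_equal. ring. }
  replace K with (k + S (2 * N - k))%nat at 1 by (unfold K in *; lia).
  apply prod_range_skip.
Qed.

Lemma asd_factor_neq0 d k : nonlat d t -> asd_factor d k <> RtoC 0.
Proof.
  intros H. apply Cmult_neq_0; apply qfac_neq0; intros j.
  - apply nonlat_tminus; auto.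
  - apply nonlat_nat; auto.
Qed.

Lemma qfac_tt_neq0 k : qfac t t k <> RtoC 0.
Proof. apply qfac_neq0. intros. apply ex_tt_neq1; auto. Qed.

Let kap : C := ex (3 * INC N / 2 - 3 * INC N * (INC N + 1) / 2 * t).

Lemma asd_res_eq al al' al'' k p : (al + al' + al'' = 0)%C -> nonlat (al' - al) t -> nonlat (al'' - al) t ->
  p = (ex (INC k / 2 - INC k * (INC k + 1) / 2 * t) * qfac t t k * qfac t t (2 * N - k)
    * (ex (INC k / 2 + INC k * (al' - al) - INC k * (INC k + 1) / 2 * t) * asd_factor (al' - al) k)
    * (ex (INC k / 2 + INC k * (al'' - al) - INC k * (INC k + 1) / 2 * t) * asd_factor (al'' - al) k))%C ->
  (kap * ((/ blk al k) ^ (3 * N) / p))%C = asd_res al al' al'' k.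
Proof.
  intros S n1 n2 ->. unfold asd_res, blk. rewrite pow_inv_ex.
  assert (E3 : INC (3 * N) = (3 * INC N)%C) by (rewrite mult_INR, RtoC_mult; f_equal; f_equal; simpl; ring).
  rewrite E3.
  pose proof (asd_factor_neq0 _ k n1). pose proof (asd_factor_neq0 _ k n2).
  pose proof (qfac_tt_neq0 k). pose proof (qfac_tt_neq0 (2 * N - k)).
  set (n := INC k) in *. set (m := INC N) in *.
  set (e1 := ex (n / 2 - n * (n + 1) / 2 * t)).
  set (e2 := ex (n / 2 + n * (al' - al) - n * (n + 1) / 2 * t)).
  set (e3 := ex (n / 2 + n * (al'' - al) - n * (n + 1) / 2 * t)).
  assert (Q : (kap * ex (- (3 * m * (al + off k * t))))%C = (asd_num al (n - m) * (e1 * e2 * e3))%C).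
  { unfold kap, asd_num, e1, e2, e3, off. rewrite <- !ex_plus.
    apply (ex_eq _ _ (2 * Z.of_nat N - 2 * Z.of_nat k)).
    replace al'' with (- al - al')%C by (replace al'' with (al + al' + al'' - al - al')%C by ring; rewrite S; ring).
    rewrite IZC_minus, !IZC_mult. unfold IZC. rewrite <- !INR_IZR_INZ. fold m n. field. }
  assert (e1 <> 0%C) by apply ex_neq0. assert (e2 <> 0%C) by apply ex_neq0. assert (e3 <> 0%C) by apply ex_neq0.
  transitivity ((kap * ex (- (3 * m * (al + off k * t)))) / (e1 * qfac t t k * qfac t t (2 * N - k) * (e2 * asd_factor (al' - al) k) * (e3 * asd_factor (al'' - al) k)))%C.
  - unfold Cdiv. ring.
  - rewrite Q. field. repeat split; auto.
Qed.

(** Lagrange interpolation at the nodes [e(al + k t)], where [al] is one of the three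
    shifts and [-N <= k <= N].  The exponent [3 N] balances the powers of [q] in the
    residues, so that these converge when [N] grows. *)
Lemma finite_asd :
  (/ (asd_J (u + a1) * asd_J (u + a2) * asd_J (u + a3)))%C =
  (Csum (fun k => asd_res a1 a2 a3 k / (1 - ex (u + a1 + off k * t))) K
   + Csum (fun k => asd_res a2 a1 a3 k / (1 - ex (u + a2 + off k * t))) K
   + Csum (fun k => asd_res a3 a1 a2 k / (1 - ex (u + a3 + off k * t))) K)%C.
Proof.
  pose proof (lagrange_partial_fractions a (K + K + K) (3 * N) ltac:(unfold K; lia) (fun i _ => a_neq0 i) a_inj (ex u)) as L.
  assert (HP : forall i, (i < K + K + K)%nat -> (1 - a i * ex u)%C <> 0%C).
  { apply (a_cases (fun i => (1 - a i * ex u)%C <> 0%C)); intros k hk; rewrite ?(a_block1 k), ?(a_block2 k), ?(a_block3 k), one_minus_blk by auto;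
    apply off_nonlat; auto. }
  specialize (L HP). assert (PB : forall f, Cprod f (K + K + K) = (Cprod f K * Cprod (fun k => f (K + k)%nat) K * Cprod (fun k => f (K + K + k)%nat) K)%C).
  { intros f. rewrite !Cprod_split. auto. }
  rewrite !Csum_split in L.
  assert (LHS : (kap * ((ex u) ^ (3 * N) / Cprod (fun j => 1 - a j * ex u) (K + K + K)))%C = (/ (asd_J (u + a1) * asd_J (u + a2) * asd_J (u + a3)))%C).
  { rewrite PB.
    rewrite (Cprod_ext (fun j => 1 - a j * ex u)%C (fun j => 1 - ex (u + a1 + off j * t))%C) by (intros; rewrite a_block1, one_minus_blk; auto).
    rewrite (Cprod_ext (fun j => 1 - a (K + j)%nat * ex u)%C (fun j => 1 - ex (u + a2 + off j * t))%C) by (intros; rewrite a_block2, one_minus_blk; auto).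
    rewrite (Cprod_ext (fun j => 1 - a (K + K + j)%nat * ex u)%C (fun j => 1 - ex (u + a3 + off j * t))%C) by (intros; rewrite a_block3, one_minus_blk; auto).
    assert (R : forall v, Cprod (fun j => 1 - ex (v + off j * t))%C K = (ex (INC N / 2 + INC N * v - INC N * (INC N + 1) / 2 * t) * asd_J v)%C).
    { intros v. unfold off. replace K with (N + (N + 1))%nat by (unfold K; lia). rewrite prod_range. unfold asd_J. ring. }
    rewrite !R, pow_ex.
    assert (E3 : INC (3 * N) = (3 * INC N)%C) by (rewrite mult_INR, RtoC_mult; f_equal; f_equal; simpl; ring).
    rewrite E3. set (m := INC N) in *.
    assert (JN : forall v, nonlat v t -> asd_J v <> 0%C).
    { intros v H. apply Cmult_neq_0; apply qfac_neq0; intros j; [apply nonlat_tminus; auto|apply nonlat_nat; auto]. }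
    set (f1 := ex (m / 2 + m * (u + a1) - m * (m + 1) / 2 * t)). set (f2 := ex (m / 2 + m * (u + a2) - m * (m + 1) / 2 * t)).
    set (f3 := ex (m / 2 + m * (u + a3) - m * (m + 1) / 2 * t)).
    assert (Q : (kap * ex (3 * m * u))%C = (f1 * f2 * f3)%C).
    { unfold kap, f1, f2, f3. rewrite <- !ex_plus. f_equal.
      replace a3 with (- a1 - a2)%C by (replace a3 with (a1 + a2 + a3 - a1 - a2)%C by ring; rewrite hsum; ring). field. }
    assert (f1 <> 0%C) by apply ex_neq0. assert (f2 <> 0%C) by apply ex_neq0. assert (f3 <> 0%C) by apply ex_neq0.
    transitivity ((kap * ex (3 * m * u)) / (f1 * asd_J (u + a1) * (f2 * asd_J (u + a2)) * (f3 * asd_J (u + a3))))%C.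
    - unfold Cdiv. ring.
    - rewrite Q. field. repeat split; auto. }
  rewrite <- LHS, L. replace (kap * (Csum (fun i => (/ a i) ^ (3 * N) / pskip (fun j => 1 - a j / a i) i (K + K + K) / (1 - a i * ex u)) K +
     Csum (fun k => (/ a (K + k)%nat) ^ (3 * N) / pskip (fun j => 1 - a j / a (K + k)%nat) (K + k) (K + K + K) / (1 - a (K + k)%nat * ex u)) K +
     Csum (fun k => (/ a (K + K + k)%nat) ^ (3 * N) / pskip (fun j => 1 - a j / a (K + K + k)%nat) (K + K + k) (K + K + K) / (1 - a (K + K + k)%nat * ex u)) K))%C
  with (Csum (fun i => kap * ((/ a i) ^ (3 * N) / pskip (fun j => 1 - a j / a i) i (K + K + K)) / (1 - a i * ex u)) K +
     Csum (fun k => kap * ((/ a (K + k)%nat) ^ (3 * N) / pskip (fun j => 1 - a j / a (K + k)%nat) (K + k) (K + K + K)) / (1 - a (K + k)%nat * ex u)) K +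
     Csum (fun k => kap * ((/ a (K + K + k)%nat) ^ (3 * N) / pskip (fun j => 1 - a j / a (K + K + k)%nat) (K + K + k) (K + K + K)) / (1 - a (K + K + k)%nat * ex u)) K)%C.
  2: { rewrite !Cmult_plus_distr_l, <- !Csum_scal. f_equal; [f_equal|]; apply Csum_ext; intros k _; unfold Cdiv; ring. }
  assert (s213 : (a2 + a1 + a3 = 0)%C) by (rewrite <- hsum; ring).
  assert (s312 : (a3 + a1 + a2 = 0)%C) by (rewrite <- hsum; ring).
  f_equal; [f_equal|]; apply Csum_ext; intros k hk.
  - rewrite a_block1, one_minus_blk by auto. f_equal. apply asd_res_eq; auto.
    unfold pskip. rewrite PB. rewrite <- (own_block a1 k hk), <- (cross_block a1 a2 k hk), <- (cross_block a1 a3 k hk).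
    f_equal; [f_equal|]; apply Cprod_ext; intros j hj.
    + rewrite a_block1 by auto. auto.
    + destruct (Nat.eq_dec (K + j) k); [lia|]. rewrite a_block2 by auto. auto.
    + destruct (Nat.eq_dec (K + K + j) k); [lia|]. rewrite a_block3 by auto. auto.
  - rewrite a_block2, one_minus_blk by auto. f_equal. apply asd_res_eq; auto; [apply nonlat_sym; auto|].
    unfold pskip. rewrite PB. rewrite <- (own_block a2 k hk), <- (cross_block a2 a1 k hk), <- (cross_block a2 a3 k hk).
    match goal with |- (?A * ?B * ?C)%C = (?O * ?X * ?Y)%C =>
      enough (H : A = X /\ B = O /\ C = Y) by (destruct H as [-> [-> ->]]; ring) end.
    split; [|split]; apply Cprod_ext; intros j hj.
    + destruct (Nat.eq_dec j (K + k)); [lia|]. rewrite a_block1 by auto. auto.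
    + rewrite a_block2 by auto. destruct (Nat.eq_dec (K + j) (K + k)); destruct (Nat.eq_dec j k); auto; lia.
    + destruct (Nat.eq_dec (K + K + j) (K + k)); [lia|]. rewrite a_block3 by auto. auto.
  - rewrite a_block3, one_minus_blk by auto. f_equal. apply asd_res_eq; auto; [apply nonlat_sym; auto|apply nonlat_sym; auto|].
    unfold pskip. rewrite PB. rewrite <- (own_block a3 k hk), <- (cross_block a3 a1 k hk), <- (cross_block a3 a2 k hk).
    match goal with |- (?A * ?B * ?C)%C = (?O * ?X * ?Y)%C =>
      enough (H : A = X /\ B = Y /\ C = O) by (destruct H as [-> [-> ->]]; ring) end.
    split; [|split]; apply Cprod_ext; intros j hj.
    + destruct (Nat.eq_dec j (K + K + k)); [lia|]. rewrite a_block1 by auto. auto.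
    + destruct (Nat.eq_dec (K + j) (K + K + k)); [lia|]. rewrite a_block2 by auto. auto.
    + rewrite a_block3 by auto. destruct (Nat.eq_dec (K + K + j) (K + K + k)); destruct (Nat.eq_dec j k); auto; lia.
Qed.

End FiniteASD.

(** * Appell sums *)

Definition Bterm (al u t : C) (n : Z) : C := (asd_num t al (IZC n) / (1 - ex (u + al + IZC n * t)))%C.
(** An Appell sum of level three. *)
Definition B (al u t : C) : C := Zsum (Bterm al u t).

Lemma upper_3 t : upper_half t -> upper_half (3 * t)%C.
Proof. unfold upper_half. intros h. rewrite Im_Rmult. lra. Qed.

Lemma asd_num_T al t n : asd_num t al (IZC n) = (ex (- (3 * t / 8) - 3 * al / 2) * Tterm 0 (1/2) (3 * al) (3 * t) n)%C.
Proof.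
  unfold asd_num, Tterm. simpl Cpow. rewrite Cmult_1_r, <- !ex_plus. f_equal.
  rewrite RtoC_half, RtoC_mult, RtoC_plus, RtoC_half. unfold IZC. field.
Qed.

Lemma zsums_asd_num al t : upper_half t ->
  zsums (fun n => asd_num t al (IZC n)) (ex (- (3 * t / 8) - 3 * al / 2) * T 0 (1/2) (3 * al) (3 * t))%C.
Proof.
  intros h. eapply zsums_ext; [|apply (zsums_scal _ _ _ (zsums_T 0 (1/2) (3 * al) (3 * t) (upper_3 t h)))].
  intros n. symmetry. apply asd_num_T.
Qed.

Lemma one_minus_neq0 z : ex z <> RtoC 1 -> (1 - ex z)%C <> RtoC 0.
Proof. intros H E. apply H. replace (ex z) with (1 - (1 - ex z))%C by ring. rewrite E. ring. Qed.

Lemma Clim_ex_ap b t : upper_half t -> Clim (fun n => ex (b + INC n * t)) 0%C.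
Proof.
  intros h. pose proof (exp_Im_lt1 t h).
  destruct (sums_majorant (fun n => ex (b + INC n * t)) (fun k => exp (- (2 * PI * Im b)) * exp (- (2 * PI * Im t)) ^ k)) as [l Hl].
  - intros n. rewrite Cmod_ex_ap. lra.
  - apply summable_geom; [left; apply exp_pos|lra].
  - apply (sums_term _ _ Hl).
Qed.

Lemma nonlat_bounded_below v t : upper_half t -> nonlat v t -> exists m, 0 < m /\ forall n : Z, m <= Cmod (1 - ex (v + IZC n * t)).
Proof.
  intros h H.
  assert (N : forall w, nonlat w t -> exists m, 0 < m /\ forall n : nat, m <= Cmod (1 - ex (w + INC n * t))).
  { intros w Hw. apply (Clim_bounded_below (fun n => 1 - ex (w + INC n * t))%C (1 - 0)%C).
    - apply Clim_minus; [apply Clim_const|apply Clim_ex_ap; auto].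
    - replace (1 - 0)%C with (RtoC 1) by ring. apply RtoC_neq0; lra.
    - intros n. apply one_minus_neq0, nonlat_nat; auto. }
  destruct (N v H) as [m1 [h1 H1]]. destruct (N _ (nonlat_opp _ _ H)) as [m2 [h2 H2]].
  set (c := exp (- (2 * PI * Im v))). assert (hc : 0 < c) by apply exp_pos.
  exists (Rmin m1 (m2 * c)). split; [apply Rmin_pos; auto; apply Rmult_lt_0_compat; auto|].
  intros n. destruct (Z_le_gt_dec 0 n) as [l|l].
  - eapply Rle_trans; [apply Rmin_l|]. specialize (H1 (Z.to_nat n)).
    rewrite INR_IZR_INZ, Z2Nat.id in H1 by auto. exact H1.
  - eapply Rle_trans; [apply Rmin_r|].
    replace (1 - ex (v + IZC n * t))%C with (- ex (v + IZC n * t) * (1 - ex (- v + INC (Z.to_nat (- n)) * t)))%C.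
    + rewrite Cmod_mult, Cmod_opp, Cmod_ex, Rmult_comm. apply Rmult_le_compat; [lra|lra| |apply H2].
      apply exp_mono. rewrite Im_plus. unfold IZC. rewrite Im_Rmult.
      assert (Hn : IZR n <= 0) by (apply IZR_le; lia). unfold upper_half in h. pose proof PI_RGT_0 as hpi.
      assert (Q : 0 <= (- IZR n) * Im t) by (apply Rmult_le_pos; lra).
      assert (Q2 : 0 <= PI * ((- IZR n) * Im t)) by (apply Rmult_le_pos; lra). lra.
    + rewrite INR_IZR_INZ, Z2Nat.id by lia. change (RtoC (IZR (- n))) with (IZC (- n)). rewrite IZC_opp.
      replace (- v + - IZC n * t)%C with (- (v + IZC n * t))%C by ring. rewrite ex_opp. field. apply ex_neq0.
Qed.

Lemma zsummable_B al u t : upper_half t -> nonlat (u + al) t -> zsummable (Bterm al u t).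
Proof.
  intros h H. destruct (nonlat_bounded_below _ t h H) as [m [hm Hm]].
  eapply zsummable_rle; [|apply (rzsummable_scal (/ m) _ (Rlt_le _ _ (Rinv_0_lt_compat _ hm)) (proj1 (zsums_asd_num al t h)))].
  intros n. unfold Bterm. rewrite Cmod_div by (apply one_minus_neq0, H).
  unfold Rdiv. rewrite Rmult_comm. apply Rmult_le_compat_r; [apply Cmod_ge_0|]. apply Rinv_le_contravar; auto.
Qed.

Lemma zsums_B al u t : upper_half t -> nonlat (u + al) t -> zsums (Bterm al u t) (B al u t).
Proof. intros. apply zsummable_sums, zsummable_B; auto. Qed.

Definition iqf (v t : C) (m : Z) : C := if Z_lt_dec m 0 then RtoC 0 else (/ qfac v t (Z.to_nat m))%C.

Definition good (v t : C) : Prop := forall k : nat, ex (v + INC k * t) <> RtoC 1.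

Lemma Clim_iqf v t (f : nat -> Z) : upper_half t -> good v t ->
  (forall M, exists N, forall n, (N <= n)%nat -> (M <= f n)%Z) -> Clim (fun n => iqf v t (f n)) (/ qinf v t)%C.
Proof.
  intros h g H. destruct (H 0%Z) as [N0 H0].
  apply Clim_ext_ev with (fun n => / qfac v t (Z.to_nat (f n)))%C N0.
  - intros n hn. unfold iqf. destruct (Z_lt_dec (f n) 0); auto. specialize (H0 n hn). lia.
  - apply (Clim_reindex (fun k => / qfac v t k)%C _ (fun n => Z.to_nat (f n))).
    + intros M. destruct (H (Z.of_nat M)) as [N HN]. exists N. intros n hn. specialize (HN n hn). lia.
    + apply Clim_inv; [apply qfac_lim; auto|apply qinf_neq0; auto|].
      intros n. apply qfac_neq0; auto.
Qed.

Lemma iqf_bounded v t : upper_half t -> good v t -> exists K, 0 < K /\ forall m, Cmod (iqf v t m) <= K.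
Proof.
  intros h g. destruct (Clim_bounded (fun n => / qfac v t n)%C (/ qinf v t)%C) as [K [hK HK]].
  - apply Clim_inv; [apply qfac_lim; auto|apply qinf_neq0; auto|]. intros n. apply qfac_neq0; auto.
  - exists K. split; auto. intros m. unfold iqf. destruct (Z_lt_dec m 0); auto. rewrite Cmod_0. lra.
Qed.

Lemma zsums_finite f (N : nat) : (forall n : Z, (Z.of_nat N < Z.abs n)%Z -> f n = RtoC 0) ->
  zsums f (Csum (fun k => f (Z.of_nat k - Z.of_nat N)%Z) (2 * N + 1)).
Proof.
  intros H. split.
  - apply (finite_support_zsummable f (S N)). intros n hn. apply H. lia.
  - replace (Csum (fun k => f (Z.of_nat k - Z.of_nat N)%Z) (2 * N + 1)) with (Csum (zpair f) (S N)).
    + apply sums_finite. intros n hn. unfold zpair. rewrite !H by lia. ring.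
    + rewrite zsum_range. replace (2 * S N)%nat with (1 + (2 * N + 1))%nat by lia. rewrite (Csum_split _ 1 (2 * N + 1)).
      change (Csum (fun k => f (Z.of_nat k - Z.of_nat (S N))%Z) 1) with (0 + f (Z.of_nat 0 - Z.of_nat (S N))%Z)%C.
      rewrite (H (Z.of_nat 0 - Z.of_nat (S N))%Z) by lia.
      rewrite (Csum_ext (fun k => f (Z.of_nat (1 + k) - Z.of_nat (S N))%Z) (fun k => f (Z.of_nat k - Z.of_nat N)%Z)).
      * ring.
      * intros k _. f_equal. lia.
Qed.

Definition Jp (v t : C) : C := (qinf (t - v) t * qinf v t)%C.

Lemma good_nonlat v t : nonlat v t -> good v t.
Proof. intros H k. apply nonlat_nat; auto. Qed.

Lemma good_tminus v t : nonlat v t -> good (t - v) t.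
Proof. intros H k. apply nonlat_tminus; auto. Qed.

Lemma good_tt t : upper_half t -> good t t.
Proof. intros h k. apply ex_tt_neq1; auto. Qed.

Lemma Jp_neq0 v t : upper_half t -> nonlat v t -> Jp v t <> RtoC 0.
Proof. intros h H. apply Cmult_neq_0; apply qinf_neq0; auto; [apply good_tminus|apply good_nonlat]; auto. Qed.

(** The reciprocals of the finite products are bounded uniformly in [N], which
    justifies the passage to the limit under the sum. *)
Lemma asd_block_lim al al' al'' u t : upper_half t -> nonlat (al' - al) t -> nonlat (al'' - al) t -> nonlat (u + al) t ->
  Clim (fun N => Csum (fun k => asd_res t N al al' al'' k / (1 - ex (u + al + (INC k - INC N) * t)))%C (2 * N + 1))
   (/ (qinf t t * qinf t t * (Jp (al' - al) t * Jp (al'' - al) t)) * B al u t)%C.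
Proof.
  intros h n1 n2 nu.
  set (d1 := (al' - al)%C) in *. set (d2 := (al'' - al)%C) in *.
  destruct (iqf_bounded t t h (good_tt t h)) as [K0 [hK0 HK0]].
  destruct (iqf_bounded (t - d1) t h (good_tminus _ _ n1)) as [K1 [hK1 HK1]].
  destruct (iqf_bounded d1 t h (good_nonlat _ _ n1)) as [K2 [hK2 HK2]].
  destruct (iqf_bounded (t - d2) t h (good_tminus _ _ n2)) as [K3 [hK3 HK3]].
  destruct (iqf_bounded d2 t h (good_nonlat _ _ n2)) as [K4 [hK4 HK4]].
  set (U := fun (N : nat) (n : Z) => (Bterm al u t n * (iqf t t (Z.of_nat N + n) * iqf t t (Z.of_nat N - n) *
     ((iqf (t - d1) t (Z.of_nat N + n) * iqf d1 t (Z.of_nat N + 1 - n)) * (iqf (t - d2) t (Z.of_nat N + n) * iqf d2 t (Z.of_nat N + 1 - n)))))%C).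
  assert (P0 := qinf_tt_neq0 t h). assert (J1 := Jp_neq0 d1 t h n1). assert (J2 := Jp_neq0 d2 t h n2).
  apply (ztannery U (fun n => / (qinf t t * qinf t t * (Jp d1 t * Jp d2 t)) * Bterm al u t n)%C
    (fun n => (K0 * K0 * ((K1 * K2) * (K3 * K4))) * Cmod (Bterm al u t n))).
  - intros n.
    replace (/ (qinf t t * qinf t t * (Jp d1 t * Jp d2 t)) * Bterm al u t n)%C with
      (Bterm al u t n * (/ qinf t t * / qinf t t * ((/ qinf (t - d1) t * / qinf d1 t) * (/ qinf (t - d2) t * / qinf d2 t))))%C.
    2: { unfold Jp in *. field. repeat split; auto; intros E; rewrite E in *; [apply J2|apply J2|apply J1|apply J1]; ring. }
    assert (L1 : forall M, exists N, forall m, (N <= m)%nat -> (M <= Z.of_nat m + n)%Z) by (intros M; exists (Z.to_nat (M - n)); intros; lia).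
    assert (L2 : forall M, exists N, forall m, (N <= m)%nat -> (M <= Z.of_nat m - n)%Z) by (intros M; exists (Z.to_nat (M + n)); intros; lia).
    assert (L3 : forall M, exists N, forall m, (N <= m)%nat -> (M <= Z.of_nat m + 1 - n)%Z) by (intros M; exists (Z.to_nat (M + n)); intros; lia).
    apply Clim_scal. repeat apply Clim_mult; apply Clim_iqf; auto;
      try (apply good_tt; auto); try (apply good_tminus; auto); try (apply good_nonlat; auto).
  - intros N n. unfold U. rewrite !Cmod_mult, Rmult_comm. apply Rmult_le_compat_r; [apply Cmod_ge_0|].
    repeat (apply Rmult_le_compat; try apply Cmod_ge_0; try (repeat apply Rmult_le_pos; apply Cmod_ge_0); auto).
  - apply rzsummable_scal; [repeat apply Rmult_le_pos; lra|apply zsummable_B; auto].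
  - intros N.
    rewrite (Csum_ext _ (fun k => U N (Z.of_nat k - Z.of_nat N)%Z)).
    + apply zsums_finite. intros n hn. unfold U, iqf.
      destruct (Z_lt_dec (Z.of_nat N + n) 0); [ring|]. destruct (Z_lt_dec (Z.of_nat N - n) 0); [ring|]. lia.
    + intros k hk. unfold U, asd_res, Bterm, asd_factor, iqf.
      replace (Z.of_nat N + (Z.of_nat k - Z.of_nat N))%Z with (Z.of_nat k) by lia.
      replace (Z.of_nat N - (Z.of_nat k - Z.of_nat N))%Z with (Z.of_nat (2 * N - k)) by lia.
      replace (Z.of_nat N + 1 - (Z.of_nat k - Z.of_nat N))%Z with (Z.of_nat (2 * N + 1 - k)) by lia.
      rewrite !Nat2Z.id.
      destruct (Z_lt_dec (Z.of_nat k) 0); [lia|]. destruct (Z_lt_dec (Z.of_nat (2 * N - k)) 0); [lia|].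
      destruct (Z_lt_dec (Z.of_nat (2 * N + 1 - k)) 0); [lia|].
      replace (IZC (Z.of_nat k - Z.of_nat N)) with (INC k - INC N)%C by (rewrite IZC_minus; unfold IZC; rewrite <- !INR_IZR_INZ; auto).
      fold d1 d2. field.
      assert (Q : forall v m, good v t -> qfac v t m <> 0%C) by (intros; apply qfac_neq0; auto).
      repeat split; try (apply Q; auto using good_tt, good_tminus, good_nonlat).
      replace (INC k - INC N)%C with (IZC (Z.of_nat k - Z.of_nat N)) by (rewrite IZC_minus; unfold IZC; rewrite <- !INR_IZR_INZ; auto).
      apply one_minus_neq0, nu.
  - apply zsums_scal. apply zsums_B; auto.
Qed.

Theorem asd t u a1 a2 a3 : upper_half t -> (a1 + a2 + a3 = 0)%C ->
  nonlat (a2 - a1) t -> nonlat (a3 - a1) t -> nonlat (a3 - a2) t ->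
  nonlat (u + a1) t -> nonlat (u + a2) t -> nonlat (u + a3) t ->
  (/ (Jp (u + a1) t * Jp (u + a2) t * Jp (u + a3) t))%C =
  (/ (qinf t t * qinf t t * (Jp (a2 - a1) t * Jp (a3 - a1) t)) * B a1 u t +
   / (qinf t t * qinf t t * (Jp (a1 - a2) t * Jp (a3 - a2) t)) * B a2 u t +
   / (qinf t t * qinf t t * (Jp (a1 - a3) t * Jp (a2 - a3) t)) * B a3 u t)%C.
Proof.
  intros ht hs h12 h13 h23 hu1 hu2 hu3.
  assert (h21 := nonlat_sym t _ _ h12). assert (h31 := nonlat_sym t _ _ h13). assert (h32 := nonlat_sym t _ _ h23).
  assert (LJ : forall v, Clim (fun N => asd_J t N v) (Jp v t)).
  { intros v. apply Clim_mult; [apply qfac_lim; auto|]. apply (Clim_subseq (qfac v t) _ (fun N => (N + 1)%nat)); [intros; lia|apply qfac_lim; auto]. }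
  assert (NJ : forall v N, nonlat v t -> asd_J t N v <> 0%C).
  { intros v N H. apply Cmult_neq_0; apply qfac_neq0; intros j; [apply nonlat_tminus; auto|apply nonlat_nat; auto]. }
  apply (Clim_unique (fun N => / (asd_J t N (u + a1) * asd_J t N (u + a2) * asd_J t N (u + a3)))%C).
  - apply (Clim_inv (fun N => asd_J t N (u + a1) * asd_J t N (u + a2) * asd_J t N (u + a3))%C).
    + apply Clim_mult; [apply Clim_mult|]; apply LJ.
    + apply Cmult_neq_0; [apply Cmult_neq_0|]; apply Jp_neq0; auto.
    + intros n. apply Cmult_neq_0; [apply Cmult_neq_0|]; apply NJ; auto.
  - eapply Clim_ext.
    + intros N. symmetry. apply (finite_asd t u a1 a2 a3 N ht hs h12 h13 h23 hu1 hu2 hu3).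
    + apply Clim_plus; [apply Clim_plus|]; apply asd_block_lim; auto.
Qed.

(** ** Appell sums and theta values *)

Lemma Jp_theta v t : upper_half t -> Jp v t = (- ex (v / 2 - t / 8) * theta v t / qinf t t)%C.
Proof.
  intros h. rewrite theta_product by auto. unfold Jp. pose proof (qinf_tt_neq0 t h).
  replace (v / 2 - t / 8)%C with (- (t / 8 - v / 2))%C by field. rewrite ex_opp.
  pose proof (ex_neq0 (t / 8 - v / 2)). field. auto.
Qed.

Lemma theta_neq0 v t : upper_half t -> nonlat v t -> theta v t <> RtoC 0.
Proof.
  intros h H E. apply (Jp_neq0 v t h H). rewrite Jp_theta, E by auto. unfold Cdiv. ring.
Qed.

Definition Psi (al u t : C) : C :=
  (- (eta t * eta t * eta t) * (theta al t * theta (2 * al) t) / (theta (u - al) t * theta u t * theta (u + al) t))%C.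

Lemma theta_opp u t : upper_half t -> theta (- u) t = (- theta u t)%C.
Proof. apply T_odd. Qed.

(** The case of the shifts [- al], [0], [al]. *)
Lemma asd_theta t u al : upper_half t -> nonlat al t -> nonlat (2 * al) t ->
  nonlat u t -> nonlat (u - al) t -> nonlat (u + al) t ->
  (ex (3 * al / 2) * B al u t + ex (- (3 * al / 2)) * B (- al) u t - theta (2 * al) t / theta al t * B 0 u t)%C
  = (ex (- (3 * u / 2)) * Psi al u t)%C.
Proof.
  intros ht n1 n2 nu num nup.
  pose proof (asd t u (- al) 0 al ht) as H.
  replace (0 - - al)%C with al in H by ring. replace (al - - al)%C with (2 * al)%C in H by ring.
  replace (al - 0)%C with al in H by ring. replace (u + - al)%C with (u - al)%C in H by ring.
  replace (u + 0)%C with u in H by ring. replace (- al - 0)%C with (- al)%C in H by ring.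
  replace (- al - al)%C with (- (2 * al))%C in H by ring. replace (0 - al)%C with (- al)%C in H by ring.
  specialize (H ltac:(ring) n1 n2 n1 num nu nup).
  rewrite !Jp_theta, !theta_opp in H by auto. unfold Psi. rewrite !eta_qinf.
  pose proof (theta_neq0 _ t ht n1) as T1. pose proof (theta_neq0 _ t ht n2) as T2.
  pose proof (theta_neq0 _ t ht nu) as T3. pose proof (theta_neq0 _ t ht num) as T4. pose proof (theta_neq0 _ t ht nup) as T5.
  pose proof (qinf_tt_neq0 t ht) as P0. set (P := qinf t t) in *.
  set (t1 := theta al t) in *. set (t2 := theta (2 * al) t) in *.
  set (t3 := theta u t) in *. set (t4 := theta (u - al) t) in *.
  (* all exponentials are monomials in e(al/2), e(u/2) and q^(1/24) *)
  set (x := ex (al / 2)). set (y := ex (u / 2)). set (q := ex (t / 24)).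
  assert (X0 : x <> 0%C) by apply ex_neq0. assert (Y0 : y <> 0%C) by apply ex_neq0. assert (Q0 : q <> 0%C) by apply ex_neq0.
  replace (ex (3 * al / 2)) with (x * x * x)%C by (unfold x; rewrite <- !ex_plus; f_equal; field).
  replace (ex (- (3 * al / 2))) with (/ (x * x * x))%C by (unfold x; rewrite <- !ex_plus, <- ex_opp; f_equal; field).
  replace (ex (- (3 * u / 2))) with (/ (y * y * y))%C by (unfold y; rewrite <- !ex_plus, <- ex_opp; f_equal; field).
  replace (ex ((u - al) / 2 - t / 8)) with (y / x / (q * q * q))%C in H by (unfold x, y, q; rewrite <- !ex_plus, <- !ex_minus; f_equal; field).
  replace (ex (u / 2 - t / 8)) with (y / (q * q * q))%C in H by (unfold y, q; rewrite <- !ex_plus, <- !ex_minus; f_equal; field).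
  replace (ex ((u + al) / 2 - t / 8)) with (y * x / (q * q * q))%C in H by (unfold x, y, q; rewrite <- !ex_plus, <- !ex_minus; f_equal; field).
  replace (ex (al / 2 - t / 8)) with (x / (q * q * q))%C in H by (unfold x, q; rewrite <- !ex_plus, <- !ex_minus; f_equal; field).
  replace (ex (2 * al / 2 - t / 8)) with (x * x / (q * q * q))%C in H by (unfold x, q; rewrite <- !ex_plus, <- !ex_minus; f_equal; field).
  replace (ex (- al / 2 - t / 8)) with (/ (x * (q * q * q)))%C in H by (unfold x, q; rewrite <- !ex_plus, <- !ex_opp; f_equal; field).
  replace (ex (- (2 * al) / 2 - t / 8)) with (/ (x * x * (q * q * q)))%C in H by (unfold x, q; rewrite <- !ex_plus, <- !ex_opp; f_equal; field).
  match type of H with ?A = ?R => set (L := A) in H; set (RR := R) in H end.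
  transitivity (x * x * x * / (x * x * x) * / (x * x * x) * (x * x * x) * (t1 * t2 / (q * q * q * q * q * q)) * RR)%C.
  - unfold RR. field. repeat split; auto.
  - rewrite <- H. unfold L. field. repeat split; auto.
Qed.

(** ** The quintuple product identity *)

Definition bsum (i : C) (al t : C) : C := Zsum (fun n => asd_num t (al - i * t / 3) (IZC n)).

Lemma zsums_bsum i al t : upper_half t -> zsums (fun n => asd_num t al (IZC n) * ex (- (i * IZC n * t)))%C (bsum i al t).
Proof.
  intros h. apply (zsums_ext (fun n => asd_num t (al - i * t / 3) (IZC n))).
  - intros n. unfold asd_num. rewrite <- ex_plus. f_equal. field.
  - apply zsummable_sums. apply (proj1 (zsums_asd_num (al - i * t / 3) t h)).
Qed.

(** After a shift of the index the sum of both terms has the numerator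
    [1 - e(3v)] over the denominator [1 - e(v)], with [v = u + al + n t]. *)
Lemma B_shift al u t : upper_half t -> nonlat (u + al) t ->
  (B al (u + t) t + ex (3 * u) * B al u t)%C =
  (- (ex (- (3 * al)) * bsum 3 al t + ex (u - 2 * al) * bsum 2 al t + ex (2 * u - al) * bsum 1 al t))%C.
Proof.
  intros h H.
  assert (H' : nonlat (u + t + al) t).
  { intros k E. apply (H (k + 1)%Z). rewrite <- E. f_equal. rewrite IZC_plus. unfold IZC. ring. }
  pose proof (zsums_addn _ _ (-1) (zsums_B al (u + t) t h H')) as S1.
  pose proof (zsums_scal (ex (3 * u)) _ _ (zsums_B al u t h H)) as S2.
  pose proof (zsums_scal (- ex (- (3 * al))) _ _ (zsums_bsum 3 al t h)) as S3.
  pose proof (zsums_scal (- ex (u - 2 * al)) _ _ (zsums_bsum 2 al t h)) as S4.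
  pose proof (zsums_scal (- ex (2 * u - al)) _ _ (zsums_bsum 1 al t h)) as S5.
  replace (- (ex (- (3 * al)) * bsum 3 al t + ex (u - 2 * al) * bsum 2 al t + ex (2 * u - al) * bsum 1 al t))%C
    with (- ex (- (3 * al)) * bsum 3 al t + (- ex (u - 2 * al) * bsum 2 al t + - ex (2 * u - al) * bsum 1 al t))%C by ring.
  apply (zsums_unique _ _ _ (zsums_plus _ _ _ _ S1 S2)).
  eapply zsums_ext; [|apply (zsums_plus _ _ _ _ S3 (zsums_plus _ _ _ _ S4 S5))].
  intros n. cbv beta. unfold Bterm. set (nn := IZC n).
  replace (IZC (n + -1)) with (nn - 1)%C by (unfold nn; rewrite IZC_plus; unfold IZC; ring).
  replace (u + t + al + (nn - 1) * t)%C with (u + al + nn * t)%C by ring.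
  assert (D : (1 - ex (u + al + nn * t))%C <> 0%C) by (apply one_minus_neq0, H).
  set (N := asd_num t al nn).
  assert (EN : asd_num t al (nn - 1) = (- N * ex (- (3 * al)) * ex (- (3 * nn * t)))%C).
  { unfold N, asd_num.
    replace (- ex (nn / 2 + 3 * nn * al + 3 * nn * (nn + 1) / 2 * t))%C with (ex (RtoC (1/2)) * ex (nn / 2 + 3 * nn * al + 3 * nn * (nn + 1) / 2 * t))%C by (rewrite ex_half; ring).
    rewrite <- !ex_plus. apply (ex_eq _ _ (-1)). rewrite RtoC_half. unfold IZC. field. }
  rewrite EN.
  set (x := ex u) in *. set (z := ex al). set (w := ex (nn * t)).
  assert (X0 : x <> 0%C) by apply ex_neq0. assert (Z0 : z <> 0%C) by apply ex_neq0. assert (W0 : w <> 0%C) by apply ex_neq0.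
  replace (ex (u + al + nn * t)) with (x * z * w)%C in * by (unfold x, z, w; rewrite <- !ex_plus; auto).
  replace (ex (- (3 * al))) with (/ (z * z * z))%C by (unfold z; rewrite <- !ex_plus, <- ex_opp; f_equal; ring).
  replace (ex (- (3 * nn * t))) with (/ (w * w * w))%C by (unfold w; rewrite <- !ex_plus, <- ex_opp; f_equal; ring).
  replace (ex (- (2 * nn * t))) with (/ (w * w))%C by (unfold w; rewrite <- !ex_plus, <- ex_opp; f_equal; ring).
  replace (ex (- (1 * nn * t))) with (/ w)%C by (unfold w; rewrite <- ex_opp; f_equal; ring).
  replace (ex (3 * u)) with (x * x * x)%C by (unfold x; rewrite <- !ex_plus; f_equal; ring).
  replace (ex (u - 2 * al)) with (x / (z * z))%C by (unfold x, z; rewrite <- !ex_plus, <- ex_minus; f_equal; ring).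
  replace (ex (2 * u - al)) with (x * x / z)%C by (unfold x, z; rewrite <- !ex_plus, <- ex_minus; f_equal; ring).
  field. repeat split; auto.
Qed.

Lemma Psi_shift al u t : upper_half t -> nonlat u t -> nonlat (u - al) t -> nonlat (u + al) t ->
  (ex (- (3 * (u + t) / 2)) * Psi al (u + t) t)%C = (- ex (3 * u) * (ex (- (3 * u / 2)) * Psi al u t))%C.
Proof.
  intros h n1 n2 n3. unfold Psi.
  assert (S : forall v, theta (v + t) t = (- ex (- v - t / 2) * theta v t)%C) by (intros; apply (proj2 (theta_is_theta_type t h))).
  replace (u + t - al)%C with (u - al + t)%C by ring. replace (u + t + al)%C with (u + al + t)%C by ring.
  rewrite !S. pose proof (theta_neq0 _ t h n1). pose proof (theta_neq0 _ t h n2). pose proof (theta_neq0 _ t h n3).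
  set (x := ex (u / 2)). set (z := ex al). set (q := ex (t / 2)).
  assert (X0 : x <> 0%C) by apply ex_neq0. assert (Z0 : z <> 0%C) by apply ex_neq0. assert (W0 : q <> 0%C) by apply ex_neq0.
  replace (ex (- (3 * (u + t) / 2))) with (/ (x * x * x * (q * q * q)))%C by (unfold x, q; rewrite <- !ex_plus, <- ex_opp; f_equal; field).
  replace (ex (- (3 * u / 2))) with (/ (x * x * x))%C by (unfold x; rewrite <- !ex_plus, <- ex_opp; f_equal; field).
  replace (ex (3 * u)) with (x * x * x * (x * x * x))%C by (unfold x; rewrite <- !ex_plus; f_equal; field).
  replace (ex (- (u - al) - t / 2)) with (z / (x * x * q))%C by (unfold x, z, q; rewrite <- !ex_plus, <- ex_minus; f_equal; field).
  replace (ex (- u - t / 2)) with (/ (x * x * q))%C by (unfold x, q; rewrite <- !ex_plus, <- ex_opp; f_equal; field).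
  replace (ex (- (u + al) - t / 2)) with (/ (x * x * z * q))%C by (unfold x, z, q; rewrite <- !ex_plus, <- ex_opp; f_equal; field).
  field. repeat split; auto.
Qed.

Lemma quadratic_zero a b c x y z : x <> y -> y <> z -> x <> z ->
  (a + b * x + c * (x * x) = 0)%C -> (a + b * y + c * (y * y) = 0)%C -> (a + b * z + c * (z * z) = 0)%C -> c = RtoC 0.
Proof.
  intros h1 h2 h3 E1 E2 E3.
  assert (D1 : (x - y)%C <> 0%C) by (intros E; apply h1; replace x with (x - y + y)%C by ring; rewrite E; ring).
  assert (D2 : (y - z)%C <> 0%C) by (intros E; apply h2; replace y with (y - z + z)%C by ring; rewrite E; ring).
  assert (D3 : (x - z)%C <> 0%C) by (intros E; apply h3; replace x with (x - z + z)%C by ring; rewrite E; ring).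
  replace c with (((a + b * x + c * (x * x)) * (y - z) - (a + b * y + c * (y * y)) * (x - z) + (a + b * z + c * (z * z)) * (x - y)) / ((x - y) * (y - z) * (x - z)))%C
    by (field; auto).
  rewrite E1, E2, E3. field. auto.
Qed.

(** Comparing both sides of [asd_theta] under [u -> u + t]: the right-hand side
    and the theta-free part of the left-hand side transform alike, so the
    remaining quadratic polynomial in [e(u)] vanishes. *)
Theorem quintuple_product al t : upper_half t -> Im al = 0 -> nonlat al t -> nonlat (2 * al) t ->
  (theta (2 * al) t / theta al t * bsum 1 0 t)%C = (ex (al / 2) * bsum 1 al t + ex (- (al / 2)) * bsum 1 (- al) t)%C.
Proof.
  intros h Ial n1 n2. pose proof h as h'. unfold upper_half in h'.
  set (c := (theta (2 * al) t / theta al t)%C).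
  set (P3 := (ex (- (3 * al / 2)) * bsum 3 al t + ex (3 * al / 2) * bsum 3 (- al) t - c * bsum 3 0 t)%C).
  set (P2 := (ex (- (al / 2)) * bsum 2 al t + ex (al / 2) * bsum 2 (- al) t - c * bsum 2 0 t)%C).
  set (P1 := (ex (al / 2) * bsum 1 al t + ex (- (al / 2)) * bsum 1 (- al) t - c * bsum 1 0 t)%C).
  assert (K : forall s, 0 < s < 1 -> (P3 + P2 * ex (RtoC s * t) + P1 * (ex (RtoC s * t) * ex (RtoC s * t)) = 0)%C).
  { intros s hs. set (u := (RtoC s * t)%C).
    assert (NL : forall b, Im b = 0 -> nonlat (u + b) t).
    { intros b Ib k. apply ex_neq1_Im. unfold u, IZC. rewrite !Im_plus, !Im_Rmult, Ib.
      replace (s * Im t + 0 + IZR k * Im t) with ((s + IZR k) * Im t) by ring.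
      intros E. apply Rmult_integral in E. destruct E as [E|E]; [|lra].
      assert (k < 0)%Z by (apply lt_IZR; lra). assert (-1 < k)%Z by (apply lt_IZR; lra). lia. }
    assert (Nu : nonlat u t) by (replace u with (u + 0)%C by ring; apply NL; reflexivity).
    assert (Nm : nonlat (u - al) t) by (apply NL; rewrite Im_opp, Ial; ring).
    assert (Np : nonlat (u + al) t) by (apply NL; auto).
    assert (NT : forall v, nonlat v t -> nonlat (v + t) t).
    { intros v H k E. apply (H (k + 1)%Z). rewrite <- E. f_equal. rewrite IZC_plus. unfold IZC. ring. }
    pose proof (asd_theta t u al h n1 n2 Nu Nm Np) as A1.
    pose proof (asd_theta t (u + t) al h n1 n2 (NT _ Nu)) as A2.
    replace (u + t - al)%C with (u - al + t)%C in A2 by ring. replace (u + t + al)%C with (u + al + t)%C in A2 by ring.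
    specialize (A2 (NT _ Nm) (NT _ Np)). rewrite Psi_shift, <- A1 in A2 by auto. fold c in A1, A2.
    pose proof (B_shift al u t h Np) as B1. pose proof (B_shift (- al) u t h Nm) as B2.
    assert (Nu0 : nonlat (u + 0) t) by (apply NL; reflexivity).
    pose proof (B_shift 0 u t h Nu0) as B3.
    assert (S : (ex (3 * al / 2) * (B al (u + t) t + ex (3 * u) * B al u t) + ex (- (3 * al / 2)) * (B (- al) (u + t) t + ex (3 * u) * B (- al) u t)
       - c * (B 0 (u + t) t + ex (3 * u) * B 0 u t) = 0)%C).
    { transitivity ((ex (3 * al / 2) * B al (u + t) t + ex (- (3 * al / 2)) * B (- al) (u + t) t - c * B 0 (u + t) t)
        + ex (3 * u) * (ex (3 * al / 2) * B al u t + ex (- (3 * al / 2)) * B (- al) u t - c * B 0 u t))%C; [ring|]. rewrite A2. ring. }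
    rewrite B1, B2, B3 in S. clear B1 B2 B3 A1 A2. unfold P3, P2, P1. fold u.
    set (x := ex (al / 2)) in *. assert (X0 : x <> 0%C) by apply ex_neq0.
    assert (U0 : ex u <> 0%C) by apply ex_neq0.
    replace (ex (3 * al / 2)) with (x * x * x)%C in * by (unfold x; rewrite <- !ex_plus; f_equal; field).
    replace (ex (- (3 * al / 2))) with (/ (x * x * x))%C in * by (unfold x; rewrite <- !ex_plus, <- ex_opp; f_equal; field).
    replace (ex (- (al / 2))) with (/ x)%C in * by (unfold x; rewrite <- ex_opp; auto).
    replace (ex (- (3 * al))) with (/ (x * x * x * (x * x * x)))%C in S by (unfold x; rewrite <- !ex_plus, <- ex_opp; f_equal; field).
    replace (ex (- (3 * - al))) with (x * x * x * (x * x * x))%C in S by (unfold x; rewrite <- !ex_plus; f_equal; field).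
    replace (ex (- (3 * 0))) with (RtoC 1) in S by (rewrite <- ex_0; f_equal; ring).
    replace (ex (u - 2 * al)) with (ex u / (x * x * x * x))%C in S by (unfold x; rewrite <- !ex_plus, <- ex_minus; f_equal; field).
    replace (ex (u - 2 * - al)) with (ex u * (x * x * x * x))%C in S by (unfold x; rewrite <- !ex_plus; f_equal; field).
    replace (ex (u - 2 * 0)) with (ex u) in S by (f_equal; ring).
    replace (ex (2 * u - al)) with (ex u * ex u / (x * x))%C in S by (unfold x; rewrite <- !ex_plus, <- ex_minus; f_equal; field).
    replace (ex (2 * u - - al)) with (ex u * ex u * (x * x))%C in S by (unfold x; rewrite <- !ex_plus; f_equal; field).
    replace (ex (2 * u - 0)) with (ex u * ex u)%C in S by (rewrite <- !ex_plus; f_equal; ring).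
    fold u.
    match type of S with ?L = _ => transitivity (- L)%C; [|rewrite S; ring] end.
    field. auto. }
  assert (Z : P1 = 0%C).
  { assert (Ne : forall s s', s < s' -> ex (RtoC s * t) <> ex (RtoC s' * t)).
    { intros s s' hs E. apply (f_equal Cmod) in E. rewrite !Cmod_ex, !Im_Rmult in E. apply exp_inv in E.
      pose proof PI_RGT_0. assert (s * Im t < s' * Im t) by (apply Rmult_lt_compat_r; lra). nra. }
    apply (quadratic_zero P3 P2 P1 (ex (RtoC (1/4) * t)) (ex (RtoC (1/2) * t)) (ex (RtoC (3/4) * t))).
    - apply Ne; lra.
    - apply Ne; lra.
    - apply Ne; lra.
    - apply K; lra.
    - apply K; lra.
    - apply K; lra. }
  unfold P1 in Z. replace (c * bsum 1 0 t)%C with (ex (al / 2) * bsum 1 al t + ex (- (al / 2)) * bsum 1 (- al) t - (ex (al / 2) * bsum 1 al t + ex (- (al / 2)) * bsum 1 (- al) t - c * bsum 1 0 t))%C by ring.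
  rewrite Z. ring.
Qed.

(** The triple product in base [q^3]. *)
Lemma pentagonal t : upper_half t -> bsum 1 0 t = qinf t t.
Proof.
  intros h. pose proof (upper_3 t h) as h3.
  pose proof (jacobi_triple_product (2 * t) (3 * t) h3) as J.
  assert (HS : zsums (jterm (2 * t) (3 * t)) (bsum 1 0 t)).
  { eapply zsums_ext; [|apply (zsums_bsum 1 0 t h)]. intros n. unfold asd_num, jterm. rewrite <- ex_plus. f_equal. field. }
  rewrite (zsums_unique _ _ _ HS J). replace (3 * t - 2 * t)%C with t by ring.
  apply (Clim_unique (fun N => qfac (3 * t) (3 * t) N * (qfac (2 * t) (3 * t) N * qfac t (3 * t) N))%C).
  - repeat apply Clim_mult; apply qfac_lim; auto.
  - apply Clim_ext with (fun N => qfac t t (3 * N)); [|apply (Clim_subseq (qfac t t) _ (fun n => (3 * n)%nat)); [intros; lia|apply qfac_lim; auto]].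
    induction n as [|n IH]; [unfold qfac; simpl; ring|].
    replace (3 * S n)%nat with (S (S (S (3 * n)))) by lia. rewrite !qfac_S, IH, !S_INR, mult_INR, !RtoC_plus, RtoC_mult.
    change (INR 3) with (1 + 1 + 1). rewrite !RtoC_plus. set (m := INC n).
    replace (t + (1 + 1 + 1) * m * t)%C with (t + m * (3 * t))%C by ring.
    replace (t + ((1 + 1 + 1) * m + 1) * t)%C with (2 * t + m * (3 * t))%C by ring.
    replace (t + ((1 + 1 + 1) * m + 1 + 1) * t)%C with (3 * t + m * (3 * t))%C by ring. ring.
Qed.

(** * The identity at a root of unity *)

Lemma INC_odd h : INC (2 * h + 1) = (2 * INC h + 1)%C.
Proof. rewrite plus_INR, mult_INR, RtoC_plus, RtoC_mult. reflexivity. Qed.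

Lemma nonlat_R x t : upper_half t -> 0 < x < 1 -> nonlat (RtoC x) t.
Proof.
  intros h hx k. destruct (Z.eq_dec k 0) as [->|Nk].
  - replace (RtoC x + IZC 0 * t)%C with (RtoC x) by (unfold IZC; ring). apply ex_neq1_R; auto.
  - apply ex_neq1_Im. unfold IZC. rewrite Im_plus, Im_Rmult, Im_R. unfold upper_half in h.
    assert (IZR k <> 0) by (apply not_0_IZR; auto). nra.
Qed.

Lemma nonlat_intshift v n t : nonlat v t -> nonlat (v + IZC n) t.
Proof. intros H k E. apply (H k). rewrite <- E. symmetry. apply (ex_eq _ _ n). ring. Qed.

Lemma nonlat_near (p : nat) (m : Z) s t : upper_half t -> (0 < p)%nat -> 0 < Rabs s < / INR p ->
  nonlat (RtoC (IZR m / INR p + s)) t.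
Proof.
  intros h hp hs. assert (P : 0 < INR p) by (apply lt_0_INR; auto).
  set (x := IZR m / INR p + s). destruct (base_Int_part x) as [B1 B2].
  assert (X : 0 < x - IZR (Int_part x) < 1).
  { split; [|lra]. destruct (Rle_lt_or_eq_dec _ _ B1) as [B|B]; [lra|]. exfalso.
    assert (E : INR p * s = IZR (Int_part x * Z.of_nat p - m)).
    { rewrite minus_IZR, mult_IZR, <- INR_IZR_INZ, B. unfold x. field. lra. }
    assert (Q : 0 < Rabs (INR p * s) < 1).
    { rewrite Rabs_mult, (Rabs_pos_eq (INR p)) by lra. split; [apply Rmult_lt_0_compat; lra|].
      replace 1 with (INR p * / INR p) by (field; lra). apply Rmult_lt_compat_l; lra. }
    rewrite E, <- abs_IZR in Q. destruct Q as [Q1 Q2]. apply lt_IZR in Q1, Q2. lia. }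
  replace (RtoC x) with (RtoC (x - IZR (Int_part x)) + IZC (Int_part x))%C by (unfold IZC; rewrite RtoC_minus; ring).
  apply nonlat_intshift, nonlat_R; auto.
Qed.

Lemma Csum_pair F h : Csum F (2 * h + 1) = (F O + Csum (fun k => F (S k) + F (2 * h - k)%nat) h)%C.
Proof.
  replace (2 * h + 1)%nat with (1 + (h + h))%nat by lia. rewrite Csum_split, Csum_split, Csum_plus.
  rewrite (Csum_rev (fun k => F (1 + (h + k))%nat)).
  rewrite (Csum_ext (fun k => F (1 + (h + (h - 1 - k)))%nat) (fun k => F (2 * h - k)%nat)).
  - simpl. ring.
  - intros k hk. f_equal. lia.
Qed.

Lemma B_period al u t : B (al + 1) u t = B al u t.
Proof.
  unfold B. f_equal. apply functional_extensionality. intros n. unfold Bterm, asd_num. f_equal.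
  - apply (ex_eq _ _ (3 * n)). rewrite IZC_mult. unfold IZC. ring.
  - f_equal. apply (ex_eq _ _ 1). unfold IZC. ring.
Qed.

(** [B] without the term that is singular when [u + al] is an integer. *)
Definition Bstar (al u t : C) : C := Zsum (fun n => if Z.eq_dec n 0 then RtoC 0 else Bterm al u t n).

Lemma real_bounded_below t : upper_half t -> exists m, 0 < m /\ forall x n, n <> 0%Z -> m <= Cmod (1 - ex (RtoC x + IZC n * t)).
Proof.
  intros h. pose proof (exp_Im_lt1 t h) as hr. set (r := exp (- (2 * PI * Im t))) in *.
  exists (1 - r). split; [lra|]. intros x n hn. unfold upper_half in h. pose proof PI_RGT_0 as hpi.
  assert (E : Cmod (ex (RtoC x + IZC n * t)) = exp (- (2 * PI * (IZR n * Im t)))).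
  { rewrite Cmod_ex. unfold IZC. rewrite Im_plus, Im_Rmult, Im_R. f_equal. ring. }
  assert (Pt : 0 < PI * Im t) by (apply Rmult_lt_0_compat; lra).
  destruct (Z_lt_le_dec 0 n) as [l|l].
  - assert (1 <= IZR n) by (apply IZR_le; lia).
    assert (Cmod (ex (RtoC x + IZC n * t)) <= r).
    { rewrite E. apply exp_mono. nra. }
    pose proof (Cmod_tri2 1 (ex (RtoC x + IZC n * t))) as T. rewrite Cmod_1 in T. lra.
  - assert (IZR n <= -1) by (apply IZR_le; lia).
    assert (L : / r <= Cmod (ex (RtoC x + IZC n * t))).
    { rewrite E. unfold r. rewrite <- exp_Ropp. apply exp_mono. nra. }
    assert (2 - r <= / r).
    { apply Rmult_le_reg_r with r; [lra|]. rewrite Rinv_l by lra. assert (0 <= (1 - r) * (1 - r)) by apply Rle_0_sqr. lra. }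
    pose proof (Cmod_tri2 (ex (RtoC x + IZC n * t)) 1) as T. rewrite Cmod_1, Cmod_minus_sym in T. lra.
Qed.

Lemma Bstar_dom y t : upper_half t -> exists b, rzsummable b /\ forall x n,
  Cmod (if Z.eq_dec n 0 then RtoC 0 else Bterm (RtoC y) (RtoC x) t n) <= b n.
Proof.
  intros h. destruct (real_bounded_below t h) as [m [hm Hm]].
  exists (fun n => / m * Cmod (asd_num t (RtoC y) (IZC n))). split.
  - apply rzsummable_scal; [left; apply Rinv_0_lt_compat; auto|]. apply (proj1 (zsums_asd_num (RtoC y) t h)).
  - intros x n. assert (0 < / m) by (apply Rinv_0_lt_compat; auto). destruct (Z.eq_dec n 0).
    + rewrite Cmod_0. apply Rmult_le_pos; [lra|apply Cmod_ge_0].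
    + unfold Bterm. specialize (Hm (x + y) n n0). rewrite RtoC_plus in Hm.
      rewrite Cmod_div by (apply Cmod_neq0; lra). unfold Rdiv. rewrite Rmult_comm.
      apply Rmult_le_compat_r; [apply Cmod_ge_0|]. apply Rinv_le_contravar; auto.
Qed.

Lemma zsums_Bstar y x t : upper_half t ->
  zsums (fun n => if Z.eq_dec n 0 then RtoC 0 else Bterm (RtoC y) (RtoC x) t n) (Bstar (RtoC y) (RtoC x) t).
Proof.
  intros h. apply zsummable_sums. destruct (Bstar_dom y t h) as [b [Sb Hb]]. apply (zsummable_rle _ b); auto.
Qed.

Lemma B_Bstar y x t : upper_half t -> nonlat (RtoC x + RtoC y) t ->
  B (RtoC y) (RtoC x) t = (Bstar (RtoC y) (RtoC x) t + / (1 - ex (RtoC x + RtoC y)))%C.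
Proof.
  intros h H. apply (zsums_unique _ _ _ (zsums_B (RtoC y) (RtoC x) t h H)).
  pose proof (zsums_finite (fun n => if Z.eq_dec n 0 then Bterm (RtoC y) (RtoC x) t n else RtoC 0) 0) as F.
  replace (/ (1 - ex (RtoC x + RtoC y)))%C with (Csum (fun k => (fun n => if Z.eq_dec n 0 then Bterm (RtoC y) (RtoC x) t n else RtoC 0) (Z.of_nat k - Z.of_nat 0)%Z) (2 * 0 + 1)).
  - eapply zsums_ext; [|apply (zsums_plus _ _ _ _ (zsums_Bstar y x t h) (F ltac:(intros n hn; cbv beta; destruct (Z.eq_dec n 0); [lia|auto])))].
    intros n. cbv beta. destruct (Z.eq_dec n 0); ring.
  - simpl Csum. destruct (Z.eq_dec (Z.of_nat 0 - Z.of_nat 0) 0); [|lia].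
    replace (Z.of_nat 0 - Z.of_nat 0)%Z with 0%Z by lia. unfold Bterm, asd_num.
    replace (IZC 0 / 2 + 3 * IZC 0 * RtoC y + 3 * IZC 0 * (IZC 0 + 1) / 2 * t)%C with (RtoC 0) by (unfold IZC; field).
    replace (RtoC x + RtoC y + IZC 0 * t)%C with (RtoC x + RtoC y)%C by (unfold IZC; ring). rewrite ex_0. unfold Cdiv. ring.
Qed.

Lemma Clim_ex_real (v : nat -> R) x c : Clim (fun m => RtoC (v m)) (RtoC x) -> Clim (fun m => ex (RtoC (v m) + c)) (ex (RtoC x + c)).
Proof.
  intros H. apply (Ccont_lim (fun w => ex (w + c)) (RtoC x) (fun m => RtoC (v m))); auto.
  apply (Cder_cont _ _ (twopii * 1 * ex (1 * RtoC x + c))%C).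
  apply (Cder_ext (fun w => ex (1 * w + c))); [intros; f_equal; ring|]. apply Cder_ex_lin.
Qed.

Lemma Bstar_cont y x t (v : nat -> R) : upper_half t -> Clim (fun m => RtoC (v m)) (RtoC x) ->
  Clim (fun m => Bstar (RtoC y) (RtoC (v m)) t) (Bstar (RtoC y) (RtoC x) t).
Proof.
  intros h Hv. destruct (Bstar_dom y t h) as [b [Sb Hb]]. destruct (real_bounded_below t h) as [m0 [hm Hm]].
  apply (ztannery (fun m n => if Z.eq_dec n 0 then RtoC 0 else Bterm (RtoC y) (RtoC (v m)) t n)
    (fun n => if Z.eq_dec n 0 then RtoC 0 else Bterm (RtoC y) (RtoC x) t n) b); auto.
  - intros n. destruct (Z.eq_dec n 0); [apply Clim_const|]. apply Clim_scal.
    assert (N : forall z, (1 - ex (RtoC z + RtoC y + IZC n * t))%C <> 0%C).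
    { intros z. rewrite <- RtoC_plus. apply Cmod_neq0. specialize (Hm (z + y) n n0). lra. }
    apply Clim_inv; auto. apply Clim_minus; [apply Clim_const|].
    apply Clim_ext with (fun m => ex (RtoC (v m) + (RtoC y + IZC n * t))); [intros; f_equal; ring|].
    replace (RtoC x + RtoC y + IZC n * t)%C with (RtoC x + (RtoC y + IZC n * t))%C by ring. apply Clim_ex_real; auto.
  - intros. apply zsums_Bstar; auto.
  - apply zsums_Bstar; auto.
Qed.

Lemma theta_cont u t (v : nat -> C) : upper_half t -> Clim v u -> Clim (fun m => theta (v m) t) (theta u t).
Proof. intros h. apply (Ccont_lim (fun u => theta u t)). apply (Cder_cont _ _ _ (Cder_theta u t h)). Qed.

Lemma Psi_cont al u t (v : nat -> C) : upper_half t -> nonlat (u - al) t -> nonlat u t -> nonlat (u + al) t ->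
  (forall m, nonlat (v m - al) t) -> (forall m, nonlat (v m) t) -> (forall m, nonlat (v m + al) t) ->
  Clim v u -> Clim (fun m => Psi al (v m) t) (Psi al u t).
Proof.
  intros h n1 n2 n3 m1 m2 m3 Hv. apply Clim_scal. apply Clim_inv.
  - repeat apply Clim_mult; apply theta_cont; auto.
    + apply Clim_minus; auto. apply Clim_const.
    + apply Clim_plus; auto. apply Clim_const.
  - repeat (apply Cmult_neq_0; try (apply theta_neq0; auto)).
  - intros m. repeat (apply Cmult_neq_0; try (apply theta_neq0; auto)).
Qed.

Lemma geometric_sum w n : (Csum (fun k => w ^ k) n * (1 - w))%C = (1 - w ^ n)%C.
Proof. induction n as [|n IH]; simpl; [ring|]. rewrite Cmult_plus_distr_r, IH. ring. Qed.

Lemma Csum_first F n : Csum F (S n) = (F O + Csum (fun k => F (S k)) n)%C.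
Proof. pose proof (Csum_split F 1 n) as E. change (1 + n)%nat with (S n) in E. rewrite E. simpl. ring. Qed.

Lemma geometric_root a n : ex (INC n * a) = RtoC 1 -> ex a <> RtoC 1 -> Csum (fun k => ex (INC k * a)) n = RtoC 0.
Proof.
  intros H N. pose proof (geometric_sum (ex a) n) as G. rewrite pow_ex, H in G.
  rewrite (Csum_ext _ (fun k => (ex a) ^ k)%C) by (intros; rewrite pow_ex; auto).
  assert (D : (1 - ex a)%C <> 0%C) by (apply one_minus_neq0; auto).
  replace (Csum (fun k => ex a ^ k)%C n) with (Csum (fun k => ex a ^ k)%C n * (1 - ex a) / (1 - ex a))%C by (field; auto).
  rewrite G. unfold Cdiv. ring.
Qed.

Definition al (p k : nat) : R := INR k / INR p.

Lemma al_range p k : (0 < k < p)%nat -> 0 < al p k < 1.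
Proof.
  intros [h1 h2]. apply lt_INR in h1, h2. simpl in h1. unfold al. split.
  - apply Rdiv_lt_0_compat; lra.
  - apply Rmult_lt_reg_r with (INR p); [lra|]. unfold Rdiv. rewrite Rmult_assoc, Rinv_l; lra.
Qed.

(** With these weights, the sum over [k] of Appell sums at [k/p] pairs [k] with [p - k]
    as in [asd_theta]. *)
Definition wgt (p k : nat) : C := ex (INC k / 2 + 3 * RtoC (al p k) / 2).

(** With [w = ex (1/p)] the terms are [w^(j(h+2)) / (1 - w^j)].  Lowering the
    exponent by [j] changes the sum by a full sum of nontrivial roots of unity,
    and the sum with [w^(j(h+1))] is odd under [j -> p - j]. *)
Lemma sigma_one h : (0 < h)%nat ->
  Csum (fun k => wgt (2 * h + 1) (S k) / (1 - ex (RtoC (al (2 * h + 1) (S k)))))%C (2 * h) = RtoC 1.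
Proof.
  intros hh. set (p := (2 * h + 1)%nat). assert (hp : 0 < INR p) by (apply lt_0_INR; unfold p; lia).
  assert (PZ : INC p <> 0%C) by (apply RtoC_neq0; lra).
  assert (Ep : INC p = (2 * INC h + 1)%C) by apply INC_odd.
  assert (Ea : forall k, RtoC (al p k) = (INC k / INC p)%C) by (intros; unfold al; apply RtoC_div; lra).
  set (e := fun j => ex (INC j * RtoC (al p (h + 1)))). set (x := fun j => ex (RtoC (al p j))).
  assert (N1 : forall k, (k < 2 * h)%nat -> (1 - x (S k))%C <> 0%C).
  { intros k hk. apply one_minus_neq0, ex_neq1_R, al_range. lia. }
  assert (P2 : (2 * INC h + 1)%C <> 0%C) by (rewrite <- Ep; auto).
  rewrite (Csum_ext _ (fun k => e (S k) / (1 - x (S k)) - e (S k))%C).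
  2: { intros k hk. fold (x (S k)). replace (wgt p (S k)) with (e (S k) * x (S k))%C; [field; auto|].
       unfold e, x, wgt. rewrite <- ex_plus, !Ea, plus_INR, RtoC_plus, Ep. f_equal. simpl (INR 1). field. auto. }
  rewrite Csum_minus. set (s := Csum (fun k => e (S k) / (1 - x (S k)))%C (2 * h)).
  assert (Hs : s = (- s)%C).
  { unfold s at 1. rewrite Csum_rev. replace (- s)%C with ((- (1)) * s)%C by ring. unfold s. rewrite <- Csum_scal. apply Csum_ext. intros k hk.
    replace (S (2 * h - 1 - k)) with (2 * h - k)%nat by lia. specialize (N1 k hk).
    assert (X0 : x (S k) <> 0%C) by apply ex_neq0.
    assert (Ej : INC (2 * h - k) = (INC p - INC (S k))%C).
    { unfold p. replace (2 * h + 1)%nat with ((2 * h - k) + S k)%nat by lia. rewrite plus_INR, RtoC_plus. ring. }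
    replace (x (2 * h - k)%nat) with (/ x (S k))%C.
    2: { unfold x. rewrite <- ex_opp, !Ea, Ej. symmetry. apply (ex_eq _ _ 1). unfold IZC. field. auto. }
    replace (e (2 * h - k)%nat) with (e (S k) / x (S k))%C.
    2: { unfold e, x. rewrite <- ex_minus, !Ea, Ej, plus_INR, RtoC_plus. symmetry.
         apply (ex_eq _ _ (Z.of_nat h + 1 - Z.of_nat (S k))). rewrite IZC_minus, IZC_plus. unfold IZC. rewrite <- !INR_IZR_INZ, Ep. simpl (INR 1). field. auto. }
    assert (N2 := Cminus_neq0_sym _ _ N1).
    field. auto. }
  replace s with (RtoC 0) by (transitivity ((s + s) / 2)%C; [rewrite Hs at 2; field|field]).
  assert (G : Csum e p = 0%C).
  { apply geometric_root; [|apply ex_neq1_R, al_range; unfold p; lia]. rewrite <- (ex_Z (Z.of_nat (h + 1))), Ea. f_equal.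
    unfold IZC. rewrite <- INR_IZR_INZ. field. auto. }
  unfold p in G. rewrite Nat.add_1_r, Csum_first in G. unfold e at 1 in G. rewrite Cmult_0_l, ex_0 in G. replace (Csum (fun k => e (S k)) (2 * h)) with (1 + Csum (fun k => e (S k)) (2 * h) - 1)%C by ring.
  rewrite G. ring.
Qed.

(** ** The limit *)

Lemma wgt_refl h j : (j <= 2 * h + 1)%nat ->
  wgt (2 * h + 1) (2 * h + 1 - j) = ex (INC j / 2 - 3 * RtoC (al (2 * h + 1) j) / 2).
Proof.
  intros hj. set (p := (2 * h + 1)%nat) in *.
  assert (hp : 0 < INR p) by (apply lt_0_INR; unfold p; lia).
  assert (PZ : INC p <> 0%C) by (apply RtoC_neq0; lra).
  assert (Ep : INC p = (2 * INC h + 1)%C) by apply INC_odd.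
  assert (PZ2 : (2 * INC h + 1)%C <> 0%C) by (rewrite <- Ep; auto).
  unfold wgt, al. rewrite minus_INR by auto. apply (ex_eq _ _ (Z.of_nat h + 2 - Z.of_nat j)).
  rewrite !RtoC_div, IZC_minus, IZC_plus, RtoC_minus by lra. unfold IZC. rewrite <- !INR_IZR_INZ, Ep. field. auto.
Qed.

Lemma al_refl p j : (0 < p)%nat -> (j <= p)%nat -> al p (p - j) = - al p j + 1.
Proof. intros hp hj. unfold al. rewrite minus_INR by auto. field. apply not_0_INR. lia. Qed.

Lemma al_0 p : al p 0 = 0. Proof. unfold al. apply Rdiv_0_l. Qed.

(** The coefficient of [B 0] when [asd_theta] is summed over [al = k/p]. *)
Definition Gam (h : nat) (t : C) : C := (1 + Csum (fun k => ex (INC (S k) / 2)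
  * (theta (2 * RtoC (al (2 * h + 1) (S k))) t / theta (RtoC (al (2 * h + 1) (S k))) t)) h)%C.

Lemma nonlat_rat h t (k : nat) : upper_half t -> (0 < k < 2 * h + 1)%nat -> nonlat (RtoC (al (2 * h + 1) k)) t.
Proof. intros. apply nonlat_R; auto. apply al_range; auto. Qed.

Lemma al_double p k : (2 * RtoC (al p k))%C = RtoC (al p (2 * k)).
Proof. unfold al. rewrite mult_INR. simpl INR. rewrite <- RtoC_mult. f_equal. unfold Rdiv. ring. Qed.

Lemma asd_all_k h x t : upper_half t -> (forall m : Z, nonlat (RtoC (IZR m / INR (2 * h + 1) + x)) t) ->
  Csum (fun k => wgt (2 * h + 1) k * B (RtoC (al (2 * h + 1) k)) (RtoC x) t)%C (2 * h + 1)
  = (Gam h t * B (RtoC 0) (RtoC x) t + ex (- (3 * RtoC x / 2))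
     * Csum (fun k => ex (INC (S k) / 2) * Psi (RtoC (al (2 * h + 1) (S k))) (RtoC x) t) h)%C.
Proof.
  intros ht H. set (p := (2 * h + 1)%nat) in *.
  assert (hp : 0 < INR p) by (apply lt_0_INR; unfold p; lia).
  etransitivity; [apply Csum_pair|]. unfold Gam. fold p. rewrite al_0.
  replace (wgt p 0) with (RtoC 1).
  2: { symmetry. unfold wgt. rewrite al_0, <- ex_0. f_equal. simpl INR. field. }
  rewrite Cmult_plus_distr_r, <- Cplus_assoc. f_equal.
  rewrite <- Csum_scal, Cmult_comm, <- Csum_scal, <- Csum_plus. apply Csum_ext. intros k hk.
  set (a := RtoC (al p (S k))). set (j := INC (S k)).
  replace (2 * h - k)%nat with (p - S k)%nat by (unfold p; lia).
  replace (wgt p (p - S k)) with (ex (INC (S k) / 2 - 3 * RtoC (al p (S k)) / 2)) by (symmetry; apply wgt_refl; lia).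
  rewrite al_refl by (unfold p; lia).
  rewrite RtoC_plus, RtoC_opp, B_period. pose proof (asd_theta t (RtoC x) a ht) as A.
  assert (N1 : nonlat a t) by (apply nonlat_rat; auto; lia).
  assert (N2 : nonlat (2 * a) t) by (unfold a; rewrite al_double; apply nonlat_rat; auto; lia).
  assert (N3 : nonlat (RtoC x) t).
  { specialize (H 0%Z). replace (IZR 0 / INR p + x) with x in H by (field; lra). auto. }
  assert (N4 : nonlat (RtoC x - a) t).
  { specialize (H (- Z.of_nat (S k))%Z). unfold a, al. rewrite <- RtoC_minus. rewrite opp_IZR, <- INR_IZR_INZ in H.
    replace (x - INR (S k) / INR p) with (- INR (S k) / INR p + x) by (field; lra). auto. }
  assert (N5 : nonlat (RtoC x + a) t).
  { specialize (H (Z.of_nat (S k))%Z). unfold a, al. rewrite <- RtoC_plus. rewrite <- INR_IZR_INZ in H.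
    rewrite Rplus_comm. auto. }
  specialize (A N1 N2 N3 N4 N5).
  assert (A' : (ex (3 * a / 2) * B a (RtoC x) t + ex (- (3 * a / 2)) * B (- a) (RtoC x) t)%C
    = (theta (2 * a) t / theta a t * B 0 (RtoC x) t + ex (- (3 * RtoC x / 2)) * Psi a (RtoC x) t)%C).
  { rewrite <- A. ring. }
  unfold wgt. fold a j.
  replace (j / 2 - 3 * a / 2)%C with (j / 2 + - (3 * a / 2))%C by ring. rewrite !ex_plus.
  transitivity (ex (j / 2) * (ex (3 * a / 2) * B a (RtoC x) t + ex (- (3 * a / 2)) * B (- a) (RtoC x) t))%C; [ring|].
  rewrite A'. ring.
Qed.

Lemma Clim_Csum (u : nat -> nat -> C) l n : (forall k, (k < n)%nat -> Clim (fun m => u m k) (l k)) ->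
  Clim (fun m => Csum (u m) n) (Csum l n).
Proof. intros H. induction n as [|n IH]; [exact (Clim_const (RtoC 0))|]. simpl. apply Clim_plus; auto. Qed.

Lemma Clim_RtoC_shift (s : nat -> R) x : Clim (fun m => RtoC (s m)) 0%C -> Clim (fun m => RtoC (x + s m)) (RtoC x).
Proof.
  intros H. apply Clim_ext with (fun m => (RtoC x + RtoC (s m))%C); [intros; rewrite RtoC_plus; auto|].
  replace (RtoC x) with (RtoC x + 0)%C at 1 by ring. apply Clim_plus; auto. apply Clim_const.
Qed.

(** The part of the identity that stays continuous as [x] tends to [1/p]. *)
Definition psi_tail (p g : nat) (x t : C) : C :=
  Csum (fun k => ex (INC (S (S k)) / 2) * Psi (RtoC (al p (S (S k)))) x t)%C g.

Definition regular_part (g : nat) (t : C) (x : R) : C :=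
  let h := S g in let p := (2 * h + 1)%nat in
  (Csum (fun k => wgt p k * Bstar (RtoC (al p k)) (RtoC x) t) p
   + Csum (fun k => wgt p k * / (1 - ex (RtoC x + RtoC (al p k)))) (2 * h)
   - Gam h t * B (RtoC 0) (RtoC x) t
   - ex (- (3 * RtoC x / 2)) * psi_tail p g (RtoC x) t)%C.

Section RootLimit.
Variables (g : nat) (t : C).
Hypothesis ht : upper_half t.
Let h := S g.
Let p := (2 * h + 1)%nat.
Let b1 := RtoC (al p 1).

Lemma INRp_pos : 0 < INR p. Proof. apply lt_0_INR. unfold p. lia. Qed.

Lemma INRp_neq0 : INR p <> 0. Proof. apply Rgt_not_eq, INRp_pos. Qed.

Lemma al_sum j k : al p j + al p k = al p (j + k).
Proof. unfold al. rewrite plus_INR. field. apply INRp_neq0. Qed.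

Lemma nonlat_1p (s : R) : 0 < Rabs s < / INR p -> forall m : Z, nonlat (RtoC (IZR m / INR p + (al p 1 + s))) t.
Proof.
  intros hs m. replace (IZR m / INR p + (al p 1 + s)) with (IZR (m + 1) / INR p + s).
  - apply nonlat_near; auto. unfold p; lia.
  - rewrite plus_IZR. unfold al. simpl. field. apply INRp_neq0.
Qed.

Lemma nonlat_shift_al (s : R) k : 0 < Rabs s < / INR p -> nonlat (RtoC (al p 1 + s) + RtoC (al p k)) t.
Proof.
  intros hs. pose proof (nonlat_1p s hs (Z.of_nat k)) as N. rewrite <- INR_IZR_INZ in N.
  rewrite <- RtoC_plus, Rplus_comm. exact N.
Qed.

Lemma nonlat_shift_al_minus (s : R) k : 0 < Rabs s < / INR p -> nonlat (RtoC (al p 1 + s) - RtoC (al p k)) t.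
Proof.
  intros hs. pose proof (nonlat_1p s hs (- Z.of_nat k)) as N. rewrite opp_IZR, <- INR_IZR_INZ in N.
  rewrite <- RtoC_minus. replace (al p 1 + s - al p k) with (- INR k / INR p + (al p 1 + s)); auto.
  unfold al. field. apply INRp_neq0.
Qed.

Lemma nonlat_shift0 (s : R) : 0 < Rabs s < / INR p -> nonlat (RtoC (al p 1 + s)) t.
Proof.
  intros hs. pose proof (nonlat_shift_al s 0 hs) as N. rewrite al_0, Cplus_0_r in N. auto.
Qed.

Lemma nonlat_base_al k : (k < 2 * h)%nat -> nonlat (RtoC (al p 1) + RtoC (al p k)) t.
Proof. intros hk. rewrite <- RtoC_plus, al_sum. apply nonlat_R; auto. apply al_range. unfold p. lia. Qed.

Lemma nonlat_base_minus k : (2 <= k < 2 * h)%nat -> nonlat (RtoC (al p 1) - RtoC (al p k)) t.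
Proof.
  intros hk. replace (RtoC (al p 1) - RtoC (al p k))%C with (- RtoC (al p (k - 1)))%C.
  - apply nonlat_opp, nonlat_R; auto. apply al_range. unfold p. lia.
  - rewrite <- RtoC_opp, <- RtoC_minus. f_equal. unfold al. rewrite minus_INR by lia. simpl (INR 1). field. apply INRp_neq0.
Qed.

Lemma regular_part_lim (s : nat -> R) : Clim (fun m => RtoC (s m)) 0%C -> (forall m, 0 < Rabs (s m) < / INR p) ->
  Clim (fun m => regular_part g t (al p 1 + s m)) (regular_part g t (al p 1)).
Proof.
  intros Hs Hb. pose proof (Clim_RtoC_shift s (al p 1) Hs) as Hv.
  assert (E1 : forall k, (k < 2 * h)%nat -> Clim (fun m => / (1 - ex (RtoC (al p 1 + s m) + RtoC (al p k))))%C (/ (1 - ex (RtoC (al p 1) + RtoC (al p k))))%C).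
  { intros k hk. apply Clim_inv.
    - apply Clim_minus; [apply Clim_const|]. apply (Clim_ex_real (fun m => al p 1 + s m)); auto.
    - apply one_minus_neq0. pose proof (nonlat_base_al k hk 0%Z) as N. rewrite Cmult_0_l, Cplus_0_r in N. auto.
    - intros m. apply one_minus_neq0. pose proof (nonlat_shift_al (s m) k (Hb m) 0%Z) as N.
      rewrite Cmult_0_l, Cplus_0_r in N. auto. }
  apply Clim_minus; [apply Clim_minus; [apply Clim_plus|]|].
  - apply Clim_Csum. intros k hk. apply Clim_scal. apply (Bstar_cont (al p k) (al p 1) t (fun m => al p 1 + s m)); auto.
  - apply Clim_Csum. intros k hk. apply Clim_scal. auto.
  - apply Clim_scal. specialize (E1 O ltac:(unfold h; lia)).
    rewrite al_0 in E1.
    rewrite (B_Bstar 0 (al p 1)); auto.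
    2: { pose proof (nonlat_base_al 0 ltac:(unfold h; lia)) as N. rewrite al_0 in N. auto. }
    eapply Clim_ext; [|apply Clim_plus; [apply (Bstar_cont 0 (al p 1) t (fun m => al p 1 + s m)); auto|apply E1]].
    intros m. symmetry. apply B_Bstar; auto.
    pose proof (nonlat_shift_al (s m) 0 (Hb m)) as N. rewrite al_0 in N. auto.
  - apply Clim_mult.
    + apply (Ccont_lim (fun u => ex (- (3 * u / 2))) (RtoC (al p 1)) (fun m => RtoC (al p 1 + s m))); auto.
      eapply Cder_cont. apply (Cder_ext (fun u => ex ((- (3) / 2) * u + 0))); [intros; f_equal; field|]. apply Cder_ex_lin.
    + apply Clim_Csum. intros k hk. apply Clim_scal. apply (Psi_cont _ _ _ (fun m => RtoC (al p 1 + s m))); auto.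
      * apply nonlat_base_minus. unfold h; lia.
      * apply nonlat_R; auto. apply al_range. unfold p, h; lia.
      * apply nonlat_base_al. unfold h; lia.
      * intros m. apply nonlat_shift_al_minus; auto.
      * intros m. apply nonlat_shift0; auto.
      * intros m. apply nonlat_shift_al; auto.
Qed.

Definition hfun (s : C) : C := (ex (- (3 * s / 2)) / (theta (b1 + s) t * theta (2 * b1 + s) t))%C.

(** The term [n = 0], [k = p - 1] is the only singular one on the left; on the right
    it is the one with [Psi] at [al = 1/p]. *)
Lemma regular_part_eq (s : R) : 0 < Rabs s < / INR p ->
  (regular_part g t (al p 1 + s) + wgt p (2 * h) / (1 - ex (RtoC s)))%C =
  (ex (- (3 * b1 / 2)) * (eta t * eta t * eta t) * (theta b1 t * theta (2 * b1) t) * (hfun (RtoC s) / theta (RtoC s) t))%C.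
Proof.
  intros hs. pose proof (asd_all_k h (al p 1 + s) t ht (nonlat_1p s hs)) as A. fold p in A.
  pose proof INRp_pos as hp.
  rewrite (Csum_ext _ (fun k => wgt p k * Bstar (RtoC (al p k)) (RtoC (al p 1 + s)) t + wgt p k * / (1 - ex (RtoC (al p 1 + s) + RtoC (al p k))))%C) in A.
  2: { intros k hk. rewrite (B_Bstar (al p k)); auto; [ring|]. apply nonlat_shift_al; auto. }
  rewrite Csum_plus in A.
  assert (CE : forall F, Csum F p = (Csum F (2 * h) + F (2 * h)%nat)%C).
  { intros F. replace p with (S (2 * h)) by (unfold p; lia). reflexivity. }
  replace (Csum (fun k => wgt p k * / (1 - ex (RtoC (al p 1 + s) + RtoC (al p k))))%C p)
    with (Csum (fun k => wgt p k * / (1 - ex (RtoC (al p 1 + s) + RtoC (al p k))))%C (2 * h) + wgt p (2 * h) / (1 - ex (RtoC s)))%C in A.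
  2: { symmetry. rewrite (CE (fun k => wgt p k * / (1 - ex (RtoC (al p 1 + s) + RtoC (al p k))))%C). f_equal.
    unfold Cdiv. f_equal. f_equal. f_equal. apply (ex_eq _ _ 1).
    unfold IZC. rewrite <- !RtoC_plus. f_equal.
    replace (al p 1 + s + al p (2 * h)) with (s + (al p 1 + al p (2 * h))) by ring. rewrite al_sum.
    replace (1 + 2 * h)%nat with p by (unfold p; lia). unfold al. f_equal. field. lra. }
  change (Csum (fun k => ex (INC (S k) / 2) * Psi (RtoC (al p (S k))) (RtoC (al p 1 + s)) t)%C h)
    with (Csum (fun k => ex (INC (S k) / 2) * Psi (RtoC (al p (S k))) (RtoC (al p 1 + s)) t)%C (S g)) in A.
  rewrite Csum_first in A. change (Csum _ g) with (psi_tail p g (RtoC (al p 1 + s)) t) in A. unfold regular_part. fold h. fold p.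
  set (X1 := Csum (fun k => wgt p k * Bstar (RtoC (al p k)) (RtoC (al p 1 + s)) t)%C p) in *.
  set (X2 := Csum (fun k => wgt p k * / (1 - ex (RtoC (al p 1 + s) + RtoC (al p k))))%C (2 * h)) in *.
  set (X3 := psi_tail _ _ _ _) in *.
  set (X4 := (wgt p (2 * h) / (1 - ex (RtoC s)))%C) in *.
  replace (X1 + X2 - Gam h t * B (RtoC 0) (RtoC (al p 1 + s)) t - ex (- (3 * RtoC (al p 1 + s) / 2)) * X3 + X4)%C
    with ((X1 + (X2 + X4)) - Gam h t * B (RtoC 0) (RtoC (al p 1 + s)) t - ex (- (3 * RtoC (al p 1 + s) / 2)) * X3)%C by ring.
  rewrite A. transitivity (ex (- (3 * RtoC (al p 1 + s) / 2)) * (ex (RtoC (INR 1) / 2) * Psi b1 (RtoC (al p 1 + s)) t))%C; [unfold b1; ring|].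
  unfold Psi, hfun.
  replace (RtoC (INR 1) / 2)%C with (RtoC (1/2)) by (rewrite RtoC_half; reflexivity). rewrite ex_half.
  rewrite RtoC_plus. fold b1. replace (b1 + RtoC s - b1)%C with (RtoC s) by ring.
  replace (b1 + RtoC s + b1)%C with (2 * b1 + RtoC s)%C by ring.
  replace (- (3 * (b1 + RtoC s) / 2))%C with (- (3 * b1 / 2) + - (3 * RtoC s / 2))%C by field. rewrite ex_plus.
  assert (N1 : theta (RtoC s) t <> 0%C).
  { apply theta_neq0; auto. pose proof (nonlat_shift_al_minus s 1 hs) as N. rewrite <- RtoC_minus in N.
    replace (al p 1 + s - al p 1) with s in N by ring. auto. }
  assert (N2 : theta (b1 + RtoC s) t <> 0%C) by (apply theta_neq0; auto; unfold b1; rewrite <- RtoC_plus; apply nonlat_shift0; auto).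
  assert (N3 : theta (2 * b1 + RtoC s) t <> 0%C).
  { apply theta_neq0; auto. pose proof (nonlat_shift_al s 1 hs) as N. rewrite RtoC_plus in N. fold b1 in N.
    replace (b1 + RtoC s + b1)%C with (2 * b1 + RtoC s)%C in N by ring. auto. }
  field. auto.
Qed.

Definition Zlog (u : C) : C := (thetap u t / theta u t)%C.

Definition hfun' : C := / (theta b1 t * theta (2 * b1) t) * (- (3 * RtoC PI * Ci) - Zlog b1 - Zlog (2 * b1))%C.

Lemma theta_b1 : theta b1 t <> 0%C /\ theta (2 * b1) t <> 0%C.
Proof. split; apply theta_neq0; auto; unfold b1; rewrite ?al_double; apply nonlat_rat; auto; unfold h; lia. Qed.

Lemma Cder_hfun : Cder hfun 0 hfun'.
Proof.
  destruct theta_b1 as [N2 N3].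
  assert (D : forall c, Cder (fun s => theta (c + s) t) 0 (thetap c t)).
  { intros c. eapply Cder_eq.
    - apply (Cder_comp (fun u => theta u t) (fun s => c + s)%C 0 (thetap (c + 0) t) (0 + 1)%C).
      + apply Cder_theta; auto.
      + apply (Cder_plus (fun _ => c) (fun s => s)); [apply Cder_const|apply Cder_id].
    - rewrite Cplus_0_r. ring. }
  eapply Cder_eq.
  - apply (Cder_div (fun s => ex (- (3 * s / 2))) (fun s => theta (b1 + s) t * theta (2 * b1 + s) t)%C 0
      (twopii * (- (3) / 2) * ex ((- (3) / 2) * 0 + 0))%C).
    + apply (Cder_ext (fun u => ex ((- (3) / 2) * u + 0))); [intros; f_equal; field|]. apply Cder_ex_lin.
    + apply (Cder_mult (fun s => theta (b1 + s) t) (fun s => theta (2 * b1 + s) t)); apply D.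
    + rewrite !Cplus_0_r. apply Cmult_neq_0; auto.
  - rewrite !Cplus_0_r.
    replace (- (3) / 2 * 0)%C with (RtoC 0) by field. replace (- (3 * 0 / 2))%C with (RtoC 0) by field. rewrite ex_0. unfold hfun', Zlog.
    rewrite RtoC_mult. field. auto.
Qed.

(** Let [u] tend to [1/p]; averaging over both sides of [1/p] removes the pole. *)
Theorem identity_at_root :
  (ex (3 * b1 / 2) * Csum (fun k => wgt p k * Bstar (RtoC (al p k)) b1 t) p)%C =
  (Gam h t * ex (3 * b1 / 2) * B (RtoC 0) b1 t
   + psi_tail p g b1 t
   - (Zlog b1 + Zlog (2 * b1)) / twopii)%C.
Proof.
  pose proof INRp_pos as hp.
  set (s := fun m : nat => / (INR m + 2) / INR p).
  assert (Sp : forall m, 0 < s m < / INR p).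
  { intros m. pose proof (pos_INR m). split; [apply Rdiv_lt_0_compat; auto; apply Rinv_0_lt_compat; lra|].
    rewrite <- (Rmult_1_l (/ INR p)). apply Rmult_lt_compat_r; [apply Rinv_0_lt_compat; auto|].
    rewrite <- Rinv_1. apply Rinv_lt_contravar; lra. }
  assert (Slim : Clim (fun m => RtoC (s m)) 0%C).
  { apply Clim_ext with (fun m => (RtoC (/ INR p) * RtoC (/ (INR m + 2)))%C).
    - intros m. rewrite <- RtoC_mult. f_equal. unfold s, Rdiv. ring.
    - replace (RtoC 0) with (RtoC (/ INR p) * 0)%C by ring. apply Clim_scal, Clim_small_real. }
  assert (Slim' : Clim (fun m => RtoC (- s m)) 0%C).
  { apply Clim_ext with (fun m => (- RtoC (s m))%C); [intros; rewrite RtoC_opp; auto|].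
    replace (RtoC 0) with (- 0)%C by ring. apply Clim_opp; auto. }
  assert (Ab : forall m, 0 < Rabs (s m) < / INR p) by (intros m; specialize (Sp m); rewrite Rabs_pos_eq; lra).
  assert (Ab' : forall m, 0 < Rabs (- s m) < / INR p) by (intros m; rewrite Rabs_Ropp; auto).
  pose proof (Clim_plus _ _ _ _ (regular_part_lim s Slim Ab) (regular_part_lim (fun m => - s m) Slim' Ab')) as L1.
  set (c := (ex (- (3 * b1 / 2)) * (eta t * eta t * eta t) * (theta b1 t * theta (2 * b1) t))%C).
  assert (Q : Clim (fun m => (hfun (RtoC (s m)) - hfun (- RtoC (s m))) / theta (RtoC (s m)) t)%C
     (2 * hfun' / thetap 0 t)%C).
  { apply (quotient_Clim (fun s => hfun s - hfun (- s)%C)%C (fun u => theta u t)); auto.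
    - eapply Cder_eq.
      + apply (Cder_minus hfun (fun s => hfun (- s)%C)); [apply Cder_hfun|].
        apply (Cder_comp hfun (fun s => - s)%C 0 hfun' (- (1))%C).
        * replace (- 0)%C with (RtoC 0) by ring. apply Cder_hfun.
        * apply (Cder_ext (fun s => (- (1)) * s)%C); [intros; ring|]. eapply Cder_eq; [apply (Cder_scal (- (1))%C (fun s => s)), Cder_id|]. ring.
      + ring.
    - apply Cder_theta; auto.
    - replace (- 0)%C with (RtoC 0) by ring. ring.
    - apply theta_0; auto.
    - rewrite thetap_0_eta by auto. apply Cmult_neq_0; [apply two_pi_i_neq0|]. apply Cmult_neq_0; [apply Cmult_neq_0|]; apply eta_neq0; auto.
    - intros m. apply RtoC_neq0. specialize (Sp m). lra. }
  assert (L2 : Clim (fun m => regular_part g t (al p 1 + s m) + regular_part g t (al p 1 + - s m))%C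
     (c * (2 * hfun' / thetap 0 t) - wgt p (2 * h))%C).
  { eapply Clim_ext; [|apply Clim_minus; [apply (Clim_scal c), Q|apply Clim_const]].
    intros m. pose proof (regular_part_eq (s m) (Ab m)) as R1. pose proof (regular_part_eq (- s m) (Ab' m)) as R2.
    fold c in R1, R2. rewrite RtoC_opp in R2 at 1. rewrite ex_opp in R2.
    assert (N : ex (RtoC (s m)) <> 1%C).
    { apply ex_neq1_R. specialize (Sp m). split; [lra|]. apply Rlt_le_trans with (/ INR p); [lra|].
      rewrite <- Rinv_1. apply Rinv_le_contravar; [lra|]. rewrite <- INR_1. apply le_INR. unfold p; lia. }
    assert (N1 : (1 - ex (RtoC (s m)))%C <> 0%C) by (apply one_minus_neq0; auto).
    assert (N2 := Cminus_neq0_sym _ _ N1).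
    rewrite RtoC_opp, theta_opp in R2 by auto.
    replace (hfun (- RtoC (s m)) / - theta (RtoC (s m)) t)%C with (- (hfun (- RtoC (s m)) / theta (RtoC (s m)) t))%C in R2.
    2: { field. apply theta_neq0; auto. apply nonlat_R; auto. specialize (Sp m). split; [lra|].
      apply Rlt_le_trans with (/ INR p); [lra|]. rewrite <- Rinv_1. apply Rinv_le_contravar; [lra|]. rewrite <- INR_1. apply le_INR. unfold p; lia. }
    replace (regular_part g t (al p 1 + s m)) with (regular_part g t (al p 1 + s m) + wgt p (2 * h) / (1 - ex (RtoC (s m))) - wgt p (2 * h) / (1 - ex (RtoC (s m))))%C by ring.
    replace (regular_part g t (al p 1 + - s m)) with (regular_part g t (al p 1 + - s m) + wgt p (2 * h) / (1 - / ex (RtoC (s m))) - wgt p (2 * h) / (1 - / ex (RtoC (s m))))%C by ring.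
    rewrite R1, R2.
    replace (wgt p (2 * h)) with (wgt p (2 * h) / (1 - ex (RtoC (s m))) + wgt p (2 * h) / (1 - / ex (RtoC (s m))))%C at 1.
    - unfold Cdiv. ring.
    - field. split; [|split]; auto. apply ex_neq0. }
  pose proof (Clim_unique _ _ _ L1 L2) as E. clear L1 L2 Q.
  assert (EW : (ex (3 * b1 / 2) * wgt p (2 * h))%C = (- (1))%C).
  { rewrite <- ex_half. unfold wgt. rewrite <- ex_plus. apply (ex_eq _ _ (Z.of_nat h + 1)). rewrite IZC_plus. unfold IZC. rewrite <- INR_IZR_INZ.
    unfold b1, al. rewrite RtoC_half, !RtoC_div by lra. unfold p. rewrite plus_INR, mult_INR. simpl (INR 2).
    replace (1 + 1) with 2 by ring. rewrite RtoC_plus, RtoC_mult. field.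
    assert (NN : (2 * INC h + 1)%C <> 0%C).
    { rewrite <- RtoC_mult, <- RtoC_plus. apply RtoC_neq0, Rgt_not_eq. pose proof (pos_INR h). lra. }
    auto. }
  assert (ES : (ex (3 * b1 / 2) * Csum (fun k => wgt p k * / (1 - ex (b1 + RtoC (al p k)))) (2 * h))%C = (- (1))%C).
  { rewrite <- Csum_scal.
    transitivity (Csum (fun k => (- (1)) * (wgt p (S k) / (1 - ex (RtoC (al p (S k))))))%C (2 * h)).
    - apply Csum_ext. intros k hk. unfold b1. rewrite <- RtoC_plus, al_sum. unfold Cdiv. rewrite !Cmult_assoc. f_equal.
      rewrite <- ex_half. unfold wgt. rewrite <- !ex_plus. apply (ex_eq _ _ (-1)%Z). unfold IZC.
      change (S k) with (1 + k)%nat. rewrite <- al_sum. rewrite plus_INR, !RtoC_plus, RtoC_half. simpl (INR 1). field.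
    - rewrite (Csum_scal (- (1))%C (fun k => wgt p (S k) / (1 - ex (RtoC (al p (S k)))))%C).
      change (fun k => wgt p (S k) / (1 - ex (RtoC (al p (S k)))))%C with (fun k => wgt (2 * h + 1) (S k) / (1 - ex (RtoC (al (2 * h + 1) (S k)))))%C. rewrite sigma_one by (unfold h; lia). ring. }
  assert (C1 : (ex (3 * b1 / 2) * c * (2 * hfun' / thetap 0 t))%C
    = (- (3) - 2 * ((Zlog b1 + Zlog (2 * b1)) / twopii))%C).
  { unfold c. rewrite thetap_0_eta, ex_opp by auto.
    destruct theta_b1 as [N2 N3]. unfold hfun'.
    pose proof (eta_neq0 t ht). pose proof (ex_neq0 (3 * b1 / 2)). rewrite RtoC_mult.
    assert (RtoC PI <> 0%C) by (apply RtoC_neq0; pose proof PI_RGT_0; lra).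
    assert (Ci <> 0%C) by apply Ci_neq0.
    field. repeat split; auto. }
  unfold regular_part in E. fold h in E. fold p in E. fold b1 in E.
  apply (f_equal (fun z => ex (3 * b1 / 2) * z)%C) in E. set (X1 := Csum (fun k => wgt p k * Bstar (RtoC (al p k)) b1 t)%C p) in *.
  set (X2 := Csum (fun k => wgt p k * / (1 - ex (b1 + RtoC (al p k))))%C (2 * h)) in *.
  set (X3 := psi_tail _ _ _ _) in *.
  set (X4 := (c * (2 * hfun' / thetap 0 t))%C) in *.
  set (ee := ex (3 * b1 / 2)) in *.
  assert (C1' : (ee * X4)%C = (- (3) - 2 * ((Zlog b1 + Zlog (2 * b1)) / twopii))%C) by (rewrite <- C1; unfold X4, Cdiv; ring).
  replace (ee * (X4 - wgt p (2 * h)))%C with (ee * X4 - ee * wgt p (2 * h))%C in E by ring. rewrite C1', EW in E.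
  rewrite ex_opp in E. fold ee in E. assert (N : ee <> 0%C) by apply ex_neq0.
  assert (E' : (2 * (ee * X1) + 2 * (ee * X2) - 2 * (Gam h t * ee * B (RtoC 0) b1 t) - 2 * X3)%C =
    (- (3) - 2 * ((Zlog b1 + Zlog (2 * b1)) / twopii) - - (1))%C).
  { rewrite <- E. field. auto. }
  rewrite ES in E'.
  assert (F : (2 * (ee * X1))%C = (2 * (Gam h t * ee * B (RtoC 0) b1 t + X3 - (Zlog b1 + Zlog (2 * b1)) / twopii))%C).
  { transitivity ((2 * (ee * X1) + 2 * - (1) - 2 * (Gam h t * ee * B (RtoC 0) b1 t) - 2 * X3) + 2 + 2 * (Gam h t * ee * B (RtoC 0) b1 t) + 2 * X3)%C; [ring|].
    rewrite E'. ring. }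
  replace (ee * X1)%C with (2 * (ee * X1) / 2)%C by field. rewrite F.
  set (Q := ((Zlog b1 + Zlog (2 * b1)) / twopii)%C). field.
Qed.
End RootLimit.

(** * Sums over roots of unity *)

Lemma ex_ratio_neq1 (p : nat) (a : Z) : (0 < p)%nat -> ~ (Z.of_nat p | a)%Z -> ex (IZC a / INC p) <> RtoC 1.
Proof.
  intros hp Ha. assert (hp' : 0 < INR p) by (apply lt_0_INR; auto).
  set (P := Z.of_nat p) in *.
  assert (R : (0 < a mod P < P)%Z).
  { pose proof (Z.mod_pos_bound a P ltac:(unfold P; lia)) as M. destruct (Z.eq_dec (a mod P) 0) as [E|E]; [|lia].
    exfalso. apply Ha. apply Z.mod_divide; auto. unfold P; lia. }
  rewrite (ex_eq _ (RtoC (IZR (a mod P) / INR p)) (a / P)).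
  - apply ex_neq1_R. destruct R as [R1 R2]. apply IZR_lt in R1, R2. unfold P in R2 at 2. rewrite <- INR_IZR_INZ in R2. split.
    + apply Rdiv_lt_0_compat; auto.
    + apply Rmult_lt_reg_r with (INR p); auto. unfold Rdiv. rewrite Rmult_assoc, Rinv_l; lra.
  - rewrite RtoC_div by lra. pose proof (Z.div_mod a P ltac:(unfold P; lia)) as D.
    assert (D' : IZC a = (INC p * IZC (a / P) + IZC (a mod P))%C).
    { rewrite D at 1. rewrite IZC_plus, IZC_mult. f_equal. f_equal. unfold IZC, P. rewrite <- INR_IZR_INZ. auto. }
    rewrite D'. unfold IZC. field. apply RtoC_neq0; lra.
Qed.

Lemma Csum_const c n : Csum (fun _ => c) n = (INC n * c)%C.
Proof. induction n as [|n IH]; [simpl; ring|]. rewrite S_INR, RtoC_plus. simpl Csum. rewrite IH. ring. Qed.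

Lemma root_sum (p : nat) (a : Z) : (0 < p)%nat ->
  Csum (fun k => ex (INC k * (IZC a / INC p))) p = if Zdivide_dec (Z.of_nat p) a then INC p else RtoC 0.
Proof.
  intros hp. assert (PZ : INC p <> 0%C) by (apply RtoC_neq0, not_0_INR; lia).
  destruct (Zdivide_dec (Z.of_nat p) a) as [[b E]|N].
  - rewrite (Csum_ext _ (fun _ => RtoC 1)), Csum_const; [ring|]. intros k hk.
    replace (INC k * (IZC a / INC p))%C with (IZC (Z.of_nat k * b)); [apply ex_Z|].
    rewrite E, !IZC_mult. unfold IZC. rewrite <- !INR_IZR_INZ. field. auto.
  - apply geometric_root; [|apply ex_ratio_neq1; auto].
    replace (INC p * (IZC a / INC p))%C with (IZC a) by (field; auto). apply ex_Z.
Qed.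

Lemma zsums_class (p : nat) f n0 l : (0 < p)%nat -> zsummable f -> (forall n, ~ (Z.of_nat p | n - n0)%Z -> f n = RtoC 0) ->
  zsums (fun m => f (n0 + Z.of_nat p * m)%Z) l -> zsums f l.
Proof.
  intros hp Hf H0 Hl. set (P := Z.of_nat p) in *. assert (hP : (0 < P)%Z) by (unfold P; lia).
  pose proof (Z.div_mod n0 P ltac:(lia)) as D. pose proof (Z.mod_pos_bound n0 P hP) as M.
  assert (R := zsums_residues p f (fun a => if Nat.eq_dec a (Z.to_nat (n0 mod P)) then l else RtoC 0) hp Hf).
  rewrite (Csum_single _ p (Z.to_nat (n0 mod P))) in R.
  - destruct (Nat.eq_dec (Z.to_nat (n0 mod P)) (Z.to_nat (n0 mod P))); [|congruence]. apply R. intros a ha.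
    destruct (Nat.eq_dec a (Z.to_nat (n0 mod P))) as [->|Na].
    + apply (zsums_addn _ _ (- (n0 / P))) in Hl. eapply zsums_ext; [|apply Hl]. intros m. cbv beta. f_equal. rewrite Z2Nat.id by lia. lia.
    + eapply zsums_ext; [|apply zsums_zero]. intros m. symmetry. apply H0. intros [c Hc]. apply Na.
      assert (Q : ((n0 + c * P) mod P = n0 mod P)%Z) by (apply Z.mod_add; lia).
      replace (n0 + c * P)%Z with (Z.of_nat a + m * P)%Z in Q by lia. rewrite Z.mod_add in Q by lia.
      rewrite Z.mod_small in Q by lia. rewrite <- Q. lia.
  - apply Nat2Z.inj_lt. rewrite Z2Nat.id; lia.
  - intros k _ hk. destruct (Nat.eq_dec k (Z.to_nat (n0 mod P))); [contradiction|auto].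
Qed.

Lemma bsum_period i a t : upper_half t -> bsum i (a + 1) t = bsum i a t.
Proof.
  intros h. apply (zsums_unique _ _ _ (zsums_bsum i (a + 1) t h)).
  eapply zsums_ext; [|apply (zsums_bsum i a t h)]. intros n. cbv beta. f_equal. unfold asd_num.
  apply (ex_eq _ _ (- (3 * n))). rewrite IZC_opp, IZC_mult. unfold IZC. ring.
Qed.

Lemma upper_scale x t : 0 < x -> upper_half t -> upper_half (RtoC x * t)%C.
Proof. unfold upper_half. intros hx h. rewrite Im_Rmult. apply Rmult_lt_0_compat; auto. Qed.

(** [Gam] is a ratio of eta values: by the quintuple product identity it filters the
    pentagonal series by the condition that [p] divides [6n+1]. *)
Theorem Gam_eta h t (e n0 : Z) : upper_half t -> (e = 1 \/ e = -1)%Z -> (6 * n0 + 1 = e * Z.of_nat (2 * h + 1))%Z ->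
  Gam h t = (INC (2 * h + 1) * ex (IZC n0 / 2) * (eta (RtoC (INR (2 * h + 1) ^ 2) * t) / eta t))%C.
Proof.
  intros ht he hn. set (p := (2 * h + 1)%nat) in *.
  assert (hp : 0 < INR p) by (apply lt_0_INR; unfold p; lia).
  assert (PZ : INC p <> 0%C) by (apply RtoC_neq0; lra).
  assert (Ep : INC p = (2 * INC h + 1)%C) by apply INC_odd.
  assert (PZ2 : (2 * INC h + 1)%C <> 0%C) by (rewrite <- Ep; auto).
  assert (Zp : IZC (Z.of_nat p) = INC p) by (unfold IZC; rewrite <- INR_IZR_INZ; auto).
  set (w := (RtoC (INR p ^ 2) * t)%C). assert (hw : upper_half w) by (apply upper_scale; auto; apply pow_lt; auto).
  set (x := fun k => (INC k / 2 + RtoC (al p k) / 2)%C).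
  assert (E1 : (Gam h t * bsum 1 0 t)%C = Csum (fun k => ex (x k) * bsum 1 (RtoC (al p k)) t)%C p).
  { symmetry. etransitivity; [apply Csum_pair|]. unfold Gam. fold p. rewrite Cmult_plus_distr_r. f_equal.
    - unfold x. rewrite al_0. simpl INR. replace (0 / 2 + 0 / 2)%C with (RtoC 0) by field. rewrite ex_0. auto.
    - rewrite (Cmult_comm (Csum _ _)), <- Csum_scal. apply Csum_ext. intros k hk.
      replace (2 * h - k)%nat with (p - S k)%nat by (unfold p; lia). set (a := RtoC (al p (S k))).
      replace (RtoC (al p (p - S k))) with (- a + 1)%C by (unfold a; rewrite al_refl by (unfold p; lia); rewrite RtoC_plus, RtoC_opp; auto).
      rewrite bsum_period by auto.
      replace (ex (x (p - S k)%nat)) with (ex (INC (S k) / 2) * ex (- (a / 2)))%C.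
      2: { rewrite <- ex_plus. unfold x. rewrite al_refl by (unfold p; lia). rewrite RtoC_plus, RtoC_opp. fold a.
        symmetry. apply (ex_eq _ _ (Z.of_nat h + 1 - Z.of_nat (S k))). rewrite IZC_minus, IZC_plus. unfold IZC. rewrite <- !INR_IZR_INZ.
        rewrite minus_INR by (unfold p; lia). rewrite RtoC_minus, Ep. field. }
      unfold x. fold a. rewrite ex_plus.
      transitivity (ex (INC (S k) / 2) * (theta (2 * a) t / theta a t * bsum 1 0 t))%C; [|ring].
      rewrite quintuple_product; auto; [ring|unfold a; apply nonlat_rat; auto; lia|unfold a; rewrite al_double; apply nonlat_rat; auto; lia]. }
  assert (E2 : zsums (fun n => Csum (fun k => ex (x k) * (asd_num t (RtoC (al p k)) (IZC n) * ex (- (1 * IZC n * t))))%C p) (Gam h t * bsum 1 0 t)%C).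
  { rewrite E1. apply (zsums_Csum (fun k n => ex (x k) * (asd_num t (RtoC (al p k)) (IZC n) * ex (- (1 * IZC n * t))))%C).
    intros k hk. apply zsums_scal, zsums_bsum; auto. }
  set (f := fun n => (ex (IZC n / 2 + (3 * IZC n * IZC n + IZC n) / 2 * t) * (if Zdivide_dec (Z.of_nat p) (Z.of_nat h + 1 + 3 * n) then INC p else 0))%C).
  assert (E3 : zsums f (Gam h t * bsum 1 0 t)%C).
  { eapply zsums_ext; [|apply E2]. intros n. unfold f. rewrite <- (root_sum p) by (unfold p; lia). rewrite <- Csum_scal.
    apply Csum_ext. intros k hk. unfold asd_num, x. rewrite <- !ex_plus. f_equal. unfold al. rewrite RtoC_div by lra.
    rewrite !IZC_plus, IZC_mult. unfold IZC. rewrite <- !INR_IZR_INZ, Ep.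
    field. auto. }
  assert (E4 : zsums f (INC p * ex (IZC n0 / 2) * ex ((w - t) / 24) * bsum 1 0 w)%C).
  { apply (zsums_class p f n0).
    - unfold p; lia.
    - apply E3.
    - intros n Hn. unfold f. destruct (Zdivide_dec (Z.of_nat p) (Z.of_nat h + 1 + 3 * n)) as [[c Hc]|N]; [|ring].
      exfalso. apply Hn. assert (Q : (Z.of_nat p | 6 * (n - n0))%Z).
      { replace (6 * (n - n0))%Z with (2 * (Z.of_nat h + 1 + 3 * n) - Z.of_nat p - (6 * n0 + 1))%Z by (unfold p; lia).
        rewrite Hc, hn. exists (2 * c - 1 - e)%Z. ring. }
      apply Z.gauss in Q; auto. apply Zgcd_1_rel_prime. apply bezout_rel_prime. apply Bezout_intro with e (- n0)%Z. rewrite <- hn. ring.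
    - assert (Hs : zsums (fun m => INC p * ex (IZC n0 / 2) * ex ((w - t) / 24) * (asd_num w 0 (IZC m) * ex (- (1 * IZC m * w))))%C
        (INC p * ex (IZC n0 / 2) * ex ((w - t) / 24) * bsum 1 0 w)%C) by (apply zsums_scal, zsums_bsum; auto).
      assert (En : (6 * IZC n0)%C = (IZC e * INC p - 1)%C).
      { rewrite <- Zp, <- IZC_mult, <- hn, IZC_plus, IZC_mult. unfold IZC. ring. }
      assert (Ee : (IZC e * IZC e = 1)%C) by (rewrite <- IZC_mult; destruct he as [-> | ->]; reflexivity).
      assert (K : forall m, f (n0 + Z.of_nat p * (e * m))%Z = (INC p * ex (IZC n0 / 2) * ex ((w - t) / 24) * (asd_num w 0 (IZC m) * ex (- (1 * IZC m * w))))%C).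
      { intros m. unfold f. destruct (Zdivide_dec (Z.of_nat p) (Z.of_nat h + 1 + 3 * (n0 + Z.of_nat p * (e * m)))) as [D|N].
        - rewrite Cmult_comm, <- !Cmult_assoc. f_equal. unfold asd_num. rewrite <- !ex_plus.
          apply (ex_eq _ _ (- m + (if Z.eq_dec e 1 then Z.of_nat h * m + m else - (Z.of_nat h * m)))).
          assert (Hw : w = (INC p * INC p * t)%C) by (unfold w; simpl; rewrite Rmult_1_r, RtoC_mult; ring).
          rewrite Hw, IZC_plus, IZC_mult, Zp, IZC_mult.
          transitivity (IZC n0 / 2 + INC p * (IZC e * IZC m) / 2 + ((6 * IZC n0 + 1 + 6 * INC p * IZC e * IZC m) * (6 * IZC n0 + 1 + 6 * INC p * IZC e * IZC m) - 1) / 24 * t)%C; [field|].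
          replace (6 * IZC n0 + 1 + 6 * INC p * IZC e * IZC m)%C with (IZC e * (INC p * (1 + 6 * IZC m)))%C by (rewrite En; ring).
          replace (IZC e * (INC p * (1 + 6 * IZC m)) * (IZC e * (INC p * (1 + 6 * IZC m))))%C with ((IZC e * IZC e) * (INC p * INC p * (1 + 6 * IZC m) * (1 + 6 * IZC m)))%C by ring.
          rewrite Ee, IZC_plus, IZC_opp. destruct he as [-> | ->]; simpl Z.eq_dec; cbv iota.
          + rewrite IZC_plus, IZC_mult. unfold IZC. rewrite <- !INR_IZR_INZ, Ep. field.
          + rewrite IZC_opp, IZC_mult. unfold IZC. rewrite <- !INR_IZR_INZ, Ep. field.
        - exfalso. apply N.
          assert (Q : (Z.of_nat p | 2 * (Z.of_nat h + 1 + 3 * (n0 + Z.of_nat p * (e * m))))%Z).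
          { replace (2 * (Z.of_nat h + 1 + 3 * (n0 + Z.of_nat p * (e * m))))%Z with (Z.of_nat p + (6 * n0 + 1) + 6 * Z.of_nat p * (e * m))%Z by (unfold p; lia).
            rewrite hn. exists (1 + e + 6 * (e * m))%Z. ring. }
          apply Z.gauss in Q; auto. apply Zgcd_1_rel_prime, bezout_rel_prime. apply Bezout_intro with 1%Z (- Z.of_nat h)%Z. lia. }
      destruct he as [-> | ->].
      + eapply zsums_ext; [|apply Hs]. intros m. cbv beta. rewrite <- K. f_equal. ring.
      + apply zsums_neg in Hs. eapply zsums_ext; [|apply Hs]. intros m. cbv beta. rewrite <- K. f_equal. ring. }
  pose proof (zsums_unique _ _ _ E3 E4) as E. rewrite !pentagonal in E by auto.
  pose proof (qinf_tt_neq0 t ht) as NQ. rewrite !eta_qinf. pose proof (ex_neq0 (t / 24)).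
  replace (ex (w / 24)) with (ex ((w - t) / 24) * ex (t / 24))%C by (rewrite <- ex_plus; f_equal; field).
  replace (Gam h t) with (Gam h t * qinf t t / qinf t t)%C by (field; auto). rewrite E. field. auto.
Qed.

Lemma prime_mod6 (p : nat) : prime (Z.of_nat p) -> (3 < p)%nat ->
  exists h e n0, p = (2 * h + 1)%nat /\ (1 < h)%nat /\ (e = 1 \/ e = -1)%Z /\ (6 * n0 + 1 = e * Z.of_nat p)%Z /\ RtoC (chi12 (Z.of_nat p)) = ex (IZC n0 / 2).
Proof.
  intros hp h3. set (P := Z.of_nat p) in *.
  assert (D : forall q, (1 < q < P)%Z -> (P mod q <> 0)%Z).
  { intros q hq E. apply Z.mod_divide in E; [|lia]. destruct (prime_divisors _ hp q E) as [K|[K|[K|K]]]; lia. }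
  pose proof (D 2%Z ltac:(unfold P; lia)) as D2. pose proof (D 3%Z ltac:(unfold P; lia)) as D3.
  pose proof (Z.div_mod P 12 ltac:(lia)) as DM. pose proof (Z.mod_pos_bound P 12 ltac:(lia)) as M.
  assert (cases : (P mod 12 = 1 \/ P mod 12 = 5 \/ P mod 12 = 7 \/ P mod 12 = 11)%Z).
  { set (q := (P / 12)%Z) in *. set (r := (P mod 12)%Z) in *.
    assert (r mod 2 <> 0)%Z by (replace P with (r + (6 * q) * 2)%Z in D2 by lia; rewrite Z.mod_add in D2 by lia; auto).
    assert (r mod 3 <> 0)%Z by (replace P with (r + (4 * q) * 3)%Z in D3 by lia; rewrite Z.mod_add in D3 by lia; auto).
    assert (r = 0 \/ r = 1 \/ r = 2 \/ r = 3 \/ r = 4 \/ r = 5 \/ r = 6 \/ r = 7 \/ r = 8 \/ r = 9 \/ r = 10 \/ r = 11)%Z as K by lia.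
    destruct K as [K|[K|[K|[K|[K|[K|[K|[K|[K|[K|[K|K]]]]]]]]]]]; rewrite K in *; simpl in H, H0; try (exfalso; lia); tauto. }
  set (q := (P / 12)%Z) in *.
  assert (ev : forall n, ex (IZC (2 * n) / 2) = 1%C).
  { intros n. rewrite <- (ex_Z n). f_equal. rewrite IZC_mult. unfold IZC. field. }
  assert (od : forall n, ex (IZC (2 * n + 1) / 2) = (- (1))%C).
  { intros n. rewrite <- ex_half. apply (ex_eq _ _ n). rewrite IZC_plus, IZC_mult, RtoC_half. unfold IZC. field. }
  assert (Hh : exists h, p = (2 * h + 1)%nat /\ (1 < h)%nat).
  { exists (Z.to_nat (P / 2)). pose proof (Z.div_mod P 2 ltac:(lia)). pose proof (Z.mod_pos_bound P 2 ltac:(lia)). lia. }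
  destruct Hh as [h [h1 h2]]. exists h. unfold chi12.
  destruct cases as [K|[K|[K|K]]]; rewrite K in *.
  - exists 1%Z, (2 * q)%Z. rewrite ev. repeat split; auto; lia.
  - exists (-1)%Z, (2 * (- q - 1) + 1)%Z. rewrite od. replace (- (1))%C with (RtoC (-1)) by (rewrite <- RtoC_opp; f_equal; ring). repeat split; auto; lia.
  - exists 1%Z, (2 * q + 1)%Z. rewrite od. replace (- (1))%C with (RtoC (-1)) by (rewrite <- RtoC_opp; f_equal; ring). repeat split; auto; lia.
  - exists (-1)%Z, (2 * (- q - 1))%Z. rewrite ev. repeat split; auto; lia.
Qed.

(** * Residue classes modulo p *)

Lemma geometric_inv (p : nat) (c s : C) : ex (INC p * c) = RtoC 1 -> ex (INC p * s) <> RtoC 1 ->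
  (/ (1 - ex (c + s)))%C = (Csum (fun j => ex (INC j * (c + s))) p / (1 - ex (INC p * s)))%C.
Proof.
  intros Hc Hs. pose proof (geometric_sum (ex (c + s)) p) as G.
  rewrite (Csum_ext _ (fun j => ex (INC j * (c + s)))) in G by (intros; apply pow_ex).
  rewrite pow_ex, (Cmult_plus_distr_l _ c s), (ex_plus (_ * c)), Hc, Cmult_1_l in G.
  assert (D := one_minus_neq0 _ Hs).
  assert (D2 : (1 - ex (c + s))%C <> 0%C) by (intros E; rewrite E, Cmult_0_r in G; auto).
  rewrite <- G. field. split; auto. intros E. rewrite <- G, E in D. apply D. ring.
Qed.

(** Write [1 / (1 - w)] as a geometric sum over [1 - w^p]: the sum over [k] selects one
    of its [p] terms. *)
Lemma discrete_fourier (p : nat) (c : Z) (i : nat) (s : C) : (i < p)%nat -> (Z.of_nat p | c + Z.of_nat i)%Z ->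
  ex (INC p * s) <> RtoC 1 ->
  Csum (fun k => ex (INC k * (IZC c / INC p)) / (1 - ex (INC k / INC p + s)))%C p
  = (INC p * ex (INC i * s) / (1 - ex (INC p * s)))%C.
Proof.
  intros hi hc hs. assert (PZ : INC p <> 0%C) by (apply RtoC_neq0, not_0_INR; lia).
  assert (D := one_minus_neq0 _ hs).
  rewrite (Csum_ext _ (fun k => / (1 - ex (INC p * s)) * Csum (fun j => ex (INC j * s) * ex (INC k * (IZC (c + Z.of_nat j) / INC p))) p)%C).
  - rewrite Csum_scal, Csum_swap.
    rewrite (Csum_ext _ (fun j => ex (INC j * s) * if Zdivide_dec (Z.of_nat p) (c + Z.of_nat j) then INC p else RtoC 0)%C).
    + rewrite (Csum_single _ p i hi).
      * destruct (Zdivide_dec (Z.of_nat p) (c + Z.of_nat i)); [|contradiction]. field. auto.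
      * intros k hk hki. destruct (Zdivide_dec (Z.of_nat p) (c + Z.of_nat k)) as [d|]; [|ring]. exfalso.
        pose proof (Z.divide_sub_r _ _ _ d hc) as [q Hq]. assert (q = 0)%Z by nia. lia.
    + intros j hj. rewrite Csum_scal, root_sum by lia. auto.
  - intros k hk. unfold Cdiv at 1. rewrite (geometric_inv p).
    + unfold Cdiv at 2. rewrite Cmult_assoc, (Cmult_comm _ (/ (1 - _))). f_equal. rewrite <- Csum_scal. apply Csum_ext. intros j hj.
      rewrite <- !ex_plus. f_equal. rewrite IZC_plus. replace (IZC (Z.of_nat j)) with (INC j) by (unfold IZC; rewrite <- INR_IZR_INZ; auto).
      field. auto.
    + replace (INC p * (INC k / INC p))%C with (IZC (Z.of_nat k)); [apply ex_Z|]. unfold IZC. rewrite <- INR_IZR_INZ. field. auto.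
    + auto.
Qed.

Lemma summable_multiples (p r : nat) a : (r < p)%nat -> summable a -> summable (fun i => a (p * i + r)%nat).
Proof.
  intros hr [h [M HM]]. split; [auto|]. exists M. intros n. eapply Rle_trans; [|apply (HM (p * n)%nat)].
  induction n as [|n IH]; [rewrite Nat.mul_0_r; simpl; lra|]. eapply Rle_trans; [|apply (Rsum_mono a (S (p * n + r)) (p * S n) h); nia].
  simpl Rsum. pose proof (Rsum_mono a (p * n) (p * n + r) h ltac:(lia)). lra.
Qed.

Lemma zsummable_multiples (p : nat) f : (0 < p)%nat -> zsummable f -> zsummable (fun m => f (Z.of_nat p * m)%Z).
Proof.
  intros hp [H1 H2]. split.
  - apply (summable_multiples p 0) in H1; auto. eapply summable_le; [|apply H1]. intros n. split; [apply Cmod_ge_0|].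
    rewrite Nat.add_0_r, Nat2Z.inj_mul. lra.
  - apply (summable_multiples p (p - 1)) in H2; [|lia]. eapply summable_le; [|apply H2]. intros n. split; [apply Cmod_ge_0|].
    replace (-1 - Z.of_nat (p * n + (p - 1)))%Z with (Z.of_nat p * (-1 - Z.of_nat n))%Z by lia. lra.
Qed.

Section Classes.
Variables (g : nat) (t : C).
Hypothesis ht : upper_half t.
Let h := S g.
Let p := (2 * h + 1)%nat.
Let W := (RtoC (INR p ^ 2) * t)%C.
Let P := INC p.

Lemma P_neq0 : P <> 0%C. Proof. apply RtoC_neq0, Rgt_not_eq, lt_0_INR. unfold p. lia. Qed.

Lemma P_eq : P = (2 * INC h + 1)%C.
Proof. unfold P, p. rewrite plus_INR, mult_INR, RtoC_plus, RtoC_mult. reflexivity. Qed.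

Lemma P_eq_neq0 : (2 * INC h + 1)%C <> 0%C. Proof. rewrite <- P_eq. apply P_neq0. Qed.

Lemma P_IZC : IZC (Z.of_nat p) = P. Proof. unfold IZC, P. rewrite <- INR_IZR_INZ. auto. Qed.

Lemma class_IZC l m : IZC (Z.of_nat l + Z.of_nat p * m) = (INC l + P * IZC m)%C.
Proof. rewrite IZC_plus, IZC_mult, P_IZC. unfold IZC. rewrite <- INR_IZR_INZ. auto. Qed.

Lemma W_eq : W = (P * P * t)%C.
Proof. unfold W, P. simpl pow. rewrite Rmult_1_r, RtoC_mult. auto. Qed.

Lemma W_upper : upper_half W.
Proof. apply upper_scale; auto. apply pow_lt, lt_0_INR. unfold p. lia. Qed.

Lemma nonlat_frac (n : Z) : n <> 0%Z -> ex (P * (IZC n * t)) <> RtoC 1.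
Proof.
  intros hn. apply ex_neq1_Im. unfold P, IZC. rewrite !Im_Rmult. apply Rmult_integral_contrapositive_currified.
  - apply Rgt_not_eq, lt_0_INR. unfold p. lia.
  - apply Rmult_integral_contrapositive_currified; [apply not_0_IZR; auto|]. unfold upper_half in ht. lra.
Qed.

Definition layer (n : Z) : C := (ex (3 * RtoC (al p 1) / 2) * Csum (fun k => wgt p k *
  if Z.eq_dec n 0 then RtoC 0 else Bterm (RtoC (al p k)) (RtoC (al p 1)) t n) p)%C.

Lemma layer_0 : layer 0 = RtoC 0.
Proof. unfold layer. rewrite Csum_zero; [ring|]. intros k _. destruct (Z.eq_dec 0 0); [ring|congruence]. Qed.

Lemma zsums_layer : zsums layer (ex (3 * RtoC (al p 1) / 2) * Csum (fun k => wgt p k * Bstar (RtoC (al p k)) (RtoC (al p 1)) t) p)%C.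
Proof.
  apply (zsums_scal _ (fun n => Csum (fun k => wgt p k *
  if Z.eq_dec n 0 then RtoC 0 else Bterm (RtoC (al p k)) (RtoC (al p 1)) t n) p)%C).
  apply (zsums_Csum (fun k n => wgt p k * if Z.eq_dec n 0 then RtoC 0 else Bterm (RtoC (al p k)) (RtoC (al p 1)) t n)%C).
  intros k hk. apply zsums_scal, zsums_Bstar; auto.
Qed.

Lemma alC k : RtoC (al p k) = (INC k / P)%C.
Proof. unfold al. apply RtoC_div. apply Rgt_not_eq, lt_0_INR. unfold p. lia. Qed.

(** The sum over [k] is a sum over roots of unity; [i] is the exponent selected by
    [discrete_fourier]. *)
Lemma layer_closed (n : Z) (i : nat) : n <> 0%Z -> (i < p)%nat -> (Z.of_nat p | Z.of_nat h + 2 + 3 * n + Z.of_nat i)%Z ->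
  layer n = (- P * (ex (IZC n / 2 - 3 * IZC n / P + (3 * IZC n * (IZC n + 1) / 2 + IZC n * INC i) * t)
    / (1 - ex (P * (IZC n * t)))))%C.
Proof.
  intros hn hi hd. pose proof P_neq0 as PZ.
  pose proof (discrete_fourier p _ i (IZC n * t) hi hd (nonlat_frac n hn)) as F. fold P in F.
  set (G := fun k : nat => (ex (INC k * (IZC (Z.of_nat h + 2 + 3 * n) / P)) / (1 - ex (INC k / P + IZC n * t)))%C) in *.
  assert (EG : Csum (fun k => G (S k)) p = Csum G p).
  { pose proof (Csum_first G p) as K. change (Csum G (S p)) with (Csum G p + G p)%C in K.
    replace (G p) with (G O) in K.
    - replace (Csum (fun k => G (S k)) p) with (G O + Csum (fun k => G (S k)) p - G O)%C by ring. rewrite <- K. ring.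
    - unfold G. fold P. simpl (INR 0). f_equal.
      + symmetry. apply (ex_eq _ _ (Z.of_nat h + 2 + 3 * n)). field. auto.
      + f_equal. symmetry. apply (ex_eq _ _ 1). unfold IZC. field. auto. }
  rewrite <- EG in F. unfold layer. rewrite <- Csum_scal.
  rewrite (Csum_ext _ (fun k => (- ex (IZC n / 2 - 3 * IZC n / P + 3 * IZC n * (IZC n + 1) / 2 * t)) * G (S k))%C).
  - rewrite Csum_scal, F. unfold Cdiv.
    replace (IZC n * / 2 - 3 * IZC n * / P + (3 * IZC n * (IZC n + 1) * / 2 + IZC n * INC i) * t)%C
      with ((IZC n * / 2 - 3 * IZC n * / P + 3 * IZC n * (IZC n + 1) * / 2 * t) + INC i * (IZC n * t))%C by ring.
    rewrite (ex_plus (_ - _ + _)). ring.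
  - intros k hk. destruct (Z.eq_dec n 0); [contradiction|]. unfold Bterm, G, Cdiv. rewrite !alC.
    replace (RtoC (INR 1) / P + INC k / P)%C with (INC (S k) / P)%C.
    2: { rewrite S_INR, RtoC_plus. simpl (INR 1). field. auto. }
    rewrite !Cmult_assoc. f_equal.
    replace (- ex (IZC n * / 2 - 3 * IZC n * / P + 3 * IZC n * (IZC n + 1) * / 2 * t))%C
      with (ex (RtoC (1/2)) * ex (IZC n * / 2 - 3 * IZC n * / P + 3 * IZC n * (IZC n + 1) * / 2 * t))%C by (rewrite ex_half; ring).
    unfold wgt, asd_num. rewrite alC, <- !ex_plus. apply (ex_eq _ _ (-1)%Z).
    rewrite !IZC_plus, IZC_mult, (S_INR k). rewrite RtoC_half, RtoC_plus. unfold IZC. rewrite <- !INR_IZR_INZ. simpl (INR 1). rewrite P_eq.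
    field. apply P_eq_neq0.
Qed.

(** With [P * P * t = W] the class of [l] modulo [p] is an Appell sum in base [q^(p^2)];
    [kap l] collects the powers of [q] that do not depend on the index. *)
Definition kap (l : nat) : C := ex (INC l / 2 + INC l * (P - 3 * INC l) / 2 * t).
Definition shiftv (l : nat) : C := (INC l * P * t)%C.
Definition Usum (l : nat) : C := (kap l * ex (shiftv l) * B 0 (shiftv l) W)%C.
(** The terms of [Usum], together with those of a pentagonal sum if [b] is true. *)
Definition Kterm (b : bool) (l : nat) (m : Z) : C :=
  (kap l * ((if b then asd_num W 0 (IZC m) * ex (- (1 * IZC m * W)) else 0) + ex (shiftv l) * Bterm 0 (shiftv l) W m))%C.

Lemma class_neq0 (l : nat) m : (0 < l < p)%nat -> (Z.of_nat l + Z.of_nat p * m <> 0)%Z.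
Proof.
  generalize p. intros q hl E. assert (Z.of_nat l < Z.of_nat q)%Z by lia. destruct (Z_le_gt_dec 0 m); nia.
Qed.

Lemma shiftv_class l m : (shiftv l + IZC m * W)%C = (P * (IZC (Z.of_nat l + Z.of_nat p * m) * t))%C.
Proof. unfold shiftv. rewrite W_eq, IZC_plus, IZC_mult, P_IZC. unfold IZC. rewrite <- INR_IZR_INZ. ring. Qed.

Lemma shiftv_nonlat l : (0 < l < p)%nat -> nonlat (shiftv l) W.
Proof. intros hl m. rewrite shiftv_class. apply nonlat_frac. apply class_neq0; auto. Qed.

Lemma zsums_Kterm b l : (0 < l < p)%nat -> zsums (Kterm b l) (Usum l + if b then kap l * qinf W W else 0)%C.
Proof.
  intros hl. pose proof W_upper as hW.
  replace (Usum l + if b then kap l * qinf W W else 0)%C with (kap l * ((if b then bsum 1 0 W else 0) + ex (shiftv l) * B 0 (shiftv l) W))%C.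
  2: { unfold Usum. destruct b; rewrite ?pentagonal by auto; ring. }
  apply zsums_scal. apply zsums_plus.
  - destruct b; [apply zsums_bsum; auto|apply zsums_zero].
  - apply zsums_scal, zsums_B; auto. rewrite Cplus_0_r. apply shiftv_nonlat; auto.
Qed.

Lemma Kterm_closed b l m : (0 < l < p)%nat -> let n := IZC (Z.of_nat l + Z.of_nat p * m) in
  Kterm b l m = (ex (n / 2 + (3 * n * n / 2 + n * (P / 2 - 3 * INC l + if b then 0 else P)) * t) / (1 - ex (P * (n * t))))%C.
Proof.
  intros hl n. pose proof (nonlat_frac _ (class_neq0 l m hl)) as N. apply one_minus_neq0 in N.
  unfold Kterm, Bterm. rewrite Cplus_0_r, shiftv_class. fold n.
  set (y := ex (P * (n * t))) in *. assert (Y0 : y <> 0%C) by apply ex_neq0.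
  assert (En : n = (INC l + P * IZC m)%C) by apply class_IZC.
  assert (E1 : (kap l * ex (shiftv l) * asd_num W 0 (IZC m))%C = (ex (n / 2 + (3 * n * n / 2 + n * (P / 2 - 3 * INC l + P)) * t))%C).
  { unfold kap, shiftv, asd_num. rewrite <- !ex_plus. apply (ex_eq _ _ (- (Z.of_nat h * m))). rewrite W_eq, En, IZC_opp, IZC_mult.
    replace (IZC (Z.of_nat h)) with ((P - 1) / 2)%C by (rewrite P_eq; unfold IZC; rewrite <- INR_IZR_INZ; field). field. }
  destruct b.
  - rewrite Cplus_0_r.
    assert (E2 : ex (n / 2 + (3 * n * n / 2 + n * (P / 2 - 3 * INC l + P)) * t) = (ex (n / 2 + (3 * n * n / 2 + n * (P / 2 - 3 * INC l)) * t) * y)%C).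
    { unfold y. rewrite <- ex_plus. f_equal. ring. }
    assert (E3 : (kap l * (asd_num W 0 (IZC m) * ex (- (1 * IZC m * W))))%C = ex (n / 2 + (3 * n * n / 2 + n * (P / 2 - 3 * INC l)) * t)).
    { transitivity (kap l * ex (shiftv l) * asd_num W 0 (IZC m) * / y)%C.
      - unfold y, n. rewrite <- ex_opp, <- shiftv_class, <- !Cmult_assoc. f_equal.
        unfold asd_num. rewrite <- !ex_plus. f_equal. ring.
      - rewrite E1, E2. field. auto. }
    rewrite Cmult_plus_distr_l, E3.
    replace (kap l * (ex (shiftv l) * (asd_num W 0 (IZC m) / (1 - y))))%C with (kap l * ex (shiftv l) * asd_num W 0 (IZC m) / (1 - y))%C by (field; auto).
    rewrite E1, E2. field. auto.
  - rewrite Cplus_0_l.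
    replace (kap l * (ex (shiftv l) * (asd_num W 0 (IZC m) / (1 - y))))%C with (kap l * ex (shiftv l) * asd_num W 0 (IZC m) / (1 - y))%C by (field; auto).
    rewrite E1. auto.
Qed.

(** The exponent selected in [layer_closed] must lie in [0 .. p-1].  If it exceeds the
    one that gives [Bterm] by [p], the numerator [1] of the difference turns into a
    term of the pentagonal sum; this depends on the position of [3l]. *)
Lemma class_positive (l : nat) m : (0 < l <= h)%nat ->
  layer (Z.of_nat l + Z.of_nat p * m) = (- P * ex (- (3 * INC l / P)) * Kterm (3 * l <? h)%nat l m)%C.
Proof.
  intros hl. pose proof P_neq0 as PZ. rewrite Kterm_closed by (unfold p; lia). set (n := (Z.of_nat l + Z.of_nat p * m)%Z).
  assert (En : IZC n = (INC l + P * IZC m)%C) by apply class_IZC.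
  assert (Nn : n <> 0%Z) by (apply class_neq0; unfold p; lia).
  assert (X : forall i : nat, INC i = ((P - 3) / 2 - 3 * INC l + if (3 * l <? h)%nat then 0 else P)%C ->
    layer n = (- P * (ex (IZC n / 2 - 3 * IZC n / P + (3 * IZC n * (IZC n + 1) / 2 + IZC n * INC i) * t)
    / (1 - ex (P * (IZC n * t)))))%C -> layer n = (- P * ex (- (3 * INC l / P)) *
     (ex (IZC n / 2 + (3 * IZC n * IZC n / 2 + IZC n * (P / 2 - 3 * INC l + if (3 * l <? h)%nat then 0 else P)) * t) / (1 - ex (P * (IZC n * t)))))%C).
  { intros i Ei ->. rewrite Ei. unfold Cdiv. rewrite !Cmult_assoc, <- (Cmult_assoc (- P) (ex _) (ex _)), <- ex_plus. f_equal. f_equal.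
    apply (ex_eq _ _ (- (3 * m))). rewrite IZC_opp, IZC_mult. rewrite En at 2. unfold IZC. field. auto. }
  destruct (Nat.ltb_spec (3 * l) h) as [L|L].
  - apply (X (h - 1 - 3 * l)%nat).
    + rewrite !minus_INR, mult_INR, !RtoC_minus, RtoC_mult, P_eq by lia. simpl (INR 3). simpl (INR 1). replace (1 + 1 + 1) with 3 by ring. field.
    + apply layer_closed; auto; [unfold p; lia|]. exists (1 + 3 * m)%Z. rewrite !Nat2Z.inj_sub; lia.
  - apply (X (h + p - 1 - 3 * l)%nat).
    + rewrite !minus_INR, plus_INR, mult_INR, !RtoC_minus, RtoC_plus, RtoC_mult by (unfold p; lia). fold P. rewrite P_eq. simpl (INR 3). simpl (INR 1). replace (1 + 1 + 1) with 3 by ring. field.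
    + apply layer_closed; auto; [unfold p; lia|]. exists (2 + 3 * m)%Z. rewrite !Nat2Z.inj_sub; lia.
Qed.

Lemma class_negative (l : nat) m : (0 < l <= h)%nat ->
  layer (- (Z.of_nat l + Z.of_nat p * m)) = (P * ex (3 * INC l / P) * Kterm (3 * l <=? h + 1)%nat l m)%C.
Proof.
  intros hl. pose proof P_neq0 as PZ. rewrite Kterm_closed by (unfold p; lia). set (n := (Z.of_nat l + Z.of_nat p * m)%Z).
  assert (En : IZC n = (INC l + P * IZC m)%C) by apply class_IZC.
  assert (Nn : n <> 0%Z) by (apply class_neq0; unfold p; lia).
  pose proof (nonlat_frac n Nn) as NL. apply one_minus_neq0 in NL.
  assert (X : forall i : nat, INC i = ((P - 3) / 2 + 3 * INC l - if (3 * l <=? h + 1)%nat then 0 else P)%C ->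
    layer (- n) = (- P * (ex (IZC (- n) / 2 - 3 * IZC (- n) / P + (3 * IZC (- n) * (IZC (- n) + 1) / 2 + IZC (- n) * INC i) * t)
    / (1 - ex (P * (IZC (- n) * t)))))%C -> layer (- n) = (P * ex (3 * INC l / P) *
     (ex (IZC n / 2 + (3 * IZC n * IZC n / 2 + IZC n * (P / 2 - 3 * INC l + if (3 * l <=? h + 1)%nat then 0 else P)) * t) / (1 - ex (P * (IZC n * t)))))%C).
  { intros i Ei ->. rewrite Ei, IZC_opp.
    replace (P * (- IZC n * t))%C with (- (P * (IZC n * t)))%C by ring. rewrite ex_opp.
    set (y := ex (P * (IZC n * t))) in *. assert (Y0 : y <> 0%C) by apply ex_neq0.
    set (c := if (3 * l <=? h + 1)%nat then RtoC 0 else P).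
    assert (F : (ex (- IZC n / 2 - 3 * - IZC n / P + (3 * - IZC n * (- IZC n + 1) / 2 + - IZC n * ((P - 3) / 2 + 3 * INC l - c)) * t) * y)%C
      = (ex (3 * INC l / P) * ex (IZC n / 2 + (3 * IZC n * IZC n / 2 + IZC n * (P / 2 - 3 * INC l + c)) * t))%C).
    { unfold y. rewrite <- !ex_plus. apply (ex_eq _ _ (3 * m - n)). rewrite IZC_minus, IZC_mult. rewrite En. unfold IZC. field. auto. }
    assert (NL2 := Cminus_neq0_sym _ _ NL).
    match type of F with (?A * y)%C = (?B * ?D)%C => set (a := A) in *; set (b := B) in *; set (d := D) in * end.
    replace (P * b * (d / (1 - y)))%C with (P * (b * d) / (1 - y))%C by (field; auto). rewrite <- F. field. auto. }
  destruct (Nat.leb_spec (3 * l) (h + 1)) as [L|L].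
  - apply (X (h - 1 + 3 * l)%nat).
    + rewrite plus_INR, minus_INR, mult_INR, RtoC_plus, RtoC_minus, RtoC_mult, P_eq by lia. simpl (INR 3). simpl (INR 1). replace (1 + 1 + 1) with 3 by ring. field.
    + apply layer_closed; [lia|unfold p; lia|]. exists (1 - 3 * m)%Z. lia.
  - apply (X (h - 1 + 3 * l - p)%nat).
    + rewrite minus_INR, plus_INR, minus_INR, mult_INR, RtoC_minus, RtoC_plus, RtoC_minus, RtoC_mult by (unfold p; lia). fold P. rewrite P_eq. simpl (INR 3). simpl (INR 1). replace (1 + 1 + 1) with 3 by ring. field.
    + apply layer_closed; [lia|unfold p; lia|]. exists (- 3 * m)%Z. lia.
Qed.

(** The terms of the class of [0] are odd, so their sum vanishes. *)
Lemma layer_0_class m : layer (Z.of_nat p * - m) = (- layer (Z.of_nat p * m))%C.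
Proof.
  pose proof P_neq0 as PZ.
  destruct (Z.eq_dec m 0) as [->|N]; [change (- 0)%Z with 0%Z; rewrite Z.mul_0_r, layer_0; ring|].
  assert (Nn : forall k, k <> 0%Z -> (Z.of_nat p * k <> 0)%Z) by (intros k hk; unfold p; nia).
  rewrite (layer_closed (Z.of_nat p * - m) (h - 1)); [|apply Nn; lia|unfold p; lia|exists (1 - 3 * m)%Z; unfold p; lia].
  rewrite (layer_closed (Z.of_nat p * m) (h - 1)); [|apply Nn; lia|unfold p; lia|exists (1 + 3 * m)%Z; unfold p; lia].
  pose proof (nonlat_frac _ (Nn m N)) as NL. apply one_minus_neq0 in NL.
  rewrite Z.mul_opp_r, IZC_opp, !IZC_mult, P_IZC. rewrite IZC_mult, P_IZC in NL.
  replace (P * (- (P * IZC m) * t))%C with (- (P * (P * IZC m * t)))%C by ring. rewrite ex_opp.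
  set (y := ex (P * (P * IZC m * t))) in *. assert (Y0 : y <> 0%C) by apply ex_neq0.
  assert (NL2 := Cminus_neq0_sym _ _ NL).
  assert (F : (ex (- (P * IZC m) / 2 - 3 * - (P * IZC m) / P + (3 * - (P * IZC m) * (- (P * IZC m) + 1) / 2 + - (P * IZC m) * INC (h - 1)) * t) * y)%C
    = ex (P * IZC m / 2 - 3 * (P * IZC m) / P + (3 * (P * IZC m) * (P * IZC m + 1) / 2 + P * IZC m * INC (h - 1)) * t)).
  { unfold y. rewrite <- ex_plus. rewrite minus_INR, RtoC_minus by lia. simpl (INR 1).
    apply (ex_eq _ _ (6 * m - Z.of_nat p * m)). rewrite IZC_minus, !IZC_mult, P_IZC.
    replace (INC h) with ((P - 1) / 2)%C by (rewrite P_eq; field). unfold IZC. field. auto. }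
  rewrite <- F. field. auto.
Qed.

Lemma layer_class0_zsums : zsums (fun m => layer (Z.of_nat p * m)) (RtoC 0).
Proof.
  assert (S0 : zsummable (fun m => layer (Z.of_nat p * m))).
  { apply zsummable_multiples; [unfold p; lia|]. apply zsums_layer. }
  pose proof (zsummable_sums _ S0) as H.
  pose proof (zsums_antisym _ _ 0 H) as A. rewrite A in H; auto.
  intros m. rewrite Z.sub_0_l. apply layer_0_class.
Qed.

Definition Eterm (l : nat) : C := if (6 * l <? p)%nat then (kap l * qinf W W)%C else RtoC 0.

Lemma zsums_class_positive l : (0 < l <= h)%nat ->
  zsums (fun m => layer (Z.of_nat l + Z.of_nat p * m)) (- P * ex (- (3 * INC l / P)) * (Usum l + if (3 * l <? h)%nat then kap l * qinf W W else 0))%C.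
Proof.
  intros hl. eapply zsums_ext; [intros m; symmetry; apply class_positive; auto|].
  apply zsums_scal, zsums_Kterm. unfold p; lia.
Qed.

Lemma zsums_class_negative l : (0 < l <= h)%nat ->
  zsums (fun m => layer (Z.of_nat (p - l) + Z.of_nat p * m)) (P * ex (3 * INC l / P) * (Usum l + if (3 * l <=? h + 1)%nat then kap l * qinf W W else 0))%C.
Proof.
  intros hl. apply zsums_ext with (fun m => (fun m => (P * ex (3 * INC l / P) * Kterm (3 * l <=? h + 1)%nat l m)%C) (-1 - m)%Z).
  - intros m. rewrite <- class_negative by auto. f_equal. rewrite Nat2Z.inj_sub by (unfold p; lia). ring.
  - apply (zsums_refl (fun m => (P * ex (3 * INC l / P) * Kterm (3 * l <=? h + 1)%nat l m)%C)). apply zsums_scal, zsums_Kterm. unfold p; lia.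
Qed.

(** Exactly one [l <= h] has [6l = p - 1] or [6l = p + 1]; its pentagonal term
    carries the factor of [Gam]. *)
Theorem class_decomposition (e n0 : Z) : (e = 1 \/ e = -1)%Z -> (6 * n0 + 1 = e * Z.of_nat p)%Z ->
  (ex (3 * RtoC (al p 1) / 2) * Csum (fun k => wgt p k * Bstar (RtoC (al p k)) (RtoC (al p 1)) t) p)%C =
  (P * Csum (fun k => (ex (3 * INC (S k) / P) - ex (- (3 * INC (S k) / P))) * (Usum (S k) + Eterm (S k))) h
   - ex (1 / (2 * P)) * (Gam h t * qinf t t))%C.
Proof.
  intros he hn. pose proof P_neq0 as PZ.
  set (L := fun a : nat => if Nat.eq_dec a 0 then RtoC 0 else if le_dec a h
     then (- P * ex (- (3 * INC a / P)) * (Usum a + if (3 * a <? h)%nat then kap a * qinf W W else 0))%C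
     else (P * ex (3 * INC (p - a) / P) * (Usum (p - a) + if (3 * (p - a) <=? h + 1)%nat then kap (p - a) * qinf W W else 0))%C).
  assert (R : zsums layer (Csum L p)).
  { apply zsums_residues; [unfold p; lia|apply zsums_layer|]. intros a ha. unfold L. destruct (Nat.eq_dec a 0) as [->|Na].
    - apply layer_class0_zsums.
    - destruct (le_dec a h) as [l|l].
      + apply zsums_class_positive. lia.
      + pose proof (zsums_class_negative (p - a) ltac:(unfold p in *; lia)) as Z.
        replace (p - (p - a))%nat with a in Z by lia. exact Z. }
  rewrite (zsums_unique _ _ _ zsums_layer R). set (l0 := Z.to_nat (Z.abs n0)).
  assert (Hl0 : (0 < l0 <= h)%nat /\ ((3 * l0 = h)%nat \/ (3 * l0 = h + 1)%nat)).
  { destruct he as [-> | ->]; lia. }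
  assert (EG : (Gam h t * qinf t t)%C = (P * (kap l0 * qinf W W))%C).
  { rewrite (Gam_eta h t e n0) by auto. fold p. fold W. fold P. rewrite !eta_qinf. pose proof (qinf_tt_neq0 t ht). pose proof (ex_neq0 (t / 24)).
    transitivity (P * (ex (IZC n0 / 2) * (ex (W / 24) / ex (t / 24)) * qinf W W))%C; [field; auto|]. f_equal. f_equal.
    rewrite <- ex_minus, <- ex_plus. unfold kap. rewrite W_eq.
    assert (Zp : (6 * IZC n0 + 1 = IZC e * P)%C).
    { rewrite <- P_IZC, <- IZC_mult, <- hn, IZC_plus, IZC_mult. unfold IZC. ring. }
    assert (Zl : INC l0 = (IZC e * IZC n0)%C).
    { unfold l0. rewrite INR_IZR_INZ, Z2Nat.id by lia. rewrite <- IZC_mult. unfold IZC. f_equal. f_equal. destruct he as [-> | ->]; unfold p in *; lia. }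
    rewrite Zl. replace P with (IZC e * (6 * IZC n0 + 1))%C by (rewrite Zp; rewrite Cmult_assoc, <- IZC_mult; destruct he as [-> | ->]; unfold IZC; simpl; ring).
    destruct he as [-> | ->].
    - f_equal. unfold IZC. field.
    - apply (ex_eq _ _ n0). unfold IZC. field. }
  rewrite EG. etransitivity; [apply (Csum_pair L h)|]. unfold L at 1. destruct (Nat.eq_dec 0 0); [|congruence].
  set (D := fun k => if Nat.eq_dec (S k) l0 then (- (ex (1 / (2 * P)) * (P * (kap l0 * qinf W W))))%C else RtoC 0).
  rewrite (Csum_ext _ (fun k => P * ((ex (3 * INC (S k) / P) - ex (- (3 * INC (S k) / P))) * (Usum (S k) + Eterm (S k))) + D k)%C).
  - rewrite Csum_plus, Csum_scal. rewrite (Csum_single D h (l0 - 1)).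
    + unfold D. destruct (Nat.eq_dec (S (l0 - 1)) l0); [ring|lia].
    + lia.
    + intros k hk hk2. unfold D. destruct (Nat.eq_dec (S k) l0); [lia|auto].
  - intros k hk. unfold L. destruct (Nat.eq_dec (S k) 0) as [?|_]; [lia|]. destruct (le_dec (S k) h) as [_|?]; [|lia].
    destruct (Nat.eq_dec (2 * h - k) 0) as [?|_]; [lia|]. destruct (le_dec (2 * h - k) h) as [?|_]; [lia|].
    replace (p - (2 * h - k))%nat with (S k) by (unfold p; lia). unfold D, Eterm.
    set (l := S k) in *. destruct (Nat.eq_dec l l0) as [El|Nl].
    + assert (F : forall x m, (x = RtoC (1/2) + 1 / (2 * P) + IZC m)%C -> ex x = (- ex (1 / (2 * P)))%C).
      { intros x m E. rewrite (ex_eq x _ m E), ex_plus, ex_half. ring. }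
      rewrite RtoC_half in F. destruct Hl0 as [B0 B].
      replace (3 * l <? h)%nat with false by (symmetry; apply Nat.ltb_ge; lia).
      replace (3 * l <=? h + 1)%nat with true by (symmetry; apply Nat.leb_le; lia).
      destruct B as [B|B].
      * replace (6 * l <? p)%nat with true by (symmetry; apply Nat.ltb_lt; unfold p; lia).
        rewrite <- El, (F (- (3 * INC l / P))%C (-1)%Z); [ring|]. unfold IZC.
        assert (Q : (3 * INC l = (P - 1) / 2)%C).
        { rewrite P_eq, <- B, El, mult_INR. simpl (INR 3). replace (1 + 1 + 1) with 3 by ring. rewrite RtoC_mult. field. }
        rewrite Q. field. auto.
      * replace (6 * l <? p)%nat with false by (symmetry; apply Nat.ltb_ge; unfold p; lia).
        rewrite <- El, (F (3 * INC l / P)%C 0%Z); [ring|]. unfold IZC.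
        assert (Q : (3 * INC l = (P + 1) / 2)%C).
        { assert (INR (3 * l0) = INR (h + 1)) as Q0 by (f_equal; auto). rewrite mult_INR, plus_INR in Q0. simpl (INR 3) in Q0; simpl (INR 1) in Q0.
          rewrite P_eq. replace (INR h) with (3 * INR l0 - 1) by lra. rewrite El, RtoC_minus, RtoC_mult. field. }
        rewrite Q. field. auto.
    + replace (3 * l <? h)%nat with (6 * l <? p)%nat.
      2: { destruct (Nat.ltb_spec (3 * l) h); [apply Nat.ltb_lt|apply Nat.ltb_ge]; unfold p; lia. }
      replace (3 * l <=? h + 1)%nat with (6 * l <? p)%nat.
      2: { destruct (Nat.leb_spec (3 * l) (h + 1)); [apply Nat.ltb_lt|apply Nat.ltb_ge]; unfold p; lia. }
      destruct (6 * l <? p)%nat; ring.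
Qed.
End Classes.

(** * The function calJ as a combination of theta values *)

Lemma zsums_plus_minus f l : zsums f l -> sums (fun j => f (Z.of_nat (S j)) + f (- Z.of_nat (S j))%Z)%C (l - f 0%Z)%C.
Proof.
  intros H. destruct (zsums_split f l H) as [s [r [Hs [Hr ->]]]].
  replace (s + r - f 0%Z)%C with ((s - f 0%Z) + r)%C by ring. apply sums_plus.
  - apply (sums_shift1 (fun n => f (Z.of_nat n))). replace (f (Z.of_nat 0) + (s - f 0%Z))%C with s; auto. simpl Z.of_nat. ring.
  - eapply sums_ext; [|apply Hr]. intros n. cbv beta. f_equal. lia.
Qed.

Lemma sgn_Z n : RtoC (powerRZ (-1) n) = ex (IZC n / 2).
Proof.
  assert (N : forall k : nat, RtoC ((-1) ^ k) = ex (IZC (Z.of_nat k) / 2)).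
  { intros k. rewrite sgn_ex, RtoC_half. unfold IZC. rewrite <- INR_IZR_INZ. auto. }
  destruct n as [|k|k].
  - simpl. rewrite <- ex_0. f_equal. unfold IZC. field.
  - simpl. rewrite N, positive_nat_Z. auto.
  - simpl. rewrite RtoC_inv, N, <- ex_opp, positive_nat_Z. f_equal.
    + change (Z.neg k) with (- Z.pos k)%Z. rewrite IZC_opp. unfold Cdiv. ring.
    + apply pow_nonzero. lra.
Qed.

Lemma sgn_square n : (ex (IZC n / 2) * ex (IZC n / 2))%C = RtoC 1.
Proof. rewrite <- ex_plus, <- (ex_Z n). f_equal. field. Qed.

Lemma ex_cos_sin x : ex (RtoC x) = (RtoC (cos (2 * PI * x)) + Ci * RtoC (sin (2 * PI * x)))%C.
Proof. rewrite ex_R. Ceq; simpl; ring. Qed.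

Section JFormula.
Variables (g : nat) (t : C).
Hypothesis ht : upper_half t.
Let h := S g.
Let p := (2 * h + 1)%nat.
Let W := (RtoC (INR p ^ 2) * t)%C.
Let P := INC p.
Let b1 := RtoC (al p 1).

Lemma INRp_gt1 : 1 < INR p. Proof. rewrite <- INR_1. apply lt_INR. unfold p, h. lia. Qed.

Lemma b1_eq : b1 = (1 / P)%C.
Proof. unfold b1, al. rewrite RtoC_div; [reflexivity|]. pose proof INRp_gt1. apply Rgt_not_eq. lra. Qed.

Lemma PP_neq0 : P <> 0%C. Proof. apply RtoC_neq0, Rgt_not_eq. pose proof INRp_gt1. lra. Qed.

(** The value of [calN], up to elementary factors. *)
Definition rankA : C := (qinf t t + ex b1 * B 0 b1 t)%C.
Definition rank_term (n : Z) : C := (asd_num t 0 (IZC n) * ex (- (1 * IZC n * t)) + ex b1 * Bterm 0 b1 t n)%C.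

Lemma WW : W = (P * P * t)%C. Proof. exact (W_eq g t). Qed.

Lemma b1_nonlat : nonlat b1 t.
Proof. apply nonlat_R; auto. apply al_range. unfold p, h. lia. Qed.

Lemma zsums_rank : zsums rank_term rankA.
Proof.
  unfold rankA. rewrite <- pentagonal by auto. apply zsums_plus; [apply zsums_bsum; auto|].
  apply zsums_scal, zsums_B; auto. rewrite Cplus_0_r. apply b1_nonlat.
Qed.

Lemma rank_term_closed n : rank_term n = (ex (IZC n / 2 + (3 * IZC n * IZC n + IZC n) / 2 * t) / (1 - ex (b1 + IZC n * t)))%C.
Proof.
  unfold rank_term, Bterm. rewrite Cplus_0_r. pose proof (b1_nonlat n) as N. apply one_minus_neq0 in N.
  assert (E1 : (asd_num t 0 (IZC n) * ex (- (1 * IZC n * t)))%C = ex (IZC n / 2 + (3 * IZC n * IZC n + IZC n) / 2 * t)).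
  { unfold asd_num. rewrite <- ex_plus. f_equal. field. }
  assert (E2 : asd_num t 0 (IZC n) = (ex (IZC n / 2 + (3 * IZC n * IZC n + IZC n) / 2 * t) * ex (IZC n * t))%C).
  { unfold asd_num. rewrite <- ex_plus. f_equal. field. }
  rewrite E1, E2. rewrite (ex_plus b1) in *. field. auto.
Qed.

Lemma xi_cos : (ex b1 + / ex b1)%C = RtoC (2 * cos (2 * PI / INR p)).
Proof.
  rewrite <- ex_opp. unfold b1. rewrite <- RtoC_opp, !ex_cos_sin.
  replace (2 * PI * - al p 1) with (- (2 * PI * al p 1)) by ring. rewrite cos_neg, sin_neg.
  replace (2 * PI * al p 1) with (2 * PI / INR p) by (unfold al; simpl (INR 1); unfold Rdiv; ring).
  rewrite RtoC_opp, RtoC_mult. ring.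
Qed.

Lemma calN_series : (RtoC 1 + C_Series (fun j =>
        let n := S j in
        RtoC ((-1) ^ n) * (RtoC 1 + qpow (INR n) t) * RtoC (2 - 2 * cos (2 * PI / INR p))
        / (RtoC 1 - RtoC (2 * cos (2 * PI / INR p)) * qpow (INR n) t + qpow (2 * INR n) t)
        * qpow (INR n * (3 * INR n + 1) / 2) t))%C = ((1 - ex b1) * rankA)%C.
Proof.
  pose proof (b1_nonlat 0%Z) as N0. rewrite Cmult_0_l, Cplus_0_r in N0. apply one_minus_neq0 in N0.
  assert (R0 : rank_term 0%Z = (/ (1 - ex b1))%C).
  { rewrite rank_term_closed. replace (b1 + IZC 0 * t)%C with b1 by (unfold IZC; ring).
    replace (IZC 0 / 2 + (3 * IZC 0 * IZC 0 + IZC 0) / 2 * t)%C with (RtoC 0) by (unfold IZC; field). rewrite ex_0. field. auto. }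
  pose proof (sums_scal (1 - ex b1)%C _ _ (zsums_plus_minus _ _ zsums_rank)) as H. rewrite R0 in H.
  erewrite C_Series_unique.
  2: { eapply sums_ext; [|exact H]. intros j. cbv beta zeta. set (n := S j).
    rewrite sgn_ex, !qpow_ex. rewrite RtoC_minus, <- xi_cos.
    rewrite !rank_term_closed.
    pose proof (b1_nonlat (Z.of_nat n)) as N1. pose proof (b1_nonlat (- Z.of_nat n)%Z) as N2.
    apply one_minus_neq0 in N1. apply one_minus_neq0 in N2.
    rewrite ex_plus in N1, N2. rewrite !(ex_plus b1). rewrite IZC_opp in *.
    assert (En : IZC (Z.of_nat n) = INC n) by (unfold IZC; rewrite <- INR_IZR_INZ; auto). rewrite En in *.
    replace (- INC n * t)%C with (- (INC n * t))%C in * by ring. rewrite ex_opp in *.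
    set (y := ex (INC n * t)) in *. set (x := ex b1) in *.
    assert (y0 : y <> 0%C) by apply ex_neq0. assert (x0 : x <> 0%C) by apply ex_neq0.
    replace (ex (RtoC (2 * INR n) * t)) with (y * y)%C by (unfold y; rewrite <- ex_plus; f_equal; rewrite RtoC_mult; ring).
    replace (ex (RtoC (INR n * (3 * INR n + 1) / 2) * t)) with (ex ((3 * INC n * INC n + INC n) / 2 * t)).
    2: { f_equal. f_equal. rewrite RtoC_half, RtoC_mult, RtoC_plus, RtoC_mult. field. }
    set (Q := ex ((3 * INC n * INC n + INC n) / 2 * t)).
    replace (RtoC (INR n / 2)) with (INC n / 2)%C by (rewrite RtoC_half; auto).
    replace (- INC n / 2 + (3 * - INC n * - INC n + - INC n) / 2 * t)%C
      with (INC n / 2 + (3 * INC n * INC n + INC n) / 2 * t - INC n * t - INC n)%C by field.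
    replace (ex (INC n / 2 + (3 * INC n * INC n + INC n) / 2 * t - INC n * t - INC n))
      with (ex (INC n / 2) * Q / y)%C.
    2: { unfold Q, y. rewrite <- ex_plus, <- ex_minus. symmetry. apply (ex_eq _ _ (- Z.of_nat n)). rewrite IZC_opp, En. ring. }
    rewrite ex_plus. fold Q. assert (M2 : (y - x)%C <> 0%C).
    { intros E. apply N2. replace (1 - x * / y)%C with ((y - x) / y)%C by (field; auto). rewrite E. field. auto. }
    assert (M3 : (x - y)%C <> 0%C) by (apply Cminus_neq0_sym; auto).
    replace (1 - (x + / x) * y + y * y)%C with ((1 - x * y) * (x - y) / x)%C by (field; auto).
    field. repeat split; auto. }
  field. auto.
Qed.

Lemma calN_rank : calN p t = (- (2) * Ci * ex (1 / (2 * P)) * rankA / eta t)%C.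
Proof.
  unfold calN. pose proof calN_series as E0. cbv zeta in *. rewrite E0. rewrite eta_qinf, qpoch_qinf, qpow_ex.
  pose proof (qinf_tt_neq0 t ht) as NQ. pose proof (ex_neq0 (t / 24)) as N24. pose proof PP_neq0 as PZ. pose proof INRp_gt1 as h1.
  replace (ex (RtoC (- (1 / 24)) * t)) with (/ ex (t / 24))%C.
  2: { rewrite <- ex_opp. f_equal. rewrite RtoC_opp, RtoC_div by lra. field. }
  assert (S0 : RtoC (sin (PI / INR p)) <> 0%C).
  { apply RtoC_neq0, Rgt_not_eq. apply sin_gt_0; pose proof PI_RGT_0.
    - apply Rdiv_lt_0_compat; lra.
    - apply Rmult_lt_reg_r with (INR p); [lra|]. unfold Rdiv. rewrite Rmult_assoc, Rinv_l by lra. nra. }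
  rewrite RtoC_inv by (intros E; apply S0; rewrite E; auto).
  assert (E : (1 - ex b1)%C = (- (2) * Ci * ex (1 / (2 * P)) * RtoC (sin (PI / INR p)))%C).
  { rewrite b1_eq. replace (1 / P)%C with (1 / (2 * P) + 1 / (2 * P))%C by (field; auto).
    replace (1 / (2 * P))%C with (RtoC (/ (2 * INR p))) by (rewrite RtoC_inv by lra; rewrite RtoC_mult; unfold P; field; auto).
    rewrite ex_plus, ex_cos_sin. replace (2 * PI * / (2 * INR p)) with (PI / INR p) by (field; lra).
    pose proof (sin2_cos2 (PI / INR p)) as SC. unfold Rsqr in SC.
    set (s := sin (PI / INR p)) in *. set (c := cos (PI / INR p)) in *.
    replace (RtoC 1) with (RtoC (s * s + c * c)) by (rewrite SC; auto). rewrite RtoC_plus, !RtoC_mult.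
    replace ((RtoC c + Ci * RtoC s) * (RtoC c + Ci * RtoC s))%C with (RtoC c * RtoC c + 2 * Ci * RtoC c * RtoC s + (Ci * Ci) * (RtoC s * RtoC s))%C by ring.
    replace (- (2) * Ci * (RtoC c + Ci * RtoC s) * RtoC s)%C with (- (2) * Ci * RtoC c * RtoC s + - (2) * (Ci * Ci) * RtoC s * RtoC s)%C by ring.
    replace (Ci * Ci)%C with (- (1))%C by (Ceq; simpl; ring). ring. }
  rewrite E. field. auto.
Qed.

Lemma calM_U l : (0 < l <= h)%nat -> (RtoC ((-1) ^ l) * (eta W * calM l p W))%C = (2 * Usum g t l)%C.
Proof.
  intros hl. pose proof PP_neq0 as PZ. pose proof (W_upper g t ht) as hW. assert (hl' : (0 < l < p)%nat) by (unfold p; lia).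
  pose proof (shiftv_nonlat g t ht l hl') as NV. unfold calM. set (v := shiftv g t l) in *.
  assert (Ex : (RtoC (INR l / INR p) * W)%C = v).
  { unfold v, shiftv. rewrite RtoC_div by (apply Rgt_not_eq; pose proof INRp_gt1; lra). rewrite WW. change (INC (2 * S g + 1)) with P. fold P. field. auto. }
  assert (H : zsums (fun n => RtoC (powerRZ (-1) n) * qpow (IZR n + INR l / INR p) W
       / (RtoC 1 - qpow (IZR n + INR l / INR p) W)
       * qpow (3 / 2 * IZR n * (IZR n + 1)) W)%C (B 0 v W)).
  { replace (B 0 v W) with (B 0 v W - ex (- (3 * W / 8) - 3 * 0 / 2) * T 0 (1/2) (3 * 0) (3 * W))%C.
    - eapply zsums_ext; [|apply zsums_minus; [apply zsums_B; auto; rewrite Cplus_0_r; apply NV|apply zsums_asd_num; auto]].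
      intros n. unfold Bterm. rewrite Cplus_0_r. rewrite sgn_Z, !qpow_ex.
      replace (RtoC (IZR n + INR l / INR p) * W)%C with (v + IZC n * W)%C.
      2: { rewrite RtoC_plus, <- Ex. unfold IZC. ring. }
      pose proof (NV n) as N. apply one_minus_neq0 in N. unfold asd_num.
      replace (IZC n / 2 + 3 * IZC n * 0 + 3 * IZC n * (IZC n + 1) / 2 * W)%C with (IZC n / 2 + RtoC (3 / 2 * IZR n * (IZR n + 1)) * W)%C.
      2: { rewrite !RtoC_mult, RtoC_plus, RtoC_half. unfold IZC. field. }
      rewrite (ex_plus (IZC n / 2)). field. auto.
    - replace (3 * 0)%C with (RtoC 0) by ring. rewrite theta_0; [ring|]. apply upper_3; auto. }
  rewrite (C_Series_Z_zsums _ _ H). rewrite eta_qinf, qpoch_qinf, qpow_ex, sgn_ex.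
  pose proof (qinf_tt_neq0 W hW) as NQ. unfold Usum. transitivity (2 * (ex (RtoC (INR l / 2)) * ex (W / 24) * ex (RtoC (3 / 2 * (INR l / INR p) * (1 - INR l / INR p) - 1 / 24) * W)) * B 0 v W)%C; [field; auto|].
  rewrite <- !Cmult_assoc. f_equal. rewrite !Cmult_assoc. f_equal. unfold kap. rewrite <- !ex_plus. f_equal.
  unfold v, shiftv. rewrite WW. change (INC (2 * S g + 1)) with P.
  rewrite RtoC_half, RtoC_minus, !RtoC_mult, RtoC_minus, RtoC_half, !RtoC_div by (apply Rgt_not_eq; pose proof INRp_gt1; lra).
  fold P. field. auto.
Qed.

(** The term [eps2] is the pentagonal sum left over in the class of [l]. *)
Lemma eps2_E l : (0 < l <= h)%nat -> (RtoC ((-1) ^ l) * (eta W * eps2 l p W))%C = (2 * Eterm g t l)%C.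
Proof.
  intros hl. pose proof PP_neq0 as PZ. pose proof INRp_gt1 as h1. assert (nz : INR p <> 0) by (apply Rgt_not_eq; lra). unfold eps2, Eterm. fold h p W.
  destruct (Rlt_dec (INR l / INR p) (1 / 6)) as [L|L].
  - replace (6 * l <? p)%nat with true.
    2: { symmetry. apply Nat.ltb_lt, INR_lt. rewrite mult_INR. replace (INR 6) with 6 by (simpl; ring).
      apply Rmult_lt_compat_r with (r := INR p) in L; [|lra]. unfold Rdiv in L at 1. rewrite Rmult_assoc, Rinv_l in L by exact nz. lra. }
    replace (cexp (RtoC (-3 * PI * (INR l / INR p - 1 / 6) ^ 2) * Ci * W)) with (ex (RtoC (-3 / 2 * (INR l / INR p - 1 / 6) ^ 2) * W)).
    2: { unfold ex. f_equal. rewrite !RtoC_mult, RtoC_half. field. }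
    rewrite eta_qinf, sgn_ex.
    transitivity (2 * (ex (RtoC (INR l / 2)) * ex (W / 24) * ex (RtoC (-3 / 2 * (INR l / INR p - 1 / 6) ^ 2) * W) * qinf W W))%C; [ring|].
    f_equal. f_equal. unfold kap. rewrite <- !ex_plus. f_equal. rewrite WW. change (INC (2 * S g + 1)) with P.
    replace ((INR l / INR p - 1 / 6) ^ 2) with ((INR l / INR p - 1 / 6) * (INR l / INR p - 1 / 6)) by ring. replace (-3) with (- (3)) by ring. rewrite !RtoC_half, !RtoC_mult, !RtoC_half, RtoC_opp, !RtoC_minus, !RtoC_div by (first [exact nz | lra]). fold P. field. auto.
  - replace (6 * l <? p)%nat with false.
    2: { symmetry. apply Nat.ltb_ge. apply Nat.nlt_ge. intros Q. apply L. apply lt_INR in Q. rewrite mult_INR in Q. replace (INR 6) with 6 in Q by (simpl; ring).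
      apply Rmult_lt_reg_r with (INR p); [lra|]. unfold Rdiv at 1. rewrite Rmult_assoc, Rinv_l by exact nz. lra. }
    ring.
Qed.

(** The mock parts cancel: [calJ] is a combination of logarithmic derivatives and
    quotients of theta values at points of order [p]. *)
Theorem calJ_theta (e n0 : Z) : (e = 1 \/ e = -1)%Z -> (6 * n0 + 1 = e * Z.of_nat p)%Z -> RtoC (chi12 (Z.of_nat p)) = ex (IZC n0 / 2) ->
  calJ p t = (2 * Ci * RtoC (chi12 (Z.of_nat p)) / P *
   (psi_tail p g b1 t
    - (Zlog t b1 + Zlog t (2 * b1)) / twopii))%C.
Proof.
  intros he hn hchi. pose proof PP_neq0 as PZ. pose proof INRp_gt1 as h1.
  pose proof (identity_at_root g t ht) as I1. fold h p b1 in I1.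
  pose proof (class_decomposition g t ht e n0 he hn) as I2. fold h p P b1 in I2. rewrite I1 in I2.
  pose proof (Gam_eta h t e n0 ht he hn) as G. fold p W P in G. rewrite <- hchi in G.
  set (H := Csum (fun k => (ex (3 * INC (S k) / P) - ex (- (3 * INC (S k) / P))) * (Usum g t (S k) + Eterm g t (S k)))%C h) in *.
  assert (NC : (Ci <> 0)%C) by apply Ci_neq0.
  assert (E : calJ p t = (eta W * calN p t - 2 * RtoC (chi12 (Z.of_nat p)) * (H / Ci))%C).
  { unfold calJ. fold W. rewrite RtoC_mult.
    assert (S1 : forall F, C_sum F 1 ((p - 1) / 2) = Csum (fun k => F (S k)) h).
    { intros F. replace ((p - 1) / 2)%nat with (S g).
      - unfold C_sum. rewrite <- sum_n_m_S. change (sum_n_m (fun n => F (S n)) 0 g) with (sum_n (G := C_AbelianMonoid) (fun n => F (S n)) g).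
        rewrite sum_n_Csum. auto.
      - unfold p, h. replace (2 * S g + 1 - 1)%nat with (S g * 2)%nat by lia. rewrite Nat.div_mul; auto. }
    rewrite S1.
    transitivity (eta W * calN p t - 2 * RtoC (chi12 (Z.of_nat p)) * (eta W * Csum (fun k => RtoC ((-1) ^ S k * sin (6 * INR (S k) * PI / INR p)) * (calM (S k) p W + eps2 (S k) p W)) h))%C; [ring|].
    f_equal. f_equal. unfold H. unfold Cdiv at 1. rewrite (Cmult_comm (Csum _ _)), <- !Csum_scal. apply Csum_ext. intros k hk.
    rewrite RtoC_mult.
    transitivity (RtoC (sin (6 * INR (S k) * PI / INR p)) * (RtoC ((-1) ^ S k) * (eta W * calM (S k) p W) + RtoC ((-1) ^ S k) * (eta W * eps2 (S k) p W)))%C; [ring|].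
    rewrite calM_U, eps2_E by lia.
    assert (D : (ex (3 * INC (S k) / P) - ex (- (3 * INC (S k) / P)))%C = (2 * Ci * RtoC (sin (6 * INR (S k) * PI / INR p)))%C).
    { replace (3 * INC (S k) / P)%C with (RtoC (3 * INR (S k) / INR p)) by (unfold P; rewrite RtoC_div, RtoC_mult by lra; auto).
      rewrite <- RtoC_opp, !ex_cos_sin. replace (2 * PI * - (3 * INR (S k) / INR p)) with (- (2 * PI * (3 * INR (S k) / INR p))) by ring.
      rewrite cos_neg, sin_neg. replace (2 * PI * (3 * INR (S k) / INR p)) with (6 * INR (S k) * PI / INR p) by (field; lra). rewrite RtoC_opp. ring. }
    rewrite D. field. auto. }
  rewrite E, calN_rank. pose proof (eta_neq0 t ht) as NE.
  set (chi := RtoC (chi12 (Z.of_nat p))) in *.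
  assert (CC : (chi * chi = 1)%C) by (rewrite hchi; apply sgn_square).
  set (X := psi_tail p g b1 t) in *.
  set (Z := ((Zlog t b1 + Zlog t (2 * b1)) / twopii)%C) in *.
  assert (F : (P * H)%C = (P * chi * (eta W / eta t) * (ex (1 / (2 * P)) * rankA) + (X - Z))%C).
  { rewrite <- G. transitivity ((P * H - ex (1 / (2 * P)) * (Gam h t * qinf t t)) + ex (1 / (2 * P)) * (Gam h t * qinf t t))%C; [ring|].
    rewrite <- I2. unfold rankA.
    replace (ex (3 * b1 / 2)) with (ex (1 / (2 * P)) * ex b1)%C; [ring|]. rewrite <- ex_plus. f_equal. rewrite b1_eq. field. auto. }
  replace H with (P * H / P)%C by (field; auto). rewrite F.
  assert (CI2 : (Ci * Ci = - (1))%C) by (Ceq; simpl; ring).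
  assert (IV : (/ Ci = - Ci)%C).
  { replace (/ Ci)%C with (- (Ci * Ci) / Ci)%C by (rewrite CI2; field; auto). field. auto. }
  assert (DV : forall z, (z / Ci)%C = (- (z * Ci))%C) by (intros z; unfold Cdiv; rewrite IV; ring).
  rewrite DV.
  transitivity (- (2) * Ci * ex (1 / (2 * P)) * rankA * (eta W / eta t) * (1 - chi * chi) + 2 * Ci * chi / P * (X - Z))%C; [field; auto|].
  rewrite CC. field. auto.
Qed.
End JFormula.

(** * Theta values at torsion points *)

(** Klein forms up to the factor [eta ^ 3], and their logarithmic derivatives. *)
Definition klein (x y : R) (t : C) : C := (ex (RtoC x * (RtoC x * t + RtoC y) / 2) * theta (RtoC x * t + RtoC y) t)%C.
Definition kzeta (x y : R) (t : C) : C := (Zlog t (RtoC x * t + RtoC y) + twopii * RtoC x)%C.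

(** Differentiate the transformation law of [theta]. *)
Lemma thetap_modular A t c : SL2Z A -> upper_half t ->
  (forall u, theta (u / autom A t) (moebius A t) = (c * ex (IZC (m_c A) * u * u / (2 * autom A t)) * theta u t)%C) ->
  forall u, (thetap (u / autom A t) (moebius A t) / autom A t)%C =
   (c * ex (IZC (m_c A) * u * u / (2 * autom A t)) * (twopii * (IZC (m_c A) * u / autom A t) * theta u t + thetap u t))%C.
Proof.
  intros hA ht H u. pose proof (autom_neq0 A t hA ht) as D0. set (D := autom A t) in *.
  apply (Cder_unique (fun u => theta (u / D) (moebius A t)) u).
  - eapply Cder_eq; [apply (Cder_comp (fun w => theta w (moebius A t)) (fun u => u / D)%C u (thetap (u / D) (moebius A t)) (/ D)%C)|].
    + apply Cder_theta. apply moebius_upper; auto.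
    + apply (Cder_ext (fun u => / D * u)%C); [intros; unfold Cdiv; ring|]. eapply Cder_eq; [apply (Cder_scal (/ D)%C (fun u => u)), Cder_id|]. ring.
    + reflexivity.
  - apply (Cder_ext (fun u => c * ex (IZC (m_c A) * u * u / (2 * D)) * theta u t)%C); [intros; symmetry; apply H|].
    eapply Cder_eq.
    + apply (Cder_mult (fun u => c * ex (IZC (m_c A) * u * u / (2 * D)))%C (fun u => theta u t)).
      * apply (Cder_scal c (fun u => ex (IZC (m_c A) * u * u / (2 * D)))).
        apply (Cder_ext (fun u => ex (IZC (m_c A) / (2 * D) * u * u))); [intros; f_equal; field; auto|].
        apply Cder_ex_quad.
      * apply Cder_theta; auto.
    + replace (IZC (m_c A) / (2 * D) * u * u)%C with (IZC (m_c A) * u * u / (2 * D))%C by (field; auto). field. auto.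
Qed.

Lemma row_inverse A x y : SL2Z A ->
  x = (x * IZR (m_a A) + y * IZR (m_c A)) * IZR (m_d A) - (x * IZR (m_b A) + y * IZR (m_d A)) * IZR (m_c A).
Proof.
  intros hA. assert (E : IZR (m_a A) * IZR (m_d A) - IZR (m_b A) * IZR (m_c A) = 1).
  { rewrite <- !mult_IZR, <- minus_IZR. f_equal. apply hA. }
  replace x with (x * (IZR (m_a A) * IZR (m_d A) - IZR (m_b A) * IZR (m_c A))) at 1 by (rewrite E; ring). ring.
Qed.

Section KleinModular.
Variables (A : mat2) (t c : C).
Hypothesis hA : SL2Z A.
Hypothesis ht : upper_half t.
Hypothesis hc : c <> RtoC 0.
Hypothesis H : forall u, theta (u / autom A t) (moebius A t) = (c * ex (IZC (m_c A) * u * u / (2 * autom A t)) * theta u t)%C.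

Lemma row_point x y : (RtoC x * moebius A t + RtoC y)%C =
  ((RtoC (x * IZR (m_a A) + y * IZR (m_c A)) * t + RtoC (x * IZR (m_b A) + y * IZR (m_d A))) / autom A t)%C.
Proof.
  pose proof (autom_neq0 A t hA ht) as D0. unfold moebius, autom, IZC in *. rewrite !RtoC_plus, !RtoC_mult. field. auto.
Qed.

Lemma row_autom x y (x' := x * IZR (m_a A) + y * IZR (m_c A)) (y' := x * IZR (m_b A) + y * IZR (m_d A)) :
  (RtoC x + IZC (m_c A) * (RtoC x' * t + RtoC y') = RtoC x' * autom A t)%C.
Proof.
  rewrite (row_inverse A x y hA). fold x' y'. rewrite RtoC_minus, !RtoC_mult. unfold autom, IZC. ring.
Qed.

Lemma klein_modular x y : klein x y (moebius A t) =
  (c * klein (x * IZR (m_a A) + y * IZR (m_c A)) (x * IZR (m_b A) + y * IZR (m_d A)) t)%C.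
Proof.
  pose proof (autom_neq0 A t hA ht) as D0. pose proof (row_autom x y) as RA. cbv zeta in RA.
  unfold klein. rewrite row_point, H.
  set (x' := x * IZR (m_a A) + y * IZR (m_c A)) in *. set (y' := x * IZR (m_b A) + y * IZR (m_d A)) in *.
  set (u := (RtoC x' * t + RtoC y')%C) in *. set (D := autom A t) in *.
  rewrite <- !Cmult_assoc, (Cmult_comm (ex _)), <- !Cmult_assoc. f_equal. rewrite (Cmult_comm (theta u t)), !Cmult_assoc. f_equal.
  rewrite <- ex_plus. f_equal.
  transitivity ((RtoC x + IZC (m_c A) * u) * u / (2 * D))%C; [field; auto|]. rewrite RA. field. auto.
Qed.

Lemma kzeta_modular x y (x' := x * IZR (m_a A) + y * IZR (m_c A)) (y' := x * IZR (m_b A) + y * IZR (m_d A)) :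
  theta (RtoC x' * t + RtoC y') t <> RtoC 0 ->
  kzeta x y (moebius A t) = (autom A t * kzeta x' y' t)%C.
Proof.
  intros N. pose proof (autom_neq0 A t hA ht) as D0. pose proof (row_autom x y) as RA. cbv zeta in RA.
  unfold kzeta, Zlog. rewrite row_point. fold x' y' in RA |- *.
  set (u := (RtoC x' * t + RtoC y')%C) in *.
  pose proof (thetap_modular A t c hA ht H u) as TP. rewrite H. set (D := autom A t) in *.
  assert (TP' : thetap (u / D) (moebius A t) = (D * (c * ex (IZC (m_c A) * u * u / (2 * D)) *
       (twopii * (IZC (m_c A) * u / D) * theta u t + thetap u t)))%C) by (rewrite <- TP; field; auto).
  rewrite TP'. pose proof (ex_neq0 (IZC (m_c A) * u * u / (2 * D))) as N2.
  transitivity (D * (thetap u t / theta u t) + twopii * (RtoC x + IZC (m_c A) * u))%C; [field; auto|].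
  rewrite RA. ring.
Qed.

Lemma thetap0_modular : thetap 0 (moebius A t) = (autom A t * c * thetap 0 t)%C.
Proof.
  pose proof (autom_neq0 A t hA ht) as D0. pose proof (thetap_modular A t c hA ht H 0%C) as TP.
  replace (0 / autom A t)%C with (RtoC 0) in TP by (field; auto).
  replace (IZC (m_c A) * 0 * 0 / (2 * autom A t))%C with (RtoC 0) in TP by (field; auto).
  rewrite ex_0 in TP. set (D := autom A t) in *.
  replace (thetap 0 (moebius A t)) with (D * (thetap 0 (moebius A t) / D))%C by (field; auto). rewrite TP. field. auto.
Qed.
End KleinModular.

(** ** Quasi-periodicity *)

Lemma klein_shift x y m n t : upper_half t -> klein (x + IZR m) (y + IZR n) t =
  (ex ((IZC m + IZC n + IZC m * IZC n) / 2 + (IZC n * RtoC x - IZC m * RtoC y) / 2) * klein x y t)%C.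
Proof.
  intros h. unfold klein. rewrite !RtoC_plus. fold (IZC m) (IZC n).
  replace ((RtoC x + IZC m) * t + (RtoC y + IZC n))%C with (RtoC x * t + RtoC y + IZC m * t + IZC n)%C by ring.
  rewrite theta_shift by auto. rewrite !Cmult_assoc. f_equal. rewrite <- !ex_plus. f_equal. field.
Qed.

Lemma kzeta_shift x y m n t : upper_half t -> theta (RtoC x * t + RtoC y) t <> RtoC 0 -> kzeta (x + IZR m) (y + IZR n) t = kzeta x y t.
Proof.
  intros h N. unfold kzeta. rewrite !RtoC_plus. fold (IZC m) (IZC n).
  replace ((RtoC x + IZC m) * t + (RtoC y + IZC n))%C with (RtoC x * t + RtoC y + IZC m * t + IZC n)%C by ring.
  set (u := (RtoC x * t + RtoC y)%C) in *.
  set (e := fun v : C => ex (- IZC m * v + (IZC n / 2 + IZC m / 2 - IZC m * IZC m / 2 * t))).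
  assert (E : forall v, theta (v + IZC m * t + IZC n) t = (e v * theta v t)%C).
  { intros v. rewrite theta_shift by auto. f_equal. unfold e. f_equal. ring. }
  assert (D : thetap (u + IZC m * t + IZC n) t = (twopii * - IZC m * e u * theta u t + e u * thetap u t)%C).
  { apply (Cder_unique (fun v => theta (v + IZC m * t + IZC n) t) u).
    - eapply Cder_eq; [apply (Cder_comp (fun w => theta w t) (fun v => v + IZC m * t + IZC n)%C u (thetap (u + IZC m * t + IZC n) t) (1 + 0 + 0)%C)|ring].
      + apply Cder_theta; auto.
      + apply (Cder_plus (fun v => v + IZC m * t)%C (fun _ => IZC n)); [|apply Cder_const].
        apply (Cder_plus (fun v => v) (fun _ => (IZC m * t)%C)); [apply Cder_id|apply Cder_const].
    - apply (Cder_ext (fun v => e v * theta v t)%C); [intros; symmetry; apply E|].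
      apply (Cder_mult e (fun v => theta v t)); [apply Cder_ex_lin|apply Cder_theta; auto]. }
  unfold Zlog. rewrite D, E. pose proof (ex_neq0 (- IZC m * u + (IZC n / 2 + IZC m / 2 - IZC m * IZC m / 2 * t))) as N2. field. auto.
Qed.

(** ** The weight one form attached to a row vector *)

Section TorsionForm.
Variables (g : nat).
Let h := S g.
Let p := (2 * h + 1)%nat.

Definition kl (a d : Z) (j : Z) (t : C) : C := klein (IZR (j * a) / INR p) (IZR (j * d) / INR p) t.
Definition kz (a d : Z) (j : Z) (t : C) : C := kzeta (IZR (j * a) / INR p) (IZR (j * d) / INR p) t.
(** [Psi] at the torsion points of the row [(a, d)] instead of [(0, 1)]. *)
Definition psi_form (a d : Z) (k : Z) (t : C) : C :=
  (- (thetap 0 t / twopii) * (kl a d k t * kl a d (2 * k) t) / (kl a d (1 - k) t * kl a d 1 t * kl a d (1 + k) t))%C.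
(** Both parts have weight one: [psi_form] has degree zero in [klein] and [thetap],
    and one derivative. *)
Definition torsion_form (a d : Z) (t : C) : C :=
  (Csum (fun k => ex (INC (S (S k)) / 2) * psi_form a d (Z.of_nat (S (S k))) t) g
    - (kz a d 1 t + kz a d 2 t) / twopii)%C.

Lemma pp : 0 < INR p. Proof. apply lt_0_INR. unfold p. lia. Qed.

Lemma nonlat_torsion (a d j : Z) t : upper_half t -> Z.gcd a d = 1%Z -> ~ (Z.of_nat p | j)%Z ->
  nonlat (RtoC (IZR (j * a) / INR p) * t + RtoC (IZR (j * d) / INR p)) t.
Proof.
  intros ht hg hj k. pose proof pp as hp. pose proof INR_IZR_INZ p as Ep.
  assert (NI : forall b k, IZR (j * b) / INR p = IZR k -> (Z.of_nat p | j * b)%Z).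
  { intros b n E. exists n. apply eq_IZR. rewrite (mult_IZR n), <- Ep, <- E. field. lra. }
  destruct (Req_dec (IZR (j * a) / INR p + IZR k) 0) as [E|E].
  - replace (RtoC (IZR (j * a) / INR p) * t + RtoC (IZR (j * d) / INR p) + IZC k * t)%C with (IZC (j * d) / INC p)%C.
    + apply ex_ratio_neq1; [unfold p, h; lia|]. intros Dd. apply hj.
      assert (Da : (Z.of_nat p | j * a)%Z) by (apply (NI a (- k)%Z); rewrite opp_IZR; lra).
      destruct (Z.gcd_bezout a d 1 hg) as [u [v B]]. replace j with (u * (j * a) + v * (j * d))%Z.
      * apply Z.divide_add_r; apply Z.divide_mul_r; auto.
      * transitivity (j * (u * a + v * d))%Z; [ring|]. rewrite B. ring.
    + unfold IZC. rewrite <- RtoC_div by lra.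
      transitivity (RtoC (IZR (j * d) / INR p) + RtoC (IZR (j * a) / INR p + IZR k) * t)%C.
      * rewrite E. ring.
      * rewrite RtoC_plus. ring.
  - apply ex_neq1_Im. unfold IZC. rewrite !Im_plus, !Im_Rmult, Im_R.
    replace (IZR (j * a) / INR p * Im t + 0 + IZR k * Im t) with ((IZR (j * a) / INR p + IZR k) * Im t) by ring.
    apply Rmult_integral_contrapositive_currified; auto. unfold upper_half in ht. lra.
Qed.

Lemma theta_torsion a d j t : upper_half t -> Z.gcd a d = 1%Z -> ~ (Z.of_nat p | j)%Z ->
  theta (RtoC (IZR (j * a) / INR p) * t + RtoC (IZR (j * d) / INR p)) t <> RtoC 0.
Proof. intros. apply theta_neq0; auto. apply nonlat_torsion; auto. Qed.

Lemma kl_neq0 a d j t : upper_half t -> Z.gcd a d = 1%Z -> ~ (Z.of_nat p | j)%Z -> kl a d j t <> RtoC 0.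
Proof. intros. unfold kl, klein. apply Cmult_neq_0; [apply ex_neq0|apply theta_torsion; auto]. Qed.

Lemma nodiv j : (0 < Z.abs j < Z.of_nat p)%Z -> ~ (Z.of_nat p | j)%Z.
Proof.
  generalize p. intros r hj [q Hq]. subst j. rewrite Z.abs_mul, (Z.abs_eq (Z.of_nat r)) in hj by lia.
  destruct (Z.eq_dec q 0) as [->|N]; [simpl in hj; lia|]. nia.
Qed.

Lemma kl_denominator a d k t (K := Z.of_nat (S (S k))) : upper_half t -> Z.gcd a d = 1%Z -> (k < g)%nat ->
  kl a d 1 t <> 0%C /\ kl a d (1 - K) t <> 0%C /\ kl a d (1 + K) t <> 0%C.
Proof. intros. repeat split; apply kl_neq0; auto; apply nodiv; unfold K, p, h; lia. Qed.

Definition row_a (A : mat2) (a d : Z) : Z := (a * m_a A + d * m_c A)%Z.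
Definition row_d (A : mat2) (a d : Z) : Z := (a * m_b A + d * m_d A)%Z.

Lemma row_gcd A a d : SL2Z A -> Z.gcd a d = 1%Z -> Z.gcd (row_a A a d) (row_d A a d) = 1%Z.
Proof.
  intros hA hg. destruct (Z.gcd_bezout a d 1 hg) as [u [v B]]. apply Z.bezout_1_gcd.
  unfold SL2Z in hA. exists (u * m_d A - v * m_b A)%Z, (v * m_a A - u * m_c A)%Z. unfold row_a, row_d.
  transitivity ((u * a + v * d) * (m_a A * m_d A - m_b A * m_c A))%Z; [ring|]. rewrite B, hA. ring.
Qed.

Lemma row_ratio A a d j : IZR (j * a) / INR p * IZR (m_a A) + IZR (j * d) / INR p * IZR (m_c A) = IZR (j * row_a A a d) / INR p.
Proof. pose proof pp. unfold row_a. rewrite !mult_IZR, plus_IZR, !mult_IZR. field. lra. Qed.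

Lemma row_ratio2 A a d j : IZR (j * a) / INR p * IZR (m_b A) + IZR (j * d) / INR p * IZR (m_d A) = IZR (j * row_d A a d) / INR p.
Proof. pose proof pp. unfold row_d. rewrite !mult_IZR, plus_IZR, !mult_IZR. field. lra. Qed.

Theorem torsion_form_modular A a d t : SL2Z A -> upper_half t -> Z.gcd a d = 1%Z ->
  torsion_form a d (moebius A t) = (autom A t * torsion_form (row_a A a d) (row_d A a d) t)%C.
Proof.
  intros hA ht hg. destruct (theta_modular A t hA ht) as [c [hc H]]. pose proof (row_gcd A a d hA hg) as hg'.
  assert (K : forall j, kl a d j (moebius A t) = (c * kl (row_a A a d) (row_d A a d) j t)%C).
  { intros j. unfold kl. rewrite (klein_modular A t c hA ht H), row_ratio, row_ratio2. auto. }
  assert (KZ : forall j, ~ (Z.of_nat p | j)%Z -> kz a d j (moebius A t) = (autom A t * kz (row_a A a d) (row_d A a d) j t)%C).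
  { intros j hj. unfold kz. rewrite (kzeta_modular A t c hA ht hc H), row_ratio, row_ratio2; auto.
    rewrite row_ratio, row_ratio2. apply theta_torsion; auto. }
  unfold torsion_form. rewrite !KZ by (apply nodiv; unfold p, h; lia).
  rewrite (Csum_ext _ (fun k => autom A t * (ex (INC (S (S k)) / 2) * psi_form (row_a A a d) (row_d A a d) (Z.of_nat (S (S k))) t))%C).
  - rewrite Csum_scal. unfold Cdiv. ring.
  - intros k hk. unfold psi_form. rewrite !K, (thetap0_modular A t c hA ht H).
    pose proof two_pi_i_neq0 as N0.
    destruct (kl_denominator _ _ k t ht hg' hk) as [N1 [N2 N3]].
    set (w := twopii) in *. field. auto.
Qed.

Lemma torsion_shift j b q : IZR (j * (b + Z.of_nat p * q)) / INR p = IZR (j * b) / INR p + IZR (j * q).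
Proof. pose proof pp. rewrite !mult_IZR, plus_IZR, mult_IZR, <- INR_IZR_INZ. field. lra. Qed.

Lemma kl_shift a d j m n t : upper_half t ->
  kl (a + Z.of_nat p * m) (d + Z.of_nat p * n) j t =
  (ex (IZC j * (IZC m + IZC n) / 2 + IZC j * IZC j * (IZC m * IZC n) / 2 + IZC j * IZC j * (IZC n * IZC a - IZC m * IZC d) / (2 * INC p)) * kl a d j t)%C.
Proof.
  intros ht. pose proof pp as hp. unfold kl.
  rewrite !torsion_shift, klein_shift by auto. f_equal. f_equal.
  rewrite !RtoC_div by lra. fold (IZC (j * a)) (IZC (j * d)). rewrite !IZC_mult. field. apply RtoC_neq0. lra.
Qed.

Lemma kz_shift a d j m n t : upper_half t -> Z.gcd a d = 1%Z -> ~ (Z.of_nat p | j)%Z ->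
  kz (a + Z.of_nat p * m) (d + Z.of_nat p * n) j t = kz a d j t.
Proof.
  intros ht hg hj. unfold kz. rewrite !torsion_shift, kzeta_shift; auto. apply theta_torsion; auto.
Qed.

(** The lower rows of the matrices with [p^2 | c] and [d = 1 (mod p)], moved to [(0, 1)]:
    the parity hypothesis makes the exponents of all factors add up to an integer. *)
Theorem torsion_form_periodic c n t : upper_half t -> (exists q, (c + 1) * n = 2 * q)%Z ->
  torsion_form (Z.of_nat p * Z.of_nat p * c) (1 + Z.of_nat p * n) t = torsion_form 0 1 t.
Proof.
  intros ht [q hq]. replace (Z.of_nat p * Z.of_nat p * c)%Z with (0 + Z.of_nat p * (Z.of_nat p * c))%Z by ring.
  pose proof pp as hp. assert (PZ : INC p <> 0%C) by (apply RtoC_neq0; lra).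
  assert (ZP : IZC (Z.of_nat p) = INC p) by (unfold IZC; rewrite <- INR_IZR_INZ; auto).
  unfold torsion_form. rewrite !kz_shift by (try apply nodiv; unfold p, h; auto; lia).
  f_equal. apply Csum_ext. intros k hk. f_equal. unfold psi_form. rewrite !kl_shift by auto.
  set (K := Z.of_nat (S (S k))).
  destruct (kl_denominator 0 1 k t ht eq_refl hk) as [N1 [N2 N3]]. fold K in N2, N3.
  rewrite IZC_mult, ZP.
  set (e := fun j : Z => (IZC j * (INC p * IZC c + IZC n) / 2 + IZC j * IZC j * (INC p * IZC c * IZC n) / 2
     + IZC j * IZC j * (IZC n * IZC 0 - INC p * IZC c * IZC 1) / (2 * INC p))%C).
  fold (e K) (e (2 * K)%Z) (e (1 - K)%Z) (e 1%Z) (e (1 + K)%Z).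
  assert (X : (ex (e K) * ex (e (2 * K)%Z))%C = (ex (e (1 - K)%Z) * ex (e 1%Z) * ex (e (1 + K)%Z))%C).
  { rewrite <- !ex_plus. set (H := Z.of_nat h).
    (* the difference of exponents is an integer *)
    assert (PAR : exists r, (3 * (K - 1) * (Z.of_nat p * c + n) + 3 * (K * K - 1) * (Z.of_nat p * c * n) - 3 * (K * K - 1) * c = 2 * r)%Z).
    { assert (EP : Z.of_nat p = (2 * H + 1)%Z) by (unfold p, H; lia). rewrite EP.
      assert (KK : exists s, (K * (K - 1) = 2 * s)%Z).
      { destruct (Z.Even_or_Odd K) as [[s Hs]|[s Hs]]; rewrite Hs; [exists (s * (2 * s - 1))%Z|exists ((2 * s + 1) * s)%Z]; ring. }
      destruct KK as [s Hs].
      exists (3 * (K - 1) * H * c + 3 * (K * K - 1) * H * c * n + 3 * (K - 1) * q + 3 * s * (c * n - c))%Z.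
      transitivity (6 * (K - 1) * H * c + 6 * (K * K - 1) * H * c * n + 3 * (K - 1) * ((c + 1) * n) + 3 * (K * (K - 1)) * (c * n - c))%Z; [ring|].
      rewrite hq, Hs. ring. }
    destruct PAR as [r Hr]. apply (ex_eq _ _ r).
    apply (f_equal IZC) in Hr. rewrite !IZC_minus, !IZC_plus, !IZC_mult, !IZC_minus, !IZC_plus, !IZC_mult, ZP in Hr.
    unfold e. rewrite !IZC_minus, !IZC_plus, !IZC_mult.
    replace (IZC r) with (IZC 2 * IZC r / 2)%C by (unfold IZC; field). rewrite <- Hr. unfold IZC. field. auto. }
  pose proof two_pi_i_neq0 as N0. set (w := twopii) in *.
  pose proof (ex_neq0 (e (1 - K)%Z)). pose proof (ex_neq0 (e 1%Z)). pose proof (ex_neq0 (e (1 + K)%Z)).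
  transitivity (- (thetap 0 t / w) * (kl 0 1 K t * kl 0 1 (2 * K) t) * (ex (e K) * ex (e (2 * K)%Z)) / ((kl 0 1 (1 - K) t * kl 0 1 1 t * kl 0 1 (1 + K) t) * (ex (e (1 - K)%Z) * ex (e 1%Z) * ex (e (1 + K)%Z))))%C.
  - field. repeat split; auto.
  - rewrite X. field. repeat split; auto.
Qed.

Theorem calJ_torsion (e n0 : Z) t : upper_half t -> (e = 1 \/ e = -1)%Z -> (6 * n0 + 1 = e * Z.of_nat p)%Z -> RtoC (chi12 (Z.of_nat p)) = ex (IZC n0 / 2) ->
  calJ p t = (2 * Ci * RtoC (chi12 (Z.of_nat p)) / INC p * torsion_form 0 1 t)%C.
Proof.
  intros ht he hn hchi. pose proof (calJ_theta g t ht e n0 he hn hchi) as E. fold h p in E. rewrite E. clear E.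
  assert (Z0 : forall j : Z, IZR (j * 0) / INR p = 0) by (intros; rewrite Z.mul_0_r; unfold Rdiv; ring).
  assert (KL : forall j : Z, kl 0 1 j t = theta (RtoC (IZR j / INR p)) t).
  { intros j. unfold kl, klein. rewrite Z0, Z.mul_1_r, !Cmult_0_l. replace (0 / 2)%C with (RtoC 0) by field. rewrite ex_0, Cplus_0_l. ring. }
  assert (KZ : forall j : Z, kz 0 1 j t = Zlog t (RtoC (IZR j / INR p))).
  { intros j. unfold kz, kzeta. rewrite Z0, Z.mul_1_r, !Cmult_0_l, Cplus_0_l. ring. }
  pose proof pp as hp.
  assert (AL : forall k, RtoC (al p k) = RtoC (IZR (Z.of_nat k) / INR p)) by (intros; unfold al; rewrite INR_IZR_INZ; auto).
  f_equal. unfold torsion_form. rewrite !KZ. f_equal.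
  - apply Csum_ext. intros k hk. f_equal. unfold psi_form, Psi. rewrite !KL, !AL.
    rewrite thetap_0_eta by auto. pose proof two_pi_i_neq0 as N0. set (w := twopii) in *.
    replace (w * (eta t * eta t * eta t) / w)%C with (eta t * eta t * eta t)%C by (field; auto).
    f_equal; [f_equal; f_equal; f_equal|f_equal; [f_equal|]; f_equal].
    + rewrite <- RtoC_mult. f_equal. rewrite mult_IZR. unfold Rdiv. ring.
    + rewrite <- RtoC_minus. f_equal. rewrite minus_IZR. unfold Rdiv. change (Z.of_nat 1) with 1%Z. ring.
    + rewrite <- RtoC_plus. f_equal. rewrite plus_IZR. unfold Rdiv. change (Z.of_nat 1) with 1%Z. ring.
  - f_equal. f_equal. f_equal; rewrite AL; auto. rewrite <- RtoC_mult. f_equal. unfold Rdiv. ring.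
Qed.
End TorsionForm.

(** * Functions meromorphic at infinity *)

Lemma hol_inv f : hol f -> (forall z, upper_half z -> f z <> RtoC 0) -> hol (fun z => / f z)%C.
Proof.
  intros Hf N. pose proof Hf as [f' H]. exists (fun z => - f' z / (f z * f z))%C. intros z hz.
  split.
  - apply Cder_inv; auto. apply H; auto.
  - apply Ccont_mult.
    + intros e he. destruct (H z hz) as [_ K]. destruct (K e he) as [d [hd Hd]]. exists d. split; auto. intros x hx.
      replace (- f' x - - f' z)%C with (- (f' x - f' z))%C by ring. rewrite Cmod_opp. auto.
    + eapply Cder_cont. apply (Cder_inv (fun z => f z * f z)%C); [|apply Cmult_neq_0; auto].
      apply (Cder_mult f f); apply H; auto.
Qed.

Lemma hol_affine f a b : 0 < a -> hol f -> hol (fun z => f (RtoC a * z + RtoC b)%C).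
Proof.
  intros ha [f' H]. exists (fun z => f' (RtoC a * z + RtoC b) * RtoC a)%C. intros z hz.
  assert (U : upper_half (RtoC a * z + RtoC b)%C).
  { unfold upper_half in *. rewrite Im_plus, Im_Rmult, Im_R. assert (0 < a * Im z) by (apply Rmult_lt_0_compat; auto). lra. }
  destruct (H _ U) as [H1 H2].
  assert (D : Cder (fun z => RtoC a * z + RtoC b)%C z (RtoC a)).
  { eapply Cder_eq; [apply (Cder_plus (fun z => RtoC a * z)%C (fun _ => RtoC b)); [apply (Cder_scal _ (fun z => z)), Cder_id|apply Cder_const]|ring]. }
  split.
  - apply (Cder_comp f (fun z => RtoC a * z + RtoC b)%C); auto.
  - apply (Ccont_mult (fun z => f' (RtoC a * z + RtoC b)%C) (fun _ => RtoC a)); [|apply Ccont_const].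
    intros e he. destruct (H2 e he) as [d [hd Hd]]. destruct (Cder_cont _ _ _ D d hd) as [d' [hd' Hd']].
    exists d'. split; auto.
Qed.

(** A class closed under sums and products whose members have q-expansions with
    finite principal part. *)
Definition modq (f : C -> C) : Prop :=
  hol f /\ (exists h : nat, (0 < h)%nat /\ forall z, upper_half z -> f (z + INC h)%C = f z) /\
  exists K N Y, 0 < K /\ 0 < Y /\ forall z, Y <= Im z -> Cmod (f z) <= K * exp (N * Im z).

Lemma periodic_multiple (f : C -> C) (h k : nat) : (forall z, upper_half z -> f (z + INC h)%C = f z) ->
  forall z, upper_half z -> f (z + INC (k * h))%C = f z.
Proof.
  intros H z hz. induction k as [|k IH]; [simpl; f_equal; ring|].
  rewrite <- IH. rewrite <- (H (z + INC (k * h))%C).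
  - f_equal. replace (S k * h)%nat with (h + k * h)%nat by reflexivity. rewrite plus_INR, RtoC_plus. ring.
  - unfold upper_half in *. rewrite Im_plus, Im_R. lra.
Qed.

Lemma modq_ext f g : (forall z, upper_half z -> f z = g z) -> modq f -> modq g.
Proof.
  intros E [H1 [[h [hh Hh]] [K [N [Y [hK [hY HN]]]]]]]. split; [apply (hol_ext f); auto|split].
  - exists h. split; auto. intros z hz. rewrite <- !E; auto. unfold upper_half in *. rewrite Im_plus, Im_R. lra.
  - exists K, N, Y. split; [auto|split; auto]. intros z hz. rewrite <- E; auto. unfold upper_half. lra.
Qed.

Lemma modq_const c : modq (fun _ => c).
Proof.
  split; [apply hol_const|split].
  - exists 1%nat. split; auto.
  - exists (Cmod c + 1), 0, 1. pose proof (Cmod_ge_0 c). repeat split; try lra. intros z _. rewrite Rmult_0_l, exp_0. lra.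
Qed.

Lemma modq_common f g : modq f -> modq g -> exists h K N Y, (0 < h)%nat /\ 0 < K /\ 0 < Y /\ 0 <= N /\
  (forall z, upper_half z -> f (z + INC h)%C = f z) /\ (forall z, upper_half z -> g (z + INC h)%C = g z) /\
  (forall z, Y <= Im z -> Cmod (f z) <= K * exp (N * Im z)) /\ (forall z, Y <= Im z -> Cmod (g z) <= K * exp (N * Im z)).
Proof.
  intros [_ [[h [hh Hh]] [K [N [Y [hK [hY HN]]]]]]] [_ [[h' [hh' Hh']] [K' [N' [Y' [hK' [hY' HN']]]]]]].
  set (M := Rabs N + Rabs N'). assert (M1 : N <= M) by (unfold M; pose proof (Rle_abs N); pose proof (Rabs_pos N'); lra).
  assert (M2 : N' <= M) by (unfold M; pose proof (Rle_abs N'); pose proof (Rabs_pos N); lra).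
  exists (h * h')%nat, (K + K'), M, (Y + Y'). split; [nia|]. repeat split; try lra.
  - unfold M. pose proof (Rabs_pos N). pose proof (Rabs_pos N'). lra.
  - rewrite Nat.mul_comm. apply periodic_multiple; auto.
  - apply periodic_multiple; auto.
  - intros z hz. eapply Rle_trans; [apply HN; lra|]. apply Rmult_le_compat; [lra|left; apply exp_pos|lra|]. apply exp_mono. apply Rmult_le_compat_r; lra.
  - intros z hz. eapply Rle_trans; [apply HN'; lra|]. apply Rmult_le_compat; [lra|left; apply exp_pos|lra|]. apply exp_mono. apply Rmult_le_compat_r; lra.
Qed.

Lemma modq_plus f g : modq f -> modq g -> modq (fun z => f z + g z)%C.
Proof.
  intros Hf Hg. destruct (modq_common f g Hf Hg) as [h [K [N [Y [hh [hK [hY [hN [P1 [P2 [B1 B2]]]]]]]]]]].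
  split; [apply hol_plus; [apply Hf|apply Hg]|split].
  - exists h. split; auto. intros z hz. rewrite P1, P2; auto.
  - exists (2 * K), N, Y. repeat split; try lra. intros z hz. specialize (B1 z hz). specialize (B2 z hz).
    eapply Rle_trans; [apply Cmod_triangle|]. lra.
Qed.

Lemma modq_mult f g : modq f -> modq g -> modq (fun z => f z * g z)%C.
Proof.
  intros Hf Hg. destruct (modq_common f g Hf Hg) as [h [K [N [Y [hh [hK [hY [hN [P1 [P2 [B1 B2]]]]]]]]]]].
  split; [apply hol_mult; [apply Hf|apply Hg]|split].
  - exists h. split; auto. intros z hz. rewrite P1, P2; auto.
  - exists (K * K), (2 * N), Y. repeat split; try lra; [apply Rmult_lt_0_compat; auto|]. intros z hz. rewrite Cmod_mult. replace (K * K * exp (2 * N * Im z)) with ((K * exp (N * Im z)) * (K * exp (N * Im z))).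
    + apply Rmult_le_compat; auto; apply Cmod_ge_0.
    + replace (2 * N * Im z) with (N * Im z + N * Im z) by ring. rewrite exp_plus. ring.
Qed.

Lemma modq_scal c f : modq f -> modq (fun z => c * f z)%C.
Proof. intros. apply modq_mult; auto. apply modq_const. Qed.

Lemma modq_minus f g : modq f -> modq g -> modq (fun z => f z - g z)%C.
Proof.
  intros. apply modq_ext with (fun z => f z + (- (1)) * g z)%C; [intros; ring|]. apply modq_plus; auto. apply modq_scal; auto.
Qed.

Lemma modq_Csum (F : nat -> C -> C) n : (forall k, (k < n)%nat -> modq (F k)) -> modq (fun z => Csum (fun k => F k z) n).
Proof.
  intros H. induction n as [|n IH]; [exact (modq_const (RtoC 0))|]. simpl. apply modq_plus; auto.
Qed.

Lemma modq_affine f (a d : nat) (b : Z) : (0 < a)%nat -> (0 < d)%nat -> modq f ->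
  modq (fun z => f ((INC a * z + IZC b) / INC d)%C).
Proof.
  intros ha hd [H1 [[h [hh Hh]] [K [N [Y [hK [hY HN]]]]]]].
  assert (pa : 0 < INR a) by (apply lt_0_INR; auto). assert (pd : 0 < INR d) by (apply lt_0_INR; auto).
  assert (Nd : INC d <> 0%C) by (apply RtoC_neq0; lra).
  assert (E : forall z, ((INC a * z + IZC b) / INC d)%C = (RtoC (INR a / INR d) * z + RtoC (IZR b / INR d))%C).
  { intros z. rewrite !RtoC_div by lra. fold (IZC b). field. auto. }
  assert (pad : 0 < INR a / INR d) by (apply Rdiv_lt_0_compat; auto).
  assert (EI : forall z, Im ((INC a * z + IZC b) / INC d)%C = INR a / INR d * Im z).
  { intros z. rewrite E, Im_plus, Im_Rmult, Im_R. ring. }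
  split; [|split].
  - apply (hol_ext (fun z => f (RtoC (INR a / INR d) * z + RtoC (IZR b / INR d))%C)); [intros; f_equal; symmetry; apply E|]. apply hol_affine; auto.
  - exists (d * h)%nat. split; [nia|]. intros z hz.
    rewrite <- (periodic_multiple f h a Hh ((INC a * z + IZC b) / INC d)%C).
    + f_equal. rewrite !mult_INR, !RtoC_mult. field. auto.
    + unfold upper_half in *. rewrite EI. apply Rmult_lt_0_compat; auto.
  - exists K, (N * (INR a / INR d)), (Y / (INR a / INR d)). repeat split; auto; [apply Rdiv_lt_0_compat; auto|].
    intros z hz. eapply Rle_trans; [apply HN|].
    + rewrite EI. apply Rmult_le_reg_r with (/ (INR a / INR d)); [apply Rinv_0_lt_compat; auto|].
      replace (INR a / INR d * Im z * / (INR a / INR d)) with (Im z) by (field; lra). auto.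
    + rewrite EI. right. f_equal. f_equal. ring.
Qed.

(** ** One-sided expansion *)

Lemma Clim_shift_back u l M : Clim (fun n => u (n + M)%nat) l -> Clim u l.
Proof.
  intros H e he. destruct (H e he) as [N HN]. exists (N + M)%nat. intros n hn.
  replace n with ((n - M) + M)%nat by lia. apply HN. lia.
Qed.

Lemma one_sided f l (M : nat) : (forall n, (n < - Z.of_nat M)%Z -> f n = RtoC 0) -> sums (zpair f) l ->
  sums (fun k => f (Z.of_nat k - Z.of_nat M)%Z) l.
Proof.
  intros H S. apply (Clim_shift_back _ _ (2 * M)). apply Clim_ext_ev with (fun n => Csum (zpair f) (n + M)) 0%nat.
  - intros n _. rewrite zsum_range. replace (2 * (n + M))%nat with (n + (n + 2 * M))%nat by lia. rewrite Csum_split.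
    rewrite Csum_zero.
    + rewrite Cplus_0_l. apply Csum_ext. intros k _. f_equal. lia.
    + intros k hk. apply H. lia.
  - intros e he. destruct (S e he) as [N HN]. exists N. intros n hn. apply HN. lia.
Qed.

Section Expansion.
Variable f : C -> C.
Hypothesis Hf : modq f.

(** The Fourier coefficients with very negative index vanish: the growth bound, at
    heights tending to infinity, makes them arbitrarily small. *)
Lemma modq_expansion : exists (h M : nat) (a : nat -> C), (0 < h)%nat /\
  (exists B r, 0 < B /\ 0 < r /\ forall n, Cmod (a n) <= B * r ^ n) /\
  forall z, upper_half z -> sums (fun n => a n * ex ((INC n - INC M) / INC h * z))%C (f z).
Proof.
  destruct Hf as [H1 [[h [hh Hh]] [K [N [Y [hK [hY HN]]]]]]].
  assert (ph : 0 < INR h) by (apply lt_0_INR; auto). assert (Nh : INC h <> 0%C) by (apply RtoC_neq0; lra).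
  set (F := fun z => f (INC h * z + RtoC 0)%C).
  assert (HF : hol F) by (apply hol_affine; auto).
  assert (PF : forall z, upper_half z -> F (z + 1)%C = F z).
  { intros z hz. unfold F. rewrite <- (Hh (INC h * z + 0)%C); [f_equal; ring|].
    rewrite Cplus_0_r. apply upper_scale; auto. }
  assert (BF : forall z, Y <= INR h * Im z -> Cmod (F z) <= K * exp (N * INR h * Im z)).
  { intros z hz. eapply Rle_trans; [apply HN|]; rewrite Cplus_0_r, Im_Rmult; [auto|]. right. f_equal. f_equal. ring. }
  assert (CB : forall n y, 0 < y -> Y <= INR h * y -> Cmod (fcoef F n) <= K * exp ((N * INR h + 2 * PI * IZR n) * y)).
  { intros n y hy hyY. eapply Rle_trans; [apply (fcoef_bound F n (RtoC y * Ci)%C (K * exp (N * INR h * y))); auto|].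
    - unfold upper_half. rewrite Im_Rmult, Im_i. lra.
    - intros t _. eapply Rle_trans; [apply BF|]; rewrite Im_plus, Im_Rmult, Im_i, Im_R.
      + replace (y * 1 + 0) with y by ring. auto.
      + right. f_equal. f_equal. ring.
    - rewrite Im_Rmult, Im_i. rewrite Rmult_assoc, <- exp_plus. right. f_equal. f_equal. ring. }
  pose proof PI_RGT_0 as hpi.
  set (y0 := Y / INR h). assert (hy0 : 0 < y0) by (apply Rdiv_lt_0_compat; auto).
  assert (Z0 : forall n, N * INR h + 2 * PI * IZR n < 0 -> fcoef F n = RtoC 0).
  { intros n hn. destruct (Ceq_dec (fcoef F n) 0) as [E|E]; auto. exfalso.
    pose proof (Cmod_pos _ E) as P. set (c := N * INR h + 2 * PI * IZR n) in *.
    set (y := y0 + K / (Cmod (fcoef F n) * (- c))).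
    assert (Q : 0 < Cmod (fcoef F n) * - c) by (apply Rmult_lt_0_compat; lra).
    assert (hy : y0 < y) by (unfold y; assert (0 < K / (Cmod (fcoef F n) * - c)) by (apply Rdiv_lt_0_compat; auto); lra).
    pose proof (CB n y ltac:(lra)) as CBy. fold c in CBy.
    assert (Yy : Y <= INR h * y).
    { apply Rle_trans with (INR h * y0); [unfold y0; right; field; lra|]. apply Rmult_le_compat_l; lra. }
    specialize (CBy Yy).
    assert (L : 1 + (- c) * y <= exp ((- c) * y)) by apply exp_ineq1_le.
    assert (X : exp (c * y) * exp ((- c) * y) = 1) by (rewrite <- exp_plus, <- exp_0; f_equal; ring).
    pose proof (exp_pos (- c * y)) as e2.
    assert (R : Cmod (fcoef F n) * exp (- c * y) <= K).
    { apply Rmult_le_compat_r with (r := exp (- c * y)) in CBy; [|lra]. rewrite Rmult_assoc, X in CBy. lra. }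
    assert (R2 : Cmod (fcoef F n) * (1 + - c * y) <= K) by (eapply Rle_trans; [apply Rmult_le_compat_l; [lra|apply L]|auto]).
    assert (R3 : Cmod (fcoef F n) * (- c * y) = Cmod (fcoef F n) * (- c) * y0 + K) by (unfold y; field; split; lra).
    assert (0 < Cmod (fcoef F n) * (- c) * y0) by (apply Rmult_lt_0_compat; auto). lra. }
  assert (exists M : nat, N * INR h < 2 * PI * INR M) as [M HM].
  { exists (Z.to_nat (up (Rabs (N * INR h / (2 * PI))))). destruct (archimed (Rabs (N * INR h / (2 * PI)))) as [U _].
    assert (V : N * INR h / (2 * PI) < INR (Z.to_nat (up (Rabs (N * INR h / (2 * PI)))))).
    { rewrite (INR_IZR_INZ (Z.to_nat _)), Z2Nat.id.
      - pose proof (Rle_abs (N * INR h / (2 * PI))). lra.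
      - apply le_IZR. pose proof (Rabs_pos (N * INR h / (2 * PI))). lra. }
    apply Rmult_lt_compat_r with (r := 2 * PI) in V; [|lra]. unfold Rdiv in V at 1. rewrite Rmult_assoc, Rinv_l in V by lra. lra. }
  exists h, M, (fun k => fcoef F (Z.of_nat k - Z.of_nat M)%Z). split; auto. split.
  - exists (K * exp ((N * INR h - 2 * PI * INR M) * y0)), (exp (2 * PI * y0)). repeat split.
    + apply Rmult_lt_0_compat; auto. apply exp_pos.
    + apply exp_pos.
    + intros n. eapply Rle_trans; [apply (CB _ y0 hy0); unfold y0; right; field; lra|].
      rewrite <- Rpower_pow by apply exp_pos. unfold Rpower. rewrite ln_exp, (Rmult_assoc K), <- exp_plus.
      right. f_equal. f_equal. rewrite minus_IZR, <- !INR_IZR_INZ. ring.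
  - intros z hz. set (w := (z / INC h)%C).
    assert (hw : upper_half w).
    { unfold w, Cdiv. rewrite Cmult_comm, <- RtoC_inv by lra. apply upper_scale; auto. apply Rinv_0_lt_compat; auto. }
    pose proof (fourier_expansion F w HF PF hw) as FE.
    apply (one_sided _ _ M) in FE.
    + replace (f z) with (F w) by (unfold F, w; f_equal; field; auto).
      eapply sums_ext; [|apply FE]. intros n. cbv beta. f_equal. f_equal. unfold w. rewrite IZC_minus. unfold IZC. rewrite <- !INR_IZR_INZ. field. auto.
    + intros n hn. rewrite Z0; [ring|]. apply IZR_lt in hn. rewrite opp_IZR, <- INR_IZR_INZ in hn.
      assert (2 * PI * IZR n < 2 * PI * - INR M) by (apply Rmult_lt_compat_l; lra). lra.
Qed.

Lemma modq_meromorphic : meromorphic_at_infinity f.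
Proof.
  destruct modq_expansion as [h [M [a [hh [_ H]]]]]. exists h, (- INR M / INR h), a. split; auto. intros z hz.
  apply sums_is_series. eapply sums_ext; [|apply H; auto]. intros n. rewrite qpow_ex. f_equal. f_equal. f_equal.
  assert (0 < INR h) by (apply lt_0_INR; auto). rewrite RtoC_plus, !RtoC_div, RtoC_opp by lra. field. apply RtoC_neq0; lra.
Qed.
End Expansion.

Lemma sums_skip f l n : (forall k, (k < n)%nat -> f k = RtoC 0) -> sums f l -> sums (fun k => f (n + k)%nat) l.
Proof.
  intros Z H. induction n as [|n IH]; auto. apply (sums_ext (fun k => f (n + S k)%nat)); [intros; f_equal; lia|].
  apply (sums_shift1 (fun k => f (n + k)%nat)). rewrite (Z (n + 0)%nat), Cplus_0_l by lia. auto.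
Qed.

(** Compare the tail with a geometric series of ratio at most [1/2]. *)
Lemma power_series_leading b B r w l : (forall n, Cmod (b n) <= B * r ^ n) -> 0 < r -> r * Cmod w <= 1/2 ->
  sums (fun n => b n * w ^ n)%C l -> Cmod (l - b O) <= 2 * (B * (r * Cmod w)).
Proof.
  intros Hb hr hw H. set (s := r * Cmod w) in *. assert (hs : 0 <= s) by (apply Rmult_le_pos; [lra|apply Cmod_ge_0]).
  assert (hB : 0 <= B) by (specialize (Hb O); pose proof (Cmod_ge_0 (b O)); simpl in Hb; lra).
  replace l with (b O * w ^ 0 + (l - b O))%C in H by (simpl; ring).
  apply (sums_shift1 (fun n => b n * w ^ n)%C) in H. apply (sums_bound _ _ (fun n => B * (s * s ^ n)) _ H).
  - intros n. rewrite Cmod_mult, Cmod_pow. eapply Rle_trans; [apply Rmult_le_compat_r; [apply pow_le, Cmod_ge_0|apply Hb]|].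
    right. unfold s. simpl. rewrite !Rpow_mult_distr. ring.
  - intros n. rewrite !Rsum_scal.
    assert (G : Rsum (fun k => s ^ k) n * (1 - s) = 1 - s ^ n) by (induction n as [|n IH]; simpl; [ring|rewrite Rmult_plus_distr_r, IH; ring]).
    pose proof (pow_le s n hs). assert (Rsum (fun k => s ^ k) n <= 2) by nra.
    assert (B * s * Rsum (fun k => s ^ k) n <= B * s * 2) by (apply Rmult_le_compat_l; auto; apply Rmult_le_pos; auto).
    rewrite <- Rmult_assoc. rewrite (Rmult_comm 2). auto.
Qed.

(** A function of this class without zeros has its inverse in the class: the
    leading term of the expansion dominates near infinity. *)
Lemma modq_inv f : modq f -> (forall z, upper_half z -> f z <> RtoC 0) -> modq (fun z => / f z)%C.
Proof.
  intros Hf Nf. split; [apply hol_inv; auto; apply Hf|split].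
  - destruct Hf as [_ [[h [hh Hh]] _]]. exists h. split; auto. intros z hz. rewrite Hh; auto.
  - destruct (modq_expansion f Hf) as [h [M [a [hh [[B [r [hB [hr Ba]]]] H]]]]].
    assert (ph : 0 < INR h) by (apply lt_0_INR; auto). assert (Nh : INC h <> 0%C) by (apply RtoC_neq0; lra).
    assert (X : exists n, a n <> RtoC 0).
    { apply Classical_Prop.NNPP. intros X. assert (U : upper_half Ci) by (unfold upper_half; rewrite Im_i; lra). apply (Nf Ci U).
      apply (sums_unique _ _ _ (H Ci U)). apply (sums_finite _ 0). intros n _. destruct (Ceq_dec (a n) 0) as [->|Q]; [ring|].
      exfalso. eauto. }
    destruct (Wf_nat.dec_inh_nat_subset_has_unique_least_element _ (fun n => Classical_Prop.classic (a n <> RtoC 0)) X) as [n0 [[A0 L] _]].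
    pose proof (Cmod_pos _ A0) as P0. pose proof PI_RGT_0 as hpi. set (c := Cmod (a n0)) in *.
    set (w := fun z => ex (z / INC h)). set (E := fun z => ex ((INC n0 - INC M) / INC h * z)).
    assert (SF : forall z, upper_half z -> sums (fun n => a (n0 + n)%nat * w z ^ n)%C (/ E z * f z)%C).
    { intros z hz. pose proof (fun Z => sums_skip _ _ n0 Z (H z hz)) as K. eapply sums_ext; [|apply sums_scal, K].
      - intros n. unfold w. rewrite pow_ex, plus_INR, RtoC_plus.
        replace (ex ((INC n0 + INC n - INC M) / INC h * z)) with (E z * ex (INC n * (z / INC h)))%C by (unfold E; rewrite <- ex_plus; f_equal; field; auto).
        field. apply ex_neq0.
      - intros k hk. destruct (Ceq_dec (a k) 0) as [->|Q]; [ring|]. specialize (L k Q). lia. }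
    assert (pB : 0 < B * r ^ n0) by (apply Rmult_lt_0_compat; auto; apply pow_lt; auto).
    set (del := Rmin (1/2) (c / (4 * (B * r ^ n0)))).
    assert (pd : 0 < del) by (apply Rmin_pos; [lra|apply Rdiv_lt_0_compat; lra]).
    exists (2 / c), (2 * PI * (INR n0 - INR M) / INR h), (INR h * r / (2 * PI * del)).
    split; [apply Rdiv_lt_0_compat; lra|]. split; [apply Rdiv_lt_0_compat; apply Rmult_lt_0_compat; lra|]. intros z hz.
    assert (iz : 0 < Im z) by (eapply Rlt_le_trans; [|apply hz]; apply Rdiv_lt_0_compat; apply Rmult_lt_0_compat; lra).
    assert (Q : r * Cmod (w z) <= del).
    { unfold w. rewrite Cmod_ex. replace (Im (z / INC h)%C) with (Im z / INR h).
      2: { unfold Cdiv. rewrite <- RtoC_inv, Cmult_comm, Im_Rmult by lra. field. lra. }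
      set (x := 2 * PI * (Im z / INR h)). assert (hx : r / del <= x).
      { unfold x. apply Rmult_le_reg_r with (INR h / (2 * PI)); [apply Rdiv_lt_0_compat; lra|].
        replace (2 * PI * (Im z / INR h) * (INR h / (2 * PI))) with (Im z) by (field; lra).
        replace (r / del * (INR h / (2 * PI))) with (INR h * r / (2 * PI * del)) by (field; lra). auto. }
      rewrite exp_Ropp. pose proof (le_exp x). pose proof (exp_pos x). apply Rmult_le_reg_r with (exp x / del); [apply Rdiv_lt_0_compat; auto|].
      replace (r * / exp x * (exp x / del)) with (r / del) by (field; lra). replace (del * (exp x / del)) with (exp x) by (field; lra). lra. }
    assert (d1 : del <= 1/2) by apply Rmin_l. assert (d2 : del <= c / (4 * (B * r ^ n0))) by apply Rmin_r.
    assert (TB : Cmod (/ E z * f z - a n0) <= 2 * (B * r ^ n0 * (r * Cmod (w z)))).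
    { rewrite <- (Nat.add_0_r n0) at 1. apply (power_series_leading (fun n => a (n0 + n)%nat)); [|auto|lra|apply SF; auto].
      intros n. rewrite Rmult_assoc, <- pow_add. apply Ba. }
    assert (TC : 2 * (B * r ^ n0 * (r * Cmod (w z))) <= c / 2).
    { apply Rle_trans with (2 * (B * r ^ n0 * (c / (4 * (B * r ^ n0))))).
      - apply Rmult_le_compat_l; [lra|]. apply Rmult_le_compat_l; lra.
      - right. field. split; apply Rgt_not_eq; auto. apply pow_lt; auto. }
    pose proof (Cmod_tri2 (a n0) (/ E z * f z)) as T. rewrite Cmod_minus_sym in TB. fold c in T.
    rewrite Cmod_mult, Cmod_inv in T by apply ex_neq0.
    assert (CE : Cmod (E z) = / exp (2 * PI * (INR n0 - INR M) / INR h * Im z)).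
    { unfold E. rewrite Cmod_ex, <- exp_Ropp. f_equal. rewrite <- RtoC_minus, <- RtoC_div, Im_Rmult by lra. field. lra. }
    rewrite CE, Rinv_inv in T. set (e := exp _) in *. rewrite Cmod_inv by auto. assert (pf : 0 < Cmod (f z)) by (apply Cmod_pos, Nf; unfold upper_half; auto).
    apply Rmult_le_reg_r with (Cmod (f z) * c / 2); [apply Rdiv_lt_0_compat; [apply Rmult_lt_0_compat; auto|lra]|].
    replace (/ Cmod (f z) * (Cmod (f z) * c / 2)) with (c / 2) by (field; lra).
    replace (2 / c * e * (Cmod (f z) * c / 2)) with (e * Cmod (f z)) by (field; lra). lra.
Qed.

(** ** Theta constants at torsion points *)

Lemma rzsummable_bounded b : rzsummable b -> exists K, 0 < K /\ forall n, Rsum (fun i => b (Z.of_nat i) + b (-1 - Z.of_nat i)%Z) n <= K.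
Proof.
  intros [H1 H2]. destruct (summable_plus _ _ H1 H2) as [_ [K HK]]. exists (Rabs K + 1). split.
  - pose proof (Rabs_pos K). lra.
  - intros n. eapply Rle_trans; [apply HK|]. pose proof (Rle_abs K). lra.
Qed.

(** Above height [1] the terms are bounded by those at [t = i]. *)
Lemma modq_T j (N : nat) (M : Z) y : (0 < N)%nat -> modq (fun t => T j (IZR M / INR N) (RtoC y) t).
Proof.
  intros hN. assert (pN : 0 < INR N) by (apply lt_0_INR; auto). assert (NZ : INC N <> 0%C) by (apply RtoC_neq0; lra).
  set (a := IZR M / INR N). split; [|split].
  - exists (fun t => T (S (S j)) a (RtoC y) t / (4 * RtoC PI * Ci))%C. intros t ht. split; [apply Cder_T_t; auto|].
    apply (Ccont_mult (fun t => T (S (S j)) a (RtoC y) t) (fun _ => / (4 * RtoC PI * Ci))%C); [|apply Ccont_const].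
    eapply Cder_cont. apply Cder_T_t; auto.
  - exists (2 * N * N)%nat. split; [nia|]. intros t ht.
    apply T_unique. eapply zsums_ext; [|apply (zsums_T j a (RtoC y) t ht)]. intros n. unfold Tterm. f_equal.
    apply (ex_eq _ _ (- ((Z.of_nat N * n + M) * (Z.of_nat N * n + M)))).
    rewrite IZC_opp, !IZC_mult, !IZC_plus, !IZC_mult. unfold a.
    rewrite RtoC_half, RtoC_mult, RtoC_plus, RtoC_div, !mult_INR, !RtoC_mult by lra. unfold IZC. rewrite <- INR_IZR_INZ.
    replace (RtoC (INR 2)) with (RtoC 2) by (f_equal; simpl; ring). field. auto.
  - assert (hC : upper_half Ci) by (unfold upper_half; rewrite Im_i; lra).
    destruct (rzsummable_bounded _ (zsummable_Tterm j a (RtoC y) Ci hC)) as [K [hK HK]].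
    exists K, 0, 1. repeat split; try lra. intros t ht. rewrite Rmult_0_l, exp_0, Rmult_1_r.
    assert (ut : upper_half t) by (unfold upper_half; lra).
    assert (B : forall n, Cmod (Tterm j a (RtoC y) t n) <= Cmod (Tterm j a (RtoC y) Ci n)).
    { intros n. rewrite !Cmod_Tterm. apply Rmult_le_compat_l.
      - apply pow_le. apply Rmult_le_pos; [pose proof PI_RGT_0; lra|apply Rabs_pos].
      - apply exp_mono. rewrite Im_R, Im_i. pose proof PI_RGT_0.
        assert (0 <= (IZR n + a) * (IZR n + a)) by apply Rle_0_sqr.
        assert (0 <= ((IZR n + a) * (IZR n + a)) * (Im t - 1)) by (apply Rmult_le_pos; lra).
        assert (0 <= PI * (((IZR n + a) * (IZR n + a)) * (Im t - 1))) by (apply Rmult_le_pos; lra). lra. }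
    destruct (zsums_T j a (RtoC y) t ut) as [_ S1].
    apply (sums_bound _ _ (fun i => Cmod (Tterm j a (RtoC y) Ci (Z.of_nat i)) + Cmod (Tterm j a (RtoC y) Ci (-1 - Z.of_nat i))) _ S1); auto.
    intros i. eapply Rle_trans; [apply Cmod_triangle|]. apply Rplus_le_compat; auto.
Qed.

Lemma T0_klein x y t : upper_half t -> T 0 (1/2 + x) (RtoC y) t = (ex (RtoC x * RtoC y / 2) * klein x y t)%C.
Proof.
  intros ht. apply T_unique. unfold klein, theta.
  eapply zsums_ext; [|apply zsums_scal, zsums_scal, zsums_T; auto]. intros n. unfold Tterm. simpl Cpow.
  rewrite !Cmult_1_r, <- !ex_plus. f_equal. rewrite !RtoC_half, !RtoC_mult, !RtoC_plus, RtoC_half. field.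
Qed.

(** [kzeta] is a logarithmic derivative of theta with characteristics. *)
Lemma T1_kzeta x y t : upper_half t -> theta (RtoC x * t + RtoC y) t <> RtoC 0 ->
  T 1 (1/2 + x) (RtoC y) t = (T 0 (1/2 + x) (RtoC y) t * kzeta x y t)%C.
Proof.
  intros ht N. rewrite T0_klein by auto. unfold klein, kzeta, Zlog.
  set (u := (RtoC x * t + RtoC y)%C) in *.
  transitivity (ex (RtoC x * RtoC y / 2) * (ex (RtoC x * u / 2) * (thetap u t + twopii * RtoC x * theta u t)))%C; [|field; auto].
  apply T_unique. eapply zsums_ext; [|apply zsums_scal, zsums_scal, zsums_plus; [apply zsums_T; auto|apply zsums_scal, zsums_T; auto]].
  intros n. unfold Tterm. simpl Cpow. rewrite !Cmult_1_r. set (w := twopii).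
  transitivity (ex (IZC n / 2) * (w * RtoC (IZR n + (1 / 2 + x))) * (ex (RtoC x * RtoC y / 2) * ex (RtoC x * u / 2) * ex (RtoC ((IZR n + 1 / 2) * (IZR n + 1 / 2) / 2) * t + RtoC (IZR n + 1 / 2) * u)))%C.
  - rewrite !RtoC_plus. ring.
  - f_equal. rewrite <- !ex_plus. f_equal. unfold u. rewrite !RtoC_half, !RtoC_mult, !RtoC_plus, RtoC_half. field.
Qed.

Lemma eta_T z : upper_half z -> eta z = T 0 (1/6) 0 (3 * z).
Proof.
  intros hz. symmetry. rewrite eta_qinf, <- pentagonal by auto. apply T_unique.
  eapply zsums_ext; [|apply zsums_scal, zsums_bsum; auto]. intros n. unfold asd_num, Tterm. rewrite !Cmult_1_r, <- !ex_plus. f_equal. rewrite RtoC_half, RtoC_mult, RtoC_plus, RtoC_div by lra. unfold IZC. field.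
Qed.

Lemma modq_eta : modq eta.
Proof.
  apply (modq_ext (fun z => T 0 (IZR 1 / INR 6) (RtoC 0) ((RtoC (INR 3) * z + IZC 0) / RtoC (INR 1))%C)).
  - intros z hz. rewrite eta_T by auto. f_equal.
    + simpl. field.
    + simpl. unfold IZC. replace (1 + 1 + 1) with 3 by ring. field.
  - apply (modq_affine (T 0 (IZR 1 / INR 6) (RtoC 0)) 3 1 0); try lia. apply (modq_T 0 6 1 0). lia.
Qed.

Section TorsionQ.
Variable g : nat.
Let h := S g.
Let p := (2 * h + 1)%nat.

Lemma modq_T_torsion j (b k : Z) : modq (fun t => T j (1/2 + IZR b / INR p) (RtoC (IZR k / INR p)) t).
Proof.
  assert (hp : 0 < INR p) by (apply lt_0_INR; unfold p; lia).
  replace (1/2 + IZR b / INR p) with (IZR (Z.of_nat p + 2 * b) / INR (2 * p)).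
  - apply modq_T. unfold p; lia.
  - rewrite mult_INR, plus_IZR, mult_IZR, <- INR_IZR_INZ. simpl (INR 2). field. lra.
Qed.

Lemma modq_kl a d j : modq (kl g a d j).
Proof.
  apply (modq_ext (fun t => / ex (RtoC (IZR (j * a) / INR p) * RtoC (IZR (j * d) / INR p) / 2) * T 0 (1/2 + IZR (j * a) / INR p) (RtoC (IZR (j * d) / INR p)) t)%C).
  - intros t ht. rewrite T0_klein by auto. unfold kl. fold h p. field. apply ex_neq0.
  - apply modq_scal, modq_T_torsion.
Qed.

Lemma modq_kz a d j : Z.gcd a d = 1%Z -> ~ (Z.of_nat p | j)%Z -> modq (kz g a d j).
Proof.
  intros hg hj.
  assert (NT : forall t, upper_half t -> T 0 (1/2 + IZR (j * a) / INR p) (RtoC (IZR (j * d) / INR p)) t <> RtoC 0).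
  { intros t ht. rewrite T0_klein by auto. apply Cmult_neq_0; [apply ex_neq0|]. exact (kl_neq0 g a d j t ht hg hj). }
  apply (modq_ext (fun t => T 1 (1/2 + IZR (j * a) / INR p) (RtoC (IZR (j * d) / INR p)) t * / T 0 (1/2 + IZR (j * a) / INR p) (RtoC (IZR (j * d) / INR p)) t)%C).
  - intros t ht. rewrite T1_kzeta; auto.
    + unfold kz. fold h p. field. apply NT; auto.
    + exact (theta_torsion g a d j t ht hg hj).
  - apply modq_mult; [apply modq_T_torsion|]. apply (modq_inv (fun t => T 0 (1/2 + IZR (j * a) / INR p) (RtoC (IZR (j * d) / INR p)) t)); auto. apply modq_T_torsion.
Qed.

Lemma modq_thetap0 : modq (thetap 0).
Proof.
  apply (modq_ext (fun t => T 1 (IZR 1 / INR 2) (RtoC 0) t)).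
  - intros t _. unfold thetap. f_equal.
  - apply modq_T. lia.
Qed.

Theorem modq_torsion_form a d : Z.gcd a d = 1%Z -> modq (torsion_form g a d).
Proof.
  intros hg. apply modq_minus.
  - apply (modq_Csum (fun k t => ex (INC (S (S k)) / 2) * psi_form g a d (Z.of_nat (S (S k))) t)%C).
    intros k hk. apply modq_scal. set (K := Z.of_nat (S (S k))).
    apply (modq_ext (fun t => (- (1) / twopii) * thetap 0 t * (kl g a d K t * kl g a d (2 * K) t) * / (kl g a d (1 - K) t * kl g a d 1 t * kl g a d (1 + K) t))%C).
    + intros t ht. unfold psi_form. unfold Cdiv. ring.
    + apply (modq_mult (fun t => - (1) / twopii * thetap 0 t * (kl g a d K t * kl g a d (2 * K) t))%C
        (fun t => / (kl g a d (1 - K) t * kl g a d 1 t * kl g a d (1 + K) t))%C).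
      * apply (modq_mult (fun t => - (1) / twopii * thetap 0 t)%C (fun t => kl g a d K t * kl g a d (2 * K) t)%C).
        -- apply modq_scal, modq_thetap0.
        -- apply modq_mult; apply modq_kl.
      * apply (modq_inv (fun t => kl g a d (1 - K) t * kl g a d 1 t * kl g a d (1 + K) t)%C).
        -- apply (modq_mult (fun t => kl g a d (1 - K) t * kl g a d 1 t)%C (kl g a d (1 + K))); [|apply modq_kl].
           apply modq_mult; apply modq_kl.
        -- intros t ht. destruct (kl_denominator g a d k t ht hg hk) as [N1 [N2 N3]]. apply Cmult_neq_0; [apply Cmult_neq_0|]; auto.
  - apply (modq_ext (fun t => / twopii * (kz g a d 1 t + kz g a d 2 t))%C); [intros; unfold Cdiv; ring|].
    apply modq_scal. apply modq_plus; apply modq_kz; auto; apply nodiv; lia.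
Qed.
End TorsionQ.

(** * The eta multiplier *)

Lemma cos_ratio_bound z : z <> RtoC 0 -> -1 <= Re z / Cmod z <= 1.
Proof.
  intros N. pose proof (Cmod_pos z N) as P. pose proof (re_le_Cmod z) as B. apply Rabs_le_between in B.
  split; apply Rmult_le_reg_r with (Cmod z); auto; unfold Rdiv; rewrite Rmult_assoc, Rinv_l by lra; lra.
Qed.

Lemma Cmod_sqr z : Cmod z * Cmod z = Re z * Re z + Im z * Im z.
Proof. unfold Cmod. rewrite sqrt_sqrt; [unfold Re, Im; ring|]. simpl. nra. Qed.

Lemma Carg_cos_sin z : z <> RtoC 0 -> cos (Carg z) = Re z / Cmod z /\ sin (Carg z) = Im z / Cmod z.
Proof.
  intros N. pose proof (Cmod_pos z N) as P. pose proof (cos_ratio_bound z N) as B.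
  assert (S : sin (acos (Re z / Cmod z)) = Rabs (Im z) / Cmod z).
  { rewrite sin_acos by auto. rewrite <- (Rabs_pos_eq (Cmod z)) at 2 by lra. rewrite <- Rabs_div by lra. rewrite <- sqrt_Rsqr_abs. f_equal.
    unfold Rsqr. pose proof (Cmod_sqr z) as Q. apply Rmult_eq_reg_r with (Cmod z * Cmod z); [|nra].
    transitivity (Cmod z * Cmod z - Re z * Re z); [field; lra|]. transitivity (Im z * Im z); [lra|field; lra]. }
  unfold Carg. destruct (Rle_dec 0 (Im z)) as [L|L].
  - rewrite cos_acos, S, Rabs_pos_eq; auto.
  - rewrite cos_neg, sin_neg, cos_acos, S, Rabs_left; [|lra|auto]. split; auto. unfold Rdiv. ring.
Qed.

Lemma cexp_Clog z : z <> RtoC 0 -> cexp (Clog z) = z.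
Proof.
  intros N. pose proof (Cmod_pos z N) as P. destruct (Carg_cos_sin z N) as [C1 S1].
  unfold cexp, Clog. rewrite Re_pair, Im_pair, C1, S1, exp_ln by auto. Ceq; field; lra.
Qed.

Lemma Cpower_plus z a b : Cpower z (a + b) = (Cpower z a * Cpower z b)%C.
Proof. unfold Cpower. rewrite <- cexp_plus. f_equal. rewrite RtoC_plus. ring. Qed.

Lemma Cpower_neq0 z a : Cpower z a <> RtoC 0.
Proof. apply cexp_neq0. Qed.

Lemma Cpower_1 z : z <> RtoC 0 -> Cpower z 1 = z.
Proof. intros N. unfold Cpower. rewrite Cmult_1_l. apply cexp_Clog; auto. Qed.

Lemma Cpower_0 z : Cpower z 0 = RtoC 1.
Proof. unfold Cpower. rewrite Cmult_0_l. apply cexp_0. Qed.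

Lemma Cpower_opp z a : (Cpower z a * Cpower z (- a))%C = RtoC 1.
Proof. rewrite <- Cpower_plus, Rplus_opp_r. apply Cpower_0. Qed.

Lemma Cpower_half_sqr z : z <> RtoC 0 -> (Cpower z (1/2) * Cpower z (1/2))%C = z.
Proof. intros N. rewrite <- Cpower_plus. replace (1/2 + 1/2) with 1 by field. apply Cpower_1; auto. Qed.

Lemma Cpower_mhalf_sqr z : z <> RtoC 0 -> (Cpower z (- (1/2)) * Cpower z (- (1/2)))%C = (/ z)%C.
Proof.
  intros N. pose proof (Cpower_half_sqr z N) as H. pose proof (Cpower_opp z (1/2)) as K.
  set (a := Cpower z (1/2)) in *. set (b := Cpower z (- (1/2))) in *.
  assert (Na : a <> RtoC 0) by apply Cpower_neq0.
  replace b with (/ a)%C; [rewrite <- H; field; auto|]. transitivity (/ a * (a * b))%C; [rewrite K; ring|field; auto].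
Qed.

Lemma Cpower_scale x z s : 0 < x -> z <> RtoC 0 -> Cpower (RtoC x * z) s = (RtoC (Rpower x s) * Cpower z s)%C.
Proof.
  intros hx N. pose proof (Cmod_pos z N) as P.
  assert (E : Clog (RtoC x * z) = (RtoC (ln x) + Clog z)%C).
  { assert (EC : Cmod (RtoC x * z) = x * Cmod z) by (rewrite Cmod_mult, Cmod_R, Rabs_pos_eq; lra).
    assert (ER : Re (RtoC x * z)%C = x * Re z) by (ReIm; ring).
    assert (EI : Im (RtoC x * z)%C = x * Im z) by (ReIm; ring).
    unfold Clog, Carg. rewrite EC, ER, EI. apply C_eq; ReIm.
    - rewrite ln_mult; auto.
    - replace (x * Re z / (x * Cmod z)) with (Re z / Cmod z) by (field; lra).
      destruct (Rle_dec 0 (x * Im z)) as [L|L], (Rle_dec 0 (Im z)) as [M|M]; rewrite ?Rplus_0_l; auto; exfalso.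
      + apply M. apply Rmult_le_reg_l with x; lra.
      + apply L. apply Rmult_le_pos; lra. }
  unfold Cpower. rewrite E, Cmult_plus_distr_l, cexp_plus. f_equal. rewrite <- RtoC_mult. unfold Rpower.
  unfold cexp. rewrite Re_R, Im_R, cos_0, sin_0. Ceq; ring.
Qed.

Lemma Cpower_mhalf_Re z : Im z <> 0 -> 0 < Re (Cpower z (- (1/2))).
Proof.
  intros hI. assert (N : z <> RtoC 0) by (intros E; apply hI; rewrite E; apply Im_R).
  pose proof (Cmod_pos z N) as P. assert (A : - PI < Carg z < PI).
  { assert (Q : 0 < acos (Re z / Cmod z) < PI).
    { pose proof (acos_bound (Re z / Cmod z)) as [a1 a2].
      destruct (Carg_cos_sin z N) as [_ S1].
      assert (K : forall th, (th = 0 \/ th = PI) -> acos (Re z / Cmod z) <> th).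
      { intros th hth E. assert (S0 : sin (Carg z) = 0).
        { unfold Carg. rewrite E. destruct hth as [-> | ->]; destruct (Rle_dec 0 (Im z)); rewrite ?sin_neg, ?sin_0, ?sin_PI; ring. }
        rewrite S1 in S0. apply hI. apply Rmult_eq_reg_r with (/ Cmod z); [|apply Rgt_not_eq, Rinv_0_lt_compat; auto]. lra. }
      pose proof (K 0 (or_introl eq_refl)). pose proof (K PI (or_intror eq_refl)). split; [destruct a1; congruence || auto|destruct a2; congruence || auto]. }
    unfold Carg. destruct (Rle_dec 0 (Im z)); lra. }
  unfold Cpower, cexp. rewrite Re_mult, Re_R, Im_R, Re_pair. unfold Clog.
  rewrite Rmult_0_l, Rminus_0_r. apply Rmult_lt_0_compat; [apply exp_pos|].
  rewrite Im_mult, Re_R, Im_R, Im_pair, Rmult_0_l, Rplus_0_r. apply cos_gt_0; lra.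
Qed.

Lemma Cder_autom A z : Cder (autom A) z (IZC (m_c A)).
Proof.
  unfold autom. eapply Cder_eq; [apply (Cder_plus (fun z => IZC (m_c A) * z)%C (fun _ => IZC (m_d A))); [apply (Cder_scal _ (fun z => z)), Cder_id|apply Cder_const]|ring].
Qed.

Lemma Ccont_ext_loc f g z d : 0 < d -> (forall x, Cmod (x - z)%C < d -> f x = g x) -> Ccont f z -> Ccont g z.
Proof.
  intros hd E H e he. destruct (H e he) as [d' [hd' Hd']]. exists (Rmin d d'). split; [apply Rmin_pos; auto|].
  intros x hx. pose proof (Rmin_l d d'). pose proof (Rmin_r d d'). rewrite <- !E; [apply Hd'; lra| |lra].
  replace (z - z)%C with (RtoC 0) by ring. rewrite Cmod_0. auto.
Qed.

(** The square root of the automorphy factor is continuous: its real part is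
    positive, and its square is continuous. *)
Lemma Ccont_root_autom A z : SL2Z A -> upper_half z -> Ccont (fun z => Cpower (autom A z) (- (1/2))) z.
Proof.
  intros hA hz. destruct (Z.eq_dec (m_c A) 0) as [E|N].
  - apply (Ccont_ext_loc (fun _ => Cpower (IZC (m_d A)) (- (1/2))) _ z 1); [lra| |apply Ccont_const].
    intros x _. f_equal. unfold autom. rewrite E. unfold IZC. ring.
  - assert (IM : forall w, upper_half w -> Im (autom A w) <> 0).
    { intros w hw. unfold autom, IZC. rewrite Im_plus, Im_Rmult, Im_R. assert (IZR (m_c A) <> 0) by (apply not_0_IZR; auto).
      unfold upper_half in hw. assert (IZR (m_c A) * Im w <> 0) by (apply Rmult_integral_contrapositive_currified; lra). lra. }
    set (s := fun z => Cpower (autom A z) (- (1/2))).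
    assert (P0 : 0 < Re (s z)) by (apply Cpower_mhalf_Re; auto).
    assert (CI1 : Ccont (fun z => / autom A z)%C z).
    { eapply Cder_cont. apply Cder_inv; [apply Cder_autom|apply autom_neq0; auto]. }
    intros e he. destruct (CI1 (e * Re (s z))) as [d [hd Hd]]; [apply Rmult_lt_0_compat; auto|].
    exists (Rmin d (Im z)). split; [apply Rmin_pos; auto|]. intros x hx. pose proof (Rmin_l d (Im z)). pose proof (Rmin_r d (Im z)).
    assert (hx' : upper_half x).
    { unfold upper_half in *. pose proof (Im_le_Cmod (x - z)) as Q. rewrite Im_minus in Q. apply Rabs_le_between in Q. lra. }
    specialize (Hd x ltac:(lra)).
    rewrite <- !Cpower_mhalf_sqr in Hd by (apply autom_neq0; auto). fold (s x) (s z) in Hd |- *.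
    replace (s x * s x - s z * s z)%C with ((s x - s z) * (s x + s z))%C in Hd by ring. rewrite Cmod_mult in Hd.
    assert (P1 : 0 < Re (s x)) by (apply Cpower_mhalf_Re; auto).
    assert (L : Re (s z) <= Cmod (s x + s z)).
    { pose proof (re_le_Cmod (s x + s z)) as Q. rewrite Re_plus in Q. apply Rabs_le_between in Q. lra. }
    apply Rmult_lt_reg_r with (Re (s z)); auto. eapply Rle_lt_trans; [|apply Hd].
    apply Rmult_le_compat_l; [apply Cmod_ge_0|auto].
Qed.

Lemma Ccont_moebius A z : SL2Z A -> upper_half z -> Ccont (moebius A) z.
Proof.
  intros hA hz. apply Ccont_mult.
  - eapply Cder_cont. apply (Cder_plus (fun z => IZC (m_a A) * z)%C (fun _ => IZC (m_b A))); [apply (Cder_scal _ (fun z => z)), Cder_id|apply Cder_const].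
  - eapply Cder_cont. apply Cder_inv; [apply Cder_autom|apply autom_neq0; auto].
Qed.

Lemma Cder_zero_const f : (forall z, upper_half z -> Cder f z 0) -> forall z w, upper_half z -> upper_half w -> f z = f w.
Proof.
  intros H z w hz hw. apply C_eq_rot. intros k.
  assert (E : (fun s => Re (k * f (z + RtoC s * (w - z)))%C) 0 = (fun s => Re (k * f (z + RtoC s * (w - z)))%C) 1).
  { apply (eq_is_derive (fun s => Re (k * f (z + RtoC s * (w - z)))%C)); [|lra]. intros s hs.
    assert (U : upper_half (z + RtoC s * (w - z))%C).
    { unfold upper_half in *. rewrite Im_plus, Im_Rmult, Im_minus. nra. }
    pose proof (Cder_line f z (w - z)%C s k 0 (H _ U)) as D. replace (Re (k * (0 * (w - z)))%C) with 0 in D; auto.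
    replace (k * (0 * (w - z)))%C with (RtoC 0) by ring. rewrite Re_R. auto. }
  cbv beta in E. replace (z + RtoC 0 * (w - z))%C with z in E by ring. replace (z + RtoC 1 * (w - z))%C with w in E by ring. auto.
Qed.

(** If [(1 + y)^6 = 1] and [y <> 0] then [6] is minus a multiple of [y], which is small. *)
Lemma near_sixth_root x : Cmod (x - 1)%C < 1/10 -> (x * x * x * (x * x * x) = 1)%C -> x = RtoC 1.
Proof.
  intros hx H. destruct (Ceq_dec x 1) as [E|N]; auto. exfalso.
  set (y := (x - 1)%C) in *. assert (Ey : x = (1 + y)%C) by (unfold y; ring).
  assert (Ny : y <> RtoC 0) by (intros E; apply N; rewrite Ey, E; ring).
  set (w := (15 + y * (20 + y * (15 + y * (6 + y))))%C).
  assert (F : (y * (6 + y * w) = 0)%C).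
  { transitivity (x * x * x * (x * x * x) - 1)%C; [rewrite Ey; unfold w; ring|]. rewrite H. ring. }
  assert (G : (6 + y * w = 0)%C).
  { replace (6 + y * w)%C with (y * (6 + y * w) / y)%C by (field; auto). rewrite F. field; auto. }
  assert (B : forall a b c, 0 <= c -> Cmod a <= b -> Cmod (RtoC c + y * a) <= c + b).
  { intros a b c h0 hab. eapply Rle_trans; [apply Cmod_triangle|]. rewrite Cmod_R, Cmod_mult, Rabs_pos_eq by auto.
    pose proof (Cmod_ge_0 a). pose proof (Cmod_ge_0 y). assert (Cmod y * Cmod a <= 1 * b) by (apply Rmult_le_compat; lra). lra. }
  assert (W : Cmod w <= 15 + (20 + (15 + (6 + 1)))).
  { apply B; [lra|]. apply B; [lra|]. apply B; [lra|].
    eapply Rle_trans; [apply Cmod_triangle|]. rewrite Cmod_R, Rabs_pos_eq by lra. lra. }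
  assert (Q : Cmod (y * w) = 6).
  { replace (y * w)%C with (- (6))%C; [rewrite Cmod_opp, Cmod_R, Rabs_pos_eq; lra|]. transitivity (y * w - (6 + y * w))%C; [ring|rewrite G; ring]. }
  rewrite Cmod_mult in Q. pose proof (Cmod_ge_0 y). pose proof (Cmod_ge_0 w).
  assert (Cmod y * Cmod w <= 1/10 * (15 + (20 + (15 + (6 + 1))))) by (apply Rmult_le_compat; lra). lra.
Qed.

(** Close values with equal sixth powers agree, so [v] is locally constant. *)
Lemma sixth_power_const v q : q <> RtoC 0 -> (forall z, upper_half z -> Ccont v z) ->
  (forall z, upper_half z -> (v z * v z * v z * (v z * v z * v z) = q)%C) ->
  forall z w, upper_half z -> upper_half w -> v z = v w.
Proof.
  intros hq Hc H. apply Cder_zero_const. intros z hz.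
  assert (N : v z <> RtoC 0) by (intros E; apply hq; rewrite <- (H z hz), E; ring). pose proof (Cmod_pos _ N) as P.
  destruct (Hc z hz (Cmod (v z) / 10)) as [d [hd Hd]]; [lra|].
  apply (Cder_ext_loc (fun _ => v z) v z 0 (Rmin d (Im z))); [apply Rmin_pos; auto| |apply Cder_const].
  intros x hx. pose proof (Rmin_l d (Im z)). pose proof (Rmin_r d (Im z)).
  assert (hx' : upper_half x).
  { unfold upper_half in *. pose proof (Im_le_Cmod (x - z)) as Q. rewrite Im_minus in Q. apply Rabs_le_between in Q. lra. }
  specialize (Hd x ltac:(lra)).
  assert (E : (v x / v z)%C = RtoC 1).
  { apply near_sixth_root.
    - replace (v x / v z - 1)%C with ((v x - v z) / v z)%C by (field; auto). rewrite Cmod_div by auto.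
      apply Rmult_lt_reg_r with (Cmod (v z)); auto. unfold Rdiv at 1. rewrite Rmult_assoc, Rinv_l by lra. lra.
    - transitivity ((v x * v x * v x * (v x * v x * v x)) / (v z * v z * v z * (v z * v z * v z)))%C; [field; auto|].
      rewrite (H x hx'), (H z hz). field. auto. }
  replace (v x) with (v x / v z * v z)%C by (field; auto). rewrite E. ring.
Qed.

(** ** The half periods *)

Lemma klein_half (m n i j : Z) : exists rho : R, forall t, upper_half t ->
  klein (IZR (2 * m + i) / 2) (IZR (2 * n + j) / 2) t = (ex (RtoC rho) * klein (IZR i / 2) (IZR j / 2) t)%C.
Proof.
  exists ((IZR m + IZR n + IZR m * IZR n) / 2 + (IZR n * (IZR i / 2) - IZR m * (IZR j / 2)) / 2). intros t ht.
  replace (IZR (2 * m + i) / 2) with (IZR i / 2 + IZR m) by (rewrite plus_IZR, mult_IZR; field).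
  replace (IZR (2 * n + j) / 2) with (IZR j / 2 + IZR n) by (rewrite plus_IZR, mult_IZR; field).
  rewrite klein_shift by auto. f_equal. f_equal. rewrite !RtoC_plus, !RtoC_half, !RtoC_plus, !RtoC_minus, !RtoC_mult, !RtoC_half. reflexivity.
Qed.

Definition klein_product (t : C) : C := (klein (IZR 0 / 2) (IZR 1 / 2) t * klein (IZR 1 / 2) (IZR 0 / 2) t * klein (IZR 1 / 2) (IZR 1 / 2) t)%C.

Lemma klein_product_eta t : upper_half t -> klein_product t = (2 * ex (RtoC (1/8)) * (eta t * eta t * eta t))%C.
Proof.
  intros ht. pose proof (two_torsion_product t ht) as E. unfold klein_product, klein.
  assert (E8 : RtoC (1/8) = (1/8)%C) by (apply RtoC_div; lra).
  replace (RtoC (IZR 0 / 2)) with (RtoC 0) by (f_equal; field).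
  replace (RtoC 0 * t + RtoC (IZR 1 / 2))%C with (RtoC (1/2)) by (rewrite Cmult_0_l, Cplus_0_l; auto).
  replace (RtoC (IZR 1 / 2) * t + RtoC 0)%C with (t / 2)%C by (rewrite RtoC_half; field).
  replace (RtoC (IZR 1 / 2) * t + RtoC (IZR 1 / 2))%C with (t / 2 + RtoC (1/2))%C by (rewrite RtoC_half; field).
  replace (0 * RtoC (1/2) / 2)%C with (RtoC 0) by field. rewrite ex_0.
  transitivity (ex (RtoC (IZR 1 / 2) * (t / 2) / 2) * ex (RtoC (IZR 1 / 2) * (t / 2 + RtoC (1 / 2)) / 2) * (theta (RtoC (1/2)) t * theta (t / 2) t * theta (t / 2 + RtoC (1/2)) t))%C; [ring|].
  rewrite E. transitivity (2 * (ex (RtoC (IZR 1 / 2) * (t / 2) / 2) * ex (RtoC (IZR 1 / 2) * (t / 2 + RtoC (1 / 2)) / 2) * ex (- t / 4)) * (eta t * eta t * eta t))%C; [ring|].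
  f_equal. f_equal. rewrite <- !ex_plus. f_equal. rewrite RtoC_half, E8. field.
Qed.

Lemma parity (a : Z) : exists a' i, (a = 2 * a' + i)%Z /\ (i = 0 \/ i = 1)%Z.
Proof. destruct (Z.Even_or_Odd a) as [[b H]|[b H]]; exists b; [exists 0%Z|exists 1%Z]; lia. Qed.

(** [A] acts on the three half periods through its reduction modulo [2], which
    permutes them. *)
Lemma klein_product_modular A : SL2Z A -> exists rho : R, forall t c, upper_half t ->
  (forall u, theta (u / autom A t) (moebius A t) = (c * ex (IZC (m_c A) * u * u / (2 * autom A t)) * theta u t)%C) ->
  klein_product (moebius A t) = (c * c * c * ex (RtoC rho) * klein_product t)%C.
Proof.
  intros hA.
  assert (R : forall x y m' n' i j : Z, (x * m_a A + y * m_c A = 2 * m' + i)%Z -> (x * m_b A + y * m_d A = 2 * n' + j)%Z ->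
    exists rho : R, forall t c, upper_half t ->
    (forall u, theta (u / autom A t) (moebius A t) = (c * ex (IZC (m_c A) * u * u / (2 * autom A t)) * theta u t)%C) ->
    klein (IZR x / 2) (IZR y / 2) (moebius A t) = (c * (ex (RtoC rho) * klein (IZR i / 2) (IZR j / 2) t))%C).
  { intros x y m' n' i j H1 H2. destruct (klein_half m' n' i j) as [rho Hr]. exists rho. intros t c ht H.
    rewrite (klein_modular A t c hA ht H). f_equal. rewrite <- Hr by auto. f_equal.
    - rewrite <- H1, plus_IZR, !mult_IZR. field.
    - rewrite <- H2, plus_IZR, !mult_IZR. field. }
  destruct (parity (m_a A)) as [a' [a0 [Ha Ia]]]. destruct (parity (m_b A)) as [b' [b0 [Hb Ib]]].
  destruct (parity (m_c A)) as [c' [c0 [Hc Ic]]]. destruct (parity (m_d A)) as [d' [d0 [Hd Id]]].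
  destruct (parity (a0 + c0)) as [e' [e0 [He Ie]]]. destruct (parity (b0 + d0)) as [f' [f0 [Hf If]]].
  destruct (R 0%Z 1%Z c' d' c0 d0) as [r1 H1]; [lia|lia|].
  destruct (R 1%Z 0%Z a' b' a0 b0) as [r2 H2]; [lia|lia|].
  destruct (R 1%Z 1%Z (a' + c' + e') (b' + d' + f') e0 f0)%Z as [r3 H3]; [lia|lia|].
  exists (r1 + r2 + r3). intros t c ht H. unfold klein_product.
  rewrite (H1 t c ht H), (H2 t c ht H), (H3 t c ht H). rewrite !RtoC_plus, !ex_plus. unfold SL2Z in hA.
  assert (DET : exists q, (a0 * d0 - b0 * c0 = 2 * q + 1)%Z).
  { exists (- (2 * a' * d' + a' * d0 + a0 * d' - 2 * b' * c' - b' * c0 - b0 * c'))%Z. rewrite Ha, Hb, Hc, Hd in hA. lia. }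
  destruct DET as [q DET].
  destruct Ia as [-> | ->], Ib as [-> | ->], Ic as [-> | ->], Id as [-> | ->]; try (exfalso; lia); destruct Ie as [-> | ->], If as [-> | ->]; try (exfalso; lia); ring.
Qed.

(** theta'(0) and the product over the half periods are both multiples of [eta^3]; they
    have degrees [1] and [3] in the constant [c], which can be eliminated. *)
Lemma eta_sixth_power A : SL2Z A -> exists rho : R, forall t, upper_half t ->
  let w := eta (moebius A t) in
  (w * w * w * (w * w * w) = autom A t * autom A t * autom A t * ex (RtoC rho) * (eta t * eta t * eta t * (eta t * eta t * eta t)))%C.
Proof.
  intros hA. destruct (klein_product_modular A hA) as [rho Hr]. exists (- rho). intros t ht w.
  destruct (theta_modular A t hA ht) as [c [hc H]]. pose proof (moebius_upper A t hA ht) as ht'.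
  pose proof (thetap0_modular A t c hA ht H) as E1. rewrite !thetap_0_eta in E1 by auto. fold w in E1.
  pose proof (Hr t c ht H) as E2. rewrite !klein_product_eta in E2 by auto. fold w in E2.
  pose proof two_pi_i_neq0 as N0. pose proof (eta_neq0 t ht) as NE. set (D := autom A t) in *. set (n3 := (eta t * eta t * eta t)%C) in *. set (w3 := (w * w * w)%C) in *.
  assert (N3 : n3 <> RtoC 0) by (unfold n3; apply Cmult_neq_0; [apply Cmult_neq_0|]; auto).
  assert (F1 : w3 = (D * c * n3)%C).
  { set (k := twopii) in *. transitivity (k * w3 / k)%C; [field; auto|]. rewrite E1. field. auto. }
  pose proof (ex_neq0 (RtoC (1/8))) as N8. pose proof (ex_neq0 (RtoC rho)) as NR.
  assert (F2 : w3 = (c * c * c * ex (RtoC rho) * n3)%C).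
  { set (k := ex (RtoC (1/8))) in *. transitivity (2 * k * w3 / (2 * k))%C; [field; auto|]. rewrite E2. field. auto. }
  assert (F3 : (c * c = D / ex (RtoC rho))%C).
  { transitivity (c * c * c * ex (RtoC rho) * n3 / (c * ex (RtoC rho) * n3))%C; [field; auto|]. rewrite <- F2, F1. field. auto. }
  rewrite RtoC_opp, ex_opp. rewrite F1. transitivity (D * D * (c * c) * (n3 * n3))%C; [ring|]. rewrite F3. field. auto.
Qed.

Lemma Ccont_comp f g z : Ccont f (g z) -> Ccont g z -> Ccont (fun x => f (g x)) z.
Proof. intros H K e he. destruct (H e he) as [d [hd Hd]]. destruct (K d hd) as [d' [hd' Hd']]. exists d'. auto. Qed.

Theorem nu_eta_spec A : SL2Z A -> Cmod (nu_eta A) = 1 /\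
  forall z, upper_half z -> slash (1 / 2) eta A z = (nu_eta A * eta z)%C.
Proof.
  intros hA. pose proof modq_eta as [He _].
  set (v := fun z => (slash (1/2) eta A z * / eta z)%C).
  destruct (eta_sixth_power A hA) as [rho Hr].
  assert (V6 : forall z, upper_half z -> (v z * v z * v z * (v z * v z * v z) = ex (RtoC rho))%C).
  { intros z hz. unfold v, slash. pose proof (Cpower_mhalf_sqr _ (autom_neq0 A z hA hz)) as S1. specialize (Hr z hz). pose proof (eta_neq0 z hz) as NE. pose proof (autom_neq0 A z hA hz) as ND.
    set (s := Cpower (autom A z) (- (1/2))) in *. set (w := eta (moebius A z)) in *. transitivity ((s * s) * (s * s) * (s * s) * (w * w * w * (w * w * w)) / (eta z * eta z * eta z * (eta z * eta z * eta z)))%C; [field; auto|].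
    rewrite S1, Hr. field. auto. }
  assert (VC : forall z, upper_half z -> Ccont v z).
  { intros z hz. apply Ccont_mult; [apply Ccont_mult|].
    - apply Ccont_root_autom; auto.
    - apply (Ccont_comp eta (moebius A)); [apply hol_cont; auto; apply moebius_upper; auto|apply Ccont_moebius; auto].
    - apply (hol_cont (fun z => / eta z)%C); auto. apply hol_inv; auto. apply eta_neq0. }
  pose proof (sixth_power_const v _ (ex_neq0 _) VC V6) as CST.
  assert (U : upper_half Ci) by (unfold upper_half; rewrite Im_i; lra).
  assert (SP : forall z, upper_half z -> slash (1/2) eta A z = (v Ci * eta z)%C).
  { intros z hz. rewrite (CST Ci z U hz). unfold v. pose proof (eta_neq0 z hz). field. auto. }
  assert (E : nu_eta A = v Ci).
  { apply (iota_unique (K := C_AbsRing) (V := C_CompleteNormedModule)); auto.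
    assert (UN : forall y : C, slash (1/2) eta A Ci = (y * eta Ci)%C -> y = v Ci).
    { intros y Hy. rewrite (SP Ci U) in Hy. pose proof (eta_neq0 Ci U) as NE.
      transitivity (y * eta Ci / eta Ci)%C; [field; auto|]. rewrite <- Hy. field. auto. }
    intros y Hy. apply UN. apply Hy, U. }
  rewrite E. split; auto.
  assert (M : Cmod (v Ci) ^ 6 = 1).
  { transitivity (Cmod (v Ci * v Ci * v Ci * (v Ci * v Ci * v Ci))).
    - rewrite !Cmod_mult. ring.
    - rewrite (V6 Ci U), Cmod_ex, Im_R, Rmult_0_r, Ropp_0, exp_0. auto. }
  pose proof (Cmod_ge_0 (v Ci)) as P. set (x := Cmod (v Ci)) in *.
  destruct (Rtotal_order x 1) as [L|[E1|L]]; auto; exfalso.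
  - assert (x ^ 6 < 1); [|lra]. apply pow_lt_1_compat; [lra|lia].
  - assert (1 < x ^ 6); [|lra]. apply Rlt_pow_R1; [lra|lia].
Qed.

(** * Conclusion *)

Tactic Notation "matcbn" := cbn [m_a m_b m_c m_d mat2_mul conj_p].
Tactic Notation "matcbn" "in" hyp(H) := cbn [m_a m_b m_c m_d mat2_mul conj_p] in H.

Lemma nu_eta_neq0 A : SL2Z A -> nu_eta A <> RtoC 0.
Proof. intros hA. apply Cmod_neq0. rewrite (proj1 (nu_eta_spec A hA)). lra. Qed.

Lemma Csum_periodic_shift (G : Z -> C) (p : nat) (b : Z) : (forall r, G (r + Z.of_nat p)%Z = G r) ->
  Csum (fun r => G (Z.of_nat r + b)%Z) p = Csum (fun r => G (Z.of_nat r)) p.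
Proof.
  intros HG.
  assert (S1 : forall b, Csum (fun r => G (Z.of_nat r + (b + 1))%Z) p = Csum (fun r => G (Z.of_nat r + b)%Z) p).
  { intros c. pose proof (Csum_first (fun r => G (Z.of_nat r + c)%Z) p) as E.
    change (Csum (fun r => G (Z.of_nat r + c)%Z) (S p)) with (Csum (fun r => G (Z.of_nat r + c)%Z) p + G (Z.of_nat p + c)%Z)%C in E.
    replace (G (Z.of_nat p + c)%Z) with (G (Z.of_nat 0 + c)%Z) in E by (rewrite <- HG; f_equal; lia).
    rewrite (Csum_ext (fun r => G (Z.of_nat r + (c + 1))%Z) (fun r => G (Z.of_nat (S r) + c)%Z)) by (intros; f_equal; lia).
    match type of E with (?x + ?y = ?y + ?z)%C => transitivity (y + z - y)%C; [ring|rewrite <- E; ring] end. }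
  induction b as [|b IH|b IH] using Z.peano_ind.
  - apply Csum_ext. intros k _. f_equal. lia.
  - rewrite <- IH, <- (S1 b). apply Csum_ext. intros k _. f_equal; lia.
  - rewrite <- IH. rewrite <- (S1 (Z.pred b)). apply Csum_ext. intros k _. f_equal. lia.
Qed.

Lemma hermite_form (x y u v : Z) : (0 < x * v - y * u)%Z -> exists B (a d : nat) (b : Z), SL2Z B /\ (0 < a)%nat /\ (0 < d)%nat /\
  forall z, upper_half z -> let w := ((INC a * z + IZC b) / INC d)%C in
    upper_half w /\ (autom B w * INC d = IZC u * z + IZC v)%C /\ moebius B w = ((IZC x * z + IZC y) / (IZC u * z + IZC v))%C.
Proof.
  intros hdet. set (g := Z.gcd x u).
  assert (hg : (0 < g)%Z).
  { pose proof (Z.gcd_nonneg x u). destruct (Z.eq_dec g 0) as [E|E]; [|unfold g in *; lia]. apply Z.gcd_eq_0 in E. destruct E as [-> ->]. lia. }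
  destruct (Z.gcd_divide_l x u) as [x1 Hx]. destruct (Z.gcd_divide_r x u) as [u1 Hu]. fold g in Hx, Hu.
  destruct (Z.gcd_bezout x u g eq_refl) as [s [r B]].
  assert (B1 : (s * x1 + r * u1 = 1)%Z).
  { apply (Z.mul_reg_r _ _ g); [lia|]. rewrite Z.mul_add_distr_r, Z.mul_1_l, <- !Z.mul_assoc, <- Hx, <- Hu. auto. }
  set (b := (s * y + r * v)%Z). set (d := (x1 * v - u1 * y)%Z).
  assert (hd : (0 < d)%Z) by nia.
  assert (Ey : (x1 * b - r * d = y)%Z) by (unfold b, d; transitivity (y * (s * x1 + r * u1))%Z; [ring|rewrite B1; ring]).
  assert (Ev : (u1 * b + s * d = v)%Z) by (unfold b, d; transitivity (v * (s * x1 + r * u1))%Z; [ring|rewrite B1; ring]).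
  exists (Mat2 x1 (- r) u1 s), (Z.to_nat g), (Z.to_nat d), b.
  assert (hB : SL2Z (Mat2 x1 (- r) u1 s)) by (unfold SL2Z; matcbn; lia).
  split; [auto|]. split; [lia|]. split; [lia|]. intros z hz w.
  assert (Eg : INC (Z.to_nat g) = IZC g) by (unfold IZC; rewrite INR_IZR_INZ, Z2Nat.id by lia; auto).
  assert (Ed : INC (Z.to_nat d) = IZC d) by (unfold IZC; rewrite INR_IZR_INZ, Z2Nat.id by lia; auto).
  assert (gp : 0 < IZR g) by (apply IZR_lt; auto). assert (dp : 0 < IZR d) by (apply IZR_lt; auto).
  assert (Nd : IZC d <> 0%C) by (apply RtoC_neq0; lra).
  unfold w in *. clear w. rewrite Eg, Ed. set (w := ((IZC g * z + IZC b) / IZC d)%C).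
  assert (hw : upper_half w).
  { unfold w, upper_half in *. replace ((IZC g * z + IZC b) / IZC d)%C with (RtoC (IZR g / IZR d) * z + RtoC (IZR b / IZR d))%C.
    - rewrite Im_plus, Im_Rmult, Im_R. assert (0 < IZR g / IZR d) by (apply Rdiv_lt_0_compat; auto).
      assert (0 < IZR g / IZR d * Im z) by (apply Rmult_lt_0_compat; auto). lra.
    - rewrite !RtoC_div by lra. unfold IZC in *. field. auto. }
  assert (EA : (autom (Mat2 x1 (- r) u1 s) w * IZC d = IZC u * z + IZC v)%C).
  { unfold autom, w. matcbn. rewrite <- Ev, Hu, IZC_plus, !IZC_mult. field. auto. }
  split; auto. split; auto. pose proof (autom_neq0 _ w hB hw) as NA. rewrite <- EA.
  unfold moebius. rewrite <- Ey, Hx, IZC_minus, !IZC_mult. matcbn. rewrite IZC_opp. unfold w. field. auto.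
Qed.

Section Final.
Variables (g : nat).
Let h := S g.
Let p := (2 * h + 1)%nat.
Variable (c0 : C).
Hypothesis HJ : forall t, upper_half t -> calJ p t = (c0 * torsion_form g 0 1 t)%C.

Lemma INRp : 0 < INR p. Proof. apply lt_0_INR. unfold p. lia. Qed.
Lemma INRp0 : INC p <> RtoC 0. Proof. apply RtoC_neq0, Rgt_not_eq, INRp. Qed.
Lemma IZCp : IZC (Z.of_nat p) = INC p. Proof. unfold IZC. rewrite <- INR_IZR_INZ. auto. Qed.

(** The parity condition of [torsion_form_periodic] holds because [p] is odd and the
    determinant is one. *)
Lemma calJ_modular A c n t : SL2Z A -> upper_half t -> m_c A = (Z.of_nat p * Z.of_nat p * c)%Z -> m_d A = (1 + Z.of_nat p * n)%Z ->
  calJ p (moebius A t) = (autom A t * calJ p t)%C.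
Proof.
  intros hA ht hc hd. rewrite !HJ; auto; [|apply moebius_upper; auto].
  rewrite torsion_form_modular by auto. unfold row_a, row_d. rewrite !Z.mul_0_l, !Z.add_0_l, !Z.mul_1_l, hc, hd.
  replace (torsion_form g (Z.of_nat p * Z.of_nat p * c) (1 + Z.of_nat p * n) t) with (torsion_form g 0 1 t); [ring|].
  symmetry. apply torsion_form_periodic; auto.
  unfold SL2Z in hA. rewrite hc, hd in hA.
  destruct (Z.Even_or_Odd c) as [[q Hq]|[q Hq]]; [|exists ((q + 1) * n)%Z; rewrite Hq; ring].
  destruct (Z.Even_or_Odd n) as [[q' Hq']|[q' Hq']]; [exists ((c + 1) * q')%Z; rewrite Hq'; ring|].
  exfalso. assert (E : Z.of_nat p = (2 * Z.of_nat h + 1)%Z) by (unfold p; lia). rewrite E, Hq, Hq' in hA.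
  lia.
Qed.

Lemma calJ_period t k : upper_half t -> calJ p (t + IZC k)%C = calJ p t.
Proof.
  intros ht. assert (hA : SL2Z (Mat2 1 k 0 1)) by (unfold SL2Z; cbn [m_a m_b m_c m_d]; ring).
  pose proof (calJ_modular (Mat2 1 k 0 1) 0 0 t hA ht ltac:(cbn [m_c]; ring) ltac:(cbn [m_d]; ring)) as E.
  unfold moebius, autom in E. matcbn in E. replace ((IZC 1 * t + IZC k) / (IZC 0 * t + IZC 1))%C with (t + IZC k)%C in E by (unfold IZC; field).
  rewrite E. unfold IZC. ring.
Qed.

Variable m : nat.

Definition twist (r : Z) (z : C) : C := (ex (- (IZC r * INC m / INC p)) * calJ p ((z + IZC r) / INC p))%C.
Definition average (z : C) : C := Csum (fun r => twist (Z.of_nat r) z) p.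

Lemma upper_frac z r : upper_half z -> upper_half ((z + IZC r) / INC p)%C.
Proof.
  intros hz. pose proof INRp. unfold Cdiv. rewrite Cmult_comm, <- RtoC_inv by (apply Rgt_not_eq; auto).
  apply upper_scale; [apply Rinv_0_lt_compat; auto|]. unfold upper_half, IZC in *. rewrite Im_plus, Im_R. lra.
Qed.

Lemma calK_average z : calK p m z = (RtoC (sin (PI / INR p)) * RtoC (/ INR p) * average z)%C.
Proof.
  unfold calK, average. f_equal. unfold C_sum.
  change (sum_n_m (G := C_AbelianMonoid) ?f 0 ?n) with (sum_n (G := C_AbelianMonoid) f n). rewrite sum_n_Csum.
  replace (S (p - 1)) with p by (unfold p; lia). apply Csum_ext. intros r hr. unfold twist, ex, IZC. rewrite <- INR_IZR_INZ. f_equal. f_equal.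
  pose proof INRp. pose proof INRp0. rewrite RtoC_opp, RtoC_div, !RtoC_mult by lra. field. auto.
Qed.

Lemma twist_periodic r z : upper_half z -> twist (r + Z.of_nat p) z = twist r z.
Proof.
  intros hz. pose proof INRp0 as NP. unfold twist. rewrite IZC_plus, IZCp. f_equal.
  - apply (ex_eq _ _ (- Z.of_nat m)). rewrite IZC_opp. replace (IZC (Z.of_nat m)) with (INC m) by (unfold IZC; rewrite <- INR_IZR_INZ; auto). field. auto.
  - replace ((z + (IZC r + INC p)) / INC p)%C with ((z + IZC r) / INC p + IZC 1)%C by (unfold IZC; field; auto).
    apply calJ_period, upper_frac; auto.
Qed.

(** [(1, r; 0, p) A = A' (1, r + b; 0, p)] with a matrix [A'] as in [calJ_modular]. *)
Lemma average_modular A z : Gamma1 p A -> upper_half z ->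
  average (moebius A z) = (autom A z * ex (IZC (m_b A) * INC m / INC p) * average z)%C.
Proof.
  intros [hA [[a1 Ha] [[d1 Hd] [c1 Hc]]]] hz. pose proof INRp0 as NP. set (b := m_b A).
  unfold average. rewrite <- (Csum_periodic_shift (fun r => twist r z) p b) by (intros; apply twist_periodic; auto).
  rewrite <- Csum_scal. apply Csum_ext. intros k hk. set (r := Z.of_nat k).
  unfold twist.
  assert (Q : exists q, (b + r * m_d A - (m_a A + r * m_c A) * (b + r) = Z.of_nat p * q)%Z).
  { exists (- a1 * b + r * d1 - r * a1 - r * c1 * (b + r))%Z. replace (m_d A) with (1 + d1 * Z.of_nat p)%Z by lia.
    replace (m_a A) with (1 + a1 * Z.of_nat p)%Z by lia. rewrite Hc. ring. }
  destruct Q as [q Hq].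
  set (A' := Mat2 (m_a A + r * m_c A) q (Z.of_nat p * m_c A) (m_d A - (b + r) * m_c A)).
  assert (hA' : SL2Z A').
  { unfold SL2Z, A' in *. matcbn. transitivity ((m_a A + r * m_c A) * (m_d A - (b + r) * m_c A) - (Z.of_nat p * q) * m_c A)%Z; [ring|].
    etransitivity; [|exact hA]. rewrite <- Hq. fold b. ring. }
  set (w := ((z + IZC (r + b)) / INC p)%C).
  assert (hw : upper_half w) by (apply upper_frac; auto).
  assert (EA : autom A' w = autom A z).
  { unfold autom, A', w. matcbn. rewrite IZC_minus, !IZC_mult, !IZC_plus, IZCp. field. auto. }
  assert (EM : moebius A' w = ((moebius A z + IZC r) / INC p)%C).
  { pose proof (autom_neq0 A z hA hz) as ND. unfold moebius. rewrite EA. unfold A', w. matcbn. fold b.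
    apply (f_equal IZC) in Hq. rewrite IZC_mult, IZCp in Hq.
    replace (IZC q) with (INC p * IZC q / INC p)%C by (field; auto). rewrite <- Hq.
    rewrite !IZC_minus, !IZC_plus, !IZC_mult, !IZC_plus, !IZC_mult.
    transitivity ((IZC (m_a A) * z + IZC b + IZC r * (autom A z)) / autom A z / INC p)%C; [|field; auto].
    unfold autom in ND |- *. field. auto. }
  rewrite <- EM, (calJ_modular A' c1 (d1 - (b + r) * c1) w hA' hw).
  - rewrite EA. replace (- (IZC r * INC m / INC p))%C with (IZC b * INC m / INC p + - (IZC (r + b) * INC m / INC p))%C.
    + rewrite ex_plus. ring.
    + rewrite IZC_plus. field. auto.
  - unfold A'. matcbn. rewrite Hc. ring.
  - unfold A'. matcbn. rewrite Hc. replace (m_d A) with (1 + d1 * Z.of_nat p)%Z by lia. ring.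
Qed.

Lemma pz_upper z : upper_half z -> upper_half (INC p * z)%C.
Proof. intros. apply upper_scale; auto. apply INRp. Qed.

Lemma conj_p_SL2Z A : Gamma1 p A -> SL2Z (conj_p p A) /\ (Z.of_nat p * (m_c A / Z.of_nat p) = m_c A)%Z.
Proof.
  intros [hA [_ [_ [c1 Hc]]]]. assert (hp : (Z.of_nat p <> 0)%Z) by (unfold p; lia).
  assert (E : (Z.of_nat p * (m_c A / Z.of_nat p) = m_c A)%Z) by (rewrite Hc, Z.div_mul by auto; ring).
  split; auto. unfold SL2Z, conj_p in *. matcbn. etransitivity; [|exact hA]. rewrite <- E at 2. ring.
Qed.

Lemma autom_conj_p A z : Gamma1 p A -> autom (conj_p p A) (INC p * z) = autom A z.
Proof.
  intros hA. destruct (conj_p_SL2Z A hA) as [_ E]. unfold autom, conj_p. matcbn. rewrite <- E at 2. rewrite IZC_mult, IZCp. ring.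
Qed.

Lemma moebius_conj_p A z : Gamma1 p A -> moebius (conj_p p A) (INC p * z) = (INC p * moebius A z)%C.
Proof.
  intros hA. unfold moebius. rewrite autom_conj_p by auto. matcbn. rewrite IZC_mult, IZCp. unfold Cdiv. ring.
Qed.

Lemma calR_average z : calR p m z = (RtoC (sin (PI / INR p)) * RtoC (/ INR p) * average z / eta (INC p * z))%C.
Proof. unfold calR. rewrite calK_average. unfold Cdiv. ring. Qed.

Lemma twist_exponent b : cexp (RtoC (2 * PI * IZR b * INR m / INR p) * Ci) = ex (IZC b * INC m / INC p).
Proof.
  pose proof INRp. pose proof INRp0. unfold ex. f_equal. rewrite RtoC_div, !RtoC_mult by lra. fold (IZC b). field. auto.
Qed.

Theorem calR_modular A z : Gamma1 p A -> upper_half z -> slash (1/2) (calR p m) A z = (nu_R p m A * calR p m z)%C.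
Proof.
  intros hA hz. destruct (conj_p_SL2Z A hA) as [hC _]. pose proof (proj2 (nu_eta_spec _ hC) _ (pz_upper z hz)) as N.
  unfold slash in *. rewrite autom_conj_p, moebius_conj_p in N by auto.
  pose proof hA as [hS _]. pose proof (autom_neq0 A z hS hz) as ND. pose proof (Cpower_mhalf_sqr _ ND) as SQ.
  pose proof (nu_eta_neq0 _ hC) as NN. pose proof (eta_neq0 _ (pz_upper z hz)) as NE.
  rewrite !calR_average, average_modular by auto. unfold nu_R. rewrite twist_exponent.
  pose proof (Cpower_neq0 (autom A z) (- (1/2))) as NS. set (s := Cpower (autom A z) (- (1/2))) in *.
  replace (eta (INC p * moebius A z)) with (nu_eta (conj_p p A) * eta (INC p * z) / s)%C by (rewrite <- N; field; auto).
  transitivity ((s * s) * autom A z * ex (IZC (m_b A) * INC m / INC p) / nu_eta (conj_p p A) * (RtoC (sin (PI / INR p)) * RtoC (/ INR p) * average z / eta (INC p * z)))%C.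
  - field. auto.
  - rewrite SQ. field. auto.
Qed.

Lemma eta_weight A z : SL2Z A -> upper_half z -> eta (moebius A z) = (nu_eta A * Cpower (autom A z) (1/2) * eta z)%C.
Proof.
  intros hA hz. pose proof (proj2 (nu_eta_spec A hA) z hz) as N. unfold slash in N. pose proof (Cpower_opp (autom A z) (1/2)) as O.
  transitivity ((Cpower (autom A z) (1/2) * Cpower (autom A z) (- (1/2))) * eta (moebius A z))%C; [rewrite O; ring|].
  rewrite <- Cmult_assoc, N. ring.
Qed.

Lemma SL2Z_mul A B : SL2Z A -> SL2Z B -> SL2Z (mat2_mul A B).
Proof. unfold SL2Z. intros hA hB. matcbn. transitivity ((m_a A * m_d A - m_b A * m_c A) * (m_a B * m_d B - m_b B * m_c B))%Z; [ring|]. rewrite hA, hB. ring. Qed.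

Lemma autom_mul A B z : SL2Z B -> upper_half z -> autom (mat2_mul A B) z = (autom A (moebius B z) * autom B z)%C.
Proof.
  intros hB hz. pose proof (autom_neq0 B z hB hz) as N. unfold moebius. unfold autom at 1 2. matcbn. rewrite !IZC_plus, !IZC_mult.
  transitivity (IZC (m_c A) * (IZC (m_a B) * z + IZC (m_b B)) + IZC (m_d A) * autom B z)%C; [unfold autom; ring|field; auto].
Qed.

Lemma moebius_mul A B z : SL2Z A -> SL2Z B -> upper_half z -> moebius (mat2_mul A B) z = moebius A (moebius B z).
Proof.
  intros hA hB hz. pose proof (autom_neq0 B z hB hz) as N. pose proof (autom_neq0 A _ hA (moebius_upper B z hB hz)) as N2.
  unfold moebius at 1. rewrite autom_mul by auto. set (w := moebius B z) in *.
  assert (Ew : (IZC (m_a B) * z + IZC (m_b B) = w * autom B z)%C) by (unfold w, moebius; field; auto).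
  replace (IZC (m_a (mat2_mul A B)) * z + IZC (m_b (mat2_mul A B)))%C with ((IZC (m_a A) * w + IZC (m_b A)) * autom B z)%C.
  - unfold moebius. field. auto.
  - matcbn. rewrite !IZC_plus, !IZC_mult.
    transitivity (IZC (m_a A) * (IZC (m_a B) * z + IZC (m_b B)) + IZC (m_b A) * autom B z)%C; [rewrite Ew; ring|unfold autom; ring].
Qed.

(** Compare the two ways to transform [eta]. *)
Lemma nu_eta_cocycle A B z : SL2Z A -> SL2Z B -> upper_half z ->
  (nu_eta (mat2_mul A B) * Cpower (autom (mat2_mul A B) z) (1/2))%C =
  (nu_eta A * nu_eta B * Cpower (autom A (moebius B z)) (1/2) * Cpower (autom B z) (1/2))%C.
Proof.
  intros hA hB hz. pose proof (eta_weight _ z (SL2Z_mul A B hA hB) hz) as E. rewrite moebius_mul in E by auto.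
  rewrite (eta_weight A) in E by (auto; apply moebius_upper; auto). rewrite (eta_weight B) in E by auto.
  pose proof (eta_neq0 z hz) as N.
  transitivity (nu_eta (mat2_mul A B) * Cpower (autom (mat2_mul A B) z) (1/2) * eta z / eta z)%C; [field; auto|]. rewrite <- E. field. auto.
Qed.

Lemma Gamma1_mul A B : Gamma1 p A -> Gamma1 p B -> Gamma1 p (mat2_mul A B).
Proof.
  intros [hA [[a1 Ha] [[d1 Hd] [c1 Hc]]]] [hB [[a2 Ha2] [[d2 Hd2] [c2 Hc2]]]]. split; [apply SL2Z_mul; auto|].
  assert (E1 : m_a A = (1 + a1 * Z.of_nat p)%Z) by lia. assert (E2 : m_d A = (1 + d1 * Z.of_nat p)%Z) by lia.
  assert (E3 : m_a B = (1 + a2 * Z.of_nat p)%Z) by lia. assert (E4 : m_d B = (1 + d2 * Z.of_nat p)%Z) by lia.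
  matcbn. rewrite E1, E2, E3, E4, Hc, Hc2. repeat split.
  - exists (a1 + a2 + a1 * a2 * Z.of_nat p + m_b A * c2)%Z. ring.
  - exists (d1 + d2 + d1 * d2 * Z.of_nat p + c1 * m_b B)%Z. ring.
  - exists (c1 * (1 + a2 * Z.of_nat p) + c2 * (1 + d1 * Z.of_nat p))%Z. ring.
Qed.

Lemma conj_p_mul A B : Gamma1 p A -> Gamma1 p B -> conj_p p (mat2_mul A B) = mat2_mul (conj_p p A) (conj_p p B).
Proof.
  intros hA hB. destruct (conj_p_SL2Z A hA) as [_ E1]. destruct (conj_p_SL2Z B hB) as [_ E2].
  assert (hp : (Z.of_nat p <> 0)%Z) by (unfold p; lia).
  unfold conj_p, mat2_mul. matcbn. f_equal.
  - rewrite <- E2 at 1. ring.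
  - ring.
  - rewrite <- E1, <- E2 at 1. replace (Z.of_nat p * (m_c A / Z.of_nat p) * m_a B + m_d A * (Z.of_nat p * (m_c B / Z.of_nat p)))%Z
      with ((m_c A / Z.of_nat p * m_a B + m_d A * (m_c B / Z.of_nat p)) * Z.of_nat p)%Z by ring. apply Z.div_mul; auto.
  - rewrite <- E1 at 1. ring.
Qed.

Theorem nu_R_multiplier : multiplier_system (1/2) (Gamma1 p) (nu_R p m).
Proof.
  pose proof INRp0 as NP. split.
  - intros A hA. destruct (conj_p_SL2Z A hA) as [hC _]. unfold nu_R. rewrite twist_exponent.
    rewrite Cmod_div by (apply nu_eta_neq0; auto). rewrite (proj1 (nu_eta_spec _ hC)), Cmod_ex.
    replace (IZC (m_b A) * INC m / INC p)%C with (RtoC (IZR (m_b A) * INR m / INR p)).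
    + rewrite Im_R, Rmult_0_r, Ropp_0, exp_0. field.
    + pose proof INRp. rewrite RtoC_div, RtoC_mult by lra. reflexivity.
  - intros A B z hA hB hz. destruct (conj_p_SL2Z A hA) as [hC _]. destruct (conj_p_SL2Z B hB) as [hC2 _].
    pose proof hA as [hSA _]. pose proof hB as [hSB _].
    pose proof (nu_eta_cocycle _ _ _ hC hC2 (pz_upper z hz)) as K. rewrite <- conj_p_mul in K by auto.
    rewrite autom_conj_p in K by (apply Gamma1_mul; auto). rewrite (autom_conj_p B), moebius_conj_p, autom_conj_p in K by auto.
    unfold nu_R. rewrite !twist_exponent.
    assert (EB : ex (IZC (m_b (mat2_mul A B)) * INC m / INC p) = (ex (IZC (m_b A) * INC m / INC p) * ex (IZC (m_b B) * INC m / INC p))%C).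
    { destruct hA as [_ [[a1 Ha] _]]. destruct hB as [_ [_ [[d2 Hd] _]]]. rewrite <- ex_plus.
      apply (ex_eq _ _ ((a1 * m_b B + m_b A * d2) * Z.of_nat m)). matcbn.
      replace (m_a A) with (1 + a1 * Z.of_nat p)%Z by lia. replace (m_d B) with (1 + d2 * Z.of_nat p)%Z by lia.
      rewrite !IZC_mult, !IZC_plus, !IZC_mult, !IZC_plus, !IZC_mult, IZCp.
      replace (IZC (Z.of_nat m)) with (INC m) by (unfold IZC; rewrite <- INR_IZR_INZ; auto). unfold IZC. field. auto. }
    rewrite EB. pose proof (nu_eta_neq0 _ hC) as N1. pose proof (nu_eta_neq0 _ hC2) as N2.
    pose proof (Cpower_half_sqr _ (autom_neq0 _ z (SL2Z_mul A B hSA hSB) hz)) as S1.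
    pose proof (Cpower_half_sqr _ (autom_neq0 A _ hSA (moebius_upper B z hSB hz))) as S2.
    pose proof (Cpower_half_sqr _ (autom_neq0 B z hSB hz)) as S3. rewrite autom_mul in S1 at 3 by auto.
    set (x := Cpower (autom (mat2_mul A B) z) (1/2)) in *. set (y := Cpower (autom A (moebius B z)) (1/2)) in *.
    set (w := Cpower (autom B z) (1/2)) in *. rewrite <- S2, <- S3 in S1.
    assert (Nx : x <> RtoC 0) by apply Cpower_neq0. assert (Ny : y <> RtoC 0) by apply Cpower_neq0. assert (Nw : w <> RtoC 0) by apply Cpower_neq0.
    assert (K' : nu_eta (conj_p p (mat2_mul A B)) = (nu_eta (conj_p p A) * nu_eta (conj_p p B) * y * w / x)%C) by (rewrite <- K; field; auto).
    rewrite K'. set (ea := ex (IZC (m_b A) * INC m / INC p)). set (eb := ex (IZC (m_b B) * INC m / INC p)).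
    transitivity (ea * eb * (x * x) / (nu_eta (conj_p p A) * nu_eta (conj_p p B) * y * w))%C; [field; auto|]. rewrite S1. field. auto.
Qed.

Lemma average_cusp B : SL2Z B -> exists Q, modq Q /\ forall z, upper_half z -> average (moebius B z) = (autom B z * Q z)%C.
Proof.
  intros hB. pose proof INRp0 as NP. enough (K : forall N, exists Q, modq Q /\ forall z, upper_half z -> Csum (fun r => twist (Z.of_nat r) (moebius B z)) N = (autom B z * Q z)%C) by apply K.
  intros N. induction N as [|N [Q [HQ EQ]]].
  - exists (fun _ => RtoC 0). split; [apply modq_const|]. intros z _. cbn [Csum]. ring.
  - set (r := Z.of_nat N).
    destruct (hermite_form (m_a B + r * m_c B) (m_b B + r * m_d B) (Z.of_nat p * m_c B) (Z.of_nat p * m_d B)) as [B' [a [d [b [hB' [ha [hd HF]]]]]]].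
    { replace ((m_a B + r * m_c B) * (Z.of_nat p * m_d B) - (m_b B + r * m_d B) * (Z.of_nat p * m_c B))%Z
       with (Z.of_nat p * (m_a B * m_d B - m_b B * m_c B))%Z by ring. rewrite hB. lia. }
    assert (Nd : INC d <> RtoC 0) by (apply RtoC_neq0, not_0_INR; lia).
    set (k := (ex (- (IZC r * INC m / INC p)) * c0 * INC p / INC d)%C).
    set (TF := torsion_form g (row_a B' 0 1) (row_d B' 0 1)).
    exists (fun z => Q z + k * TF ((INC a * z + IZC b) / INC d))%C. split.
    + apply modq_plus; auto. apply modq_scal. apply (modq_affine TF); auto. apply modq_torsion_form. apply row_gcd; auto.
    + intros z hz. destruct (HF z hz) as [hw [EA EM]]. set (w := ((INC a * z + IZC b) / INC d)%C) in *.
      change (Csum (fun r => twist (Z.of_nat r) (moebius B z)) (S N)) with (Csum (fun r => twist (Z.of_nat r) (moebius B z)) N + twist r (moebius B z))%C.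
      rewrite EQ by auto. rewrite Cmult_plus_distr_l. f_equal. unfold twist.
      pose proof (autom_neq0 B z hB hz) as ND.
      replace ((moebius B z + IZC r) / INC p)%C with (moebius B' w).
      * rewrite HJ by (apply moebius_upper; auto). rewrite torsion_form_modular by auto. fold TF.
        replace (autom B' w) with (INC p * autom B z / INC d)%C; [unfold k; field; auto|].
        transitivity (autom B' w * INC d / INC d)%C; [|field; auto]. rewrite EA. unfold autom. rewrite !IZC_mult, IZCp. field. auto.
      * rewrite EM. rewrite !IZC_plus, !IZC_mult, IZCp. unfold moebius.
        transitivity ((IZC (m_a B) * z + IZC (m_b B) + IZC r * autom B z) / (INC p * autom B z))%C; [unfold autom; f_equal; ring|field; auto].
Qed.

(** [calJ] and [eta] are evaluated at images of [moebius B z] under matrices of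
    determinant [p]; [hermite_form] replaces these by upper triangular ones. *)
Lemma calR_cusp B : SL2Z B -> modq (slash (1/2) (calR p m) B).
Proof.
  intros hB. destruct (average_cusp B hB) as [Q [HQ EQ]].
  destruct (hermite_form (Z.of_nat p * m_a B) (Z.of_nat p * m_b B) (m_c B) (m_d B)) as [B' [a [d [b [hB' [ha [hd HF]]]]]]].
  { replace (Z.of_nat p * m_a B * m_d B - Z.of_nat p * m_b B * m_c B)%Z
       with (Z.of_nat p * (m_a B * m_d B - m_b B * m_c B))%Z by ring. rewrite hB. lia. }
  assert (pd : 0 < INR d) by (apply lt_0_INR; auto). assert (Nd : INC d <> RtoC 0) by (apply RtoC_neq0; lra).
  set (rho := RtoC (Rpower (/ INR d) (- (1/2)))).
  set (k := (RtoC (sin (PI / INR p)) * RtoC (/ INR p) * rho / nu_eta B')%C).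
  apply (modq_ext (fun z => k * (Q z * / eta ((INC a * z + IZC b) / INC d)))%C).
  - intros z hz. destruct (HF z hz) as [hw [EA EM]]. set (w := ((INC a * z + IZC b) / INC d)%C) in *.
    pose proof (autom_neq0 B z hB hz) as ND. pose proof (nu_eta_neq0 B' hB') as NN. pose proof (eta_neq0 w hw) as NE.
    unfold slash. rewrite calR_average, EQ by auto.
    pose proof (proj2 (nu_eta_spec B' hB') w hw) as N. unfold slash in N.
    replace (moebius B' w) with (INC p * moebius B z)%C in N.
    2: { rewrite EM, !IZC_mult, IZCp. unfold moebius. unfold Cdiv, autom. ring. }
    replace (autom B' w) with (RtoC (/ INR d) * autom B z)%C in N.
    2: { transitivity (autom B' w * INC d / INC d)%C; [|field; auto]. rewrite EA. rewrite RtoC_inv by lra. unfold autom. field. auto. }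
    rewrite Cpower_scale in N; [|apply Rinv_0_lt_compat; auto|auto]. fold rho in N.
    pose proof (Cpower_mhalf_sqr _ ND) as SQ. pose proof (Cpower_neq0 (autom B z) (- (1/2))) as NS. set (s := Cpower (autom B z) (- (1/2))) in *.
    assert (NR : rho <> RtoC 0) by (unfold rho; apply RtoC_neq0, Rgt_not_eq; unfold Rpower; apply exp_pos).
    replace (eta (INC p * moebius B z)) with (nu_eta B' * eta w / (rho * s))%C by (rewrite <- N; field; auto).
    unfold k. transitivity (RtoC (sin (PI / INR p)) * RtoC (/ INR p) * rho * (s * s * autom B z) * Q z / (nu_eta B' * eta w))%C; [rewrite SQ; field; auto|field; auto].
  - apply modq_scal. apply (modq_mult Q (fun z => / eta ((INC a * z + IZC b) / INC d))%C); auto.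
    apply (modq_affine (fun w => / eta w)%C); auto. apply modq_inv; [apply modq_eta|apply eta_neq0].
Qed.

Lemma calR_hol : hol (calR p m).
Proof.
  assert (hI : SL2Z (Mat2 1 0 0 1)) by reflexivity. destruct (calR_cusp _ hI) as [H _].
  set (k := Cpower (RtoC 1) (- (1/2))).
  apply (hol_ext (fun z => / k * slash (1/2) (calR p m) (Mat2 1 0 0 1) z)%C); [|apply hol_scal; auto].
  intros z hz. unfold slash, moebius, autom. matcbn.
  replace ((IZC 1 * z + IZC 0) / (IZC 0 * z + IZC 1))%C with z by (unfold IZC; field).
  replace (IZC 0 * z + IZC 1)%C with (RtoC 1) by (unfold IZC; ring). fold k. field. apply Cpower_neq0.
Qed.

Theorem calR_weakly_holomorphic : weakly_holomorphic_modular_form (1/2) (Gamma1 p) (nu_R p m) (calR p m).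
Proof.
  split; [apply nu_R_multiplier|]. split; [|split].
  - intros z hz. destruct calR_hol as [f' H]. exists (f' z). apply H; auto.
  - intros A hA z hz. apply calR_modular; auto.
  - intros B hB. apply modq_meromorphic, calR_cusp; auto.
Qed.
End Final.

Theorem corollary6p5 :
  forall (p m : nat),
    prime (Z.of_nat p) -> (3 < p)%nat -> (m <= p - 1)%nat ->
    weakly_holomorphic_modular_form (1 / 2) (Gamma1 p) (nu_R p m) (calR p m)
    /\
    (forall (A : mat2) (z : C), Gamma1 p A -> upper_half z ->
       slash (1 / 2) (calR p m) A z =
       (cexp (RtoC (2 * PI * IZR (m_b A) * INR m / INR p) * Ci)
        / nu_eta (conj_p p A) * calR p m z)%C).
Proof.
  intros p m hp h3 hm. destruct (prime_mod6 p hp h3) as [h [e [n0 [Hp [hh [he [hn hchi]]]]]]].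
  destruct h as [|g]; [lia|]. subst p.
  assert (HJ : forall t, upper_half t -> calJ (2 * S g + 1) t = (2 * Ci * RtoC (chi12 (Z.of_nat (2 * S g + 1))) / INC (2 * S g + 1) * torsion_form g 0 1 t)%C)
    by (intros t ht; apply (calJ_torsion g e n0 t ht he hn hchi)).
  split.
  - apply (calR_weakly_holomorphic g _ HJ).
  - intros A z hA hz. apply (calR_modular g _ HJ m A z hA hz).
Qed.
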